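(* Let $J\subset\mathbb{R}$ be an open interval, let $f_0:J\to\mathbb{E}^3$ be a regular real analytic curve, let $v:J\to\mathbb{E}^3$ be a real analytic unit vector field with $\langle v,f_0'\rangle=0$ on $J$, and let $H\in\mathbb{R}\setminus\{0\}$. Fix $x_0\in J$, put $z_0=x_0+0\,i$, and assume Euclidean coordinates of $\mathbb{E}^3$ are chosen so that $f_0'(x_0)$ and $v(x_0)$ point in the directions $e_1$ and $e_2$ respectively. Let $\hat F_0:J\to\Lambda G_\sigma$ be the extended frame along $J$ constructed from $(f_0,v,H)$ as described in the context, with $\hat F_0(x_0)=I$. Then: (1) There exist an open set $\Sigma\subset\mathbb{C}$ containing $J$ (identified with $J\times\{0\}$) and a holomorphic map $\hat\Phi:\Sigma\to\Lambda G^{\mathbb{C}}_\sigma$ such that $\hat\Phi|_J=\hat F_0$. (2) The Maurer-Cartan form of $\hat\Phi$ has a Fourier expansion in $\lambda$ of the form $$\hat\Phi^{-1}\,\mathrm{d}\hat\Phi=\sum_{i=-1}^{1}A_i\lambda^i\,\mathrm{d}z,\qquad [A_{-1}]_{12}\neq 0 \text{ everywhere on } \Sigma .$$ (3) Let $\hat\Phi=\hat F\hat B$, with $\hat F:\Sigma\to\Lambda G_\sigma$ and $\hat B:\Sigma\to\Lambda^+_PG^{\mathbb{C}}_\sigma$, be the pointwise Iwasawa decomposition. The surface $f:\Sigma\to\mathbb{E}^3$, $$f(x,y)=\mathcal{S}_1(\hat F(z))-\mathcal{S}_1(\hat F(z_0))+f_0(x_0),\qquad z=x+iy,$$ is of constant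 mean curvature $H$, restricts to $f_0$ along $J$, and is tangent along $J$ to the plane spanned by $f_0'$ and $v$. (4) The surface $f$ is the unique solution of the Björling problem for $(f_0,v,H)$ (defined in the context), in the following sense: $f$ is a solution, and if $\tilde f$ is any other solution, then for every point $x_1\in J$ there is a neighbourhood $\mathcal{N}=(x_1-\epsilon,x_1+\epsilon)\times(-\delta,\delta)\subset\mathbb{C}$ of $(x_1,0)$ such that $f|_{\mathcal N}=\tilde f|_{\mathcal N}$.
   Context: **Euclidean space.** $\mathbb{E}^3$ is identified with $\mathfrak{su}(2)$ with inner product $\langle X,Y\rangle=-\frac12\operatorname{trace}(XY)$ and orthonormal basis $$e_1=\begin{pmatrix}0&-i\\-i&0\end{pmatrix},\quad e_2=\begin{pmatrix}0&1\\-1&0\end{pmatrix},\quad e_3=\begin{pmatrix}i&0\\0&-i\end{pmatrix}.$$ **Mean curvature convention.** For a conformal immersion $f$ with $z=x+iy$ and metric $4e^{2u}(\mathrm{d}x^2+\mathrm{d}y^2)$, let $F$ be the $SU(2)$-frame with $Fe_1F^{-1}=f_x/|f_x|$, $Fe_2F^{-1}=f_y/|f_y|$ (unique up to sign). The unit normal is $N=Fe_3F^{-1}$ and the mean curvature is $H=\frac18e^{-2u}\langle f_{xx}+f_{yy},N\rangle$. **Björling problem for $(f_0,v,H)$.** A solution is a conformal immersion $f:\Sigma\to\mathbb{E}^3$ of constant mean curvature $H$, where $\Sigma\subset\mathbb{C}$ is some open set containing $J$, such that $f|_J=f_0$ and the tangent planes of $f$ along $J$ are spanned by $f_0'$ and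 $v$, with $f_y$ a positive multiple of $v$ along $J$. **Loop groups.** $G=SU(2)$, $G^{\mathbb{C}}=SL(2,\mathbb{C})$. $\Lambda G_\sigma$ (resp. $\Lambda G^{\mathbb{C}}_\sigma$) is the group of loops $\lambda\in\mathbb{S}^1\mapsto g(\lambda)$ in $G$ (resp. $G^{\mathbb{C}}$) that are twisted: diagonal entries are even and off-diagonal entries are odd functions of $\lambda$. $\Lambda^+_PG^{\mathbb{C}}_\sigma$ is the subgroup of $B\in\Lambda G^{\mathbb{C}}_\sigma$ which extend holomorphically (as $G^{\mathbb{C}}$-valued maps) to the unit disc in $\lambda$ and satisfy $B(0)=\mathrm{diag}(\rho,\rho^{-1})$ with $\rho>0$ real. Iwasawa decomposition: every $g\in\Lambda G^{\mathbb{C}}_\sigma$ is uniquely $g=FB$ with $F\in\Lambda G_\sigma$, $B\in\Lambda_P^+G^{\mathbb{C}}_\sigma$, and the factors depend real analytically on $g$. **Sym-Bobenko formula.** $\mathcal{S}_1(\hat F)=-\frac1{2H}\left(\hat Fe_3\hat F^{-1}+2i\lambda(\partial_\lambda\hat F)\hat F^{-1}\right)\big|_{\lambda=1}$. **Construction of $\hat F_0$.** Along $J$ set $u=\ln\left(\frac12|f_0'|\right)$. Let $F_0:J\to SU(2)$ be the real analytic map with $F_0e_1F_0^{-1}=\frac12e^{-u}f_0'$, $F_0e_2F_0^{-1}=v$, $F_0(x_0)=I$. Write $$F_0^{-1}(F_0)_x=\begin{pmatrix}a&b\\-\bar b&-a\end{pmatrix}$$ ($a$ purely imaginary), and set $Q=-2e^u(\bar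 b+He^u)$ on $J$. Define the $1$-form on $J$ $$\hat\alpha_0=\begin{pmatrix}a&-He^u\lambda^{-1}-\frac12\bar Qe^{-u}\lambda\\ \frac12Qe^{-u}\lambda^{-1}+He^u\lambda&-a\end{pmatrix}\mathrm{d}x ,$$ and let $\hat F_0:J\to\Lambda G_\sigma$ be the solution of $\hat F_0^{-1}\mathrm{d}\hat F_0=\hat\alpha_0$, $\hat F_0(x_0)=I$. *)

(* Defs.v *)
From Stdlib Require Import Reals.
From Coquelicot Require Import Coquelicot.
Open Scope R_scope.

Definition M2 : Type := @matrix C 2 2.

(* [ent A i j] is 0 when [i] or [j] exceeds 1, so entrywise conditions below
   may quantify over all [i j : nat]. *)
Definition ent (A : M2) (i j : nat) : C := coeff_mat (RtoC 0) A i j.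
Definition mat2 (p q r s : C) : M2 := (p, (q, tt), ((r, (s, tt)), tt)).

Definition madd (A B : M2) : M2 := @Mplus C_AbelianGroup 2 2 A B.
Definition mmul (A B : M2) : M2 := @Mmult C_Ring 2 2 2 A B.
Definition mone : M2 := @Mone C_Ring 2.
Definition mzero : M2 := @Mzero C_AbelianGroup 2 2.
Definition mscal (c : C) (A : M2) : M2 :=
  mk_matrix 2 2 (fun i j => (c * ent A i j)%C).
Definition msub (A B : M2) : M2 := madd A (mscal (RtoC (-1)) B).

Declare Scope M2_scope.
Delimit Scope M2_scope with M2.
Bind Scope M2_scope with M2.
Infix "+" := madd : M2_scope.
Infix "-" := msub : M2_scope.
Infix "**" := mmul (at level 40, left associativity) : M2_scope.
Infix "*:" := mscal (at level 40, left associativity) : M2_scope.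

Definition mtrace (A : M2) : C := (ent A 0 0 + ent A 1 1)%C.
Definition mdet (A : M2) : C :=
  (ent A 0 0 * ent A 1 1 - ent A 0 1 * ent A 1 0)%C.
Definition mdagger (A : M2) : M2 :=
  mk_matrix 2 2 (fun i j => Cconj (ent A j i)).
(* The adjugate; it is only applied to matrices of determinant 1, where it is
   the inverse. *)
Definition minv (A : M2) : M2 :=
  mat2 (ent A 1 1) (- ent A 0 1)%C (- ent A 1 0)%C (ent A 0 0).

Definition is_SL2 (A : M2) : Prop := mdet A = RtoC 1.
Definition is_SU2 (A : M2) : Prop :=
  mdet A = RtoC 1 /\ mmul A (mdagger A) = mone.

Definition is_su2 (X : M2) : Prop :=
  mdagger X = mscal (RtoC (-1)) X /\ mtrace X = RtoC 0.

(* On su(2) the trace is real, so taking [Re] loses nothing. *)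
Definition inner (X Y : M2) : R := Re (RtoC (- / 2) * mtrace (X ** Y)%M2)%C.
Definition enorm (X : M2) : R := sqrt (inner X X).

Definition e1 : M2 := mat2 (RtoC 0) (- Ci)%C (- Ci)%C (RtoC 0).
Definition e2 : M2 := mat2 (RtoC 0) (RtoC 1) (RtoC (-1)) (RtoC 0).
Definition e3 : M2 := mat2 Ci (RtoC 0) (RtoC 0) (- Ci)%C.

Definition Ad (F X : M2) : M2 := (F ** X ** minv F)%M2.

Definition is_Mderive (g : R -> M2) (t : R) (D : M2) : Prop :=
  forall i j : nat,
    @is_derive R_AbsRing C_R_NormedModule
      (fun s => ent (g s) i j) t (ent D i j).
Definition ex_Mderive (g : R -> M2) (t : R) : Prop :=
  exists D : M2, is_Mderive g t D.

Definition RCderive_n (g : R -> C) (n : nat) (t : R) : C :=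
  (Derive_n (fun s => Re (g s)) n t, Derive_n (fun s => Im (g s)) n t).

Definition Mderive (g : R -> M2) (t : R) : M2 :=
  mk_matrix 2 2 (fun i j => RCderive_n (fun s => ent (g s) i j) 1 t).

Definition is_CMderive (g : C -> M2) (z : C) (D : M2) : Prop :=
  forall i j : nat,
    @is_derive C_AbsRing C_NormedModule
      (fun w => ent (g w) i j) z (ent D i j).

Definition real_analytic_on (J : R -> Prop) (g : R -> M2) : Prop :=
  forall x : R, J x -> forall i j : nat,
    exists (c : nat -> C) (r : R), 0 < r /\
      forall t : R, Rabs (t - x) < r ->
        @is_pseries R_AbsRing C_R_NormedModule c (t - x) (ent (g t) i j).

Definition is_open_interval (J : R -> Prop) : Prop :=
  exists a b : Rbar, forall x : R, J x <-> Rbar_lt a x /\ Rbar_lt x b.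

Definition pdx (f : C -> M2) (z : C) : M2 :=
  Mderive (fun t => f (t, Im z)) (Re z).
Definition pdy (f : C -> M2) (z : C) : M2 :=
  Mderive (fun t => f (Re z, t)) (Im z).

Fixpoint is_Ck (U : C -> Prop) (n : nat) (f : C -> M2) : Prop :=
  (forall z : C, U z -> forall i j : nat,
     @continuous C_UniformSpace C_UniformSpace (fun w => ent (f w) i j) z) /\
  match n with
  | O => True
  | S m =>
      (forall z : C, U z ->
         ex_Mderive (fun t => f (t, Im z)) (Re z) /\
         ex_Mderive (fun t => f (Re z, t)) (Im z)) /\
      is_Ck U m (pdx f) /\ is_Ck U m (pdy f)
  end.

Definition smooth_on (U : C -> Prop) (f : C -> M2) : Prop :=
  forall n : nat, is_Ck U n f.

Definition conformal_immersion (U : C -> Prop) (f : C -> M2) : Prop :=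
  (forall z : C, U z -> is_su2 (f z)) /\
  smooth_on U f /\
  (forall z : C, U z -> forall p q : R,
     (RtoC p *: pdx f z + RtoC q *: pdy f z)%M2 = mzero -> p = 0 /\ q = 0) /\
  (forall z : C, U z ->
     inner (pdx f z) (pdx f z) = inner (pdy f z) (pdy f z) /\
     inner (pdx f z) (pdy f z) = 0).

(* u where the metric is 4 e^(2u) (dx^2 + dy^2), i.e. |f_x| = 2 e^u *)
Definition conf_factor (f : C -> M2) (z : C) : R := ln (/ 2 * enorm (pdx f z)).

Definition is_coordinate_frame (f : C -> M2) (z : C) (F : M2) : Prop :=
  is_SU2 F /\
  Ad F e1 = (RtoC (/ enorm (pdx f z)) *: pdx f z)%M2 /\
  Ad F e2 = (RtoC (/ enorm (pdy f z)) *: pdy f z)%M2.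

(* The frame is unique up to sign, and [Ad F e3] does not see the sign. *)
Definition has_mean_curvature (f : C -> M2) (z : C) (H : R) : Prop :=
  exists F : M2, is_coordinate_frame f z F /\
    H = / 8 * exp (- 2 * conf_factor f z)
        * inner (pdx (pdx f) z + pdy (pdy f) z)%M2 (Ad F e3).

Definition cmc_surface (U : C -> Prop) (f : C -> M2) (H : R) : Prop :=
  conformal_immersion U f /\ (forall z : C, U z -> has_mean_curvature f z H).

Definition same_span (X Y X' Y' : M2) : Prop :=
  forall W : M2,
    (exists p q : R, W = (RtoC p *: X + RtoC q *: Y)%M2) <->
    (exists p q : R, W = (RtoC p *: X' + RtoC q *: Y')%M2).

Definition contains_interval (U : C -> Prop) (J : R -> Prop) : Prop :=
  forall x : R, J x -> U (RtoC x).

Definition restricts_to (J : R -> Prop) (f : C -> M2) (f0 : R -> M2) : Prop :=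
  forall x : R, J x -> f (RtoC x) = f0 x.

Definition tangent_along (J : R -> Prop) (f : C -> M2) (f0 v : R -> M2) : Prop :=
  forall x : R, J x ->
    same_span (pdx f (RtoC x)) (pdy f (RtoC x)) (Mderive f0 x) (v x).

Definition bjorling_solution (J : R -> Prop) (f0 v : R -> M2) (H : R)
    (U : C -> Prop) (f : C -> M2) : Prop :=
  @open C_UniformSpace U /\ contains_interval U J /\
  cmc_surface U f H /\ restricts_to J f f0 /\ tangent_along J f f0 v /\
  (forall x : R, J x ->
     exists c : R, 0 < c /\ pdy f (RtoC x) = (RtoC c *: v x)%M2).

(* A loop is represented by a function on all of C of which only the values on
   the unit circle are ever used. Loops are taken to be smooth. *)
Definition Loop : Type := C -> M2.

Definition on_circle (l : C) : Prop := Cmod l = 1.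
Definition cis (t : R) : C := (cos t, sin t).

Definition smooth_loop (g : Loop) : Prop :=
  forall (i j n : nat) (t : R),
    ex_derive_n (fun s => Re (ent (g (cis s)) i j)) n t /\
    ex_derive_n (fun s => Im (ent (g (cis s)) i j)) n t.

Definition twisted (g : Loop) : Prop :=
  forall l : C, on_circle l ->
    ent (g (- l)%C) 0 0 = ent (g l) 0 0 /\
    ent (g (- l)%C) 1 1 = ent (g l) 1 1 /\
    ent (g (- l)%C) 0 1 = (- ent (g l) 0 1)%C /\
    ent (g (- l)%C) 1 0 = (- ent (g l) 1 0)%C.

Definition in_LambdaGC (g : Loop) : Prop :=
  smooth_loop g /\ twisted g /\ (forall l : C, on_circle l -> is_SL2 (g l)).

Definition in_LambdaG (g : Loop) : Prop :=
  smooth_loop g /\ twisted g /\ (forall l : C, on_circle l -> is_SU2 (g l)).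

Definition in_LambdaP (B : Loop) : Prop :=
  in_LambdaGC B /\
  exists E : C -> M2,
    (forall l : C, on_circle l -> E l = B l) /\
    (forall l : C, Cmod l <= 1 -> is_SL2 (E l)) /\
    (forall i j : nat,
       @continuous_on C_UniformSpace C_UniformSpace
         (fun l => Cmod l <= 1) (fun l => ent (E l) i j)) /\
    (forall (l : C), Cmod l < 1 -> exists D : M2, is_CMderive E l D) /\
    exists rho : R, 0 < rho /\
      E (RtoC 0) = mat2 (RtoC rho) (RtoC 0) (RtoC 0) (RtoC (/ rho)).

(* Complex differentiability for the Frechet topology of smooth loops: the
   difference quotients converge uniformly on the circle together with all
   their derivatives in the angle. *)
Definition holomorphic_into_loops (U : C -> Prop) (Phi : C -> Loop) : Prop :=
  forall z : C, U z ->
    exists D : Loop, smooth_loop D /\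
      forall (k : nat) (eps : R), 0 < eps ->
        exists delta : R, 0 < delta /\
          forall h : C, h <> RtoC 0 -> Cmod h < delta -> U (z + h)%C ->
            forall (i j : nat) (t : R),
              Cmod (RCderive_n
                      (fun s => ((ent (Phi (z + h)%C (cis s)) i j
                                  - ent (Phi z (cis s)) i j) / h
                                 - ent (D (cis s)) i j)%C) k t) <= eps.

Definition is_iwasawa (g F B : Loop) : Prop :=
  in_LambdaG F /\ in_LambdaP B /\
  forall l : C, on_circle l -> g l = (F l ** B l)%M2.

(* The derivative in lambda along the circle at lambda = e^(it), that is
   (i lambda)^(-1) d/dt. *)
Definition loop_dlambda (g : Loop) (t : R) : M2 :=
  ((/ (Ci * cis t))%C *: Mderive (fun s => g (cis s)) t)%M2.

Definition sym_bobenko (H : R) (g : Loop) : M2 :=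
  let l := RtoC 1 in
  (RtoC (- / (2 * H)) *:
     (Ad (g l) e3
      + (RtoC 2 * Ci * l)%C *: (loop_dlambda g 0 ** minv (g l))))%M2.

Definition curve_u (f0 : R -> M2) (x : R) : R := ln (/ 2 * enorm (Mderive f0 x)).

Definition is_frame_along (J : R -> Prop) (f0 v : R -> M2) (x0 : R)
    (F0 : R -> M2) : Prop :=
  real_analytic_on J F0 /\
  (forall x : R, J x ->
     is_SU2 (F0 x) /\
     Ad (F0 x) e1 = (RtoC (/ 2 * exp (- curve_u f0 x)) *: Mderive f0 x)%M2 /\
     Ad (F0 x) e2 = v x) /\
  F0 x0 = mone.

Definition alpha0 (f0 : R -> M2) (H : R) (F0 : R -> M2) (x : R) (l : C) : M2 :=
  let w := (minv (F0 x) ** Mderive F0 x)%M2 in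
  let a := ent w 0 0 in
  let b := ent w 0 1 in
  let eu := RtoC (exp (curve_u f0 x)) in
  let emu := RtoC (exp (- curve_u f0 x)) in
  let Q := (- RtoC 2 * eu * (Cconj b + RtoC H * eu))%C in
  mat2 a
       (- RtoC H * eu * / l - RtoC (/ 2) * Cconj Q * emu * l)%C
       (RtoC (/ 2) * Q * emu * / l + RtoC H * eu * l)%C
       (- a)%C.

Definition is_extended_frame_along (J : R -> Prop) (f0 v : R -> M2) (H x0 : R)
    (Fhat0 : R -> Loop) : Prop :=
  exists F0 : R -> M2, is_frame_along J f0 v x0 F0 /\
    (forall x : R, J x -> in_LambdaG (Fhat0 x)) /\
    (forall (x : R) (l : C), J x -> on_circle l ->
       exists D : M2, is_Mderive (fun t => Fhat0 t l) x D /\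
         (minv (Fhat0 x l) ** D)%M2 = alpha0 f0 H F0 x l) /\
    (forall l : C, on_circle l -> Fhat0 x0 l = mone).

(* Main.v *)
Require Import Defs.
From Stdlib Require Import Reals ZArith Lra Lia List ClassicalEpsilon FunctionalExtensionality.
From Coquelicot Require Import Coquelicot.
Import List ListNotations.
Open Scope R_scope.

(** The potential [F_0^-1 F_0'] is real analytic along [J], so near each point of
    [J] it is the restriction of a power series [A(z)], and [Phi] is [Fhat0] times the
    solution of [Psi' = Psi A]. In power series in [z], [conj z], graded by degree, the
    Birkhoff factorization of [Psi^* Psi] and hence the Iwasawa decomposition of [Psi]
    can be solved grade by grade. Liouville type arguments in [l] give the shape of
    the derivatives of the unitary factor, from which the first and second derivatives
    of the Sym-Bobenko surface follow. The local pieces of [Phi] agree because a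
    holomorphic function vanishing on a real interval vanishes nearby.

    Uniqueness: two solutions satisfy [f_xx + f_yy = 2 H f_x x f_y] with the same Cauchy
    data on [J]; the gradient of their difference vanishes by a maximum principle for its
    squared norm times an exponential weight. *)

(** The obstacle is a global Iwasawa splitting with analytic dependence on the point. It is reduced
    to loops near the identity: [Psi] is the identity at the centre of its disc, the unitary loop
    [Fhat0] at the centre only multiplies the frame from the left, and uniqueness of the splitting
    carries the local factors over to any given one. In grade [N] the degree in [l] and [conj l] is
    at most [N + c], so each grade of a splitting is a finite computation, smoothness in the loop
    parameter costs nothing, and a discrete Gronwall inequality gives a positive radius. [Sigma] is
    then a union of small discs centred on [J]. A competing solution is only known to be smooth, so
    uniqueness cannot compare power series. The weight in the maximum principle has the form
    [exp (tau * exp (- lam * s))] with [s] harmonic off the real axis: the inner exponential makes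
    its exponent strictly subharmonic, the outer constant localizes the maximum, and the trace-free
    part of the Hessian of the difference, which the first order condition forces to be large,
    absorbs the squared gradient of the weight. *)

(** * Algebra of complex 2 by 2 matrices *)

Lemma mat2_eta (A : M2) : A = mat2 (ent A 0 0) (ent A 0 1) (ent A 1 0) (ent A 1 1).
Proof. destruct A as [[a [b []]] [[c [d []]] []]]. reflexivity. Qed.

Lemma M2_ext (A B : M2) :
 ent A 0 0 = ent B 0 0 -> ent A 0 1 = ent B 0 1 ->
 ent A 1 0 = ent B 1 0 -> ent A 1 1 = ent B 1 1 -> A = B.
Proof. intros. rewrite (mat2_eta A), (mat2_eta B). congruence. Qed.

Lemma mat2_inj p q r s p' q' r' s' : mat2 p q r s = mat2 p' q' r' s' ->
 p = p' /\ q = q' /\ r = r' /\ s = s'.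
Proof. intros E. injection E. tauto. Qed.

Lemma mmul_mat2 p q r s p' q' r' s' :
 (mat2 p q r s ** mat2 p' q' r' s')%M2 =
 mat2 (p * p' + q * r') (p * q' + q * s') (r * p' + s * r') (r * q' + s * s').
Proof. apply M2_ext; unfold mmul, Mmult, ent; rewrite coeff_mat_bij by lia;
  simpl pred; rewrite sum_Sn, sum_O; reflexivity.
Qed.

Lemma madd_mat2 p q r s p' q' r' s' :
 (mat2 p q r s + mat2 p' q' r' s')%M2 = mat2 (p + p') (q + q') (r + r') (s + s').
Proof. auto. Qed.

Lemma mscal_mat2 c p q r s :
 (c *: mat2 p q r s)%M2 = mat2 (c * p) (c * q) (c * r) (c * s).
Proof. auto. Qed.

Lemma minv_mat2 p q r s : minv (mat2 p q r s) = mat2 s (- q) (- r) p.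
Proof. auto. Qed.

Lemma mdagger_mat2 p q r s :
 mdagger (mat2 p q r s) = mat2 (Cconj p) (Cconj r) (Cconj q) (Cconj s).
Proof. auto. Qed.

Lemma mone_mat2 : mone = mat2 1 0 0 1.
Proof. auto. Qed.

Lemma mzero_mat2 : mzero = mat2 0 0 0 0.
Proof. auto. Qed.

Lemma mdet_mat2 p q r s : mdet (mat2 p q r s) = (p * s - q * r)%C.
Proof. auto. Qed.

Lemma mtrace_mat2 p q r s : mtrace (mat2 p q r s) = (p + s)%C.
Proof. auto. Qed.

Lemma ent_out (A : M2) (i j : nat) : (1 < i \/ 1 < j)%nat -> ent A i j = RtoC 0.
Proof. intros [Hi|Hj].
 - destruct i as [|[|i]]; try lia. destruct j as [|[|j]]; reflexivity.
 - destruct j as [|[|j]]; try lia.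
  unfold ent; destruct i as [|[|i]]; try reflexivity.
Qed.

(** Quantifying over entry functions rather than entries lets one case split serve derivatives,
    continuity and smoothness of matrix families; indices above 1 give the constant function 0. *)
Lemma ent_cases (P : (M2 -> C) -> Prop) :
 P (fun A => ent A 0 0) -> P (fun A => ent A 0 1) ->
 P (fun A => ent A 1 0) -> P (fun A => ent A 1 1) -> P (fun _ => RtoC 0) ->
 forall i j, P (fun A => ent A i j).
Proof. intros H0 H1 H2 H3 H4 i j.
 destruct (Nat.le_gt_cases i 1) as [Hi|Hi]; [destruct (Nat.le_gt_cases j 1) as [Hj|Hj]|].
 - destruct i as [|[|i]]; destruct j as [|[|j]]; try lia; assumption.
 - replace (fun A : M2 => ent A i j) with (fun _ : M2 => RtoC 0); auto.
  extensionality A. symmetry; apply ent_out; lia.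
 - replace (fun A : M2 => ent A i j) with (fun _ : M2 => RtoC 0); auto.
  extensionality A. symmetry; apply ent_out; lia.
Qed.

Ltac m2 :=
 repeat match goal with A : M2 |- _ => rewrite (mat2_eta A);
  generalize (ent A 0 0) (ent A 0 1) (ent A 1 0) (ent A 1 1); clear A end; intros;
 repeat (rewrite ?mmul_mat2, ?madd_mat2, ?mscal_mat2, ?minv_mat2, ?mdagger_mat2,
  ?mone_mat2, ?mzero_mat2, ?mdet_mat2); first [ring|f_equal; ring].

Lemma madd_comm (A B : M2) : (A + B)%M2 = (B + A)%M2.
Proof. m2. Qed.

Lemma madd_assoc (A B D : M2) : (A + (B + D))%M2 = (A + B + D)%M2.
Proof. m2. Qed.

Lemma mmul_assoc (A B D : M2) : (A ** (B ** D))%M2 = (A ** B ** D)%M2.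
Proof. m2. Qed.

Lemma mmul_1_l (A : M2) : (mone ** A)%M2 = A.
Proof. m2. Qed.

Lemma mmul_1_r (A : M2) : (A ** mone)%M2 = A.
Proof. m2. Qed.

Lemma mmul_minv_r (A : M2) : mdet A = 1%C -> (A ** minv A)%M2 = mone.
Proof. rewrite (mat2_eta A), minv_mat2, mmul_mat2, mdet_mat2, mone_mat2. intros E.
 f_equal; try ring; rewrite <- E; ring.
Qed.

Lemma mmul_minv_l (A : M2) : mdet A = 1%C -> (minv A ** A)%M2 = mone.
Proof. rewrite (mat2_eta A), minv_mat2, mmul_mat2, mdet_mat2, mone_mat2. intros E.
 f_equal; try ring; rewrite <- E; ring.
Qed.

Lemma mdet_mmul (A B : M2) : mdet (A ** B)%M2 = (mdet A * mdet B)%C.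
Proof. m2. Qed.

Lemma mdet_minv (A : M2) : mdet (minv A) = mdet A.
Proof. m2. Qed.

Lemma minv_mmul (A B : M2) : minv (A ** B)%M2 = (minv B ** minv A)%M2.
Proof. m2. Qed.

Lemma minv_invol (A : M2) : minv (minv A) = A.
Proof. m2. Qed.

Lemma Cconj_plus (a b : C) : Cconj (a + b) = (Cconj a + Cconj b)%C.
Proof. unfold Cconj, Cplus; simpl. f_equal; ring. Qed.
Lemma Cconj_mult (a b : C) : Cconj (a * b) = (Cconj a * Cconj b)%C.
Proof. unfold Cconj, Cmult; simpl. f_equal; ring. Qed.
Lemma Cconj_opp (a : C) : Cconj (- a) = (- Cconj a)%C.
Proof. auto. Qed.
Lemma Cconj_RtoC (a : R) : Cconj (RtoC a) = RtoC a.
Proof. unfold Cconj, RtoC; simpl. f_equal; ring. Qed.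
Lemma Cconj_conj (a : C) : Cconj (Cconj a) = a.
Proof. destruct a. unfold Cconj; simpl. f_equal; ring. Qed.
Lemma Cconj_Ci : Cconj Ci = (- Ci)%C.
Proof. unfold Cconj, Copp; simpl. f_equal; ring. Qed.
Lemma Cmod_Cconj (a : C) : Cmod (Cconj a) = Cmod a.
Proof. unfold Cmod; simpl. f_equal. ring. Qed.
Lemma Cmult_Cconj (a : C) : (a * Cconj a)%C = RtoC (Cmod a ^ 2).
Proof. unfold Cmod. rewrite pow2_sqrt by nra.
 unfold Cconj, Cmult, RtoC; simpl. f_equal; ring.
Qed.

Lemma mdagger_mmul (A B : M2) : mdagger (A ** B)%M2 = (mdagger B ** mdagger A)%M2.
Proof. rewrite (mat2_eta A), (mat2_eta B), mmul_mat2, !mdagger_mat2, mmul_mat2.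
 rewrite !Cconj_plus, !Cconj_mult. f_equal; ring.
Qed.

Lemma mdagger_invol (A : M2) : mdagger (mdagger A) = A.
Proof. rewrite (mat2_eta A), !mdagger_mat2, !Cconj_conj. reflexivity. Qed.

Lemma mdet_mdagger (A : M2) : mdet (mdagger A) = Cconj (mdet A).
Proof. rewrite (mat2_eta A), mdagger_mat2, !mdet_mat2. unfold Cminus.
 rewrite Cconj_plus, Cconj_opp, !Cconj_mult. ring.
Qed.

Lemma mmul_eq_one (A B : M2) : mdet A = 1%C -> (A ** B)%M2 = mone -> B = minv A.
Proof. intros HA E. rewrite <- (mmul_1_r (minv A)), <- E, mmul_assoc, mmul_minv_l, mmul_1_l; auto.
Qed.

Lemma is_SU2_dagger (A : M2) : is_SU2 A <-> mdet A = 1%C /\ mdagger A = minv A.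
Proof. split; intros [H1 H2]; split; auto.
 - apply mmul_eq_one; auto.
 - rewrite H2. apply mmul_minv_r; auto.
Qed.

Lemma is_SU2_mmul (A B : M2) : is_SU2 A -> is_SU2 B -> is_SU2 (A ** B)%M2.
Proof. rewrite !is_SU2_dagger. intros [H1 H2] [H3 H4]; split.
 - rewrite mdet_mmul, H1, H3. ring.
 - rewrite mdagger_mmul, minv_mmul, H2, H4. reflexivity.
Qed.

Lemma is_SU2_minv (A : M2) : is_SU2 A -> is_SU2 (minv A).
Proof. rewrite !is_SU2_dagger. intros [H1 H2]; split.
 - now rewrite mdet_minv.
 - rewrite <- H2 at 1. rewrite mdagger_invol, minv_invol. reflexivity.
Qed.

Lemma is_SU2_mone : is_SU2 mone.
Proof. split; [rewrite mone_mat2, mdet_mat2; ring|].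
 rewrite mmul_1_l, mone_mat2, mdagger_mat2, !Cconj_RtoC. reflexivity.
Qed.

(** * Derivatives *)

Lemma plus_minus {G : AbelianGroup} (z x : G) : plus x (minus z x) = z.
Proof. unfold minus. now rewrite (plus_comm z), plus_assoc, plus_opp_r, plus_zero_l. Qed.

(** All later estimates are done with increments, so the filter definition is unpacked once, for
    real and for complex scalars. *)
Lemma is_derive_eps_gen {K : AbsRing} {V : NormedModule K} (f : K -> V) x l : is_derive f x l <->
 forall eps, 0 < eps -> exists del, 0 < del /\ forall h : K, abs h < del ->
  norm (minus (minus (f (plus x h)) (f x)) (scal h l)) <= eps * abs h.
Proof. assert (E : forall h : K, minus (plus x h) x = h)
  by (intros h; unfold minus; rewrite plus_comm, plus_assoc, plus_opp_l; apply plus_zero_l).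
 split.
 - intros [_ D] eps He. destruct (D x (fun P H => H) (mkposreal eps He)) as [d Hd].
  exists d. split; [apply cond_pos|]. intros h Hh. 
  assert (B : ball x d (plus x h)) by (change (abs (minus (plus x h) x) < d); now rewrite E).
  specialize (Hd _ B). simpl in Hd. change (norm (minus (minus (f (plus x h)) (f x)) (scal (minus (plus x h) x) l)) <= eps * abs (minus (plus x h) x)) in Hd.
  now rewrite E in Hd.
 - intros D. split; [apply is_linear_scal_l|]. intros y Hy eps.
  replace y with x by (apply is_filter_lim_locally_unique; exact Hy).
  destruct (D eps (cond_pos eps)) as [d [Hd H]]. exists (mkposreal d Hd). refine (fun z : K => _). intros Hz.
  specialize (H (minus z x) Hz). 
  assert (E' : plus x (minus z x) = z) by apply (plus_minus z x).
  rewrite E' in H. exact H.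
Qed.

Lemma is_derive_eps (f : R -> R) (x l : R) :
 is_derive f x l <->
 (forall eps, 0 < eps -> exists del, 0 < del /\ forall h, Rabs h < del ->
   Rabs (f (x + h) - f x - l * h) <= eps * Rabs h).
Proof.
 rewrite is_derive_eps_gen. split; intros H eps He; destruct (H eps He) as [d [Hd K]]; exists d; (split; [auto|]); intros h Hh; specialize (K h Hh);
  [rewrite (Rmult_comm l)|rewrite (Rmult_comm l) in K]; exact K.
Qed.

Definition RD (f : R -> C) (t : R) (d : C) : Prop :=
 is_derive (fun s => Re (f s)) t (Re d) /\ is_derive (fun s => Im (f s)) t (Im d).

(* First order expansion [f (z + h) = f z + a h + b conj h + o h], that is
  [a] and [b] are the Wirtinger derivatives of [f] at [z]. *)
Definition WD (f : C -> C) (z a b : C) : Prop :=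
 forall eps, 0 < eps -> exists del, 0 < del /\ forall h, Cmod h < del ->
  Cmod (f (z + h) - f z - a * h - b * Cconj h)%C <= eps * Cmod h.

Ltac nzC := let X := fresh in intros X; apply RtoC_inj in X; (lra || auto).
Ltac tri := eapply Rle_trans; [apply Cmod_triangle|].
Ltac trilt := eapply Rle_lt_trans; [apply Cmod_triangle|].

Lemma Cmod_near r z v : Cmod (v - z)%C < r - Cmod z -> Cmod v < r.
Proof. intros Hv. replace v with ((v - z) + z)%C by ring. trilt. lra. Qed.

Lemma Cmod_le_Re_Im (c : C) : Cmod c <= Rabs (Re c) + Rabs (Im c).
Proof. destruct c as [x y]. unfold Cmod; simpl.
 apply Rsqr_incr_0_var; [|generalize (Rabs_pos x) (Rabs_pos y); lra].
 rewrite Rsqr_sqrt by nra. unfold Rsqr.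
 generalize (Rabs_pos x) (Rabs_pos y) (pow2_abs x) (pow2_abs y). nra.
Qed.
Ltac reim := eapply Rle_trans; [apply Cmod_le_Re_Im|].
Ltac reimlt := eapply Rle_lt_trans; [apply Cmod_le_Re_Im|].

Lemma Re_le_Cmod (c : C) : Rabs (Re c) <= Cmod c.
Proof. apply Rle_trans with (2 := Rmax_Cmod c). apply Rmax_l. Qed.
Lemma Im_le_Cmod (c : C) : Rabs (Im c) <= Cmod c.
Proof. apply Rle_trans with (2 := Rmax_Cmod c). apply Rmax_r. Qed.

Lemma RD_eps (f : R -> C) (t : R) (d : C) :
 RD f t d <->
 (forall eps, 0 < eps -> exists del, 0 < del /\ forall h, Rabs h < del ->
   Cmod (f (t + h)%R - f t - d * RtoC h)%C <= eps * Rabs h).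
Proof. unfold RD; rewrite !is_derive_eps. split.
 - intros [H1 H2] eps Heps.
  destruct (H1 (eps / 2)) as [d1 [Hd1 K1]]; [lra|].
  destruct (H2 (eps / 2)) as [d2 [Hd2 K2]]; [lra|].
  exists (Rmin d1 d2); split; [now apply Rmin_glb_lt|]. intros h Hh.
  reim.
  assert (L1 := K1 h (Rlt_le_trans _ _ _ Hh (Rmin_l _ _))).
  assert (L2 := K2 h (Rlt_le_trans _ _ _ Hh (Rmin_r _ _))).
  replace (Re (f (t + h)%R - f t - d * RtoC h)%C) with (Re (f (t + h)) - Re (f t) - Re d * h)
   by (unfold Re, Im; simpl; ring).
  replace (Im (f (t + h)%R - f t - d * RtoC h)%C) with (Im (f (t + h)) - Im (f t) - Im d * h)
   by (unfold Re, Im; simpl; ring).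
  lra.
 - intros H; split; intros eps Heps; destruct (H eps Heps) as [del [Hdel K]];
   exists del; (split; [exact Hdel|]); intros h Hh;
   eapply Rle_trans; [|apply (K h Hh)| |apply (K h Hh)].
  + replace (Re (f (t + h)) - Re (f t) - Re d * h) with (Re (f (t + h)%R - f t - d * RtoC h)%C)
    by (unfold Re, Im; simpl; ring). apply Re_le_Cmod.
  + replace (Im (f (t + h)) - Im (f t) - Im d * h) with (Im (f (t + h)%R - f t - d * RtoC h)%C)
    by (unfold Re, Im; simpl; ring). apply Im_le_Cmod.
Qed.

Lemma norm_C_R (c : C) : @norm R_AbsRing C_R_NormedModule c = Cmod c.
Proof. destruct c as [x y]. unfold norm; simpl. unfold prod_norm, norm; simpl. unfold abs; simpl.
 unfold Cmod; simpl. f_equal. generalize (pow2_abs x) (pow2_abs y). lra. Qed.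

Lemma is_derive_RD (f : R -> C) (t : R) (d : C) :
 @is_derive R_AbsRing C_R_NormedModule f t d <-> RD f t d.
Proof. rewrite RD_eps, is_derive_eps_gen.
 assert (E : forall h, @norm R_AbsRing C_R_NormedModule (minus (minus (f (plus t h)) (f t)) (scal h d)) = Cmod (f (t + h)%R - f t - d * RtoC h)%C).
 { intros h. rewrite norm_C_R. f_equal. apply injective_projections; cbn; match goal with |- ?a = ?b => change (@eq R a b); ring end. }
 split; intros H eps He; destruct (H eps He) as [e [Hd K]]; exists e; (split; [auto|]); intros h Hh; specialize (K h Hh);
  [rewrite <- E; exact K|exact (Rle_trans _ _ _ (Req_le _ _ (E h)) K)].
Qed.

Lemma WD_hol (f : C -> C) (z d : C) : WD f z d 0 <-> forall eps, 0 < eps -> exists del, 0 < del /\ forall h, Cmod h < del ->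
  Cmod (f (z + h) - f z - h * d)%C <= eps * Cmod h.
Proof. assert (E : forall h, (f (z + h) - f z - d * h - 0 * Cconj h = f (z + h) - f z - h * d)%C) by (intros; ring).
 split; intros H eps He; destruct (H eps He) as [e [Hd K]]; exists e; (split; [auto|]); intros h Hh; specialize (K h Hh);
  [rewrite <- E|rewrite E]; exact K.
Qed.

Lemma is_derive_WD (f : C -> C) (z d : C) :
 @is_derive C_AbsRing C_NormedModule f z d <-> WD f z d 0.
Proof. rewrite is_derive_eps_gen, WD_hol. reflexivity. Qed.

Lemma RtoC_m1 : RtoC (-1) = (- (1))%C.
Proof. ring. Qed.

Lemma Cminus_eq_0 (a b : C) : (a - b)%C = 0 -> a = b.
Proof. intros E. replace a with ((a - b) + b)%C by ring. rewrite E. ring. Qed.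

Lemma ent00 p q r s : ent (mat2 p q r s) 0 0 = p. Proof. auto. Qed.
Lemma ent01 p q r s : ent (mat2 p q r s) 0 1 = q. Proof. auto. Qed.
Lemma ent10 p q r s : ent (mat2 p q r s) 1 0 = r. Proof. auto. Qed.
Lemma ent11 p q r s : ent (mat2 p q r s) 1 1 = s. Proof. auto. Qed.
Ltac ents := rewrite ?ent00, ?ent01, ?ent10, ?ent11.

Lemma mmul_eta (A B : M2) : (A ** B)%M2 =
 mat2 (ent A 0 0 * ent B 0 0 + ent A 0 1 * ent B 1 0) (ent A 0 0 * ent B 0 1 + ent A 0 1 * ent B 1 1)
    (ent A 1 0 * ent B 0 0 + ent A 1 1 * ent B 1 0) (ent A 1 0 * ent B 0 1 + ent A 1 1 * ent B 1 1).
Proof. rewrite (mat2_eta A). apply mmul_mat2. Qed.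

Definition little_o (r : C -> C) : Prop :=
 forall eps, 0 < eps -> exists del, 0 < del /\ forall h, Cmod h < del ->
  Cmod (r h) <= eps * Cmod h.

Lemma little_o_plus (r s : C -> C) :
 little_o r -> little_o s -> little_o (fun h => r h + s h)%C.
Proof. intros Hr Hs eps Heps.
 destruct (Hr (eps / 2)) as [d1 [Hd1 K1]]; [lra|].
 destruct (Hs (eps / 2)) as [d2 [Hd2 K2]]; [lra|].
 exists (Rmin d1 d2); split; [now apply Rmin_glb_lt|]. intros h Hh.
 tri.
 assert (L1 := K1 h (Rlt_le_trans _ _ _ Hh (Rmin_l _ _))).
 assert (L2 := K2 h (Rlt_le_trans _ _ _ Hh (Rmin_r _ _))). lra.
Qed.

Lemma little_o_bound (r s : C -> C) (M d : R) : 0 <= M -> 0 < d ->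
 (forall h, Cmod h < d -> Cmod (s h) <= M * Cmod (r h)) -> little_o r -> little_o s.
Proof. intros HM Hd0 B Hr eps Heps.
 (* The summand 1 keeps the quotient meaningful when [M = 0]; the same device recurs below. *)
 destruct (Hr (eps / (M + 1))) as [d1 [Hd1 K1]].
 { apply Rdiv_lt_0_compat; lra. }
 exists (Rmin d1 d); split; [now apply Rmin_glb_lt|]. intros h Hh.
 assert (L1 := K1 h (Rlt_le_trans _ _ _ Hh (Rmin_l _ _))).
 assert (L2 := B h (Rlt_le_trans _ _ _ Hh (Rmin_r _ _))).
 eapply Rle_trans; [exact L2|].
 apply Rle_trans with (M * (eps / (M + 1) * Cmod h)); [now apply Rmult_le_compat_l|].
 generalize (Cmod_ge_0 h); intros.
 replace (M * (eps / (M + 1) * Cmod h)) with (M / (M + 1) * (eps * Cmod h)) by (field; lra).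
 assert (M / (M + 1) <= 1) by (apply Rle_div_l; lra).
 rewrite <- (Rmult_1_l (eps * Cmod h)) at 2.
 apply Rmult_le_compat_r; auto. apply Rmult_le_pos; lra.
Qed.

Lemma little_o_quadratic (r : C -> C) (M d : R) : 0 < d ->
 (forall h, Cmod h < d -> Cmod (r h) <= M * Cmod h ^ 2) -> little_o r.
Proof. intros Hd B eps Heps.
 exists (Rmin d (eps / (Rabs M + 1))). split.
 { apply Rmin_glb_lt; auto. apply Rdiv_lt_0_compat; auto. generalize (Rabs_pos M); lra. }
 intros h Hh. eapply Rle_trans; [apply B; eapply Rlt_le_trans; [exact Hh|apply Rmin_l]|].
 assert (H1 : Cmod h <= eps / (Rabs M + 1)).
 { apply Rlt_le; eapply Rlt_le_trans; [exact Hh|apply Rmin_r]. }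
 assert (HM := Rabs_pos M). assert (HM2 := Rle_abs M). assert (Hh0 := Cmod_ge_0 h).
 apply (Rmult_le_compat_l (Rabs M + 1)) in H1; [|lra].
 replace ((Rabs M + 1) * (eps / (Rabs M + 1))) with eps in H1 by (field; lra). nra.
Qed.

Lemma little_o_ext (r s : C -> C) (d : R) : 0 < d ->
 (forall h, Cmod h < d -> r h = s h) -> little_o r -> little_o s.
Proof. intros Hd E. apply little_o_bound with 1 d; auto; [lra|].
 intros h Hh. rewrite E; auto. lra.
Qed.

Lemma WD_lip (f : C -> C) z a b : WD f z a b ->
 exists M d, 0 <= M /\ 0 < d /\ forall h, Cmod h < d -> Cmod (f (z + h) - f z)%C <= M * Cmod h.
Proof. intros H. destruct (H 1) as [d [Hd K]]; [lra|].
 exists (1 + Cmod a + Cmod b), d. split; [|split; auto].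
 - generalize (Cmod_ge_0 a) (Cmod_ge_0 b); lra.
 - intros h Hh. specialize (K h Hh).
  replace (f (z + h) - f z)%C
   with ((f (z + h) - f z - a * h - b * Cconj h) + a * h + b * Cconj h)%C by ring.
  tri.
  eapply Rle_trans; [apply Rplus_le_compat_r; apply Cmod_triangle|].
  rewrite !Cmod_mult, Cmod_Cconj. lra.
Qed.

Lemma WD_ext_loc (f g : C -> C) z a b d : 0 < d ->
 (forall w, Cmod (w - z) < d -> f w = g w) -> WD f z a b -> WD g z a b.
Proof. intros Hd E. apply little_o_ext with d; auto. intros h Hh.
 rewrite !E; auto.
 - replace (z - z)%C with (RtoC 0) by ring. now rewrite Cmod_0.
 - now replace (z + h - z)%C with h by ring.
Qed.

Lemma WD_ext (f g : C -> C) z a b : (forall w, f w = g w) -> WD f z a b -> WD g z a b.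
Proof. intros E. apply WD_ext_loc with 1; auto; lra. Qed.

Lemma WD_const c z : WD (fun _ => c) z 0 0.
Proof. exists 1; split; [lra|]. intros h _.
 replace (c - c - 0 * h - 0 * Cconj h)%C with (RtoC 0) by ring. rewrite Cmod_0.
 generalize (Cmod_ge_0 h); nra.
Qed.

Lemma WD_id z : WD (fun w => w) z 1 0.
Proof. exists 1; split; [lra|]. intros h _.
 replace (z + h - z - 1 * h - 0 * Cconj h)%C with (RtoC 0) by ring. rewrite Cmod_0.
 generalize (Cmod_ge_0 h); nra.
Qed.

Lemma WD_plus f g z a b a' b' : WD f z a b -> WD g z a' b' ->
 WD (fun w => f w + g w)%C z (a + a') (b + b').
Proof. intros Hf Hg. eapply little_o_ext; [apply Rlt_0_1| |apply (little_o_plus _ _ Hf Hg)].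
 intros h _; simpl; ring.
Qed.

(** By the local Lipschitz bounds the product of the two increments is quadratic in [h], hence
    negligible. *)
Lemma WD_mult f g z a b a' b' : WD f z a b -> WD g z a' b' ->
 WD (fun w => f w * g w)%C z (a * g z + f z * a') (b * g z + f z * b').
Proof. intros Hf Hg.
 destruct (WD_lip _ _ _ _ Hf) as [Mf [df [HMf [Hdf Lf]]]].
 destruct (WD_lip _ _ _ _ Hg) as [Mg [dg [HMg [Hdg Lg]]]].
 assert (Q : little_o (fun h => (f (z + h) - f z) * (g (z + h) - g z))%C).
 { apply little_o_quadratic with (Mf * Mg) (Rmin df dg); [now apply Rmin_glb_lt|].
  intros h Hh. rewrite Cmod_mult.
  replace (Mf * Mg * Cmod h ^ 2) with ((Mf * Cmod h) * (Mg * Cmod h)) by ring.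
  apply Rmult_le_compat; try apply Cmod_ge_0.
  - apply Lf. eapply Rlt_le_trans; [exact Hh|apply Rmin_l].
  - apply Lg. eapply Rlt_le_trans; [exact Hh|apply Rmin_r]. }
 assert (Q1 : little_o (fun h => g z * (f (z + h) - f z - a * h - b * Cconj h))%C).
 { apply (little_o_bound _ _ (Cmod (g z)) 1) with (4 := Hf); [apply Cmod_ge_0|lra|].
  intros h _. rewrite Cmod_mult. lra. }
 assert (Q2 : little_o (fun h => f z * (g (z + h) - g z - a' * h - b' * Cconj h))%C).
 { apply (little_o_bound _ _ (Cmod (f z)) 1) with (4 := Hg); [apply Cmod_ge_0|lra|].
  intros h _. rewrite Cmod_mult. lra. }
 eapply little_o_ext; [apply Rlt_0_1| |
  apply (little_o_plus _ _ (little_o_plus _ _ Q1 Q2) Q)].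
 intros h _; simpl; ring.
Qed.

Lemma WD_conj f z a b : WD f z a b -> WD (fun w => Cconj (f w)) z (Cconj b) (Cconj a).
Proof. intros H. apply (little_o_bound _ _ 1 1) with (4 := H); [lra|lra|].
 intros h _. rewrite <- (Cmod_Cconj (_ - _ - _ - b * _)%C). right. rewrite Rmult_1_l. f_equal.
 unfold Cminus. rewrite !Cconj_plus, !Cconj_opp, !Cconj_mult, Cconj_conj. ring.
Qed.

Lemma WD_opp f z a b : WD f z a b -> WD (fun w => - f w)%C z (- a) (- b).
Proof. intros H. eapply WD_ext; [|replace (- a)%C with (0 * f z + RtoC (-1) * a)%C; 
  [replace (- b)%C with (0 * f z + RtoC (-1) * b)%C;
   [apply (WD_mult _ _ _ _ _ _ _ (WD_const (RtoC (-1)) z) H)|]|]].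
 - intros w; simpl. ring.
 - ring.
 - ring.
Qed.

Lemma WD_scal c f z a b : WD f z a b -> WD (fun w => c * f w)%C z (c * a) (c * b).
Proof. intros H. replace (c * a)%C with (0 * f z + c * a)%C by ring.
 replace (c * b)%C with (0 * f z + c * b)%C by ring.
 apply (WD_mult _ _ _ _ _ _ _ (WD_const c z) H).
Qed.

Lemma WD_eq f z a b a' b' : WD f z a b -> a = a' -> b = b' -> WD f z a' b'.
Proof. intros; now subst. Qed.

Lemma RD_lip (f : R -> C) t d : RD f t d ->
 exists M e, 0 <= M /\ 0 < e /\ forall h, Rabs h < e -> Cmod (f (t + h)%R - f t)%C <= M * Rabs h.
Proof. rewrite RD_eps. intros H. destruct (H 1) as [e [He K]]; [lra|].
 exists (1 + Cmod d), e. split; [|split; auto].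
 - generalize (Cmod_ge_0 d); lra.
 - intros h Hh. specialize (K h Hh).
  replace (f (t + h)%R - f t)%C with ((f (t + h)%R - f t - d * RtoC h) + d * RtoC h)%C by ring.
  tri.
  rewrite Cmod_mult, Cmod_R. lra.
Qed.

Definition WDon (D : C -> Prop) (f : C -> C) (z a b : C) : Prop :=
 forall eps, 0 < eps -> exists del, 0 < del /\ forall h, Cmod h < del -> D (z + h)%C ->
  Cmod (f (z + h) - f z - a * h - b * Cconj h)%C <= eps * Cmod h.

(** Chain rule along a curve that never leaves [D]; the conjugate velocity meets the derivative in
    [conj z]. *)
Lemma RD_WDon_comp (D : C -> Prop) (f : C -> C) (g : R -> C) t a b d : (forall s, D (g s)) ->
 WDon D f (g t) a b -> RD g t d -> RD (fun s => f (g s)) t (a * d + b * Cconj d).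
Proof. intros HD Hf Hg. destruct (RD_lip _ _ _ Hg) as [M [e [HM [He L]]]].
 rewrite RD_eps in Hg. apply RD_eps. intros eps Heps.
 set (A := Cmod a + Cmod b + 1).
 assert (HA : 0 < A) by (unfold A; generalize (Cmod_ge_0 a) (Cmod_ge_0 b); lra).
 destruct (Hf (eps / 2 / (M + 1))) as [d1 [Hd1 K1]].
 { apply Rdiv_lt_0_compat; lra. }
 destruct (Hg (eps / 2 / A)) as [d2 [Hd2 K2]].
 { apply Rdiv_lt_0_compat; lra. }
 exists (Rmin (Rmin e d2) (d1 / (M + 1))). split.
 { repeat apply Rmin_glb_lt; auto. apply Rdiv_lt_0_compat; lra. }
 intros h Hh.
 assert (Hhe : Rabs h < e) by (eapply Rlt_le_trans; [exact Hh|]; eapply Rle_trans; apply Rmin_l).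
 assert (Hh2 : Rabs h < d2).
 { eapply Rlt_le_trans; [exact Hh|]. eapply Rle_trans; [apply Rmin_l|apply Rmin_r]. }
 assert (Hh1 : Rabs h < d1 / (M + 1)) by (eapply Rlt_le_trans; [exact Hh|]; apply Rmin_r).
 specialize (L h Hhe). specialize (K2 h Hh2).
 assert (Hh0 := Rabs_pos h).
 assert (Hk : Cmod (g (t + h)%R - g t)%C < d1).
 {
  apply (Rmult_lt_compat_l (M + 1)) in Hh1; [|lra].
  replace ((M + 1) * (d1 / (M + 1))) with d1 in Hh1 by (field; lra). nra. }
 specialize (K1 _ Hk). replace (g t + (g (t + h)%R - g t))%C with (g (t + h)%R) in K1 by ring.
 specialize (K1 (HD _)).
 set (k := (g (t + h)%R - g t)%C) in *.
 set (r := (k - d * RtoC h)%C) in *.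
 replace (f (g (t + h)%R) - f (g t) - (a * d + b * Cconj d) * RtoC h)%C
  with ((f (g (t + h)%R) - f (g t) - a * k - b * Cconj k) + (a * r + b * Cconj r))%C.
 2:{ unfold r, Cminus. rewrite Cconj_plus, Cconj_opp, Cconj_mult, Cconj_RtoC. ring. }
 tri.
 assert (L1 : Cmod (a * r + b * Cconj r)%C <= A * Cmod r).
 { tri. rewrite !Cmod_mult, Cmod_Cconj.
  unfold A. generalize (Cmod_ge_0 r); nra. }
 assert (L2 : A * Cmod r <= eps / 2 * Rabs h).
 { apply Rle_trans with (A * (eps / 2 / A * Rabs h)); [apply Rmult_le_compat_l; [lra|exact K2]|].
  right. field. lra. }
 assert (L3 : eps / 2 / (M + 1) * Cmod k <= eps / 2 * Rabs h).
 { apply Rle_trans with (eps / 2 / (M + 1) * ((M + 1) * Rabs h)).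
  - apply Rmult_le_compat_l; [apply Rlt_le, Rdiv_lt_0_compat; lra|]. nra.
  - right. field. lra. }
 lra.
Qed.

Lemma RD_WD_comp (f : C -> C) (g : R -> C) t a b d :
 WD f (g t) a b -> RD g t d -> RD (fun s => f (g s)) t (a * d + b * Cconj d).
Proof. intros H. apply (RD_WDon_comp (fun _ => True)); auto.
 intros eps Heps. destruct (H eps Heps) as [del [Hd K]]. exists del; split; auto.
Qed.

Lemma RD_ext (f g : R -> C) t d : (forall s, f s = g s) -> RD f t d -> RD g t d.
Proof. intros E [H1 H2]; split; eapply is_derive_ext; [|exact H1| |exact H2]; intros; simpl; now rewrite E. Qed.

Lemma RD_ext_loc (f g : R -> C) t d e : 0 < e ->
 (forall s, Rabs (s - t) < e -> f s = g s) -> RD f t d -> RD g t d.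
Proof. intros He E [H1 H2]; split.
 - eapply is_derive_ext_loc; [|exact H1]. exists (mkposreal e He). intros s Hs. now rewrite E.
 - eapply is_derive_ext_loc; [|exact H2]. exists (mkposreal e He). intros s Hs. now rewrite E.
Qed.

Lemma RD_eq f t d d' : RD f t d -> d = d' -> RD f t d'.
Proof. intros; now subst. Qed.

Lemma RD_unique f t d d' : RD f t d -> RD f t d' -> d = d'.
Proof. intros [H1 H2] [H3 H4].
 apply is_derive_unique in H1, H2, H3, H4. destruct d, d'; simpl in *. congruence.
Qed.

Lemma RD_const c t : RD (fun _ => c) t 0.
Proof. split; apply @is_derive_const. Qed.

Lemma RD_plus f g t a b : RD f t a -> RD g t b -> RD (fun s => f s + g s)%C t (a + b)%C.
Proof. intros [H1 H2] [H3 H4]; split.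
 - apply (is_derive_plus _ _ _ _ _ H1 H3).
 - apply (is_derive_plus _ _ _ _ _ H2 H4).
Qed.

Lemma RD_mult f g t a b : RD f t a -> RD g t b ->
 RD (fun s => f s * g s)%C t (a * g t + f t * b)%C.
Proof. intros [H1 H2] [H3 H4]; split.
 - assert (K := is_derive_minus _ _ _ _ _
   (is_derive_mult _ _ _ _ _ H1 H3 Rmult_comm) (is_derive_mult _ _ _ _ _ H2 H4 Rmult_comm)).
  match type of K with is_derive _ _ ?l => replace (Re (a * g t + f t * b)%C) with l; [exact K|] end.
  unfold minus, plus, opp, mult, Re, Im; simpl. ring.
 - assert (K := is_derive_plus _ _ _ _ _
   (is_derive_mult _ _ _ _ _ H1 H4 Rmult_comm) (is_derive_mult _ _ _ _ _ H2 H3 Rmult_comm)).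
  match type of K with is_derive _ _ ?l => replace (Im (a * g t + f t * b)%C) with l; [exact K|] end.
  unfold plus, mult, Re, Im; simpl. ring.
Qed.

Lemma RD_scal c f t a : RD f t a -> RD (fun s => c * f s)%C t (c * a)%C.
Proof. intros H. eapply RD_eq; [apply (RD_mult _ _ _ _ _ (RD_const c t) H)|]. ring.
Qed.

Lemma RD_opp f t a : RD f t a -> RD (fun s => - f s)%C t (- a)%C.
Proof. intros H. eapply RD_ext; [|eapply RD_eq; [apply (RD_scal (RtoC (-1)) _ _ _ H)|]].
 - intros s; simpl. rewrite RtoC_m1; ring.
 - rewrite RtoC_m1; ring.
Qed.

Lemma RD_conj f t a : RD f t a -> RD (fun s => Cconj (f s)) t (Cconj a).
Proof. intros [H1 H2]; split; [exact H1|]. apply (is_derive_opp _ _ _ H2). Qed.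

Lemma RD_line_x x y : RD (fun t => (t, y)) x 1.
Proof. split; simpl; [apply @is_derive_id|apply @is_derive_const]. Qed.

Lemma RD_line_y x y : RD (fun t => (x, t)) y Ci.
Proof. split; simpl; [apply @is_derive_const|apply @is_derive_id]. Qed.

Lemma RD_cis t : RD cis t (Ci * cis t).
Proof. split; simpl.
 - auto_derive; auto. ring.
 - auto_derive; auto. ring.
Qed.

Lemma WD_RD_x f z a b : WD f z a b -> RD (fun t => f (t, Im z)) (Re z) (a + b).
Proof. intros H. eapply RD_eq.
 - apply (RD_WD_comp f (fun t => (t, Im z)) (Re z) a b 1); [|apply RD_line_x].
  now destruct z.
 - rewrite Cconj_RtoC. ring.
Qed.

Lemma WD_RD_y f z a b : WD f z a b -> RD (fun t => f (Re z, t)) (Im z) (Ci * (a - b)).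
Proof. intros H. eapply RD_eq.
 - apply (RD_WD_comp f (fun t => (Re z, t)) (Im z) a b Ci); [|apply RD_line_y].
  now destruct z.
 - rewrite Cconj_Ci. ring.
Qed.

Lemma Ci_mult : (Ci * Ci)%C = (- (1))%C.
Proof. unfold Cmult, Copp; simpl. f_equal; ring. Qed.

Lemma Cmod_Ci : Cmod Ci = 1.
Proof. unfold Cmod, Ci; simpl. replace (_ + _) with 1 by ring. apply sqrt_1. Qed.

Lemma Ci_neq_0 : Ci <> 0.
Proof. intros E; injection E; lra. Qed.

Lemma C2_neq_0 : RtoC 2 <> 0.
Proof. intros E; injection E; lra. Qed.

(** The two real partial derivatives are [a + b] and [i (a - b)], which determine [a] and [b]. *)
Lemma WD_unique f z a b a' b' : WD f z a b -> WD f z a' b' -> a = a' /\ b = b'.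
Proof. intros H H'.
 assert (E1 := RD_unique _ _ _ _ (WD_RD_x _ _ _ _ H) (WD_RD_x _ _ _ _ H')).
 assert (E2 := RD_unique _ _ _ _ (WD_RD_y _ _ _ _ H) (WD_RD_y _ _ _ _ H')).
 assert (E3 : (a - b = a' - b')%C).
 { replace (a - b)%C with (- (Ci * Ci) * (a - b))%C by (rewrite Ci_mult; ring).
  replace (a' - b')%C with (- (Ci * Ci) * (a' - b'))%C by (rewrite Ci_mult; ring).
  replace (- (Ci * Ci) * (a - b))%C with (- Ci * (Ci * (a - b)))%C by ring.
  rewrite E2. ring. }
 split.
 - replace a with (/ 2 * ((a + b) + (a - b)))%C by (field; auto).
  rewrite E1, E3. field; auto.
 - replace b with (/ 2 * ((a + b) - (a - b)))%C by (field; auto).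
  rewrite E1, E3. field; auto.
Qed.

Lemma ball_C_Cmod (z w : C) (e : R) : Cmod (w - z)%C < e -> @ball C_UniformSpace z e w.
Proof. split.
 - eapply Rle_lt_trans; [|exact H]. apply (Re_le_Cmod (w - z)%C).
 - eapply Rle_lt_trans; [|exact H]. apply (Im_le_Cmod (w - z)%C).
Qed.

(** Balls of the product uniform structure are squares, whence the factor 2. *)
Lemma Cmod_ball_C (z w : C) (e : R) : @ball C_UniformSpace z e w -> Cmod (w - z)%C < 2 * e.
Proof. intros [H1 H2]. reimlt.
 change (Rabs (Re w - Re z) < e) in H1. change (Rabs (Im w - Im z) < e) in H2.
 replace (Re (w - z)%C) with (Re w - Re z) by (unfold Re; simpl; ring).
 replace (Im (w - z)%C) with (Im w - Im z) by (unfold Im; simpl; ring). lra.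
Qed.

Lemma continuous_C_eps (f : C -> C) z :
 @continuous C_UniformSpace C_UniformSpace f z <->
 (forall eps, 0 < eps -> exists del, 0 < del /\ forall w, Cmod (w - z)%C < del ->
   Cmod (f w - f z)%C < eps).
Proof. split.
 - intros H eps Heps.
  assert (He2 : 0 < eps / 2) by lra.
  destruct (H (@ball C_UniformSpace (f z) (eps / 2))) as [d Hd].
  { exists (mkposreal _ He2). auto. }
  exists d; split; [apply cond_pos|]. intros w Hw.
  replace eps with (2 * (eps / 2)) by field. apply Cmod_ball_C, Hd, ball_C_Cmod, Hw.
 - intros H P [e He]. destruct (H e (cond_pos e)) as [d [Hd K]].
  assert (Hd2 : 0 < d / 2) by lra.
  exists (mkposreal _ Hd2). intros w Hw. apply He, ball_C_Cmod, K.
  apply Cmod_ball_C in Hw. simpl in Hw. lra.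
Qed.

Lemma open_C_eps (U : C -> Prop) :
 @open C_UniformSpace U <->
 (forall z, U z -> exists d, 0 < d /\ forall w, Cmod (w - z)%C < d -> U w).
Proof. split.
 - intros H z Hz. destruct (H z Hz) as [d Hd]. exists d; split; [apply cond_pos|].
  intros w Hw. now apply Hd, ball_C_Cmod.
 - intros H z Hz. destruct (H z Hz) as [d [Hd K]].
  assert (Hd2 : 0 < d / 2) by lra.
  exists (mkposreal _ Hd2). intros w Hw. apply K. apply Cmod_ball_C in Hw. simpl in Hw. lra.
Qed.

Lemma WD_continuous f z a b : WD f z a b -> @continuous C_UniformSpace C_UniformSpace f z.
Proof. intros H. destruct (WD_lip _ _ _ _ H) as [M [d [HM [Hd L]]]].
 apply continuous_C_eps. intros eps Heps.
 exists (Rmin d (eps / (M + 1))). split.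
 { apply Rmin_glb_lt; auto. apply Rdiv_lt_0_compat; lra. }
 intros w Hw. specialize (L (w - z)%C). replace (z + (w - z))%C with w in L by ring.
 eapply Rle_lt_trans; [apply L; eapply Rlt_le_trans; [exact Hw|apply Rmin_l]|].
 assert (H1 : Cmod (w - z)%C < eps / (M + 1)) by (eapply Rlt_le_trans; [exact Hw|apply Rmin_r]).
 apply (Rmult_lt_compat_l (M + 1)) in H1; [|lra].
 replace ((M + 1) * (eps / (M + 1))) with eps in H1 by (field; lra). nra.
Qed.

Lemma is_derive_zero_const (f : R -> R) (a b : R) : a <= b ->
 (forall t, a <= t <= b -> is_derive f t 0) -> f b = f a.
Proof. intros Hab H. destruct (MVT_gen f a b (fun _ => 0)) as [c [_ E]].
 - intros x. rewrite Rmin_left, Rmax_right by lra. intros Hx; apply H; lra.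
 - intros x. rewrite Rmin_left, Rmax_right by lra. intros Hx.
  apply derivable_continuous_pt. exists 0. apply is_derive_Reals, H; lra.
 - lra.
Qed.

Lemma RD_zero_const (f : R -> C) (a b : R) : 
 (forall t, Rmin a b <= t <= Rmax a b -> RD f t 0) -> f a = f b.
Proof. intros H.
 assert (K : forall a b, a <= b -> (forall t, a <= t <= b -> RD f t 0) -> f b = f a).
 { clear. intros a b Hab H.
  assert (E1 := is_derive_zero_const (fun s => Re (f s)) a b Hab (fun t Ht => proj1 (H t Ht))).
  assert (E2 := is_derive_zero_const (fun s => Im (f s)) a b Hab (fun t Ht => proj2 (H t Ht))).
  simpl in E1, E2. destruct (f a), (f b); simpl in *; congruence. }
 destruct (Rle_dec a b) as [L|L].
 - rewrite Rmin_left, Rmax_right in H by lra. symmetry. apply K; auto.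
 - rewrite Rmin_right, Rmax_left in H by lra. apply K; auto. lra.
Qed.

Lemma Cmod_cis t : Cmod (cis t) = 1.
Proof. unfold Cmod; simpl. replace (_ + _) with 1; [apply sqrt_1|].
 generalize (sin2_cos2 t). unfold Rsqr. lra.
Qed.

Lemma circle_cis (l : C) : Cmod l = 1 -> exists t, 0 <= t <= 2 * PI /\ l = cis t.
Proof. destruct l as [x y]. intros H.
 assert (E : x ^ 2 + y ^ 2 = 1).
 { unfold Cmod in H; simpl fst in H; simpl snd in H.
  rewrite <- (pow2_sqrt (x ^ 2 + y ^ 2)) by nra. rewrite H. ring. }
 assert (Hx : -1 <= x <= 1) by nra.
 assert (B := acos_bound x).
 destruct (Rle_dec 0 y) as [Hy|Hy].
 - exists (acos x). split; [lra|]. unfold cis. rewrite cos_acos, sin_acos; auto.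
  f_equal. rewrite <- (sqrt_Rsqr y) by auto. f_equal. unfold Rsqr. nra.
 - exists (2 * PI - acos x). split; [lra|]. unfold cis.
  replace (cos (2 * PI - acos x)) with (cos (acos x)).
  2:{ rewrite <- cos_neg. rewrite <- (cos_period (- acos x) 1). f_equal. simpl. ring. }
  replace (sin (2 * PI - acos x)) with (- sin (acos x)).
  2:{ rewrite <- sin_neg. rewrite <- (sin_period (- acos x) 1). f_equal. simpl. ring. }
  rewrite cos_acos, sin_acos; auto. f_equal.
  assert (K : sqrt (1 - Rsqr x) = - y).
  { rewrite <- (sqrt_Rsqr (- y)) by lra. f_equal. unfold Rsqr. nra. }
  lra.
Qed.

Lemma cis_0 : cis 0 = 1.
Proof. unfold cis. rewrite cos_0, sin_0. reflexivity. Qed.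

Lemma circle_conj (l : C) : Cmod l = 1 -> (l * Cconj l)%C = 1.
Proof. intros H. rewrite Cmult_Cconj, H. f_equal. ring. Qed.

Lemma circle_inv (l : C) : Cmod l = 1 -> (/ l)%C = Cconj l.
Proof. intros H. assert (l <> 0) by (intros ->; rewrite Cmod_0 in H; lra).
 rewrite <- (Cmult_1_l (/ l)), <- (circle_conj l H). field. auto.
Qed.

(** * Absolutely convergent complex series *)

Definition CSer (u : nat -> C) : C :=
 (Series (fun n => Re (u n)), Series (fun n => Im (u n))).
Definition abs_conv (u : nat -> C) : Prop := ex_series (fun n => Cmod (u n)).

Lemma Re_plus (a b : C) : Re (a + b)%C = Re a + Re b. Proof. auto. Qed.
Lemma Im_plus (a b : C) : Im (a + b)%C = Im a + Im b. Proof. auto. Qed.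

Lemma abs_conv_Rabs_Re u : abs_conv u -> ex_series (fun n => Rabs (Re (u n))).
Proof. intros H. apply (@ex_series_le R_AbsRing R_CompleteNormedModule) with (2 := H).
 intros n. rewrite Rabs_Rabsolu. apply Re_le_Cmod.
Qed.
Lemma abs_conv_Rabs_Im u : abs_conv u -> ex_series (fun n => Rabs (Im (u n))).
Proof. intros H. apply (@ex_series_le R_AbsRing R_CompleteNormedModule) with (2 := H).
 intros n. rewrite Rabs_Rabsolu. apply Im_le_Cmod.
Qed.
Lemma abs_conv_Re u : abs_conv u -> ex_series (fun n => Re (u n)).
Proof. intros H. apply ex_series_Rabs, abs_conv_Rabs_Re, H. Qed.
Lemma abs_conv_Im u : abs_conv u -> ex_series (fun n => Im (u n)).
Proof. intros H. apply ex_series_Rabs, abs_conv_Rabs_Im, H. Qed.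

Lemma abs_conv_le (u : nat -> C) (b : nat -> R) :
 (forall n, Cmod (u n) <= b n) -> ex_series b -> abs_conv u.
Proof. intros H Hb. apply (@ex_series_le R_AbsRing R_CompleteNormedModule) with (2 := Hb).
 intros n. rewrite Rabs_pos_eq by apply Cmod_ge_0. apply H.
Qed.

Lemma abs_conv_plus u v : abs_conv u -> abs_conv v -> abs_conv (fun n => u n + v n)%C.
Proof. intros Hu Hv. apply abs_conv_le with (fun n => Cmod (u n) + Cmod (v n)).
 - intros n. apply Cmod_triangle.
 - apply (@ex_series_plus R_AbsRing R_NormedModule _ _ Hu Hv).
Qed.

Lemma abs_conv_scal c u : abs_conv u -> abs_conv (fun n => c * u n)%C.
Proof. intros Hu. apply abs_conv_le with (fun n => Cmod c * Cmod (u n)).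
 - intros n. rewrite Cmod_mult. lra.
 - apply (@ex_series_scal R_AbsRing R_NormedModule (Cmod c) _ Hu).
Qed.

Lemma CSer_ext u v : (forall n, u n = v n) -> CSer u = CSer v.
Proof. intros E. unfold CSer. f_equal; apply Series_ext; intros n; now rewrite E. Qed.

Lemma CSer_plus u v : abs_conv u -> abs_conv v ->
 CSer (fun n => u n + v n)%C = (CSer u + CSer v)%C.
Proof. intros Hu Hv. unfold CSer, Cplus; simpl. f_equal.
 - rewrite <- Series_plus by (apply abs_conv_Re; auto). now apply Series_ext.
 - rewrite <- Series_plus by (apply abs_conv_Im; auto). now apply Series_ext.
Qed.

Lemma CSer_scal c u : abs_conv u -> CSer (fun n => c * u n)%C = (c * CSer u)%C.
Proof. intros Hu. destruct c as [x y]. unfold CSer, Cmult; simpl.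
 assert (H1 := abs_conv_Re _ Hu). assert (H2 := abs_conv_Im _ Hu).
 f_equal.
 - rewrite <- !Series_scal_l, <- Series_minus.
  + now apply Series_ext.
  + apply (@ex_series_scal R_AbsRing R_NormedModule x _ H1).
  + apply (@ex_series_scal R_AbsRing R_NormedModule y _ H2).
 - rewrite <- !Series_scal_l, <- Series_plus.
  + now apply Series_ext.
  + apply (@ex_series_scal R_AbsRing R_NormedModule x _ H2).
  + apply (@ex_series_scal R_AbsRing R_NormedModule y _ H1).
Qed.

Lemma CSer_opp u : CSer (fun n => - u n)%C = (- CSer u)%C.
Proof. unfold CSer, Copp; simpl. f_equal; rewrite <- Series_opp; now apply Series_ext.
Qed.

Lemma CSer_conj u : CSer (fun n => Cconj (u n)) = Cconj (CSer u).
Proof. unfold CSer, Cconj; simpl. f_equal. rewrite <- Series_opp; now apply Series_ext.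
Qed.

(** The factor 2 comes from bounding real and imaginary parts separately; its size is immaterial. *)
Lemma CSer_bound u b : (forall n, Cmod (u n) <= b n) -> ex_series b ->
 Cmod (CSer u) <= 2 * Series b.
Proof. intros H Hb. reim. unfold CSer; simpl.
 assert (Hu := abs_conv_le _ _ H Hb).
 assert (L1 : Rabs (Series (fun n => Re (u n))) <= Series b).
 { eapply Rle_trans; [apply Series_Rabs, abs_conv_Rabs_Re, Hu|].
  apply Series_le; auto. intros n; split; [apply Rabs_pos|].
  eapply Rle_trans; [apply Re_le_Cmod|apply H]. }
 assert (L2 : Rabs (Series (fun n => Im (u n))) <= Series b).
 { eapply Rle_trans; [apply Series_Rabs, abs_conv_Rabs_Im, Hu|].
  apply Series_le; auto. intros n; split; [apply Rabs_pos|].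
  eapply Rle_trans; [apply Im_le_Cmod|apply H]. }
 lra.
Qed.

Lemma CSer_incr u : abs_conv u -> CSer u = (u 0%nat + CSer (fun n => u (S n)))%C.
Proof. intros Hu. unfold CSer, Cplus; simpl. f_equal.
 - rewrite Series_incr_1 by (apply abs_conv_Re; auto). reflexivity.
 - rewrite Series_incr_1 by (apply abs_conv_Im; auto). reflexivity.
Qed.

Lemma CSer_0 u : (forall n, u n = RtoC 0) -> CSer u = 0.
Proof. intros E. unfold CSer, RtoC. f_equal.
 - rewrite <- (Rmult_0_l (Series (fun _ => 0))), <- Series_scal_l.
  apply Series_ext. intros n; rewrite E; simpl; ring.
 - rewrite <- (Rmult_0_l (Series (fun _ => 0))), <- Series_scal_l.
  apply Series_ext. intros n; rewrite E; simpl; ring.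
Qed.

Fixpoint Csumn (f : nat -> C) (n : nat) : C :=
 match n with O => f O | S m => (Csumn f m + f (S m))%C end.

Lemma Re_Csumn f n : Re (Csumn f n) = sum_f_R0 (fun k => Re (f k)) n.
Proof. induction n as [|n IH]; simpl; auto. rewrite <- IH. reflexivity. Qed.
Lemma Im_Csumn f n : Im (Csumn f n) = sum_f_R0 (fun k => Im (f k)) n.
Proof. induction n as [|n IH]; simpl; auto. rewrite <- IH. reflexivity. Qed.

Lemma CSer_mult u v : abs_conv u -> abs_conv v ->
 CSer (fun n => Csumn (fun k => u k * v (n - k)%nat)%C n) = (CSer u * CSer v)%C.
Proof. intros Hu Hv.
 assert (M := fun a b Ha Hb => is_series_mult a b _ _
  (Series_correct a (ex_series_Rabs a Ha)) (Series_correct b (ex_series_Rabs b Hb)) Ha Hb).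
 assert (RR := M _ _ (abs_conv_Rabs_Re _ Hu) (abs_conv_Rabs_Re _ Hv)).
 assert (RI := M _ _ (abs_conv_Rabs_Re _ Hu) (abs_conv_Rabs_Im _ Hv)).
 assert (IR := M _ _ (abs_conv_Rabs_Im _ Hu) (abs_conv_Rabs_Re _ Hv)).
 assert (II := M _ _ (abs_conv_Rabs_Im _ Hu) (abs_conv_Rabs_Im _ Hv)).
 unfold CSer, Cmult; simpl. f_equal.
 - apply is_series_unique. eapply is_series_ext; [|apply (is_series_minus _ _ _ _ RR II)].
  intros n. rewrite Re_Csumn.
  rewrite <- Rminus_def, <- minus_sum. reflexivity.
 - apply is_series_unique. eapply is_series_ext; [|apply (is_series_plus _ _ _ _ RI IR)].
  intros n. rewrite Im_Csumn.
  rewrite <- plus_sum. reflexivity.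
Qed.

(** * Lower bounds for the radius of convergence *)

(** Boundedness of the terms at every smaller radius, instead of summability: this form passes
    directly to derivatives, Cauchy products and recursive estimates, and it yields summability
    through an intermediate radius. *)
Definition radius_ge (r : R) (g : nat -> R) : Prop :=
 forall s, 0 < s < r -> exists M, forall N, g N * s ^ N <= M.

(** Each of the [N + 1] powers [q ^ k] with [k <= N] is at least [q ^ N], and their sum is below the
    geometric series. *)
Lemma pow_S_bounded (q : R) : 0 <= q < 1 -> forall N, (INR N + 1) * q ^ N <= / (1 - q).
Proof. intros Hq N.
 assert (K : forall n, (INR n + 1) * q ^ n <= sum_f_R0 (fun k => q ^ k) n).
 { induction n as [|n IH]; [simpl; lra|].
  rewrite S_INR. simpl. assert (0 <= q ^ n) by (apply pow_le; lra).
  assert (0 <= INR n) by apply pos_INR.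
  assert (q * ((INR n + 1) * q ^ n) <= (INR n + 1) * q ^ n).
  { rewrite <- (Rmult_1_l ((INR n + 1) * q ^ n)) at 2.
   apply Rmult_le_compat_r; [apply Rmult_le_pos; lra|lra]. } lra. }
 eapply Rle_trans; [apply K|]. rewrite tech3 by lra.
 apply Rmult_le_reg_r with (1 - q); [lra|]. unfold Rdiv. rewrite Rmult_assoc, Rinv_l by lra.
 assert (0 <= q ^ S N) by (apply pow_le; lra). lra.
Qed.

(** The polynomial factor is absorbed by passing from [s] to the larger radius [(s + r) / 2]. *)
Lemma radius_ge_mulN r g : (forall N, 0 <= g N) -> radius_ge r g ->
 radius_ge r (fun N => (INR N + 1) * g N).
Proof. intros Hg H s Hs. destruct (H ((s + r) / 2)) as [M HM]; [lra|].
 set (t := (s + r) / 2) in *. assert (Ht : 0 < t) by (unfold t; lra).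
 set (q := s / t). assert (Hq : 0 <= q < 1).
 { unfold q; split; [apply Rlt_le, Rdiv_lt_0_compat; lra|]. apply Rlt_div_l; [lra|]. unfold t; lra. }
 exists (M * / (1 - q)). intros N.
 replace (s ^ N) with (q ^ N * t ^ N).
 2:{ unfold q. rewrite <- Rpow_mult_distr. f_equal. field. lra. }
 replace ((INR N + 1) * g N * (q ^ N * t ^ N)) with ((g N * t ^ N) * ((INR N + 1) * q ^ N)) by ring.
 apply Rmult_le_compat; auto.
 - apply Rmult_le_pos; auto. apply pow_le; lra.
 - apply Rmult_le_pos; [generalize (pos_INR N); lra|apply pow_le; lra].
 - apply pow_S_bounded; auto.
Qed.

Lemma radius_ge_le r g g' : (forall N, g' N <= g N) -> radius_ge r g -> radius_ge r g'.
Proof. intros L H s Hs. destruct (H s Hs) as [M HM]. exists M. intros N.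
 eapply Rle_trans; [|apply HM]. apply Rmult_le_compat_r; auto. apply pow_le; lra.
Qed.

Lemma radius_ge_scal r g c : 0 <= c -> radius_ge r g -> radius_ge r (fun N => c * g N).
Proof. intros Hc H s Hs. destruct (H s Hs) as [M HM]. exists (c * M). intros N.
 rewrite Rmult_assoc. apply Rmult_le_compat_l; auto.
Qed.

Lemma radius_ge_plus r g g' : radius_ge r g -> radius_ge r g' -> radius_ge r (fun N => g N + g' N).
Proof. intros H H' s Hs. destruct (H s Hs) as [M HM]. destruct (H' s Hs) as [M' HM'].
 exists (M + M'). intros N. specialize (HM N). specialize (HM' N). lra.
Qed.

Lemma radius_ge_shift r g : radius_ge r g -> radius_ge r (fun N => g (S N)).
Proof. intros H s Hs. destruct (H s Hs) as [M HM]. exists (M / s). intros N.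
 apply (proj1 (Rle_div_r _ _ s (proj1 Hs))). eapply Rle_trans; [|apply (HM (S N))]. right; simpl; ring.
Qed.

Lemma radius_ge_unshift r g : radius_ge r (fun N => g (S N)) -> radius_ge r g.
Proof. intros H s Hs. destruct (H s Hs) as [M HM]. exists (Rmax (g 0%nat) (M * s)). intros [|N].
 - eapply Rle_trans; [|apply Rmax_l]. lra.
 - eapply Rle_trans; [|apply Rmax_r].
  replace (g (S N) * s ^ S N) with (g (S N) * s ^ N * s) by (simpl; ring).
  apply Rmult_le_compat_r; [lra|apply HM].
Qed.

(** At the intermediate radius [t] each of the [N + 1] products is at most [M * M' / t ^ N]; the
    factor [N + 1] is then absorbed by shrinking to [s]. *)
Lemma radius_ge_conv r g g' : (forall N, 0 <= g N) -> (forall N, 0 <= g' N) ->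
 radius_ge r g -> radius_ge r g' ->
 radius_ge r (fun N => sum_f_R0 (fun i => g i * g' (N - i)%nat) N).
Proof. intros P P' H H' s Hs.
 destruct (H ((s + r) / 2)) as [M HM]; [lra|]. destruct (H' ((s + r) / 2)) as [M' HM']; [lra|].
 assert (B : radius_ge ((s + r) / 2) (fun N => (INR N + 1) * / ((s + r) / 2) ^ N)).
 { apply radius_ge_mulN.
  - intros N. apply Rlt_le, Rinv_0_lt_compat, pow_lt; lra.
  - exists 1. intros N. rewrite <- pow_inv, <- Rpow_mult_distr.
   rewrite <- (pow1 N). apply pow_incr. split.
   + apply Rmult_le_pos; [apply Rlt_le, Rinv_0_lt_compat; lra|lra].
   + rewrite Rmult_comm. apply Rle_div_l; lra. }
 destruct (B s) as [K HK]; [lra|].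
 set (t := (s + r) / 2) in *. assert (Ht : 0 < t) by (unfold t; lra).
 exists (M * M' * K). intros N.
 assert (L : sum_f_R0 (fun i => g i * g' (N - i)%nat) N <= (M * M') * ((INR N + 1) * / t ^ N)).
 { replace ((M * M') * ((INR N + 1) * / t ^ N)) with (sum_f_R0 (fun _ => M * M' * / t ^ N) N).
  2:{ rewrite sum_cte, S_INR. ring. }
  apply sum_Rle. intros i Hi.
  apply Rmult_le_reg_r with (t ^ N); [apply pow_lt; auto|].
  rewrite Rmult_assoc with (r2 := / t ^ N), Rinv_l, Rmult_1_r by (apply Rgt_not_eq, pow_lt; auto).
  replace (t ^ N) with (t ^ i * t ^ (N - i)) by (rewrite <- pow_add; f_equal; lia).
  replace (g i * g' (N - i)%nat * (t ^ i * t ^ (N - i)))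
   with ((g i * t ^ i) * (g' (N - i)%nat * t ^ (N - i))) by ring.
  apply Rmult_le_compat; auto; apply Rmult_le_pos; auto; apply pow_le; lra. }
 assert (HM0 : 0 <= M).
 { eapply Rle_trans; [|apply (HM 0%nat)]. apply Rmult_le_pos; auto. simpl; lra. }
 assert (HM0' : 0 <= M').
 { eapply Rle_trans; [|apply (HM' 0%nat)]. apply Rmult_le_pos; auto. simpl; lra. }
 eapply Rle_trans; [apply Rmult_le_compat_r; [apply pow_le; lra|exact L]|].
 rewrite Rmult_assoc. apply Rmult_le_compat_l; [now apply Rmult_le_pos|]. apply HK.
Qed.

Lemma radius_ge_summable r g s : (forall N, 0 <= g N) -> radius_ge r g -> 0 <= s < r ->
 ex_series (fun N => g N * s ^ N).
Proof. intros P H Hs. destruct (H ((s + r) / 2)) as [M HM]; [lra|].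
 set (t := (s + r) / 2) in *. assert (Ht : 0 < t) by (unfold t; lra).
 apply (@ex_series_le R_AbsRing R_CompleteNormedModule) with (fun N => M * (s / t) ^ N).
 - intros N.
  rewrite Rabs_pos_eq by (apply Rmult_le_pos; auto; apply pow_le; lra).
  replace (s ^ N) with (t ^ N * (s / t) ^ N).
  2:{ rewrite <- Rpow_mult_distr. f_equal. field. lra. }
  rewrite <- Rmult_assoc. apply Rmult_le_compat_r; auto.
  apply pow_le. apply Rdiv_le_0_compat; lra.
 - apply (@ex_series_scal R_AbsRing R_NormedModule M). apply ex_series_geom.
  rewrite Rabs_pos_eq by (apply Rdiv_le_0_compat; lra). apply Rlt_div_l; [lra|]. unfold t; lra.
Qed.

Lemma radius_ge_mono r r' g : r' <= r -> radius_ge r g -> radius_ge r' g.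
Proof. intros L H s Hs. apply H; lra. Qed.

(** * Graded series in [z], [conj z], [l], [conj l] *)

Definition mono (p q : nat) (u : C) : C := (u ^ p * Cconj u ^ q)%C.
(** [dmono] and [dbmono] are the Wirtinger derivatives of [mono]; at exponent 0 the truncated
    predecessor is harmless, its coefficient being 0. *)
Definition dmono (p q : nat) (u : C) : C := (RtoC (INR p) * (u ^ pred p * Cconj u ^ q))%C.
Definition dbmono (p q : nat) (u : C) : C := (RtoC (INR q) * (u ^ p * Cconj u ^ pred q))%C.

Lemma Cmod_mono p q u : Cmod (mono p q u) = Cmod u ^ (p + q).
Proof. unfold mono. rewrite Cmod_mult, !Cmod_pow, Cmod_Cconj, pow_add. reflexivity. Qed.

Lemma mono_conj p q u : Cconj (mono p q u) = mono q p u.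
Proof. unfold mono. rewrite Cconj_mult, !Cpow_conj, Cconj_conj. ring. Qed.

Lemma mono_mult p q p' q' u : (mono p q u * mono p' q' u)%C = mono (p + p') (q + q') u.
Proof. unfold mono. rewrite !Cpow_add_r. ring. Qed.

Lemma mono_S_l p q u : mono (S p) q u = (u * mono p q u)%C.
Proof. unfold mono. simpl. ring. Qed.
Lemma mono_S_r p q u : mono p (S q) u = (Cconj u * mono p q u)%C.
Proof. unfold mono. simpl. ring. Qed.

Lemma dmono_S_l p q u : dmono (S p) q u = (mono p q u + u * dmono p q u)%C.
Proof. unfold dmono, mono. rewrite S_INR, RtoC_plus.
 destruct p as [|p]; simpl; ring.
Qed.
Lemma dmono_S_r p q u : dmono p (S q) u = (Cconj u * dmono p q u)%C.
Proof. unfold dmono. simpl. ring. Qed.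
Lemma dbmono_S_l p q u : dbmono (S p) q u = (u * dbmono p q u)%C.
Proof. unfold dbmono. simpl. ring. Qed.
Lemma dbmono_S_r p q u : dbmono p (S q) u = (mono p q u + Cconj u * dbmono p q u)%C.
Proof. unfold dbmono, mono. rewrite S_INR, RtoC_plus.
 destruct q as [|q]; simpl; ring.
Qed.

Definition lin_mono p q u h : C := (dmono p q u * h + dbmono p q u * Cconj h)%C.

(** The exponents enter the remainder only through [(p + q)^2 s^(p + q)], so the bounds can be
    summed against a series that converges beyond [s]. *)
Lemma mono_expansion (p q : nat) (u h : C) (s : R) : 0 < s -> Cmod u <= s -> Cmod (u + h)%C <= s ->
 Cmod (lin_mono p q u h) <= INR (p + q) * s ^ (p + q) / s * Cmod h /\
 Cmod (mono p q (u + h) - mono p q u - lin_mono p q u h)%C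
  <= INR (p + q) ^ 2 * s ^ (p + q) / s ^ 2 * Cmod h ^ 2.
Proof. intros Hs Hu Huh. assert (Hh := Cmod_ge_0 h).
 (* Multiplication by one more factor [v], which is [u] or its conjugate, with increment [k].
    Treating both alike makes a single step serve the inductions on [p] and on [q]. *)
 assert (Step : forall (n : nat) (M M' L : C) (v k : C),
  Cmod v <= s -> Cmod (v + k)%C <= s -> Cmod k = Cmod h ->
  Cmod M <= s ^ n ->
  Cmod L <= INR n * s ^ n / s * Cmod h ->
  Cmod (M' - M - L)%C <= INR n ^ 2 * s ^ n / s ^ 2 * Cmod h ^ 2 ->
  Cmod (k * M + v * L)%C <= INR (S n) * s ^ S n / s * Cmod h /\
  Cmod ((v + k) * M' - v * M - (k * M + v * L))%C <= INR (S n) ^ 2 * s ^ S n / s ^ 2 * Cmod h ^ 2).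
 { intros n M M' L v k Hv Hvk Hk HM HL HR.
  assert (Hsn : 0 < s ^ n) by (apply pow_lt; auto).
  assert (Hn := pos_INR n).
  split.
  - tri. rewrite !Cmod_mult, Hk, S_INR.
   assert (E : Cmod v * Cmod L <= s * (INR n * s ^ n / s * Cmod h)).
   { apply Rmult_le_compat; auto; apply Cmod_ge_0. }
   replace (s * (INR n * s ^ n / s * Cmod h)) with (INR n * s ^ n * Cmod h) in E by (field; lra).
   replace ((INR n + 1) * s ^ S n / s * Cmod h) with (INR n * s ^ n * Cmod h + s ^ n * Cmod h)
    by (simpl; field; lra).
   assert (Cmod h * Cmod M <= Cmod h * s ^ n) by (apply Rmult_le_compat_l; auto). lra.
  - replace ((v + k) * M' - v * M - (k * M + v * L))%C
    with ((v + k) * (M' - M - L) + k * L)%C by ring.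
   tri. rewrite !Cmod_mult, Hk, S_INR.
   assert (E : Cmod (v + k)%C * Cmod (M' - M - L)%C <= s * (INR n ^ 2 * s ^ n / s ^ 2 * Cmod h ^ 2)).
   { apply Rmult_le_compat; auto; apply Cmod_ge_0. }
   replace (s * (INR n ^ 2 * s ^ n / s ^ 2 * Cmod h ^ 2))
    with (INR n ^ 2 * (s ^ n / s * Cmod h ^ 2)) in E by (field; lra).
   replace ((INR n + 1) ^ 2 * s ^ S n / s ^ 2 * Cmod h ^ 2)
    with ((INR n + 1) ^ 2 * (s ^ n / s * Cmod h ^ 2)) by (simpl; field; lra).
   assert (0 <= s ^ n / s * Cmod h ^ 2).
   { apply Rmult_le_pos; [apply Rlt_le, Rdiv_lt_0_compat; lra|nra]. }
   nra. }
 assert (Hmono : forall p q, Cmod (mono p q u) <= s ^ (p + q)).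
 { intros. rewrite Cmod_mono. apply pow_incr. split; [apply Cmod_ge_0|auto]. }
 revert q. induction p as [|p IHp]; intros q.
 - induction q as [|q IHq].
  + unfold lin_mono, dmono, dbmono, mono; simpl. split.
   * replace (_ + _)%C with (RtoC 0) by ring. rewrite Cmod_0. lra.
   * replace (1 * 1 - 1 * 1 - _)%C with (RtoC 0) by ring. rewrite Cmod_0. lra.
  + destruct IHq as [IH1 IH2].
   assert (Hc : Cmod (Cconj u + Cconj h)%C <= s) by (rewrite <- Cconj_plus, Cmod_Cconj; auto).
   assert (Hc' : Cmod (Cconj u) <= s) by (rewrite Cmod_Cconj; auto).
   destruct (Step (0 + q)%nat (mono 0 q u) (mono 0 q (u + h)%C) (lin_mono 0 q u h)
    (Cconj u) (Cconj h) Hc' Hc (Cmod_Cconj h) (Hmono 0%nat q) IH1 IH2) as [K1 K2].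
   replace (lin_mono 0 (S q) u h) with (Cconj h * mono 0 q u + Cconj u * lin_mono 0 q u h)%C.
   2:{ unfold lin_mono. rewrite dmono_S_r, dbmono_S_r. ring. }
   rewrite !mono_S_r. rewrite Cconj_plus. auto.
 - destruct (IHp q) as [IH1 IH2].
  destruct (Step (p + q)%nat (mono p q u) (mono p q (u + h)%C) (lin_mono p q u h)
   u h Hu Huh eq_refl (Hmono p q) IH1 IH2) as [K1 K2].
  replace (lin_mono (S p) q u h) with (h * mono p q u + u * lin_mono p q u h)%C.
  2:{ unfold lin_mono. rewrite dmono_S_l, dbmono_S_l. ring. }
  rewrite !mono_S_l. auto.
Qed.

(* [Term c m n a b] stands for [c z^m (conj z)^n l^a (conj l)^b]. *)
Record term := Term { tc : C; tm : nat; tn : nat; ta : nat; tb : nat }.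
Definition lpoly := list term.
Definition ser := nat -> lpoly.

Definition tval (t : term) (z l : C) : C := (tc t * (mono (tm t) (tn t) z * mono (ta t) (tb t) l))%C.
Definition pval (p : lpoly) (z l : C) : C := fold_right (fun t x => tval t z l + x)%C (RtoC 0) p.
Definition pnorm (p : lpoly) : R := fold_right (fun t x => Cmod (tc t) + x) 0 p.
Definition sval (h : ser) (z l : C) : C := CSer (fun N => pval (h N) z l).

Definition hom (N d : nat) (p : lpoly) : Prop :=
 Forall (fun t => (tm t + tn t = N)%nat /\ (ta t + tb t <= d)%nat) p.

(** The degree in [l] may grow with the grade, but only like [N + c]: a derivative in [l] or in the
    angle then costs a factor of order [N] and keeps the radius, while each grade remains a finite
    Laurent polynomial on the circle. *)
Definition wf (r : R) (h : ser) : Prop :=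
 (exists c, forall N, hom N (N + c) (h N)) /\ radius_ge r (fun N => pnorm (h N)).

Lemma pnorm_ge_0 p : 0 <= pnorm p.
Proof. induction p as [|t p IH]; simpl; [lra|]. generalize (Cmod_ge_0 (tc t)); lra. Qed.

Lemma pval_app p q z l : pval (p ++ q) z l = (pval p z l + pval q z l)%C.
Proof. induction p as [|t p IH]; simpl; [ring|]. rewrite IH. ring. Qed.
Lemma pnorm_app p q : pnorm (p ++ q) = pnorm p + pnorm q.
Proof. induction p as [|t p IH]; simpl; [ring|]. rewrite IH. ring. Qed.

Lemma pval_bound N d p z l s : hom N d p -> Cmod z <= s -> Cmod l <= 1 ->
 Cmod (pval p z l) <= pnorm p * s ^ N.
Proof. intros H Hz Hl. induction H as [|t p [Hm _] _ IH]; simpl.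
 - rewrite Cmod_0. lra.
 - tri.
  rewrite Rmult_plus_distr_r. apply Rplus_le_compat; auto.
  unfold tval. rewrite !Cmod_mult, !Cmod_mono, Hm. apply Rmult_le_compat_l; [apply Cmod_ge_0|].
  assert (A : Cmod z ^ N <= s ^ N) by (apply pow_incr; split; auto; apply Cmod_ge_0).
  assert (B : Cmod l ^ (ta t + tb t) <= 1).
  { rewrite <- (pow1 (ta t + tb t)). apply pow_incr; split; auto. apply Cmod_ge_0. }
  rewrite <- (Rmult_1_r (s ^ N)). apply Rmult_le_compat; auto; apply pow_le, Cmod_ge_0.
Qed.

Lemma wf_summable r h s : wf r h -> 0 <= s < r -> ex_series (fun N => pnorm (h N) * s ^ N).
Proof. intros [_ H] Hs. apply radius_ge_summable with r; auto. intros; apply pnorm_ge_0. Qed.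

Lemma wf_abs_conv r h z l : wf r h -> Cmod z < r -> Cmod l <= 1 ->
 abs_conv (fun N => pval (h N) z l).
Proof. intros H Hz Hl. apply abs_conv_le with (fun N => pnorm (h N) * Cmod z ^ N).
 - intros N. destruct H as [[c Hc] _]. eapply pval_bound; eauto. lra.
 - apply wf_summable with r; auto. split; auto. apply Cmod_ge_0.
Qed.

Lemma wf_mono r r' h : r' <= r -> wf r h -> wf r' h.
Proof. intros L [H1 H2]; split; auto. eapply radius_ge_mono; eauto. Qed.

Definition tconj t := Term (Cconj (tc t)) (tn t) (tm t) (tb t) (ta t).
Definition tscal c t := Term (c * tc t)%C (tm t) (tn t) (ta t) (tb t).
Definition tmul t u :=
 Term (tc t * tc u)%C (tm t + tm u) (tn t + tn u) (ta t + ta u) (tb t + tb u).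
Definition tint t := Term (/ RtoC (INR (S (tm t))) * tc t)%C (S (tm t)) (tn t) (ta t) (tb t).
Definition tdz t := match tm t with O => [] | S m => [Term (RtoC (INR (S m)) * tc t)%C m (tn t) (ta t) (tb t)] end.
Definition tdw t := match tn t with O => [] | S n => [Term (RtoC (INR (S n)) * tc t)%C (tm t) n (ta t) (tb t)] end.
Definition tdl t := match ta t with O => [] | S a => [Term (RtoC (INR (S a)) * tc t)%C (tm t) (tn t) a (tb t)] end.
Definition tdlb t := match tb t with O => [] | S b => [Term (RtoC (INR (S b)) * tc t)%C (tm t) (tn t) (ta t) b] end.
(* the derivative in the angle [t] for [l = cis t] *)
Definition tdt t := tscal (Ci * (RtoC (INR (ta t)) - RtoC (INR (tb t))))%C t.
(* the projections on powers [>= 0] and [< 0] of [l], using [conj l = / l] on the circle *)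
Definition tplus t :=
 if le_lt_dec (tb t) (ta t) then [Term (tc t) (tm t) (tn t) (ta t - tb t) 0] else [].
Definition tminus t :=
 if le_lt_dec (tb t) (ta t) then [] else [Term (tc t) (tm t) (tn t) 0 (tb t - ta t)].

Definition pmul (p q : lpoly) : lpoly := flat_map (fun t => map (tmul t) q) p.

Definition sadd (h k : ser) : ser := fun N => h N ++ k N.
Definition sscal (c : C) (h : ser) : ser := fun N => map (tscal c) (h N).
Definition sconj (h : ser) : ser := fun N => map tconj (h N).
(** Cauchy product over grades: grade [N] of the product sees only grades up to [N] of the factors,
    which makes grade by grade recursion possible. *)
Definition smul (h k : ser) : ser :=
 fun N => flat_map (fun i => pmul (h i) (k (N - i)%nat)) (seq 0 (S N)).
Definition sdz (h : ser) : ser := fun N => flat_map tdz (h (S N)).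
Definition sdw (h : ser) : ser := fun N => flat_map tdw (h (S N)).
Definition sdl (h : ser) : ser := fun N => flat_map tdl (h N).
Definition sdlb (h : ser) : ser := fun N => flat_map tdlb (h N).
Definition sdt (h : ser) : ser := fun N => map tdt (h N).
Definition splus (h : ser) : ser := fun N => flat_map tplus (h N).
Definition sminus (h : ser) : ser := fun N => flat_map tminus (h N).
(** The primitive in [z] that vanishes at 0; the shift of grades leaves grade 0 empty. *)
Definition sint (h : ser) : ser := fun N => match N with O => [] | S N => map tint (h N) end.
Definition scst (c : C) : ser := fun N => match N with O => [Term c 0 0 0 0] | S _ => [] end.
Definition sla : ser := fun N => match N with O => [Term 1 0 0 1 0] | S _ => [] end.
Definition slb : ser := fun N => match N with O => [Term 1 0 0 0 1] | S _ => [] end.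

Lemma tval_mul t u z l : tval (tmul t u) z l = (tval t z l * tval u z l)%C.
Proof. unfold tval; simpl. rewrite <- !mono_mult. ring. Qed.

Lemma pval_mul p q z l : pval (pmul p q) z l = (pval p z l * pval q z l)%C.
Proof. induction p as [|t p IH]; simpl; [ring|]. rewrite pval_app, IH.
 replace (pval (map (tmul t) q) z l) with (tval t z l * pval q z l)%C; [ring|].
 clear IH. induction q as [|u q IH]; simpl; [ring|]. rewrite <- IH, tval_mul. ring.
Qed.

Lemma pnorm_mul p q : pnorm (pmul p q) = pnorm p * pnorm q.
Proof. induction p as [|t p IH]; simpl; [ring|]. rewrite pnorm_app, IH.
 replace (pnorm (map (tmul t) q)) with (Cmod (tc t) * pnorm q); [ring|].
 clear IH. induction q as [|u q IH]; simpl; [ring|]. rewrite <- IH, Cmod_mult. ring.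
Qed.

Lemma pval_smul h k N z l :
 pval (smul h k N) z l = Csumn (fun i => pval (h i) z l * pval (k (N - i)%nat) z l)%C N.
Proof. assert (G : forall n, pval (flat_map (fun i => pmul (h i) (k (N - i)%nat)) (seq 0 (S n))) z l =
  Csumn (fun i => pval (h i) z l * pval (k (N - i)%nat) z l)%C n).
 { induction n as [|n IH].
  - simpl. rewrite app_nil_r, pval_mul. reflexivity.
  - rewrite seq_S, flat_map_app, pval_app, IH. simpl. rewrite app_nil_r, pval_mul. reflexivity. }
 apply G.
Qed.

Lemma pnorm_smul h k N :
 pnorm (smul h k N) = sum_f_R0 (fun i => pnorm (h i) * pnorm (k (N - i)%nat)) N.
Proof. assert (G : forall n, pnorm (flat_map (fun i => pmul (h i) (k (N - i)%nat)) (seq 0 (S n))) =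
  sum_f_R0 (fun i => pnorm (h i) * pnorm (k (N - i)%nat)) n).
 { induction n as [|n IH].
  - simpl. rewrite app_nil_r, pnorm_mul. reflexivity.
  - rewrite seq_S, flat_map_app, pnorm_app, IH. simpl. rewrite app_nil_r, pnorm_mul. reflexivity. }
 apply G.
Qed.

Lemma Forall_smul (P Q S : nat -> term -> Prop) h k :
 (forall N, Forall (P N) (h N)) -> (forall N, Forall (Q N) (k N)) ->
 (forall i j t u, P i t -> Q j u -> S (i + j)%nat (tmul t u)) ->
 forall N, Forall (S N) (smul h k N).
Proof. intros Hh Hk HS N. unfold smul. rewrite Forall_flat_map. apply Forall_forall.
 intros i Hi. apply in_seq in Hi. unfold pmul. rewrite Forall_flat_map.
 eapply Forall_impl; [|apply Hh]. intros t Ht. rewrite Forall_map.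
 eapply Forall_impl; [|apply Hk]. intros u Hu.
 replace N with (i + (N - i))%nat by lia. now apply HS.
Qed.

Lemma wf_sadd r h k : wf r h -> wf r k -> wf r (sadd h k).
Proof. intros [[c Hc] H] [[c' Hc'] H']. split.
 - exists (c + c')%nat. intros N. apply Forall_app. split.
  + eapply Forall_impl; [|apply Hc]. simpl. lia.
  + eapply Forall_impl; [|apply Hc']. simpl. lia.
 - eapply radius_ge_le; [|apply (radius_ge_plus _ _ _ H H')].
  intros N. unfold sadd. rewrite pnorm_app. lra.
Qed.

Lemma sval_sadd r h k z l : wf r h -> wf r k -> Cmod z < r -> Cmod l <= 1 ->
 sval (sadd h k) z l = (sval h z l + sval k z l)%C.
Proof. intros Hh Hk Hz Hl. unfold sval. rewrite <- CSer_plus by (eapply wf_abs_conv; eauto).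
 apply CSer_ext. intros N. apply pval_app.
Qed.

Lemma wf_smul r h k : wf r h -> wf r k -> wf r (smul h k).
Proof. intros [[c Hc] H] [[c' Hc'] H']. split.
 - exists (c + c')%nat. eapply Forall_smul; [exact Hc|exact Hc'|].
  simpl. lia.
 - eapply radius_ge_le; [|apply (radius_ge_conv _ _ _
   (fun N => pnorm_ge_0 (h N)) (fun N => pnorm_ge_0 (k N)) H H')].
  intros N. rewrite pnorm_smul. lra.
Qed.

Lemma sval_smul r h k z l : wf r h -> wf r k -> Cmod z < r -> Cmod l <= 1 ->
 sval (smul h k) z l = (sval h z l * sval k z l)%C.
Proof. intros Hh Hk Hz Hl. unfold sval. rewrite <- CSer_mult by (eapply wf_abs_conv; eauto).
 apply CSer_ext. intros N. apply pval_smul.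
Qed.

Lemma pval_map f g p z l : (forall t, tval (f t) z l = g (tval t z l)) ->
 g 0 = RtoC 0 -> (forall a b, g (a + b)%C = (g a + g b)%C) ->
 pval (map f p) z l = g (pval p z l).
Proof. intros E E0 E1. induction p as [|t p IH]; simpl; auto. rewrite IH, E, E1. reflexivity.
Qed.

Lemma wf_map r f (c0 : R) h : 0 <= c0 ->
 (forall t, Cmod (tc (f t)) <= c0 * Cmod (tc t)) ->
 (forall t, (tm (f t) + tn (f t) = tm t + tn t)%nat /\ (ta (f t) + tb (f t) = ta t + tb t)%nat) ->
 wf r h -> wf r (fun N => map f (h N)).
Proof. intros Hc0 E1 E2 [[c Hc] H]. split.
 - exists c. intros N. unfold hom. rewrite Forall_map. eapply Forall_impl; [|apply Hc]. intros t. destruct (E2 t) as [-> ->]. auto.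
 - eapply radius_ge_le; [|apply (radius_ge_scal _ _ c0 Hc0 H)]. intros N.
  cbv beta. induction (h N) as [|t p IH]; simpl; [lra|]. generalize (E1 t). lra.
Qed.

Lemma wf_sscal r c h : wf r h -> wf r (sscal c h).
Proof. apply (wf_map r (tscal c) (Cmod c)); auto; [apply Cmod_ge_0|].
 intros t; simpl. rewrite Cmod_mult. lra.
Qed.

Lemma sval_sscal r c h z l : wf r h -> Cmod z < r -> Cmod l <= 1 ->
 sval (sscal c h) z l = (c * sval h z l)%C.
Proof. intros H Hz Hl. unfold sval. rewrite <- CSer_scal by (eapply wf_abs_conv; eauto).
 apply CSer_ext. intros N. apply (pval_map _ (fun x => c * x)%C).
 - intros t; unfold tval; simpl; ring.
 - ring.
 - intros; ring.
Qed.

Lemma wf_sconj r h : wf r h -> wf r (sconj h).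
Proof. apply (wf_map r tconj 1); [lra| |].
 - intros t; simpl. rewrite Cmod_Cconj. lra.
 - intros t; simpl. lia.
Qed.

Lemma sval_sconj h z l : sval (sconj h) z l = Cconj (sval h z l).
Proof. unfold sval. rewrite <- CSer_conj.
 apply CSer_ext. intros N. apply pval_map.
 - intros t; unfold tval; simpl. rewrite !Cconj_mult, !mono_conj. reflexivity.
 - apply Cconj_RtoC.
 - apply Cconj_plus.
Qed.

Lemma Forall_tplus (P : term -> Prop) t :
 (forall a, (tb t <= ta t)%nat -> a = (ta t - tb t)%nat -> P (Term (tc t) (tm t) (tn t) a 0)) ->
 Forall P (tplus t).
Proof. unfold tplus. destruct le_lt_dec; constructor; auto. Qed.
Lemma Forall_tminus (P : term -> Prop) t :
 (forall b, (ta t < tb t)%nat -> b = (tb t - ta t)%nat -> P (Term (tc t) (tm t) (tn t) 0 b)) ->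
 Forall P (tminus t).
Proof. unfold tminus. destruct le_lt_dec; constructor; auto. Qed.

Lemma pnorm_splus h N : pnorm (splus h N) <= pnorm (h N).
Proof. unfold splus. induction (h N) as [|t p IH]; simpl; [lra|]. rewrite pnorm_app.
 apply Rplus_le_compat; auto.
 unfold tplus; destruct le_lt_dec; simpl; generalize (Cmod_ge_0 (tc t)); lra.
Qed.
Lemma pnorm_sminus h N : pnorm (sminus h N) <= pnorm (h N).
Proof. unfold sminus. induction (h N) as [|t p IH]; simpl; [lra|]. rewrite pnorm_app.
 apply Rplus_le_compat; auto.
 unfold tminus; destruct le_lt_dec; simpl; generalize (Cmod_ge_0 (tc t)); lra.
Qed.

Lemma wf_splus r h : wf r h -> wf r (splus h).
Proof. intros [[c Hc] H]. split.
 - exists c. intros N. unfold hom, splus. rewrite Forall_flat_map.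
  eapply Forall_impl; [|apply Hc]. intros t [Ht1 Ht2]. apply Forall_tplus. simpl. lia.
 - eapply radius_ge_le; [|exact H]. intros N; apply pnorm_splus.
Qed.
Lemma wf_sminus r h : wf r h -> wf r (sminus h).
Proof. intros [[c Hc] H]. split.
 - exists c. intros N. unfold hom, sminus. rewrite Forall_flat_map.
  eapply Forall_impl; [|apply Hc]. intros t [Ht1 Ht2]. apply Forall_tminus. simpl. lia.
 - eapply radius_ge_le; [|exact H]. intros N; apply pnorm_sminus.
Qed.

Lemma mono_circle a b l : Cmod l = 1 -> mono (a + b) b l = mono a 0 l.
Proof. intros H. unfold mono.
 replace (l ^ (a + b) * Cconj l ^ b)%C with (l ^ a * (l * Cconj l) ^ b)%C.
 - rewrite circle_conj, Cpow_1_l by auto. ring.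
 - rewrite Cpow_add_r, Cpow_mult_l. ring.
Qed.

Lemma pval_plus_minus p z l : Cmod l = 1 ->
 (pval (flat_map tplus p) z l + pval (flat_map tminus p) z l = pval p z l)%C.
Proof. intros Hl. induction p as [|t p IH]; simpl; [ring|]. rewrite !pval_app, <- IH.
 assert (E : (pval (tplus t) z l + pval (tminus t) z l = tval t z l)%C).
 { unfold tplus, tminus, tval. destruct le_lt_dec as [L|L]; simpl; unfold tval; simpl.
  - rewrite <- (mono_circle (ta t - tb t) (tb t)) by auto.
   replace (ta t - tb t + tb t)%nat with (ta t) by lia. ring.
  - assert (E : mono 0 (tb t - ta t) l = mono (ta t) (tb t) l).
   { rewrite <- (mono_conj (tb t - ta t) 0), <- (mono_conj (tb t) (ta t)). f_equal.
    rewrite <- (mono_circle (tb t - ta t) (ta t)) by auto. f_equal. lia. }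
   rewrite E. ring. }
 rewrite <- E. ring.
Qed.

Lemma wf_scst r c : wf r (scst c).
Proof. split.
 - exists 0%nat. intros [|N]; repeat constructor.
 - exists (Cmod c). intros [|N]; simpl; [lra|]. generalize (Cmod_ge_0 c); lra.
Qed.
Lemma wf_sla r : wf r sla.
Proof. split.
 - exists 1%nat. intros [|N]; repeat constructor.
 - exists 1. intros [|N]; simpl; [rewrite Cmod_1|]; lra.
Qed.
Lemma wf_slb r : wf r slb.
Proof. split.
 - exists 1%nat. intros [|N]; repeat constructor.
 - exists 1. intros [|N]; simpl; [rewrite Cmod_1|]; lra.
Qed.

Lemma sval_grade0 (h : ser) r z l : wf r h -> Cmod z < r -> Cmod l <= 1 ->
 (forall N, h (S N) = []) -> sval h z l = pval (h 0%nat) z l.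
Proof. intros Hw Hz Hl E. unfold sval. rewrite CSer_incr by (eapply wf_abs_conv; eauto).
 rewrite (CSer_0 (fun n => pval (h (S n)) z l)); [ring|]. intros N; now rewrite E.
Qed.

(** Every grade above 0 carries a positive power of [z] or [conj z]. *)
Lemma sval_at_0 (h : ser) r l : wf r h -> 0 < r -> Cmod l <= 1 ->
 sval h 0 l = pval (h 0%nat) 0 l.
Proof. intros Hw Hr Hl. assert (Hz : Cmod 0 < r) by (rewrite Cmod_0; auto).
 unfold sval. rewrite CSer_incr by (eapply wf_abs_conv; eauto).
 rewrite (CSer_0 (fun n => pval (h (S n)) 0 l)); [ring|]. intros N.
 destruct Hw as [[c Hc] _]. specialize (Hc (S N)).
 induction Hc as [|t p [Ht _] _ IH]; simpl; auto. rewrite IH.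
 unfold tval. replace (mono (tm t) (tn t) 0) with (RtoC 0); [ring|].
 symmetry. apply Cmod_eq_0. rewrite Cmod_mono, Ht, Cmod_0. simpl. ring.
Qed.

Lemma sval_scst c z l r : Cmod z < r -> Cmod l <= 1 -> sval (scst c) z l = c.
Proof. intros Hz Hl. rewrite (sval_grade0 _ r) by auto using wf_scst.
 simpl. unfold tval, mono; simpl. ring.
Qed.
Lemma sval_sla z l r : Cmod z < r -> Cmod l <= 1 -> sval sla z l = l.
Proof. intros Hz Hl. rewrite (sval_grade0 _ r) by auto using wf_sla.
 simpl. unfold tval, mono; simpl. ring.
Qed.
Lemma sval_slb z l r : Cmod z < r -> Cmod l <= 1 -> sval slb z l = Cconj l.
Proof. intros Hz Hl. rewrite (sval_grade0 _ r) by auto using wf_slb.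
 simpl. unfold tval, mono; simpl. ring.
Qed.

(** Termwise derivation in [z] or [conj z] lowers the grade by one and multiplies coefficients by at
    most the old grade. Relative to the new grade the bound on the degree in [l] increases by one,
    hence [S c]. *)
Lemma wf_flat_map_shift r (f : term -> lpoly) h :
 (forall t u, In u (f t) -> (S (tm u + tn u) = tm t + tn t)%nat /\ (ta u + tb u <= ta t + tb t)%nat) ->
 (forall t, pnorm (f t) <= INR (tm t + tn t) * Cmod (tc t)) ->
 wf r h -> wf r (fun N => flat_map f (h (S N))).
Proof. intros E1 E2 [[c Hc] H]. split.
 - exists (S c). intros N. unfold hom. rewrite Forall_flat_map.
  eapply Forall_impl; [|apply (Hc (S N))]. intros t [Ht1 Ht2].
  apply Forall_forall. intros u Hu. destruct (E1 t u Hu). lia.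
 - apply radius_ge_le with (fun N => (INR (S N) + 1) * pnorm (h (S N))).
  + intros N.
   assert (G : forall p, hom (S N) (S N + c) p ->
    pnorm (flat_map f p) <= (INR (S N) + 1) * pnorm p).
   { induction 1 as [|t p [Ht _] _ IH]; [simpl; lra|].
    simpl flat_map. rewrite pnorm_app. simpl pnorm at 3. specialize (E2 t). rewrite Ht in E2.
    generalize (Cmod_ge_0 (tc t)). lra. }
   apply G, (Hc (S N)).
  + apply (radius_ge_shift _ (fun N => (INR N + 1) * pnorm (h N))).
   apply radius_ge_mulN; auto. intros; apply pnorm_ge_0.
Qed.

Lemma wf_flat_map r (f : term -> lpoly) h :
 (forall t u, In u (f t) -> (tm u + tn u = tm t + tn t)%nat /\ (ta u + tb u <= ta t + tb t)%nat) ->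
 (forall t, pnorm (f t) <= INR (ta t + tb t) * Cmod (tc t)) ->
 wf r h -> wf r (fun N => flat_map f (h N)).
Proof. intros E1 E2 [[c Hc] H]. split.
 - exists c. intros N. unfold hom. rewrite Forall_flat_map.
  eapply Forall_impl; [|apply (Hc N)]. intros t [Ht1 Ht2].
  apply Forall_forall. intros u Hu. destruct (E1 t u Hu). lia.
 - apply radius_ge_le with (fun N => (INR c + 1) * ((INR N + 1) * pnorm (h N))).
  + intros N.
   assert (G : forall p, hom N (N + c) p ->
    pnorm (flat_map f p) <= (INR c + 1) * ((INR N + 1) * pnorm p)).
   { induction 1 as [|t p [_ Ht] _ IH]; [simpl; lra|].
    simpl flat_map. rewrite pnorm_app. simpl pnorm at 3. specialize (E2 t).
    assert (L : INR (ta t + tb t) * Cmod (tc t) <= ((INR c + 1) * (INR N + 1)) * Cmod (tc t)).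
    { apply Rmult_le_compat_r; [apply Cmod_ge_0|]. apply le_INR in Ht. rewrite (plus_INR N) in Ht.
     generalize (pos_INR N) (pos_INR c). nra. }
    lra. }
   apply G, (Hc N).
  + apply radius_ge_scal; [generalize (pos_INR c); lra|].
   apply radius_ge_mulN; auto. intros; apply pnorm_ge_0.
Qed.

Ltac wf_td lem d e := apply lem;
 [intros t u; unfold d; destruct (e t); simpl; [tauto|]; intros [<-|[]]; simpl; lia
 |intros t; unfold d; destruct (e t); cbn [pnorm fold_right tc];
  [apply Rmult_le_pos; [apply pos_INR|apply Cmod_ge_0]
  |rewrite Cmod_mult, Cmod_R, Rabs_pos_eq, Rplus_0_r by apply pos_INR;
   apply Rmult_le_compat_r; [apply Cmod_ge_0|apply le_INR; lia]]].

Lemma wf_sdz r h : wf r h -> wf r (sdz h).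
Proof. wf_td wf_flat_map_shift tdz tm. Qed.
Lemma wf_sdw r h : wf r h -> wf r (sdw h).
Proof. wf_td wf_flat_map_shift tdw tn. Qed.
Lemma wf_sdl r h : wf r h -> wf r (sdl h).
Proof. wf_td wf_flat_map tdl ta. Qed.
Lemma wf_sdlb r h : wf r h -> wf r (sdlb h).
Proof. wf_td wf_flat_map tdlb tb. Qed.

Lemma flat_map_singleton {A B} (f : A -> B) l : flat_map (fun x => [f x]) l = map f l.
Proof. auto. Qed.

Lemma wf_sdt r h : wf r h -> wf r (sdt h).
Proof. intros H. unfold sdt.
 replace (fun N => map tdt (h N)) with (fun N => flat_map (fun t => [tdt t]) (h N)).
 2:{ extensionality N. apply flat_map_singleton. }
 revert H. apply wf_flat_map.
 - intros t u [<-|[]]. simpl. lia.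
 - intros t. simpl. rewrite Rplus_0_r, Cmod_mult. apply Rmult_le_compat_r; [apply Cmod_ge_0|].
  rewrite Cmod_mult, Cmod_Ci, <- RtoC_minus, Cmod_R, plus_INR, Rmult_1_l. apply Rabs_le.
  generalize (pos_INR (ta t)) (pos_INR (tb t)). lra.
Qed.

Lemma wf_sint r h : 0 < r -> wf r h -> wf r (sint h).
Proof. intros Hr [[c Hc] H]. split.
 - exists c. intros [|N]; [constructor|]. unfold hom; simpl. rewrite Forall_map.
  eapply Forall_impl; [|apply (Hc N)]. simpl. lia.
 - apply radius_ge_unshift. eapply radius_ge_le; [|exact H]. intros N. cbn [sint].
  induction (h N) as [|t p IH]; [simpl; lra|].
  cbn [map pnorm fold_right tint tc]. apply Rplus_le_compat; auto.
  rewrite Cmod_mult. rewrite <- (Rmult_1_l (Cmod (tc t))) at 2.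
  apply Rmult_le_compat_r; [apply Cmod_ge_0|].
  rewrite Cmod_inv, Cmod_R, Rabs_pos_eq.
  + rewrite <- Rinv_1. apply Rinv_le_contravar; [lra|]. rewrite S_INR.
   generalize (pos_INR (tm t)); lra.
  + apply pos_INR.
  + intros E. apply RtoC_inj in E. revert E. apply not_0_INR. lia.
Qed.

Lemma tval_tdz t z l :
 pval (tdz t) z l = (tc t * (dmono (tm t) (tn t) z * mono (ta t) (tb t) l))%C.
Proof. unfold tdz, dmono. destruct (tm t); simpl; [|unfold tval, mono; simpl]; ring. Qed.
Lemma tval_tdw t z l :
 pval (tdw t) z l = (tc t * (dbmono (tm t) (tn t) z * mono (ta t) (tb t) l))%C.
Proof. unfold tdw, dbmono. destruct (tn t); simpl; [|unfold tval, mono; simpl]; ring. Qed.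
Lemma tval_tdl t z l :
 pval (tdl t) z l = (tc t * (mono (tm t) (tn t) z * dmono (ta t) (tb t) l))%C.
Proof. unfold tdl, dmono. destruct (ta t); simpl; [|unfold tval, mono; simpl]; ring. Qed.
Lemma tval_tdlb t z l :
 pval (tdlb t) z l = (tc t * (mono (tm t) (tn t) z * dbmono (ta t) (tb t) l))%C.
Proof. unfold tdlb, dbmono. destruct (tb t); simpl; [|unfold tval, mono; simpl]; ring. Qed.

Lemma pval_expand_z N d p z l s k : hom N d p -> 0 < s -> Cmod z <= s -> Cmod (z + k)%C <= s ->
 Cmod l <= 1 ->
 Cmod (pval p (z + k) l - pval p z l - pval (flat_map tdz p) z l * k
    - pval (flat_map tdw p) z l * Cconj k)%C
  <= pnorm p * (INR N ^ 2 * s ^ N / s ^ 2 * Cmod k ^ 2).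
Proof. intros H Hs Hz Hzk Hl. induction H as [|t p [Ht _] _ IH]; simpl.
 - replace (_ - _)%C with (RtoC 0) by ring. rewrite Cmod_0. lra.
 - rewrite !pval_app, tval_tdz, tval_tdw, Rmult_plus_distr_r.
  match goal with |- Cmod ?x <= _ => replace x with
   (tc t * (mono (tm t) (tn t) (z + k) - mono (tm t) (tn t) z - lin_mono (tm t) (tn t) z k)
    * mono (ta t) (tb t) l + (pval p (z + k) l - pval p z l - pval (flat_map tdz p) z l * k
    - pval (flat_map tdw p) z l * Cconj k))%C end.
  2:{ unfold tval, lin_mono. ring. }
  tri. apply Rplus_le_compat; auto.
  rewrite !Cmod_mult. destruct (mono_expansion (tm t) (tn t) z k s Hs Hz Hzk) as [_ E].
  rewrite Ht in E. rewrite Rmult_assoc. apply Rmult_le_compat_l; [apply Cmod_ge_0|].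
  rewrite <- (Rmult_1_r (_ * Cmod k ^ 2)). apply Rmult_le_compat; auto; try apply Cmod_ge_0.
  rewrite Cmod_mono. rewrite <- (pow1 (ta t + tb t)). apply pow_incr; split; auto. apply Cmod_ge_0.
Qed.

Lemma pval_expand_l N d p z l s k : hom N d p -> Cmod z <= s -> Cmod l <= 1 -> Cmod (l + k)%C <= 1 ->
 Cmod (pval p z (l + k) - pval p z l - pval (flat_map tdl p) z l * k
    - pval (flat_map tdlb p) z l * Cconj k)%C
  <= pnorm p * s ^ N * (INR d ^ 2 * Cmod k ^ 2).
Proof. intros H Hz Hl Hlk.
 induction H as [|t p [Ht Ht'] _ IH]; simpl.
 - replace (_ - _)%C with (RtoC 0) by ring. rewrite Cmod_0. lra.
 - rewrite !pval_app, tval_tdl, tval_tdlb.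
  match goal with |- Cmod ?x <= _ => replace x with
   (tc t * mono (tm t) (tn t) z *
     (mono (ta t) (tb t) (l + k) - mono (ta t) (tb t) l - lin_mono (ta t) (tb t) l k)
    + (pval p z (l + k) - pval p z l - pval (flat_map tdl p) z l * k
    - pval (flat_map tdlb p) z l * Cconj k))%C end.
  2:{ unfold tval, lin_mono. ring. }
  tri.
  rewrite Rmult_plus_distr_r, Rmult_plus_distr_r. apply Rplus_le_compat; auto.
  rewrite !Cmod_mult. destruct (mono_expansion (ta t) (tb t) l k 1 Rlt_0_1 Hl Hlk) as [_ E].
  rewrite !pow1 in E.
  assert (Hk : 0 <= Cmod k ^ 2) by (apply pow_le, Cmod_ge_0).
  apply Rmult_le_compat; try apply Cmod_ge_0.
  + apply Rmult_le_pos; apply Cmod_ge_0.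
  + apply Rmult_le_compat_l; [apply Cmod_ge_0|]. rewrite Cmod_mono, Ht.
   apply pow_incr; split; auto. apply Cmod_ge_0.
  + eapply Rle_trans; [exact E|]. rewrite Rmult_1_r. unfold Rdiv. rewrite Rinv_1, Rmult_1_r.
   apply Rmult_le_compat_r; auto. apply (pow_incr _ _ 2). split; [apply pos_INR|now apply le_INR].
Qed.

Lemma abs_conv_unshift u : abs_conv (fun n => u (S n)) -> abs_conv u.
Proof. intros H. apply ex_series_incr_1. exact H. Qed.

(** Derivatives are indexed by their own grade, expansions by the grade of the original term; the
    two sums differ by the contribution of grade 0, which is empty. *)
Lemma sval_flat_map_shift r (f : term -> lpoly) h z l :
 (forall t, (tm t + tn t = 0)%nat -> f t = []) -> wf r h ->
 wf r (fun N => flat_map f (h (S N))) -> Cmod z < r -> Cmod l <= 1 ->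
 abs_conv (fun N => pval (flat_map f (h N)) z l) /\
 CSer (fun N => pval (flat_map f (h N)) z l) = sval (fun N => flat_map f (h (S N))) z l.
Proof. intros E H H' Hz Hl.
 assert (A := wf_abs_conv _ _ _ _ H' Hz Hl).
 assert (A' : abs_conv (fun N => pval (flat_map f (h N)) z l)) by (apply abs_conv_unshift, A).
 split; auto. rewrite CSer_incr by auto.
 replace (flat_map f (h 0%nat)) with (@nil term); [unfold sval; simpl; ring|].
 destruct H as [[c Hc] _]. specialize (Hc 0%nat).
 induction Hc as [|t p [Ht _] _ IH]; simpl; auto. rewrite <- IH, E; auto.
Qed.

Lemma tdz_0 t : (tm t + tn t = 0)%nat -> tdz t = [].
Proof. unfold tdz. destruct (tm t); auto. lia. Qed.
Lemma tdw_0 t : (tm t + tn t = 0)%nat -> tdw t = [].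
Proof. unfold tdw. destruct (tn t); auto. lia. Qed.

Lemma abs_conv_opp u : abs_conv u -> abs_conv (fun n => - u n)%C.
Proof. intros H. apply abs_conv_le with (2 := H). intros n. rewrite Cmod_opp. lra. Qed.

Lemma CSer_expansion (u v a b : nat -> C) (k : C) (g : nat -> R) (c : R) :
 abs_conv u -> abs_conv v -> abs_conv a -> abs_conv b -> ex_series g ->
 (forall N, Cmod (u N - v N - a N * k - b N * Cconj k)%C <= g N * c) ->
 Cmod (CSer u - CSer v - CSer a * k - CSer b * Cconj k)%C <= 2 * Series g * c.
Proof. intros Hu Hv Ha Hb Hg B.
 replace (CSer u - CSer v - CSer a * k - CSer b * Cconj k)%C
  with (CSer (fun N => u N - v N - a N * k - b N * Cconj k)%C).
 - rewrite Rmult_assoc, <- Series_scal_r. apply CSer_bound; auto.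
  apply ex_series_scal_r; auto.
 - replace (CSer u - CSer v - CSer a * k - CSer b * Cconj k)%C
   with (((CSer u + - CSer v) + (- k) * CSer a) + (- Cconj k) * CSer b)%C by ring.
  rewrite <- CSer_opp, <- (CSer_scal _ a Ha), <- (CSer_scal _ b Hb).
  assert (A1 := abs_conv_plus _ _ Hu (abs_conv_opp _ Hv)).
  assert (A2 := abs_conv_plus _ _ A1 (abs_conv_scal (- k)%C _ Ha)).
  rewrite <- (CSer_plus _ _ Hu (abs_conv_opp _ Hv)).
  rewrite <- (CSer_plus _ _ A1 (abs_conv_scal _ _ Ha)).
  rewrite <- (CSer_plus _ _ A2 (abs_conv_scal _ _ Hb)).
  apply CSer_ext. intros N; ring.
Qed.

(** [B] and [d] do not depend on [l]. This uniformity is what turns pointwise differentiability into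
    convergence of difference quotients uniformly on the circle. *)
Lemma sval_expand_z r h z : wf r h -> Cmod z < r ->
 exists B d, 0 < d /\ forall l k, Cmod l <= 1 -> Cmod k < d -> Cmod (z + k)%C < r /\
  Cmod (sval h (z + k) l - sval h z l - sval (sdz h) z l * k - sval (sdw h) z l * Cconj k)%C
   <= B * Cmod k ^ 2.
Proof. intros H Hz. assert (Hz0 := Cmod_ge_0 z).
 set (s := (Cmod z + r) / 2). assert (Hs : Cmod z < s < r) by (unfold s; lra).
 set (g := fun N => ((INR N + 1) * ((INR N + 1) * pnorm (h N))) * s ^ N).
 assert (Hg : ex_series g).
 { apply radius_ge_summable with r; [| |lra].
  - intros N. generalize (pos_INR N) (pnorm_ge_0 (h N)). intros.
   repeat apply Rmult_le_pos; lra.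
  - apply radius_ge_mulN; [|apply radius_ge_mulN; [intros; apply pnorm_ge_0|apply H]].
   intros N. apply Rmult_le_pos; [generalize (pos_INR N); lra|apply pnorm_ge_0]. }
 exists (2 * Series g * / s ^ 2), (s - Cmod z). split; [lra|].
 intros l k Hl Hk.
 assert (Hzk : Cmod (z + k)%C <= s).
 { tri. lra. }
 split; [lra|].
 destruct (sval_flat_map_shift r tdz h z l tdz_0 H (wf_sdz _ _ H) Hz Hl) as [A1 E1].
 destruct (sval_flat_map_shift r tdw h z l tdw_0 H (wf_sdw _ _ H) Hz Hl) as [A2 E2].
 change (sval (sdz h) z l) with (sval (fun N => flat_map tdz (h (S N))) z l).
 change (sval (sdw h) z l) with (sval (fun N => flat_map tdw (h (S N))) z l).
 rewrite <- E1, <- E2. rewrite Rmult_assoc.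
 apply CSer_expansion; auto; try (eapply wf_abs_conv; eauto; lra).
 intros N. destruct H as [[c Hc] _].
 eapply Rle_trans; [apply (pval_expand_z N _ _ _ _ s k (Hc N)); auto; lra|]. assert (HN := pos_INR N). assert (HP := pnorm_ge_0 (h N)).
 assert (HsN : 0 <= s ^ N) by (apply pow_le; lra).
 assert (Hk2 : 0 <= / s ^ 2 * Cmod k ^ 2).
 { apply Rmult_le_pos; [apply Rlt_le, Rinv_0_lt_compat, pow_lt; lra|apply pow_le, Cmod_ge_0]. }
 replace (pnorm (h N) * (INR N ^ 2 * s ^ N / s ^ 2 * Cmod k ^ 2))
  with (INR N ^ 2 * pnorm (h N) * s ^ N * (/ s ^ 2 * Cmod k ^ 2)) by (unfold Rdiv; ring).
 apply Rmult_le_compat_r; auto. apply Rmult_le_compat_r; auto. nra.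
Qed.

(** Grade [N] has degree at most [N + c] in [l], whence the weight [(c + 1)^2 (N + 1)^2] in the
    majorant. *)
Lemma sval_expand_l r h z : wf r h -> Cmod z < r ->
 exists B, forall l k, Cmod l <= 1 -> Cmod (l + k)%C <= 1 ->
  Cmod (sval h z (l + k) - sval h z l - sval (sdl h) z l * k - sval (sdlb h) z l * Cconj k)%C
   <= B * Cmod k ^ 2.
Proof. intros H Hz. assert (Hz0 := Cmod_ge_0 z).
 destruct (proj1 H) as [c Hc].
 set (g := fun N => ((INR c + 1) ^ 2 * ((INR N + 1) * ((INR N + 1) * pnorm (h N)))) * Cmod z ^ N).
 assert (Hg : ex_series g).
 { apply radius_ge_summable with r; [| |lra].
  - intros N. generalize (pos_INR N) (pnorm_ge_0 (h N)). intros.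
   repeat apply Rmult_le_pos; try lra; try (generalize (pos_INR c); lra).
  - apply radius_ge_scal; [apply pow_le; generalize (pos_INR c); lra|].
   apply radius_ge_mulN; [|apply radius_ge_mulN; [intros; apply pnorm_ge_0|apply H]].
   intros N. apply Rmult_le_pos; [generalize (pos_INR N); lra|apply pnorm_ge_0]. }
 exists (2 * Series g). intros l k Hl Hlk.
 apply CSer_expansion; auto; try (eapply wf_abs_conv; eauto; lra).
 - apply (wf_abs_conv r (sdl h)); auto. now apply wf_sdl.
 - apply (wf_abs_conv r (sdlb h)); auto. now apply wf_sdlb.
 - intros N.
  eapply Rle_trans; [apply (pval_expand_l N _ _ _ _ (Cmod z) k (Hc N)); auto; lra|]. assert (HN := pos_INR N). assert (HP := pnorm_ge_0 (h N)). assert (HC := pos_INR c).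
  assert (HsN : 0 <= Cmod z ^ N) by (apply pow_le; lra).
  assert (Hk2 : 0 <= Cmod k ^ 2) by (apply pow_le, Cmod_ge_0).
  rewrite <- Rmult_assoc. apply Rmult_le_compat_r; auto.
  replace (pnorm (h N) * Cmod z ^ N * INR (N + c) ^ 2)
   with (INR (N + c) ^ 2 * pnorm (h N) * Cmod z ^ N) by ring.
  apply Rmult_le_compat_r; auto. rewrite <- !Rmult_assoc. apply Rmult_le_compat_r; auto. rewrite plus_INR. nra.
Qed.

Lemma sval_WD r h z l : wf r h -> Cmod z < r -> Cmod l <= 1 ->
 WD (fun w => sval h w l) z (sval (sdz h) z l) (sval (sdw h) z l).
Proof. intros H Hz Hl. destruct (sval_expand_z r h z H Hz) as [B [d [Hd E]]].
 apply little_o_quadratic with B d; auto. intros k Hk. now apply E.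
Qed.

Definition closed_disc (l : C) : Prop := Cmod l <= 1.

Lemma sval_WDon_l r h z l : wf r h -> Cmod z < r -> Cmod l <= 1 ->
 WDon closed_disc (fun w => sval h z w) l (sval (sdl h) z l) (sval (sdlb h) z l).
Proof. intros H Hz Hl eps Heps. destruct (sval_expand_l r h z H Hz) as [B E].
 exists (eps / (Rabs B + 1)). assert (HB := Rabs_pos B).
 split; [apply Rdiv_lt_0_compat; lra|].
 intros k Hk Hlk. eapply Rle_trans; [now apply E|].
 assert (HB2 := Rle_abs B). assert (Hk0 := Cmod_ge_0 k).
 apply (Rmult_lt_compat_l (Rabs B + 1)) in Hk; [|lra].
 replace ((Rabs B + 1) * (eps / (Rabs B + 1))) with eps in Hk by (field; lra). nra.
Qed.

(** Along [cis] the velocity of [l] is [i l], so a monomial is multiplied by [i (a - b)]; this is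
    the factor built into [tdt]. *)
Lemma dmono_rot a b l : (dmono a b l * (Ci * l) + dbmono a b l * Cconj (Ci * l) =
 Ci * (RtoC (INR a) - RtoC (INR b)) * mono a b l)%C.
Proof. unfold dmono, dbmono, mono. rewrite Cconj_mult, Cconj_Ci.
 destruct a as [|a]; destruct b as [|b]; simpl pred; simpl Cpow; try ring;
  simpl INR; ring.
Qed.

Lemma sval_RD_t r h z t : wf r h -> Cmod z < r ->
 RD (fun s => sval h z (cis s)) t (sval (sdt h) z (cis t)).
Proof. intros H Hz. assert (Hl : forall s, Cmod (cis s) <= 1) by (intros s; rewrite Cmod_cis; lra).
 eapply RD_eq.
 - apply (RD_WDon_comp closed_disc (fun l => sval h z l) cis); [exact Hl| |apply RD_cis].
  apply (sval_WDon_l r); auto.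
 - assert (Hlt := Hl t). set (l := cis t) in *.
  assert (A1 : abs_conv (fun N => pval (sdl h N) z l)) by (apply (wf_abs_conv r); auto using wf_sdl).
  assert (A2 : abs_conv (fun N => pval (sdlb h N) z l)) by (apply (wf_abs_conv r); auto using wf_sdlb).
  rewrite (Cmult_comm (sval (sdl h) z l)), (Cmult_comm (sval (sdlb h) z l)). rewrite <- (CSer_scal _ _ A1), <- (CSer_scal _ _ A2).
  rewrite <- CSer_plus by (apply abs_conv_scal; assumption).
  apply CSer_ext. intros N. unfold sdl, sdlb, sdt. induction (h N) as [|u p IH]; simpl; [ring|].
  rewrite <- IH, !pval_app, tval_tdl, tval_tdlb. unfold tval at 1. simpl.
  transitivity (tc u * mono (tm u) (tn u) z * (dmono (ta u) (tb u) l * (Ci * l) +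
   dbmono (ta u) (tb u) l * Cconj (Ci * l)) + (Ci * l * pval (flat_map tdl p) z l +
   Cconj (Ci * l) * pval (flat_map tdlb p) z l))%C; [ring|].
  rewrite dmono_rot. ring.
Qed.

Lemma sval_ext h k z l : (forall N, pval (h N) z l = pval (k N) z l) -> sval h z l = sval k z l.
Proof. intros E. apply CSer_ext, E. Qed.

Lemma sdt_sdz h z l : sval (sdt (sdz h)) z l = sval (sdz (sdt h)) z l.
Proof. apply sval_ext. intros N. unfold sdt, sdz. induction (h (S N)) as [|t p IH]; simpl; auto.
 rewrite map_app, !pval_app, IH.
 unfold tdz, tdt; simpl. destruct (tm t) as [|m]; simpl; auto.
 unfold tval; simpl. ring.
Qed.

Lemma sdw_sdz h z l : sval (sdw (sdz h)) z l = sval (sdz (sdw h)) z l.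
Proof. apply sval_ext. intros N. unfold sdw, sdz. induction (h (S (S N))) as [|t p IH]; simpl; auto.
 rewrite !flat_map_app, !pval_app, IH.
 unfold tdz, tdw; simpl. destruct (tm t) as [|m] eqn:Em; destruct (tn t) as [|n] eqn:En; simpl;
  rewrite ?Em, ?En; simpl; auto.
 unfold tval; simpl. ring.
Qed.

Lemma sdz_sint h z l : sval (sdz (sint h)) z l = sval h z l.
Proof. apply sval_ext. intros N. unfold sdz, sint. induction (h N) as [|t p IH]; [reflexivity|].
 change (flat_map tdz (map tint (t :: p))) with (tdz (tint t) ++ flat_map tdz (map tint p)).
 change (pval (t :: p) z l) with (tval t z l + pval p z l)%C.
 rewrite pval_app, IH, tval_tdz.
 unfold dmono, tval, mono. cbn [tint tc tm tn ta tb pred].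
 assert (RtoC (INR (S (tm t))) <> 0).
 { intros E. apply RtoC_inj in E. revert E. apply not_0_INR. lia. }
 field. assumption.
Qed.

(** * Cauchy's theorem on rectangles and the mean value property *)

Definition Ccont (f : R -> C) (t : R) : Prop :=
 continuous (fun s => Re (f s)) t /\ continuous (fun s => Im (f s)) t.
Definition CInt (f : R -> C) (a b : R) : C :=
 (RInt (fun t => Re (f t)) a b, RInt (fun t => Im (f t)) a b).

Lemma Ccont_ex_RInt f a b : a <= b -> (forall t, a <= t <= b -> Ccont f t) ->
 ex_RInt (fun t => Re (f t)) a b /\ ex_RInt (fun t => Im (f t)) a b.
Proof. intros L H; split; apply (@ex_RInt_continuous R_CompleteNormedModule);
  intros t; rewrite Rmin_left, Rmax_right by exact L; intros Ht; apply (H t Ht).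
Qed.

Lemma Ccont_plus f g t : Ccont f t -> Ccont g t -> Ccont (fun s => f s + g s)%C t.
Proof. intros [H1 H2] [H3 H4]; split.
 - apply (@continuous_plus R_UniformSpace R_AbsRing R_NormedModule _ _ _ H1 H3).
 - apply (@continuous_plus R_UniformSpace R_AbsRing R_NormedModule _ _ _ H2 H4).
Qed.
Lemma Ccont_mult f g t : Ccont f t -> Ccont g t -> Ccont (fun s => f s * g s)%C t.
Proof. intros [H1 H2] [H3 H4]; split.
 - apply (@continuous_minus R_UniformSpace R_AbsRing R_NormedModule
   (fun s => Re (f s) * Re (g s)) (fun s => Im (f s) * Im (g s)));
   apply (@continuous_mult R_UniformSpace R_AbsRing); auto.
 - apply (@continuous_plus R_UniformSpace R_AbsRing R_NormedModule
   (fun s => Re (f s) * Im (g s)) (fun s => Im (f s) * Re (g s)));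
   apply (@continuous_mult R_UniformSpace R_AbsRing); auto.
Qed.
Lemma Ccont_const c t : Ccont (fun _ => c) t.
Proof. split; apply continuous_const. Qed.
Lemma Ccont_RD f t d : RD f t d -> Ccont f t.
Proof. intros [H1 H2]; split; apply (@ex_derive_continuous R_AbsRing R_NormedModule); eexists; eauto.
Qed.

Lemma CInt_plus f g a b : a <= b -> (forall t, a <= t <= b -> Ccont f t) ->
 (forall t, a <= t <= b -> Ccont g t) ->
 CInt (fun t => f t + g t)%C a b = (CInt f a b + CInt g a b)%C.
Proof. intros L Hf Hg. destruct (Ccont_ex_RInt _ _ _ L Hf), (Ccont_ex_RInt _ _ _ L Hg).
 unfold CInt, Cplus; simpl. f_equal.
 - apply (@RInt_plus R_CompleteNormedModule); auto.
 - apply (@RInt_plus R_CompleteNormedModule); auto.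
Qed.

Lemma CInt_scal c f a b : a <= b -> (forall t, a <= t <= b -> Ccont f t) ->
 CInt (fun t => c * f t)%C a b = (c * CInt f a b)%C.
Proof. intros L Hf. destruct (Ccont_ex_RInt _ _ _ L Hf) as [H1 H2].
 destruct c as [x y]. unfold CInt, Cmult; simpl. f_equal.
 - assert (E := @RInt_minus R_CompleteNormedModule _ _ _ _
   (@ex_RInt_scal R_NormedModule _ a b x H1) (@ex_RInt_scal R_NormedModule _ a b y H2)).
  rewrite !(@RInt_scal R_CompleteNormedModule) in E by auto. exact E.
 - assert (E := @RInt_plus R_CompleteNormedModule _ _ _ _
   (@ex_RInt_scal R_NormedModule _ a b x H2) (@ex_RInt_scal R_NormedModule _ a b y H1)).
  rewrite !(@RInt_scal R_CompleteNormedModule) in E by auto. exact E.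
Qed.

Lemma CInt_Chasles f a b c : a <= b -> b <= c -> (forall t, a <= t <= c -> Ccont f t) ->
 (CInt f a b + CInt f b c = CInt f a c)%C.
Proof. intros L1 L2 H.
 destruct (Ccont_ex_RInt f a b) as [A1 A2]; auto. { intros; apply H; lra. }
 destruct (Ccont_ex_RInt f b c) as [B1 B2]; auto. { intros; apply H; lra. }
 unfold CInt, Cplus; simpl. f_equal.
 - apply (@RInt_Chasles R_CompleteNormedModule); auto.
 - apply (@RInt_Chasles R_CompleteNormedModule); auto.
Qed.

Lemma CInt_bound f a b M : a <= b -> (forall t, a <= t <= b -> Ccont f t) ->
 (forall t, a <= t <= b -> Cmod (f t) <= M) -> Cmod (CInt f a b) <= 2 * (b - a) * M.
Proof. intros L H B. destruct (Ccont_ex_RInt _ _ _ L H) as [H1 H2].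
 reim. unfold CInt; simpl.
 assert (L1 : Rabs (RInt (fun t => Re (f t)) a b) <= (b - a) * M).
 { apply abs_RInt_le_const; auto. intros t Ht. eapply Rle_trans; [apply Re_le_Cmod|auto]. }
 assert (L2 : Rabs (RInt (fun t => Im (f t)) a b) <= (b - a) * M).
 { apply abs_RInt_le_const; auto. intros t Ht. eapply Rle_trans; [apply Im_le_Cmod|auto]. }
 lra.
Qed.

Lemma CInt_affine (A B : C) a b : a <= b ->
 CInt (fun t => A + B * RtoC t)%C a b = (A * RtoC (b - a) + B * RtoC ((b ^ 2 - a ^ 2) / 2))%C.
Proof. intros L. destruct A as [p q], B as [u v].
 assert (K : forall x y, RInt (fun t => x + y * t) a b = x * (b - a) + y * ((b ^ 2 - a ^ 2) / 2)).
 { intros x y. apply is_RInt_unique.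
  replace (x * (b - a) + y * ((b ^ 2 - a ^ 2) / 2))
   with (minus (x * b + y * (b ^ 2 / 2)) (x * a + y * (a ^ 2 / 2)))
   by (unfold minus, plus, opp; simpl; field).
  apply (is_RInt_derive (fun t => x * t + y * (t ^ 2 / 2))).
  - intros t _. auto_derive; auto. field.
  - intros t _. apply (@ex_derive_continuous R_AbsRing R_NormedModule). auto_derive; auto. }
 unfold CInt, Cplus, Cmult, RtoC; simpl. f_equal.
 - transitivity (p * (b - a) + u * ((b ^ 2 - a ^ 2) / 2)); [|simpl; field].
  rewrite <- K. apply (@RInt_ext R_CompleteNormedModule). intros; unfold Re; simpl; ring.
 - transitivity (q * (b - a) + v * ((b ^ 2 - a ^ 2) / 2)); [|simpl; field].
  rewrite <- K. apply (@RInt_ext R_CompleteNormedModule). intros; unfold Im; simpl; ring.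
Qed.

(** Boundary integral, counterclockwise, of the rectangle with lower left corner [(a, c)] and sides
    [L], [M]. *)
Definition rect_int (g : C -> C) (a c L M : R) : C :=
 (CInt (fun t => g (t, c)) a (a + L) + Ci * CInt (fun t => g ((a + L)%R, t)) c (c + M)
  - CInt (fun t => g (t, (c + M)%R)) a (a + L) - Ci * CInt (fun t => g (a, t)) c (c + M))%C.

Definition rect (a c L M : R) (z : C) : Prop := a <= Re z <= a + L /\ c <= Im z <= c + M.
Definition hol_on (D : C -> Prop) (g : C -> C) : Prop := forall z, D z -> exists d, WD g z d 0.

Lemma hol_Ccont_x D g y a b : hol_on D g -> (forall t, a <= t <= b -> D (t, y)) ->
 forall t, a <= t <= b -> Ccont (fun s => g (s, y)) t.
Proof. intros H HD t Ht. destruct (H _ (HD t Ht)) as [d Hd]. apply (Ccont_RD _ _ _ (WD_RD_x _ _ _ _ Hd)).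
Qed.
Lemma hol_Ccont_y D g x a b : hol_on D g -> (forall t, a <= t <= b -> D (x, t)) ->
 forall t, a <= t <= b -> Ccont (fun s => g (x, s)) t.
Proof. intros H HD t Ht. destruct (H _ (HD t Ht)) as [d Hd]. apply (Ccont_RD _ _ _ (WD_RD_y _ _ _ _ Hd)).
Qed.

(** The interior sides are traversed twice in opposite directions. *)
Lemma rect_int_split g a c L M : 0 <= L -> 0 <= M -> hol_on (rect a c L M) g ->
 rect_int g a c L M =
 (rect_int g a c (L / 2) (M / 2) + rect_int g (a + L / 2) c (L / 2) (M / 2)
  + rect_int g a (c + M / 2) (L / 2) (M / 2)
  + rect_int g (a + L / 2)%R (c + M / 2)%R (L / 2) (M / 2))%C.
Proof. intros HL HM H.
 assert (X : forall y, c <= y <= c + M ->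
  (CInt (fun t => g (t, y)) a (a + L / 2) + CInt (fun t => g (t, y)) (a + L / 2) (a + L)
   = CInt (fun t => g (t, y)) a (a + L))%C).
 { intros y Hy. apply CInt_Chasles; try lra. apply (hol_Ccont_x _ _ _ _ _ H).
  intros t Ht; split; simpl; lra. }
 assert (Y : forall x, a <= x <= a + L ->
  (CInt (fun t => g (x, t)) c (c + M / 2) + CInt (fun t => g (x, t)) (c + M / 2) (c + M)
   = CInt (fun t => g (x, t)) c (c + M))%C).
 { intros x Hx. apply CInt_Chasles; try lra. apply (hol_Ccont_y _ _ _ _ _ H).
  intros t Ht; split; simpl; lra. }
 unfold rect_int.
 replace (a + L / 2 + L / 2) with (a + L) by field.
 replace (c + M / 2 + M / 2) with (c + M) by field.
 rewrite <- (X c), <- (X (c + M)), <- (Y a), <- (Y (a + L)) by lra. ring.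
Qed.

Lemma CInt_segment (f : R -> C) (A V : C) a L e : 0 <= L -> (forall t, a <= t <= a + L -> Ccont f t) ->
 (forall t, a <= t <= a + L -> Cmod (f t - (A + V * RtoC t))%C <= e) ->
 exists r, Cmod r <= 2 * L * e /\ CInt f a (a + L) = (r + (A * RtoC L + V * RtoC (((a + L) ^ 2 - a ^ 2) / 2)))%C.
Proof. intros HL C1 B.
 assert (C2 : forall t, a <= t <= a + L -> Ccont (fun t => - A + - V * RtoC t)%C t).
 { intros t _. apply Ccont_plus; [apply Ccont_const|]. apply Ccont_mult; [apply Ccont_const|].
  split; [apply continuous_id|apply continuous_const]. }
 exists (CInt (fun t => f t + (- A + - V * RtoC t))%C a (a + L)). split.
 - replace (2 * L) with (2 * (a + L - a)) by ring. apply CInt_bound; [lra|intros; apply Ccont_plus; auto|].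
  intros t Ht. replace (f t + (- A + - V * RtoC t))%C with (f t - (A + V * RtoC t))%C by ring. auto.
 - rewrite CInt_plus by (auto; lra). rewrite CInt_affine by lra. replace (a + L - a) with L by ring. ring.
Qed.

(** The affine part of [g] at [p] has vanishing boundary integral, and what remains is at most
    [eps * (L + M)] along the boundary. *)
Lemma rect_int_small g a c L M p d eps : 0 <= L -> 0 <= M -> rect a c L M p ->
 hol_on (rect a c L M) g -> 0 <= eps ->
 (forall z, rect a c L M z -> Cmod (g z - g p - d * (z - p))%C <= eps * Cmod (z - p)%C) ->
 Cmod (rect_int g a c L M) <= 8 * eps * (L + M) ^ 2.
Proof. intros HL HM Hp H Heps B.
 set (A := (g p - d * p)%C).
 assert (Bz : forall x y, rect a c L M (x, y) -> Cmod (g (x, y) - (A + d * (RtoC x + Ci * RtoC y)))%C <= eps * (L + M)).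
 { intros x y R. replace (RtoC x + Ci * RtoC y)%C with ((x, y) : C)
   by (unfold RtoC, Ci, Cplus, Cmult; simpl; f_equal; ring).
  replace (g (x, y) - (A + d * (x, y)))%C with (g (x, y) - g p - d * ((x, y) - p))%C by (unfold A; ring).
  eapply Rle_trans; [apply (B _ R)|]. apply Rmult_le_compat_l; auto.
  reim. destruct Hp, R.
  unfold Re, Im in *; simpl in *. apply Rplus_le_compat; apply Rabs_le; lra. }
 assert (Hx := fun y (Hy : c <= y <= c + M) => CInt_segment (fun t => g (t, y)) (A + d * (Ci * RtoC y)) d a L (eps * (L + M)) HL
  (hol_Ccont_x _ _ y a (a + L) H (fun t Ht => conj Ht Hy))).
 assert (Hy := fun x (Hx : a <= x <= a + L) => CInt_segment (fun t => g (x, t)) (A + d * RtoC x) (d * Ci) c M (eps * (L + M)) HM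
  (hol_Ccont_y _ _ x c (c + M) H (fun t Ht => conj Hx Ht))).
 assert (Ex : forall x y, (A + d * (Ci * RtoC y) + d * RtoC x = A + d * (RtoC x + Ci * RtoC y))%C) by (intros; ring).
 assert (Ey : forall x y, (A + d * RtoC x + d * Ci * RtoC y = A + d * (RtoC x + Ci * RtoC y))%C) by (intros; ring).
 destruct (Hx c ltac:(lra)) as [r1 [B1 E1]]; [intros; rewrite Ex; apply Bz; split; simpl; lra|].
 destruct (Hx (c + M) ltac:(lra)) as [r2 [B2 E2]]; [intros; rewrite Ex; apply Bz; split; simpl; lra|].
 destruct (Hy a ltac:(lra)) as [r3 [B3 E3]]; [intros; rewrite Ey; apply Bz; split; simpl; lra|].
 destruct (Hy (a + L) ltac:(lra)) as [r4 [B4 E4]]; [intros; rewrite Ey; apply Bz; split; simpl; lra|].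
 unfold rect_int. rewrite E1, E2, E3, E4.
 match goal with |- Cmod ?x <= _ => replace x with (r1 + Ci * r4 + - r2 + - (Ci * r3))%C end.
 - tri.
  eapply Rle_trans; [apply Rplus_le_compat_r, Cmod_triangle|].
  eapply Rle_trans; [apply Rplus_le_compat_r, Rplus_le_compat_r, Cmod_triangle|].
  rewrite !Cmod_opp, !Cmod_mult, Cmod_Ci.
  assert (0 <= eps * (L + M)) by (apply Rmult_le_pos; lra). nra.
 - rewrite !RtoC_plus. ring.
Qed.

Definition bis_mod (g : C -> C) (L M : R) n (q : R * R) : R :=
 Cmod (rect_int g (fst q) (snd q) (L * / 2 ^ n) (M * / 2 ^ n)).

(* The lower left corner of a quarter whose boundary integral is not too small. *)
Definition bis_next (g : C -> C) (L M : R) n (q : R * R) : R * R :=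
 let dx := L * / 2 ^ S n in let dy := M * / 2 ^ S n in
 let m := bis_mod g L M in
 if Rle_dec (m n q / 4) (m (S n) q) then q
 else if Rle_dec (m n q / 4) (m (S n) (fst q + dx, snd q)) then (fst q + dx, snd q)
 else if Rle_dec (m n q / 4) (m (S n) (fst q, snd q + dy)) then (fst q, snd q + dy)
 else (fst q + dx, snd q + dy).

Fixpoint bis_corner (g : C -> C) (a c L M : R) n : R * R :=
 match n with O => (a, c) | S k => bis_next g L M k (bis_corner g a c L M k) end.

(** Bisection, because only pointwise differentiability is available and Green's formula would ask
    for a continuous derivative. Some quarter keeps at least a quarter of the modulus of the
    integral, while differentiability at the limit point makes the integral small compared with the
    squared side lengths. *)
Lemma goursat (g : C -> C) (a c L M : R) : 0 <= L -> 0 <= M -> hol_on (rect a c L M) g ->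
 rect_int g a c L M = 0.
Proof. intros HL HM Hg.
 set (size := fun n => / 2 ^ n).
 set (m := bis_mod g L M). set (corner := bis_corner g a c L M).
 set (nxt := bis_next g L M).
 assert (size_pos : forall n, 0 < size n) by (intros; apply Rinv_0_lt_compat, pow_lt; lra).
 assert (size_S : forall n, size (S n) = size n / 2).
 { intros. unfold size. simpl. field. apply pow_nonzero; lra. }
 assert (corner_S : forall n, corner (S n) = nxt n (corner n)) by reflexivity.
 assert (corner_step : forall n,
 let q := corner n in let q' := corner (S n) in
 (fst q <= fst q' /\ fst q' + L * size (S n) <= fst q + L * size n) /\
 (snd q <= snd q' /\ snd q' + M * size (S n) <= snd q + M * size n)).
 { intros n. rewrite corner_S. unfold nxt, bis_next.
  fold (size (S n)). rewrite size_S. assert (Hs := size_pos n).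
  assert (0 <= L * size n) by (apply Rmult_le_pos; lra).
  assert (0 <= M * size n) by (apply Rmult_le_pos; lra). repeat destruct Rle_dec; simpl; repeat split; lra. }
 assert (corner_in : forall n, a <= fst (corner n) /\ fst (corner n) + L * size n <= a + L /\
 c <= snd (corner n) /\ snd (corner n) + M * size n <= c + M).
 { induction n as [|n IH].
  - simpl. unfold size. repeat split; lra.
  - generalize (corner_step n). intros; repeat split; lra. }
 assert (corner_m : forall n, m 0%nat (a, c) <= m n (corner n) * 4 ^ n).
 { induction n as [|n IH]; [change (corner 0%nat) with (a, c); rewrite pow_O; lra|].
 assert (K : m n (corner n) / 4 <= m (S n) (corner (S n))).
 { rewrite corner_S. generalize (corner_in n). set (q := corner n) in *. intros CI.
  assert (S4 : m n q <= m (S n) q + m (S n) (fst q + L * size (S n), snd q)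
   + m (S n) (fst q, snd q + M * size (S n)) + m (S n) (fst q + L * size (S n), snd q + M * size (S n))).
  { unfold m, bis_mod; simpl fst; simpl snd. fold (size n) (size (S n)). rewrite rect_int_split.
   - rewrite size_S. replace (L * (size n / 2)) with (L * size n / 2) by field.
    replace (M * (size n / 2)) with (M * size n / 2) by field.
    tri.
    eapply Rle_trans; [apply Rplus_le_compat_r, Cmod_triangle|].
    eapply Rle_trans; [apply Rplus_le_compat_r, Rplus_le_compat_r, Cmod_triangle|]. lra.
   - apply Rmult_le_pos; auto. apply Rlt_le, size_pos.
   - apply Rmult_le_pos; auto. apply Rlt_le, size_pos.
   - intros z [Hz1 Hz2]. apply Hg. split; lra. }
  unfold nxt, bis_next. fold m. fold (size (S n)). repeat destruct Rle_dec; auto; lra. }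
 assert (0 < 4 ^ n) by (apply pow_lt; lra). simpl pow. nra. }
 apply Cmod_eq_0. apply Rle_antisym; [|apply Cmod_ge_0].
 assert (Mon : forall n k, fst (corner n) <= fst (corner (n + k)%nat) /\
  fst (corner (n + k)%nat) + L * size (n + k)%nat <= fst (corner n) + L * size n /\
  snd (corner n) <= snd (corner (n + k)%nat) /\
  snd (corner (n + k)%nat) + M * size (n + k)%nat <= snd (corner n) + M * size n).
 { intros n k; induction k as [|k IH].
  - rewrite Nat.add_0_r. repeat split; lra.
  - rewrite Nat.add_succ_r. generalize (corner_step (n + k)%nat). intros; repeat split; lra. }
 assert (Cross : forall n k, fst (corner k) <= fst (corner n) + L * size n /\
   snd (corner k) <= snd (corner n) + M * size n).
 { intros n k.
  assert (HLn := Rmult_le_pos _ _ HL (Rlt_le _ _ (size_pos (n + k)%nat))).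
  assert (HMn := Rmult_le_pos _ _ HM (Rlt_le _ _ (size_pos (n + k)%nat))).
  generalize (Mon n k) (Mon k n). rewrite (Nat.add_comm k n). intros; split; lra. }
 assert (Lim : forall u : nat -> R, (exists B, forall n, u n <= B) -> exists s,
  (forall n, u n <= s) /\ forall B, (forall n, u n <= B) -> s <= B).
 { intros u [B HB]. destruct (completeness (fun x => exists n, x = u n)) as [s [S1 S2]].
  - exists B. intros x [n ->]. apply HB.
  - exists (u 0%nat). now exists 0%nat.
  - exists s; split.
   + intros n. apply S1. now exists n.
   + intros B' HB'. apply S2. intros x [n ->]. apply HB'. }
 destruct (Lim (fun n => fst (corner n))) as [px [Px1 Px2]].
 { exists (fst (corner 0%nat) + L * size 0%nat). intros n; apply Cross. }
 destruct (Lim (fun n => snd (corner n))) as [py [Py1 Py2]].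
 { exists (snd (corner 0%nat) + M * size 0%nat). intros n; apply Cross. }
 (* The suprema of the coordinates of the lower left corners belong to all the nested rectangles. *)
 set (p := (px, py) : C).
 assert (Hp : forall n, rect (fst (corner n)) (snd (corner n)) (L * size n) (M * size n) p).
 { intros n; split; split; simpl; auto.
  - apply Px2. intros k; apply Cross.
  - apply Py2. intros k; apply Cross. }
 assert (Hp0 : rect a c L M p).
 { specialize (Hp 0%nat). unfold size in Hp; simpl in Hp.
  rewrite Rinv_1, !Rmult_1_r in Hp. exact Hp. }
 destruct (Hg p Hp0) as [d Hd].
 assert (Key : forall eps, 0 < eps -> m 0%nat (a, c) <= 8 * eps * (L + M) ^ 2).
 { intros eps Heps. destruct (Hd eps Heps) as [del [Hdel D]].
  assert (Hn : exists n, (L + M) * size n < del).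
  { destruct (Req_dec (L + M) 0) as [E|E]; [exists 0%nat; rewrite E; lra|].
   assert (Hq : 0 < del / (L + M)) by (apply Rdiv_lt_0_compat; lra).
   destruct (pow_lt_1_zero (/ 2)) with (y := del / (L + M)) as [n Hn]; auto.
   { rewrite Rabs_pos_eq; lra. }
   exists n. specialize (Hn n (le_n n)). rewrite Rabs_pos_eq in Hn by (apply pow_le; lra).
   unfold size. rewrite <- pow_inv. apply (Rmult_lt_compat_l (L + M)) in Hn; [|lra].
   replace ((L + M) * (del / (L + M))) with del in Hn by (field; auto). exact Hn. }
  destruct Hn as [n Hn]. eapply Rle_trans; [apply (corner_m n)|].
  assert (Hs := size_pos n).
  assert (K : m n (corner n) <= 8 * eps * (L * size n + M * size n) ^ 2).
  { apply rect_int_small with p d; auto.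
   - apply Rmult_le_pos; lra.
   - apply Rmult_le_pos; lra.
   - intros z [Hz1 Hz2]. apply Hg. generalize (corner_in n). split; lra.
   - lra.
   - intros z Hz.
    replace (g z - g p - d * (z - p))%C
     with (g (p + (z - p)) - g p - d * (z - p) - 0 * Cconj (z - p))%C
     by (replace (p + (z - p))%C with z by ring; ring).
    apply D. reimlt.
    destruct (Hp n) as [Hp1 Hp2]. destruct Hz as [Hz1 Hz2].
    unfold Re, Im in *; simpl in *.
    assert (Rabs (fst z + - px) <= L * size n) by (apply Rabs_le; lra).
    assert (Rabs (snd z + - py) <= M * size n) by (apply Rabs_le; lra). lra. }
  replace (8 * eps * (L * size n + M * size n) ^ 2)
   with (8 * eps * (L + M) ^ 2 * (size n ^ 2)) in K by ring.
  apply (Rmult_le_compat_r (4 ^ n)) in K; [|apply pow_le; lra].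
  replace (8 * eps * (L + M) ^ 2 * size n ^ 2 * 4 ^ n) with (8 * eps * (L + M) ^ 2) in K; auto.
  unfold size. replace 4 with (2 * 2) by ring. rewrite Rpow_mult_distr.
  field. apply pow_nonzero; lra. }
 assert (E0 : m 0%nat (a, c) = Cmod (rect_int g a c L M)).
 { unfold m, bis_mod; simpl. rewrite Rinv_1, !Rmult_1_r. reflexivity. } apply Rnot_lt_le. intros Hpos.
 (* If [x] were positive, the choice [eps = x / (2 A)] would give [x <= x / 2]. *)
 set (x := m 0%nat (a, c)) in *. set (A := 8 * (L + M) ^ 2 + 1).
 assert (HA : 0 < A) by (unfold A; nra).
 specialize (Key (x / (2 * A))). assert (Hx : 0 < x / (2 * A)) by (apply Rdiv_lt_0_compat; lra).
 replace (8 * (x / (2 * A)) * (L + M) ^ 2) with ((A - 1) * (x / (2 * A))) in Key by (unfold A; ring).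
 assert (E : A * (x / (2 * A)) = x / 2) by (field; lra). lra.
Qed.

Lemma WD_comp_hol (f g : C -> C) z a d : WD f (g z) a 0 -> WD g z d 0 ->
 WD (fun w => f (g w)) z (a * d) 0.
Proof.
 rewrite <- !is_derive_WD, Cmult_comm. intros Hf Hg. apply (@is_derive_comp C_AbsRing C_NormedModule _ _ _ _ _ Hf).
 apply is_derive_eps_gen. apply (WD_hol g), is_derive_WD, Hg.
Qed.

(** * Complex exponential and mean values over circles *)

(** Used as logarithmic polar coordinates: vertical segments of length [2 PI] go to circles about 0
    and the open left half plane to the punctured open disc, which reduces circles to rectangles. *)
Definition Cexp (w : C) : C := (RtoC (exp (Re w)) * cis (Im w))%C.

Lemma cis_plus s t : cis (s + t) = (cis s * cis t)%C.
Proof. unfold cis, Cmult; simpl. rewrite cos_plus, sin_plus. f_equal; ring. Qed.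

Lemma Cexp_plus v w : Cexp (v + w) = (Cexp v * Cexp w)%C.
Proof. unfold Cexp. rewrite Re_plus, Im_plus, exp_plus, cis_plus, RtoC_mult. ring.
Qed.

Lemma Cmod_Cexp w : Cmod (Cexp w) = exp (Re w).
Proof. unfold Cexp. rewrite Cmod_mult, Cmod_cis, Cmod_R, Rabs_pos_eq; [ring|]. apply Rlt_le, exp_pos.
Qed.

(** The functional equation reduces the expansion at [w] to the one at 0. *)
Lemma WD_Cexp w : WD Cexp w (Cexp w) 0.
Proof. assert (W0 : little_o (fun h => Cexp h - 1 - h)%C).
 { intros eps Heps.
  assert (X1 : RD (fun t => RtoC (exp t)) 0 1).
  { split; simpl; auto_derive; auto. rewrite exp_0; ring. }
  assert (X2 := RD_cis 0).
  destruct (proj1 (RD_eps _ _ _) X1 (Rmin 1 (eps / 4))) as [d1 [Hd1 K1]].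
  { apply Rmin_glb_lt; lra. }
  destruct (proj1 (RD_eps _ _ _) X2 (eps / 12)) as [d2 [Hd2 K2]]; [lra|].
  exists (Rmin (Rmin d1 d2) (Rmin (1/2) (eps / 8))). split.
  { repeat apply Rmin_glb_lt; lra. }
  intros h Hh. destruct h as [x y].
  assert (Hx : Rabs x <= Cmod (x, y)) by apply (Re_le_Cmod (x, y)).
  assert (Hy : Rabs y <= Cmod (x, y)) by apply (Im_le_Cmod (x, y)).
  assert (M1 := Rmin_l (Rmin d1 d2) (Rmin (1/2) (eps / 8))).
  assert (M2 := Rmin_r (Rmin d1 d2) (Rmin (1/2) (eps / 8))).
  assert (M3 := Rmin_l d1 d2). assert (M4 := Rmin_r d1 d2).
  assert (M5 := Rmin_l (1/2) (eps / 8)). assert (M6 := Rmin_r (1/2) (eps / 8)).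
  assert (M7 := Rmin_l 1 (eps / 4)). assert (M8 := Rmin_r 1 (eps / 4)).
  specialize (K1 x ltac:(lra)). specialize (K2 y ltac:(lra)).
  rewrite Rplus_0_l, exp_0 in K1. rewrite Rplus_0_l, cis_0 in K2.
  assert (P1 := Rabs_pos x). assert (P2 := Rabs_pos y).
  assert (E1 : Cmod (RtoC (exp x) - 1)%C <= 2 * Rabs x).
  { replace (RtoC (exp x) - 1)%C with ((RtoC (exp x) - 1 - 1 * RtoC x) + RtoC x)%C by ring.
   tri. rewrite Cmod_R.
   assert (Rmin 1 (eps / 4) * Rabs x <= 1 * Rabs x) by (apply Rmult_le_compat_r; lra). lra. }
  assert (E2 : Cmod (RtoC (exp x)) <= 3).
  { replace (RtoC (exp x)) with ((RtoC (exp x) - 1) + 1)%C by ring.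
   tri. rewrite Cmod_1. lra. }
  replace (Cexp (x, y) - 1 - (x, y))%C with
   ((RtoC (exp x) - 1 - 1 * RtoC x) + RtoC (exp x) * (cis y - 1 - Ci * 1 * RtoC y)
    + (RtoC (exp x) - 1) * (Ci * RtoC y))%C.
  2:{ unfold Cexp; simpl. replace ((x, y) : C) with (RtoC x + Ci * RtoC y)%C; [ring|].
    unfold RtoC, Ci, Cplus, Cmult; simpl; f_equal; ring. }
  tri.
  eapply Rle_trans; [apply Rplus_le_compat_r, Cmod_triangle|].
  rewrite !Cmod_mult, Cmod_Ci, (Cmod_R y).
  assert (T1 : Cmod (RtoC (exp x)) * Cmod (cis y - 1 - Ci * 1 * RtoC y)%C <= 3 * (eps / 12 * Rabs y)).
  { apply Rmult_le_compat; auto; apply Cmod_ge_0. }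
  nra. }
 apply (little_o_bound _ _ (Cmod (Cexp w)) 1) with (4 := W0); [apply Cmod_ge_0|lra|].
 intros h _. rewrite <- Cmod_mult. right. f_equal. rewrite Cexp_plus. ring.
Qed.

(* Differentiability at 0 is not required, so that quotients by [l] are allowed. *)
Definition disc_fun (E : C -> C) : Prop :=
 (forall l eps, Cmod l <= 1 -> 0 < eps -> exists del, 0 < del /\
   forall l', Cmod l' <= 1 -> Cmod (l' - l)%C < del -> Cmod (E l' - E l)%C < eps) /\
 (forall l, 0 < Cmod l < 1 -> exists d, WD E l d 0).

Lemma disc_circle_Ccont E t : disc_fun E -> Ccont (fun s => E (cis s)) t.
Proof. intros [H _].
 assert (K : forall eps, 0 < eps -> exists del, 0 < del /\ forall s, Rabs (s - t) < del ->
  Cmod (E (cis s) - E (cis t))%C < eps).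
 { intros eps Heps. destruct (H (cis t) eps) as [d [Hd D]]; [rewrite Cmod_cis; lra|auto|].
  destruct (RD_lip _ _ _ (RD_cis t)) as [M [e [HM [He L]]]].
  exists (Rmin e (d / (M + 1))). split.
  { apply Rmin_glb_lt; auto. apply Rdiv_lt_0_compat; lra. }
  intros s Hs. apply D; [rewrite Cmod_cis; lra|].
  specialize (L (s - t)). replace (t + (s - t)) with s in L by ring.
  eapply Rle_lt_trans; [apply L; eapply Rlt_le_trans; [exact Hs|apply Rmin_l]|].
  assert (H1 : Rabs (s - t) < d / (M + 1)) by (eapply Rlt_le_trans; [exact Hs|apply Rmin_r]).
  apply (Rmult_lt_compat_l (M + 1)) in H1; [|lra].
  replace ((M + 1) * (d / (M + 1))) with d in H1 by (field; lra). nra. }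
 split; intros P [e He]; destruct (K e (cond_pos e)) as [d [Hd D]];
  exists (mkposreal d Hd); intros s Hs; apply He.
 - eapply Rle_lt_trans; [|apply (D s Hs)].
  apply (Re_le_Cmod (E (cis s) - E (cis t))%C).
 - eapply Rle_lt_trans; [|apply (D s Hs)].
  apply (Im_le_Cmod (E (cis s) - E (cis t))%C).
Qed.

(** Uniform radial approach to the boundary values: continuity gives a gauge on [[0, 2 PI]], and
    compactness extracts one [d] for all angles. *)
Lemma disc_radial E eps : disc_fun E -> 0 < eps -> exists d, 0 < d /\
 forall r t, 0 <= t <= 2 * PI -> 1 - d < r <= 1 -> 0 <= r ->
  Cmod (E (RtoC r * cis t) - E (cis t))%C <= eps.
Proof. intros [H _] Heps.
 assert (K : forall t, exists d : posreal, forall l', Cmod l' <= 1 -> Cmod (l' - cis t)%C < 2 * d ->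
  Cmod (E l' - E (cis t))%C < eps / 2).
 { intros t. destruct (H (cis t) (eps / 2)) as [d [Hd D]]; [rewrite Cmod_cis; lra|lra|].
  assert (Hd2 : 0 < d / 2) by lra. exists (mkposreal _ Hd2). simpl.
  intros l' H1 H2. apply D; auto. lra. }
 assert (K' : forall t, exists d : posreal, forall s, Rabs (s - t) < d ->
  forall r, 0 <= r <= 1 -> 1 - d < r ->
   Cmod (E (RtoC r * cis s) - E (cis t))%C < eps / 2).
 { intros t. destruct (K t) as [d D].
  destruct (RD_lip _ _ _ (RD_cis t)) as [M [e [HM [He L]]]].
  assert (Hm : 0 < Rmin (Rmin e d) (d / (M + 1))).
  { repeat apply Rmin_glb_lt; auto; try apply cond_pos. apply Rdiv_lt_0_compat; [apply cond_pos|lra]. }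
  exists (mkposreal _ Hm). simpl. intros s Hs r Hr Hr1.
  assert (M1 := Rmin_l (Rmin e d) (d / (M + 1))). assert (M2 := Rmin_r (Rmin e d) (d / (M + 1))).
  assert (M3 := Rmin_l e d). assert (M4 := Rmin_r e d).
  apply D.
  - rewrite Cmod_mult, Cmod_cis, Cmod_R, Rabs_pos_eq; lra.
  - replace (RtoC r * cis s - cis t)%C with ((cis s - cis t) + RtoC (r - 1) * cis s)%C.
   2:{ rewrite RtoC_minus. ring. }
   trilt.
   rewrite Cmod_mult, Cmod_cis, Cmod_R, Rabs_left1 by lra.
   specialize (L (s - t)). replace (t + (s - t)) with s in L by ring.
   assert (H1 : Rabs (s - t) < d / (M + 1)) by lra.
   apply (Rmult_lt_compat_l (M + 1)) in H1; [|lra].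
   replace ((M + 1) * (d / (M + 1))) with (pos d) in H1 by (field; lra). nra. }
 set (delta := fun t => proj1_sig (constructive_indefinite_description _ (K' t))).
 assert (Hdelta : forall t s, Rabs (s - t) < delta t -> forall r, 0 <= r <= 1 -> 1 - delta t < r ->
   Cmod (E (RtoC r * cis s) - E (cis t))%C < eps / 2).
 { intros t. unfold delta. destruct constructive_indefinite_description as [d D]; simpl. exact D. }
 destruct (compactness_value_1d 0 (2 * PI) delta) as [d D].
 exists d. split; [apply cond_pos|]. intros r t Ht Hr Hr0.
 apply NNPP. intros N. apply (D t Ht). intros [u [Hu1 [Hu2 Hu3]]]. apply N.
 assert (A1 := Hdelta u t Hu2 r ltac:(lra) ltac:(lra)).
 assert (A2 := Hdelta u t Hu2 1 ltac:(lra) ltac:(generalize (cond_pos (delta u)); lra)).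
 replace (RtoC 1 * cis t)%C with (cis t) in A2 by ring.
 replace (E (RtoC r * cis t) - E (cis t))%C
  with ((E (RtoC r * cis t) - E (cis u)) - (E (cis t) - E (cis u)))%C by ring. tri. rewrite Cmod_opp. lra.
Qed.

(** The mean over the circle of radius [exp s] does not depend on [s < 0]; it is compared with the
    boundary values as the radius tends to 1 and with [E 0] as it tends to 0. *)
Lemma disc_mean E : disc_fun E -> CInt (fun t => E (cis t)) 0 (2 * PI) = (RtoC (2 * PI) * E 0)%C.
Proof. intros HE. assert (HPI := PI_RGT_0).
 set (g := fun w => E (Cexp w)).
 assert (Hg : hol_on (fun w => Re w < 0) g).
 { intros w Hw. destruct (proj2 HE (Cexp w)) as [d Hd].
  { rewrite Cmod_Cexp. split; [apply exp_pos|]. rewrite <- exp_0. now apply exp_increasing. }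
  exists (d * Cexp w)%C. apply (WD_comp_hol E Cexp); auto. apply WD_Cexp. }
 set (m := fun s => CInt (fun t => g (s, t)) 0 (2 * PI)).
 (* The horizontal sides of the rectangle have the same image under [Cexp], so their integrals
    cancel and those over the vertical sides agree. *)
 assert (Const : forall s1 s2, s1 <= s2 -> s2 < 0 -> m s1 = m s2).
 { intros s1 s2 H12 H2.
  assert (G := goursat g s1 0 (s2 - s1) (2 * PI) ltac:(lra) ltac:(lra)).
  unfold rect_int in G.
  replace (s1 + (s2 - s1)) with s2 in G by ring. rewrite Rplus_0_l in G.
  fold (m s2) (m s1) in G.
  replace (CInt (fun t => g (t, (2 * PI)%R)) s1 s2) with (CInt (fun t => g (t, 0)) s1 s2) in G.
  2:{ unfold g, Cexp; simpl.
    unfold cis. rewrite cos_2PI, sin_2PI, cos_0, sin_0. reflexivity. }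
  assert (G' : (Ci * (m s2 - m s1) = 0)%C).
  { rewrite <- G; [ring|]. intros z [Hz1 _]. apply Hg. lra. }
  destruct (Ceq_dec (m s2 - m s1)%C 0) as [E0|E0].
  - symmetry. apply Cminus_eq_0, E0.
  - exfalso. apply (Cmult_neq_0 _ _ Ci_neq_0 E0 G'). }
 assert (gE : forall s t, g (s, t) = E (RtoC (exp s) * cis t)%C) by reflexivity.
 assert (Cg : forall s t, s < 0 -> Ccont (fun t => g (s, t)) t).
 { intros s t Hs. destruct (Hg (s, t) Hs) as [d Hd]. apply (Ccont_RD _ _ _ (WD_RD_y _ _ _ _ Hd)). }
 assert (Close : forall eps, 0 < eps ->
  Cmod (CInt (fun t => E (cis t)) 0 (2 * PI) - RtoC (2 * PI) * E 0)%C <= eps).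
 { intros eps Heps. set (e := eps / (8 * PI)).
  assert (He : 0 < e) by (apply Rdiv_lt_0_compat; lra).
  destruct (disc_radial E e HE He) as [d1 [Hd1 D1]].
  destruct (proj1 HE 0 e) as [d2 [Hd2 D2]]; [rewrite Cmod_0; lra|auto|].
  (* [r1] is close to 1 and [r2] close to 0; both circles have the same mean. *)
  set (r1 := Rmax (1 / 2) (1 - d1 / 2)).
  assert (Hr1 : 0 < r1 < 1 /\ 1 - d1 < r1).
  { unfold r1. assert (A := Rmax_l (1/2) (1 - d1/2)). assert (B := Rmax_r (1/2) (1 - d1/2)).
   split; [|lra]. split; [lra|]. apply Rmax_lub_lt; lra. }
  set (r2 := Rmin r1 (d2 / 2)).
  assert (Hr2 : 0 < r2 <= r1 /\ r2 < d2).
  { unfold r2. assert (A := Rmin_l r1 (d2/2)). assert (B := Rmin_r r1 (d2/2)).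
   split; [|lra]. split; [apply Rmin_glb_lt; lra|lra]. }
  assert (Hln1 : ln r1 < 0) by (rewrite <- ln_1; apply ln_increasing; lra).
  assert (Hln : ln r2 <= ln r1).
  { destruct (Req_dec r2 r1) as [->|N]; [lra|]. apply Rlt_le, ln_increasing; lra. }
  assert (Em := Const (ln r2) (ln r1) Hln Hln1).
  assert (CE : forall t, 0 <= t <= 2 * PI -> Ccont (fun t => E (cis t)) t)
   by (intros; apply disc_circle_Ccont; auto).
  assert (A1 : Cmod (m (ln r1) - CInt (fun t => E (cis t)) 0 (2 * PI))%C <= 2 * (2 * PI) * e).
  { replace (m (ln r1) - CInt (fun t => E (cis t)) 0 (2 * PI))%C
    with (CInt (fun t => g (ln r1, t) + RtoC (-1) * E (cis t))%C 0 (2 * PI)).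
   - replace (2 * (2 * PI)) with (2 * (2 * PI - 0)) by ring. apply CInt_bound; [lra| |].
    + intros t Ht. apply Ccont_plus; [now apply Cg|]. apply Ccont_mult; [apply Ccont_const|auto].
    + intros t Ht. rewrite gE, exp_ln by lra. rewrite RtoC_m1.
     replace (E (RtoC r1 * cis t) + - (1) * E (cis t))%C
      with (E (RtoC r1 * cis t) - E (cis t))%C by ring. apply D1; lra.
   - rewrite CInt_plus, CInt_scal; auto; try lra.
    + unfold m. ring.
    + intros t Ht. apply Ccont_mult; [apply Ccont_const|auto]. }
  assert (A2 : Cmod (m (ln r2) - RtoC (2 * PI) * E 0)%C <= 2 * (2 * PI) * e).
  { replace (m (ln r2) - RtoC (2 * PI) * E 0)%C
    with (CInt (fun t => g (ln r2, t) + (- E 0 + 0 * RtoC t))%C 0 (2 * PI)).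
   - replace (2 * (2 * PI)) with (2 * (2 * PI - 0)) by ring. apply CInt_bound; [lra| |].
    + intros t Ht. apply Ccont_plus; [apply Cg; lra|].
     apply Ccont_plus; [apply Ccont_const|]. apply Ccont_mult; [apply Ccont_const|].
     split; [apply continuous_id|apply continuous_const].
    + intros t Ht. rewrite gE, exp_ln by lra.
     replace (E (RtoC r2 * cis t) + (- E 0 + 0 * RtoC t))%C
      with (E (RtoC r2 * cis t) - E 0)%C by ring.
     assert (Hm : Cmod (RtoC r2 * cis t)%C = r2)
      by (rewrite Cmod_mult, Cmod_cis, Cmod_R, Rabs_pos_eq; lra).
     apply Rlt_le, D2; [rewrite Hm; lra|].
     replace (RtoC r2 * cis t - 0)%C with (RtoC r2 * cis t)%C by ring. lra.
   - rewrite CInt_plus, CInt_affine; try lra.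
    + unfold m. replace (2 * PI - 0) with (2 * PI) by ring. ring.
    + intros t Ht; apply Cg; lra.
    + intros t Ht. apply Ccont_plus; [apply Ccont_const|]. apply Ccont_mult; [apply Ccont_const|].
     split; [apply continuous_id|apply continuous_const]. }
  rewrite Em in A2.
  replace (CInt (fun t => E (cis t)) 0 (2 * PI) - RtoC (2 * PI) * E 0)%C
   with ((m (ln r1) - RtoC (2 * PI) * E 0) + - (m (ln r1) - CInt (fun t => E (cis t)) 0 (2 * PI)))%C
   by ring.
  tri. rewrite Cmod_opp.
  assert (2 * (2 * PI) * e = eps / 2) by (unfold e; field; lra). lra. }
 assert (Z : (CInt (fun t => E (cis t)) 0 (2 * PI) - RtoC (2 * PI) * E 0 = 0)%C).
 { apply Cmod_eq_0, Rle_antisym; [|apply Cmod_ge_0]. apply Rnot_lt_le. intros Hpos.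
  specialize (Close _ (Rdiv_lt_0_compat _ 2 Hpos ltac:(lra))). lra. }
 apply Cminus_eq_0, Z.
Qed.

Lemma disc_const c : disc_fun (fun _ => c).
Proof. split.
 - exists 1; split; [lra|]. replace (c - c)%C with (RtoC 0) by ring.
  now rewrite Cmod_0.
 - exists 0. apply WD_const.
Qed.

Lemma disc_plus E F : disc_fun E -> disc_fun F -> disc_fun (fun l => E l + F l)%C.
Proof. intros [E1 E2] [F1 F2]. split.
 - intros l eps Hl Heps. destruct (E1 l (eps / 2) Hl) as [d1 [Hd1 D1]]; [lra|].
  destruct (F1 l (eps / 2) Hl) as [d2 [Hd2 D2]]; [lra|].
  exists (Rmin d1 d2); split; [now apply Rmin_glb_lt|]. intros l' Hl' Hd.
  replace (E l' + F l' - (E l + F l))%C with ((E l' - E l) + (F l' - F l))%C by ring.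
  trilt.
  assert (A1 := D1 l' Hl' (Rlt_le_trans _ _ _ Hd (Rmin_l _ _))).
  assert (A2 := D2 l' Hl' (Rlt_le_trans _ _ _ Hd (Rmin_r _ _))). lra.
 - intros l Hl. destruct (E2 l Hl) as [a Ha], (F2 l Hl) as [b Hb].
  exists (a + b)%C. eapply WD_eq; [apply (WD_plus _ _ _ _ _ _ _ Ha Hb)|reflexivity|ring].
Qed.

Lemma disc_mult E F : disc_fun E -> disc_fun F -> disc_fun (fun l => E l * F l)%C.
Proof. intros [E1 E2] [F1 F2]. split.
 - intros l eps Hl Heps.
  set (A := Cmod (E l) + Cmod (F l) + 1).
  assert (HA : 1 <= A) by (unfold A; generalize (Cmod_ge_0 (E l)) (Cmod_ge_0 (F l)); lra).
  set (e := Rmin 1 (eps / (2 * A))).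
  assert (He : 0 < e).
  { apply Rmin_glb_lt; [lra|]. apply Rdiv_lt_0_compat; lra. }
  destruct (E1 l e Hl He) as [d1 [Hd1 D1]]. destruct (F1 l e Hl He) as [d2 [Hd2 D2]].
  exists (Rmin d1 d2); split; [now apply Rmin_glb_lt|]. intros l' Hl' Hd.
  assert (A1 := D1 l' Hl' (Rlt_le_trans _ _ _ Hd (Rmin_l _ _))).
  assert (A2 := D2 l' Hl' (Rlt_le_trans _ _ _ Hd (Rmin_r _ _))).
  replace (E l' * F l' - E l * F l)%C
   with ((E l' - E l) * F l + (E l * (F l' - F l) + (E l' - E l) * (F l' - F l)))%C by ring.
  trilt.
  eapply Rle_lt_trans; [apply Rplus_le_compat_l, Cmod_triangle|]. rewrite !Cmod_mult.
  assert (M1 := Rmin_l 1 (eps / (2 * A))). assert (M2 := Rmin_r 1 (eps / (2 * A))). fold e in M1, M2.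
  assert (P1 := Cmod_ge_0 (E l' - E l)%C).
  assert (P3 := Cmod_ge_0 (E l)). assert (P4 := Cmod_ge_0 (F l)).
  apply (Rmult_le_compat_l (2 * A)) in M2; [|lra].
  replace (2 * A * (eps / (2 * A))) with eps in M2 by (field; lra).
  unfold A in *. nra.
 - intros l Hl. destruct (E2 l Hl) as [a Ha], (F2 l Hl) as [b Hb].
  exists (a * F l + E l * b)%C. eapply WD_eq; [apply (WD_mult _ _ _ _ _ _ _ Ha Hb)|reflexivity|ring].
Qed.

Lemma disc_opp E : disc_fun E -> disc_fun (fun l => - E l)%C.
Proof. replace (fun l => - E l)%C with (fun l => RtoC (-1) * E l)%C.
 - apply disc_mult; auto. apply disc_const.
 - extensionality l. ring.
Qed.

Lemma disc_id : disc_fun (fun l => l).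
Proof. split.
 - intros l eps _ Heps. exists eps. auto.
 - exists 1. apply WD_id.
Qed.

(** By continuity a positive value would persist on an interval and contribute a positive amount. *)
Lemma RInt_zero_nonneg (f : R -> R) a b : a < b ->
 (forall t, a <= t <= b -> continuous f t) -> (forall t, a <= t <= b -> 0 <= f t) ->
 RInt f a b = 0 -> forall t, a <= t <= b -> f t = 0.
Proof. intros Hab Hc Hpos HI.
 assert (Ex : forall c d, a <= c -> c <= d -> d <= b -> ex_RInt f c d).
 { intros c d H1 H2 H3. apply (@ex_RInt_continuous R_CompleteNormedModule).
  rewrite Rmin_left, Rmax_right by lra. intros; apply Hc; lra. }
 assert (Sub : forall c d, a <= c -> c < d -> d <= b -> (forall t, c < t < d -> 0 < f t) -> False).
 { intros c d H1 H2 H3 Hp.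
  assert (P : 0 < RInt f c d).
  { apply RInt_gt_0; auto. intros x Hx. apply Hc; lra. }
  assert (P1 : 0 <= RInt f a c) by (apply RInt_ge_0; auto; [apply Ex; lra|intros; apply Hpos; lra]).
  assert (P2 : 0 <= RInt f d b) by (apply RInt_ge_0; auto; [apply Ex; lra|intros; apply Hpos; lra]).
  assert (E1 := @RInt_Chasles R_CompleteNormedModule f a c d (Ex a c ltac:(lra) ltac:(lra) ltac:(lra))
   (Ex c d ltac:(lra) ltac:(lra) ltac:(lra))).
  assert (E2 := @RInt_Chasles R_CompleteNormedModule f a d b (Ex a d ltac:(lra) ltac:(lra) ltac:(lra))
   (Ex d b ltac:(lra) ltac:(lra) ltac:(lra))).
  unfold plus in E1, E2; simpl in E1, E2. lra. }
 intros t Ht. apply Rle_antisym; [|now apply Hpos]. apply Rnot_lt_le. intros Hp.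
 destruct (Hc t Ht (fun y => 0 < y)) as [d Hd].
 { apply open_gt; auto. }
 destruct (Rle_lt_dec b t) as [L|L].
 - apply (Sub (Rmax a (t - d)) t); try lra.
  + apply Rmax_l.
  + apply Rmax_lub_lt; [lra|]. generalize (cond_pos d); lra.
  + intros s Hs. apply Hd. assert (A := Rmax_r a (t - d)).
   apply Rabs_def1; unfold minus, plus, opp; simpl; lra.
 - apply (Sub t (Rmin b (t + d))); try lra.
  + apply Rmin_glb_lt; [lra|]. generalize (cond_pos d); lra.
  + apply Rmin_l.
  + intros s Hs. apply Hd. assert (A := Rmin_r b (t + d)).
   apply Rabs_def1; unfold minus, plus, opp; simpl; lra.
Qed.

(* [(E - E 0) (F - F 0)] has mean 0 and equals [|E - E 0|^2] on the circle. *)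
Lemma disc_conj_const E F : disc_fun E -> disc_fun F ->
 (forall l, Cmod l = 1 -> E l = Cconj (F l)) ->
 E 0 = Cconj (F 0) /\ forall l, Cmod l = 1 -> E l = E 0.
Proof. intros HE HF EF. assert (HPI := PI_RGT_0).
 assert (N0 : RtoC (2 * PI) <> 0).
 { intros E0. apply RtoC_inj in E0. lra. }
 assert (A : E 0 = Cconj (F 0)).
 { assert (K : (RtoC (2 * PI) * E 0 = RtoC (2 * PI) * Cconj (F 0))%C).
  { rewrite <- disc_mean by auto. rewrite <- (Cconj_RtoC (2 * PI)), <- Cconj_mult.
   rewrite <- disc_mean by auto. unfold CInt, Cconj; simpl. f_equal.
   - apply (@RInt_ext R_CompleteNormedModule). intros t _. now rewrite EF by apply Cmod_cis.
   - destruct (Ccont_ex_RInt (fun t => F (cis t)) 0 (2 * PI)) as [_ X]; [lra| |].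
    { intros; now apply disc_circle_Ccont. }
    rewrite <- (@RInt_opp R_CompleteNormedModule) by auto.
    apply (@RInt_ext R_CompleteNormedModule). intros t _. now rewrite EF by apply Cmod_cis. }
  replace (E 0) with (/ RtoC (2 * PI) * (RtoC (2 * PI) * E 0))%C by (field; auto).
  rewrite K. field. auto. }
 split; auto.
 set (P := fun l => ((E l + - E 0) * (F l + - F 0))%C).
 assert (HP : disc_fun P).
 { apply disc_mult; apply disc_plus; auto; apply disc_const. }
 assert (HM := disc_mean P HP).
 replace (P 0) with (RtoC 0) in HM by (unfold P; ring).
 assert (HM1 : RInt (fun t => Re (P (cis t))) 0 (2 * PI) = 0).
 { replace (RtoC (2 * PI) * 0)%C with (RtoC 0) in HM by ring. injection HM. auto. }
 assert (PE : forall l, Cmod l = 1 -> P l = RtoC (Cmod (E l - E 0)%C ^ 2)).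
 { intros l Hl. rewrite <- Cmult_Cconj. unfold P. rewrite A, EF by auto.
  unfold Cminus. rewrite <- Cconj_opp, <- Cconj_plus, Cconj_conj. ring. }
 intros l Hl. destruct (circle_cis l Hl) as [t [Ht ->]].
 assert (Z := RInt_zero_nonneg (fun t => Re (P (cis t))) 0 (2 * PI) ltac:(lra)).
 specialize (Z (fun t _ => proj1 (disc_circle_Ccont P t HP))).
 assert (Z' : Re (P (cis t)) = 0).
 { apply Z; auto. intros s _. rewrite PE by apply Cmod_cis. simpl. nra. }
 rewrite PE in Z' by apply Cmod_cis. simpl in Z'.
 assert (Z2 : Cmod (E (cis t) - E 0)%C = 0) by nra.
 apply Cminus_eq_0, Cmod_eq_0, Z2.
Qed.

(** * Series without negative powers of [l] *)

Definition sholo (h : ser) : Prop := forall N, Forall (fun t => tb t = 0%nat) (h N).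

Lemma sdlb_holo h z l : sholo h -> sval (sdlb h) z l = 0.
Proof. intros H. apply CSer_0. intros N. unfold sdlb. specialize (H N).
 induction H as [|t p Ht _ IH]; simpl; auto. rewrite pval_app, IH. unfold tdlb. rewrite Ht. simpl. ring.
Qed.

Lemma sval_hol_WD r h z l : wf r h -> Cmod z < r -> sholo h -> Cmod l < 1 ->
 WD (fun w => sval h z w) l (sval (sdl h) z l) 0.
Proof. intros Hw Hz Hh Hl eps Heps.
 destruct (sval_WDon_l r h z l Hw Hz (Rlt_le _ _ Hl) eps Heps) as [d [Hd D]].
 exists (Rmin d (1 - Cmod l)). split; [apply Rmin_glb_lt; lra|]. intros k Hk.
 rewrite <- (sdlb_holo h z l Hh). apply D.
 - eapply Rlt_le_trans; [exact Hk|apply Rmin_l].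
 - tri.
  assert (A := Rmin_r d (1 - Cmod l)). lra.
Qed.

Lemma sval_disc r h z : wf r h -> Cmod z < r -> sholo h -> disc_fun (fun l => sval h z l).
Proof. intros Hw Hz Hh. split.
 - intros l eps Hl Heps.
  destruct (sval_WDon_l r h z l Hw Hz Hl 1 ltac:(lra)) as [d [Hd D]].
  set (M := 1 + Cmod (sval (sdl h) z l) + Cmod (sval (sdlb h) z l)).
  assert (HM : 1 <= M).
  { unfold M. generalize (Cmod_ge_0 (sval (sdl h) z l)) (Cmod_ge_0 (sval (sdlb h) z l)). lra. }
  exists (Rmin d (eps / M)). split.
  { apply Rmin_glb_lt; auto. apply Rdiv_lt_0_compat; lra. }
  intros l' Hl' Hd'. set (k := (l' - l)%C) in *.
  assert (E : l' = (l + k)%C) by (unfold k; ring).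
  specialize (D k (Rlt_le_trans _ _ _ Hd' (Rmin_l _ _))). rewrite <- E in D. specialize (D Hl').
  assert (Hk : Cmod k < eps / M) by (eapply Rlt_le_trans; [exact Hd'|apply Rmin_r]).
  apply (Rmult_lt_compat_l M) in Hk; [|lra].
  replace (M * (eps / M)) with eps in Hk by (field; lra).
  eapply Rle_lt_trans; [|exact Hk].
  replace (sval h z l' - sval h z l)%C with
   ((sval h z l' - sval h z l - sval (sdl h) z l * k - sval (sdlb h) z l * Cconj k)
    + sval (sdl h) z l * k + sval (sdlb h) z l * Cconj k)%C by ring.
  tri.
  eapply Rle_trans; [apply Rplus_le_compat_r, Cmod_triangle|].
  rewrite !Cmod_mult, Cmod_Cconj. unfold M. lra.
 - intros l [_ Hl]. eexists. apply (sval_hol_WD r); auto.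
Qed.

(** [tdivl] drops the terms without [l], which [tl0] keeps; together they give the splitting into
    the value at [l = 0] and [l] times a quotient. *)
Definition tdivl t := match ta t with O => [] | S a => [Term (tc t) (tm t) (tn t) a (tb t)] end.
Definition tl0 t := match ta t with O => [t] | S _ => [] end.
Definition sdivl (h : ser) : ser := fun N => flat_map tdivl (h N).
Definition sl0 (h : ser) : ser := fun N => flat_map tl0 (h N).

Lemma pnorm_flat_map_le (f : term -> lpoly) p :
 (forall t, pnorm (f t) <= Cmod (tc t)) -> pnorm (flat_map f p) <= pnorm p.
Proof. intros H. induction p as [|t p IH]; [simpl; lra|].
 simpl flat_map. rewrite pnorm_app. apply Rplus_le_compat; auto.
Qed.

Lemma wf_flat_map_le r (f : term -> lpoly) h :
 (forall t u, In u (f t) -> (tm u + tn u = tm t + tn t)%nat /\ (ta u + tb u <= ta t + tb t)%nat) ->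
 (forall t, pnorm (f t) <= Cmod (tc t)) ->
 wf r h -> wf r (fun N => flat_map f (h N)).
Proof. intros E1 E2 [[c Hc] H]. split.
 - exists c. intros N. unfold hom. rewrite Forall_flat_map.
  eapply Forall_impl; [|apply (Hc N)]. intros t [Ht1 Ht2].
  apply Forall_forall. intros u Hu. destruct (E1 t u Hu). lia.
 - eapply radius_ge_le; [|exact H]. intros N. now apply pnorm_flat_map_le.
Qed.

Lemma pnorm_tdivl t : pnorm (tdivl t) <= Cmod (tc t).
Proof. unfold tdivl. destruct (ta t); simpl; generalize (Cmod_ge_0 (tc t)); lra. Qed.

Lemma wf_sdivl r h : wf r h -> wf r (sdivl h).
Proof. apply wf_flat_map_le; [|apply pnorm_tdivl].
 intros t u. unfold tdivl. destruct (ta t); simpl; [tauto|]. intros [<-|[]]. simpl. lia.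
Qed.

Lemma wf_sl0 r h : wf r h -> wf r (sl0 h).
Proof. apply wf_flat_map_le.
 - intros t u. unfold tl0. destruct (ta t) eqn:E; simpl; [|tauto]. intros [<-|[]]. lia.
 - intros t. unfold tl0. destruct (ta t); simpl; generalize (Cmod_ge_0 (tc t)); lra.
Qed.

Lemma sholo_sdivl h : sholo h -> sholo (sdivl h).
Proof. intros H N. unfold sdivl. rewrite Forall_flat_map. eapply Forall_impl; [|apply (H N)].
 intros t Ht. unfold tdivl. destruct (ta t); constructor; auto.
Qed.

Lemma sval_sl0 r h z l : wf r h -> Cmod z < r -> Cmod l <= 1 -> sholo h ->
 sval h z l = (sval h z 0 + l * sval (sdivl h) z l)%C.
Proof. intros Hw Hz Hl Hh.
 assert (E : sval h z l = (sval (sl0 h) z l + l * sval (sdivl h) z l)%C).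
 { unfold sval. rewrite <- CSer_scal by (apply (wf_abs_conv r (sdivl h)); auto using wf_sdivl).
  rewrite <- CSer_plus.
  - apply CSer_ext. intros N. unfold sl0, sdivl. induction (h N) as [|t p IH]; simpl; [ring|].
   rewrite !pval_app, IH. unfold tl0, tdivl, tval.
   destruct (ta t) as [|a] eqn:Ea; simpl; unfold tval; simpl; rewrite ?Ea, ?mono_S_l; ring.
  - apply (wf_abs_conv r (sl0 h)); auto using wf_sl0.
  - apply abs_conv_scal, (wf_abs_conv r (sdivl h)); auto using wf_sdivl. }
 rewrite E. f_equal. apply CSer_ext. intros N. unfold sl0. specialize (Hh N).
 induction Hh as [|t p Ht _ IH]; simpl; auto.
 rewrite pval_app, IH. unfold tl0, tval.
 destruct (ta t) as [|a] eqn:Ea; simpl; unfold tval, mono; rewrite Ht, ?Ea; simpl; ring.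
Qed.

Lemma sval_bound r h z l : wf r h -> Cmod z < r -> Cmod l <= 1 ->
 Cmod (sval h z l) <= 2 * Series (fun N => pnorm (h N) * Cmod z ^ N).
Proof. intros Hw Hz Hl. apply CSer_bound.
 - intros N. destruct Hw as [[c Hc] _]. eapply pval_bound; eauto. lra.
 - apply wf_summable with r; auto. split; auto. apply Cmod_ge_0.
Qed.

(* A disc function vanishing on the circle vanishes at 0; dividing by [l] and
  iterating shows that it is [O(|l|^n)] for every [n]. *)
Lemma sholo_zero r h z : wf r h -> Cmod z < r -> sholo h ->
 (forall l, Cmod l = 1 -> sval h z l = 0) -> forall l, Cmod l <= 1 -> sval h z l = 0.
Proof. intros Hw Hz Hh Z l Hl.
 destruct (Rle_lt_or_eq_dec _ _ Hl) as [Hl1|Hl1]; [|now apply Z].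
 set (B := 2 * Series (fun N => pnorm (h N) * Cmod z ^ N)).
 assert (It : forall n, exists k, wf r k /\ sholo k /\ (forall l, Cmod l = 1 -> sval k z l = 0) /\
   (forall N, pnorm (k N) <= pnorm (h N)) /\ sval h z l = (l ^ n * sval k z l)%C).
 { induction n as [|n IH].
  - exists h. repeat split; auto; try apply Hw; try (intros; lra). simpl; ring.
  - destruct IH as [k [K1 [K2 [K3 [K4 K5]]]]].
   assert (K0 : sval k z 0 = 0).
   { destruct (disc_conj_const _ _ (sval_disc r k z K1 Hz K2) (disc_const 0)) as [E _]; auto.
    - intros w Hw1. rewrite K3, Cconj_RtoC; auto.
    - rewrite E. apply Cconj_RtoC. }
   exists (sdivl k). split; [now apply wf_sdivl|]. split; [now apply sholo_sdivl|].
   split; [|split].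
   + intros w Hw1. assert (E := sval_sl0 r k z w K1 Hz ltac:(lra) K2).
    rewrite K3, K0 in E by auto.
    assert (Nw : w <> 0) by (intros ->; rewrite Cmod_0 in Hw1; lra).
    destruct (Ceq_dec (sval (sdivl k) z w) 0) as [|Nz]; auto.
    exfalso. apply (Cmult_neq_0 _ _ Nw Nz). rewrite E at 1. ring.
   + intros N. eapply Rle_trans; [|apply (K4 N)]. apply pnorm_flat_map_le, pnorm_tdivl.
   + rewrite K5, (sval_sl0 r k z l K1 Hz Hl K2), K0. simpl. ring. }
 apply Cmod_eq_0, Rle_antisym; [|apply Cmod_ge_0].
 assert (HB : forall n, Cmod (sval h z l) <= Cmod l ^ n * B).
 { intros n. destruct (It n) as [k [K1 [_ [_ [K4 K5]]]]]. rewrite K5, Cmod_mult, Cmod_pow.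
  apply Rmult_le_compat_l; [apply pow_le, Cmod_ge_0|].
  eapply Rle_trans; [apply (sval_bound r); auto|].
  apply Rmult_le_compat_l; [lra|]. apply Series_le.
  - split.
   + apply Rmult_le_pos; [apply pnorm_ge_0|apply pow_le, Cmod_ge_0].
   + apply Rmult_le_compat_r; [apply pow_le, Cmod_ge_0|apply K4].
  - apply wf_summable with r; auto. split; auto. apply Cmod_ge_0. }
 assert (HB0 : 0 <= B) by (generalize (HB 0%nat) (Cmod_ge_0 (sval h z l)); simpl; lra).
 apply Rnot_lt_le. intros Hp.
 destruct (pow_lt_1_zero (Cmod l)) with (y := Cmod (sval h z l) / (B + 1)) as [n Hn].
 { rewrite Rabs_pos_eq; auto. apply Cmod_ge_0. }
 { apply Rdiv_lt_0_compat; lra. }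
 specialize (Hn n (le_n n)). rewrite Rabs_pos_eq in Hn by (apply pow_le, Cmod_ge_0).
 specialize (HB n).
 apply (Rmult_lt_compat_l (B + 1)) in Hn; [|lra].
 replace ((B + 1) * (Cmod (sval h z l) / (B + 1))) with (Cmod (sval h z l)) in Hn by (field; lra).
 assert (0 <= Cmod l ^ n) by (apply pow_le, Cmod_ge_0). lra.
Qed.

(** * Matrices of series *)

Record smat := SM { s11 : ser; s12 : ser; s21 : ser; s22 : ser }.
Definition mval (S : smat) (z l : C) : M2 :=
 mat2 (sval (s11 S) z l) (sval (s12 S) z l) (sval (s21 S) z l) (sval (s22 S) z l).
Definition mwf (r : R) (S : smat) : Prop := wf r (s11 S) /\ wf r (s12 S) /\ wf r (s21 S) /\ wf r (s22 S).
Definition smap (f : ser -> ser) (S : smat) : smat := SM (f (s11 S)) (f (s12 S)) (f (s21 S)) (f (s22 S)).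
Definition smm (S T : smat) : smat :=
 SM (sadd (smul (s11 S) (s11 T)) (smul (s12 S) (s21 T)))
   (sadd (smul (s11 S) (s12 T)) (smul (s12 S) (s22 T)))
   (sadd (smul (s21 S) (s11 T)) (smul (s22 S) (s21 T)))
   (sadd (smul (s21 S) (s12 T)) (smul (s22 S) (s22 T))).
Definition smadd (S T : smat) : smat :=
 SM (sadd (s11 S) (s11 T)) (sadd (s12 S) (s12 T)) (sadd (s21 S) (s21 T)) (sadd (s22 S) (s22 T)).
Definition smadj (S : smat) : smat :=
 SM (s22 S) (sscal (RtoC (-1)) (s12 S)) (sscal (RtoC (-1)) (s21 S)) (s11 S).
Definition smdag (S : smat) : smat :=
 SM (sconj (s11 S)) (sconj (s21 S)) (sconj (s12 S)) (sconj (s22 S)).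
Definition szero : ser := fun _ => [].
Definition smcst (A : M2) : smat := SM (scst (ent A 0 0)) (scst (ent A 0 1)) (scst (ent A 1 0)) (scst (ent A 1 1)).
Definition smone : smat := SM (scst 1) szero szero (scst 1).

Lemma mwf_mono r r' S : r' <= r -> mwf r S -> mwf r' S.
Proof. intros L [H1 [H2 [H3 H4]]]. split; [|split; [|split]]; try (eapply wf_mono; eauto). Qed.
Lemma wf_szero r : wf r szero.
Proof. split; [exists 0%nat; constructor|]. exists 0. intros; simpl; lra.
Qed.
Lemma sval_szero z l : sval szero z l = 0.
Proof. apply CSer_0. reflexivity. Qed.

Lemma mwf_smap r f S : (forall h, wf r h -> wf r (f h)) -> mwf r S -> mwf r (smap f S).
Proof. intros Hf [H1 [H2 [H3 H4]]]. split; [|split; [|split]]; apply Hf; assumption. Qed.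
Lemma mwf_smm r S T : mwf r S -> mwf r T -> mwf r (smm S T).
Proof. intros [H1 [H2 [H3 H4]]] [H5 [H6 [H7 H8]]]. split; [|split; [|split]]; apply wf_sadd; apply wf_smul; assumption. Qed.
Lemma mwf_smadd r S T : mwf r S -> mwf r T -> mwf r (smadd S T).
Proof. intros [H1 [H2 [H3 H4]]] [H5 [H6 [H7 H8]]]. split; [|split; [|split]]; apply wf_sadd; assumption. Qed.
Lemma mwf_smadj r S : mwf r S -> mwf r (smadj S).
Proof. intros [H1 [H2 [H3 H4]]]. split; [|split; [|split]]; try apply wf_sscal; assumption. Qed.
Lemma mwf_smdag r S : mwf r S -> mwf r (smdag S).
Proof. intros [H1 [H2 [H3 H4]]]. split; [|split; [|split]]; apply wf_sconj; assumption. Qed.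
Lemma mwf_smcst r A : mwf r (smcst A).
Proof. split; [|split; [|split]]; apply wf_scst. Qed.
Lemma mwf_smone r : mwf r smone.
Proof. split; [|split; [|split]]; try apply wf_scst; apply wf_szero. Qed.

Lemma mval_smm r S T z l : mwf r S -> mwf r T -> Cmod z < r -> Cmod l <= 1 ->
 mval (smm S T) z l = (mval S z l ** mval T z l)%M2.
Proof. intros [H1 [H2 [H3 H4]]] [H5 [H6 [H7 H8]]] Hz Hl. unfold mval. rewrite mmul_mat2. simpl.
 rewrite !(sval_sadd r) by (try apply wf_smul; assumption).
 rewrite !(sval_smul r) by assumption. reflexivity.
Qed.
Lemma mval_smadd r S T z l : mwf r S -> mwf r T -> Cmod z < r -> Cmod l <= 1 ->
 mval (smadd S T) z l = (mval S z l + mval T z l)%M2.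
Proof. intros [H1 [H2 [H3 H4]]] [H5 [H6 [H7 H8]]] Hz Hl. unfold mval. simpl.
 rewrite !(sval_sadd r) by assumption. reflexivity.
Qed.
Lemma mval_smscal r c S z l : mwf r S -> Cmod z < r -> Cmod l <= 1 ->
 mval (smap (sscal c) S) z l = (c *: mval S z l)%M2.
Proof. intros [H1 [H2 [H3 H4]]] Hz Hl. unfold mval. simpl.
 rewrite !(sval_sscal r) by assumption. reflexivity.
Qed.
Lemma mval_smadj r S z l : mwf r S -> Cmod z < r -> Cmod l <= 1 ->
 mval (smadj S) z l = minv (mval S z l).
Proof. intros [H1 [H2 [H3 H4]]] Hz Hl. unfold mval. rewrite minv_mat2. simpl.
 rewrite !(sval_sscal r) by assumption. f_equal; ring.
Qed.
Lemma mval_smdag S z l : mval (smdag S) z l = mdagger (mval S z l).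
Proof. unfold mval. simpl. rewrite !sval_sconj. reflexivity. Qed.
Lemma mval_smcst r A z l : Cmod z < r -> Cmod l <= 1 -> mval (smcst A) z l = A.
Proof. intros Hz Hl. unfold mval, smcst. simpl. rewrite !(sval_scst _ _ _ r) by assumption.
 symmetry; apply mat2_eta.
Qed.
Lemma mval_smone r z l : Cmod z < r -> Cmod l <= 1 -> mval smone z l = mone.
Proof. intros Hz Hl. unfold mval. simpl. rewrite !(sval_scst _ _ _ r), !sval_szero by assumption.
 symmetry; apply mone_mat2.
Qed.

(** * Fixed points of operators that only depend on lower grades *)

Definition grade (S : smat) (N : nat) : lpoly * lpoly * lpoly * lpoly :=
 (s11 S N, s12 S N, s21 S N, s22 S N).
Definition agree (n : nat) (S T : smat) : Prop := forall N, (N < n)%nat -> grade S N = grade T N.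
(** Output grade [n] depends on input grades below [n] only, so iteration stabilizes grade by grade
    without any question of convergence. *)
Definition causal (F : smat -> smat) : Prop := forall n S T, agree n S T -> agree (Datatypes.S n) (F S) (F T).

Fixpoint siter (F : smat -> smat) (n : nat) : smat :=
 match n with O => SM szero szero szero szero | S k => F (siter F k) end.
(** Grade [N] is final after [N + 1] iterations and is read off there. *)
Definition sfix (F : smat -> smat) : smat :=
 SM (fun N => s11 (siter F (S N)) N) (fun N => s12 (siter F (S N)) N)
   (fun N => s21 (siter F (S N)) N) (fun N => s22 (siter F (S N)) N).

Lemma siter_agree F n k : causal F -> agree n (siter F n) (siter F (n + k)).
Proof. intros HF. induction n as [|n IH]; [intros N HN; lia|]. now apply HF.
Qed.

Lemma sfix_agree F n : causal F -> agree n (sfix F) (siter F n).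
Proof. intros HF N HN.
 replace n with (S N + (n - S N))%nat by lia. apply siter_agree; auto.
Qed.

Lemma sfix_eq F N : causal F -> grade (F (sfix F)) N = grade (sfix F) N.
Proof. intros HF. transitivity (grade (F (siter F N)) N).
 - apply (HF N); [now apply sfix_agree|lia].
 - apply (sfix_agree F (S N) HF). lia.
Qed.

Definition nrm (S : smat) (N : nat) : R :=
 pnorm (s11 S N) + pnorm (s12 S N) + pnorm (s21 S N) + pnorm (s22 S N).

Lemma nrm_ge_0 S N : 0 <= nrm S N.
Proof.
 unfold nrm. generalize (pnorm_ge_0 (s11 S N)) (pnorm_ge_0 (s12 S N)) (pnorm_ge_0 (s21 S N)) (pnorm_ge_0 (s22 S N)). lra.
Qed.

Lemma nrm_smm S T N : nrm (smm S T) N <= sum_f_R0 (fun i => nrm S i * nrm T (N - i)%nat) N.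
Proof. unfold nrm; simpl. unfold sadd. rewrite !pnorm_app, !pnorm_smul, <- !plus_sum.
 apply sum_Rle. intros i Hi.
 generalize (pnorm_ge_0 (s11 S i)) (pnorm_ge_0 (s12 S i)) (pnorm_ge_0 (s21 S i)) (pnorm_ge_0 (s22 S i)).
 generalize (pnorm_ge_0 (s11 T (N - i)%nat)) (pnorm_ge_0 (s12 T (N - i)%nat))
  (pnorm_ge_0 (s21 T (N - i)%nat)) (pnorm_ge_0 (s22 T (N - i)%nat)).
 generalize (pnorm (s11 S i)) (pnorm (s12 S i)) (pnorm (s21 S i)) (pnorm (s22 S i)).
 generalize (pnorm (s11 T (N - i)%nat)) (pnorm (s12 T (N - i)%nat))
  (pnorm (s21 T (N - i)%nat)) (pnorm (s22 T (N - i)%nat)).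
 intros a b c d p q r s Ha Hb Hc Hd Hp Hq Hr Hs.
 assert (0 <= p * c /\ 0 <= p * d /\ 0 <= q * a /\ 0 <= q * b /\ 0 <= r * c /\ 0 <= r * d /\ 0 <= s * a /\ 0 <= s * b)
  by (repeat split; apply Rmult_le_pos; assumption).
 lra.
Qed.

(** A Volterra recursion with geometric kernel has geometric growth, the ratio being enlarged by the
    factor [1 + M]. This is where the positive radius of convergence of the fixed points comes
    from. *)
Lemma discrete_gronwall (u : nat -> R) (a M K : R) : 0 <= a -> 0 <= M -> 0 < K -> u 0%nat <= a ->
 (forall n, u (S n) <= a * K ^ S n + sum_f_R0 (fun i => u i * (M * K ^ (S n - i))) n) ->
 forall n, u n <= a * ((1 + M) * K) ^ n.
Proof. intros Ha HM HK H0 H.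
 assert (G : forall n k, (k <= n)%nat -> u k <= a * ((1 + M) * K) ^ k).
 { induction n as [|n IH]; intros k Hk.
  - replace k with 0%nat by lia. simpl; lra.
  - destruct (Nat.eq_dec k (S n)) as [->|Nk]; [|apply IH; lia].
   eapply Rle_trans; [apply H|].
   assert (E : sum_f_R0 (fun i => u i * (M * K ^ (S n - i))) n
    <= sum_f_R0 (fun i => M * (1 + M) ^ i * (a * K ^ S n)) n).
   { apply sum_Rle. intros i Hi. 
    eapply Rle_trans; [apply Rmult_le_compat_r; [|apply (IH i Hi)]|].
    - apply Rmult_le_pos; auto. apply pow_le; lra.
    - rewrite Rpow_mult_distr. replace (K ^ S n) with (K ^ i * K ^ (S n - i))
      by (rewrite <- pow_add; f_equal; lia). right; ring. }
   rewrite <- scal_sum in E.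
   (* Telescoping: [M (1 + M)^i] is the difference of consecutive powers of [1 + M]. *)
   assert (T : sum_f_R0 (fun i => M * (1 + M) ^ i) n = (1 + M) ^ S n - 1).
   { clear. induction n as [|n IH]; [simpl; ring|]. rewrite tech5, IH. simpl. ring. }
   rewrite T in E. rewrite Rpow_mult_distr. lra. }
 intros n. now apply (G n).
Qed.

(* The flag records the parity in [l] of an entry: [true] on the diagonal. *)
Definition gall (Q : bool -> nat -> term -> Prop) (S : smat) (N : nat) : Prop :=
 Forall (Q true N) (s11 S N) /\ Forall (Q false N) (s12 S N) /\
 Forall (Q false N) (s21 S N) /\ Forall (Q true N) (s22 S N).

Lemma gall_grade Q S T N : grade S N = grade T N -> gall Q S N -> gall Q T N.
Proof. unfold gall. intros E; injection E; intros -> -> -> ->. auto. Qed.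

Lemma gall_impl (Q Q' : bool -> nat -> term -> Prop) S N :
 (forall b t, Q b N t -> Q' b N t) -> gall Q S N -> gall Q' S N.
Proof. intros H [H1 [H2 [H3 H4]]]. repeat split; (eapply Forall_impl; [|eassumption]); auto.
Qed.

Lemma sfix_gall F Q : causal F ->
 (forall S n, (forall N, (N < n)%nat -> gall Q S N) -> gall Q (F S) n) ->
 forall N, gall Q (sfix F) N.
Proof. intros HF H.
 assert (G : forall n N, (N < n)%nat -> gall Q (sfix F) N).
 { induction n as [|n IH]; intros N HN; [lia|].
  apply gall_grade with (F (sfix F)); [now apply sfix_eq|]. apply H. intros; apply IH; lia. }
 intros N. apply (G (S N)). lia.
Qed.

Lemma Forall_smul_le (P Q S : nat -> term -> Prop) h k N :
 (forall i, (i <= N)%nat -> Forall (P i) (h i) \/ k (N - i)%nat = []) ->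
 (forall i, (i <= N)%nat -> Forall (Q i) (k i)) ->
 (forall i j t u, P i t -> Q j u -> S (i + j)%nat (tmul t u)) ->
 Forall (S N) (smul h k N).
Proof. intros Hh Hk HS. unfold smul. rewrite Forall_flat_map. apply Forall_forall.
 intros i Hi. apply in_seq in Hi. unfold pmul. rewrite Forall_flat_map.
 destruct (Hh i) as [Hi'|E]; [lia| |].
 - eapply Forall_impl; [|apply Hi']. intros t Ht. rewrite Forall_map.
  eapply Forall_impl; [|apply (Hk (N - i)%nat); lia]. intros u Hu.
  replace N with (i + (N - i))%nat by lia. now apply HS.
 - rewrite E. apply Forall_forall. intros; constructor.
Qed.

(** The alternative in the first hypothesis serves products with an unknown whose grade [N] is not
    yet known to satisfy the invariant: that grade only meets grade 0 of [V], which is then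
    empty. *)
Lemma gall_smm (P Q S : bool -> nat -> term -> Prop) U V N :
 (forall i, (i <= N)%nat -> gall P U i \/ grade V (N - i) = ([], [], [], [])) ->
 (forall i, (i <= N)%nat -> gall Q V i) ->
 (forall b b' i j t u, P b i t -> Q b' j u -> S (Bool.eqb b b') (i + j)%nat (tmul t u)) ->
 gall S (smm U V) N.
Proof. intros HU HV HS.
 assert (K : forall b b' (h k : smat -> ser),
  (forall i, gall P U i -> Forall (P b i) (h U i)) -> (forall i, gall Q V i -> Forall (Q b' i) (k V i)) ->
  (forall i, grade V i = ([], [], [], []) -> k V i = []) ->
  Forall (S (Bool.eqb b b') N) (smul (h U) (k V) N)).
 { intros b b' h k A1 A2 A3. eapply Forall_smul_le with (P := P b) (Q := Q b').
  - intros i Hi. destruct (HU i Hi); auto.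
  - auto.
  - intros; now apply HS. }
 assert (D : forall i, (s11 V i, s12 V i, s21 V i, s22 V i) = ([], [], [], []) ->
  s11 V i = [] /\ s12 V i = [] /\ s21 V i = [] /\ s22 V i = []).
 { intros i E. injection E. auto. } repeat split; apply Forall_app; split.
 - apply (K true true s11 s11); [intros i G; apply G|intros i G; apply G|intros i G; apply (D i G)].
 - apply (K false false s12 s21); [intros i G; apply G|intros i G; apply G|intros i G; apply (D i G)].
 - apply (K true false s11 s12); [intros i G; apply G|intros i G; apply G|intros i G; apply (D i G)].
 - apply (K false true s12 s22); [intros i G; apply G|intros i G; apply G|intros i G; apply (D i G)].
 - apply (K false true s21 s11); [intros i G; apply G|intros i G; apply G|intros i G; apply (D i G)].
 - apply (K true false s22 s21); [intros i G; apply G|intros i G; apply G|intros i G; apply (D i G)].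
 - apply (K false false s21 s12); [intros i G; apply G|intros i G; apply G|intros i G; apply (D i G)].
 - apply (K true true s22 s22); [intros i G; apply G|intros i G; apply G|intros i G; apply (D i G)].
Qed.

Lemma gall_mwf r S (Q : bool -> nat -> term -> Prop) :
 (forall N, gall Q S N) ->
 (exists c, forall b N t, Q b N t -> (tm t + tn t = N /\ ta t + tb t <= N + c)%nat) ->
 radius_ge r (nrm S) -> mwf r S.
Proof. intros HQ [c Hc] Hr.
 assert (K : forall b (h : smat -> ser), (forall N, Forall (Q b N) (h S N)) ->
  (forall N, pnorm (h S N) <= nrm S N) -> wf r (h S)).
 { intros b h H1 H2. split.
  - exists c. intros N. eapply Forall_impl; [|apply H1]. apply (Hc b); auto.
  - eapply radius_ge_le; [|exact Hr]. auto. }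
 assert (B : forall N, pnorm (s11 S N) <= nrm S N /\ pnorm (s12 S N) <= nrm S N /\
  pnorm (s21 S N) <= nrm S N /\ pnorm (s22 S N) <= nrm S N).
 { intros N. unfold nrm.
  generalize (pnorm_ge_0 (s11 S N)) (pnorm_ge_0 (s12 S N)) (pnorm_ge_0 (s21 S N)) (pnorm_ge_0 (s22 S N)).
  intros; repeat split; lra. }
 split; [|split; [|split]].
 - apply (K true s11); intros N; [apply (HQ N)|apply (B N)].
 - apply (K false s12); intros N; [apply (HQ N)|apply (B N)].
 - apply (K false s21); intros N; [apply (HQ N)|apply (B N)].
 - apply (K true s22); intros N; [apply (HQ N)|apply (B N)].
Qed.

Lemma mwf_nrm r S : mwf r S -> radius_ge r (nrm S).
Proof. intros [[_ H1] [[_ H2] [[_ H3] [_ H4]]]].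
 apply (radius_ge_plus r (fun N => _ + _ + _)); auto.
 apply (radius_ge_plus r (fun N => _ + _)); auto.
 apply radius_ge_plus; auto.
Qed.

(** * The holomorphic frame [Psi' = Psi A] and its Birkhoff factorization *)

Lemma smul_ext_le h h' k N : (forall i, (i <= N)%nat -> h i = h' i) -> smul h k N = smul h' k N.
Proof. intros E.
 assert (G : forall n, (n <= N)%nat -> flat_map (fun i => pmul (h i) (k (N - i)%nat)) (seq 0 (S n)) =
  flat_map (fun i => pmul (h' i) (k (N - i)%nat)) (seq 0 (S n))).
 { induction n as [|n IH]; intros Hn.
  - simpl. rewrite E by lia. reflexivity.
  - rewrite (seq_S (S n) 0), !flat_map_app, IH by lia. simpl. rewrite E by lia. reflexivity. }
 apply G. lia.
Qed.

Lemma pmul_nil_r p : pmul p [] = [].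
Proof. induction p; auto. Qed.

(** Since [k] starts in grade 1, the product reads only grades below [N] of the left factor. *)
Lemma smul_ext_lt h h' k N : k 0%nat = [] -> (forall i, (i < N)%nat -> h i = h' i) ->
 smul h k N = smul h' k N.
Proof. intros E0 E. unfold smul. rewrite seq_S, !flat_map_app. f_equal.
 - destruct N as [|N]; [reflexivity|].
  assert (G : forall n, (n <= N)%nat ->
   flat_map (fun i => pmul (h i) (k (S N - i)%nat)) (seq 0 (S n)) =
   flat_map (fun i => pmul (h' i) (k (S N - i)%nat)) (seq 0 (S n))).
  { induction n as [|n IH]; intros Hn.
   - simpl. rewrite E by lia. reflexivity.
   - rewrite (seq_S (S n) 0), !flat_map_app, IH by lia. simpl. rewrite E by lia. reflexivity. }
  apply G. lia.
 - simpl. rewrite Nat.sub_diag, E0, !pmul_nil_r. reflexivity.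
Qed.

Lemma grade_inj S T N : grade S N = grade T N ->
 s11 S N = s11 T N /\ s12 S N = s12 T N /\ s21 S N = s21 T N /\ s22 S N = s22 T N.
Proof. intros E; injection E; auto. Qed.

Lemma sfix_unfold F : causal F -> F (sfix F) = sfix F.
Proof. intros HF. assert (E := fun N => grade_inj _ _ N (sfix_eq F N HF)).
 destruct (F (sfix F)) as [a b c d]. destruct (sfix F) as [a' b' c' d'].
 f_equal; extensionality N; apply (E N).
Qed.

(** Picard operator of [Psi' = Psi A] with [Psi = 1] at [z = 0]. *)
Definition psi_op (A S : smat) : smat := smadd smone (smap sint (smm S A)).
Definition Psi (A : smat) : smat := sfix (psi_op A).

Lemma grade_smm_le n S T A N : agree n S T -> (N < n)%nat -> grade (smm S A) N = grade (smm T A) N.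
Proof. intros H HN.
 assert (E := fun i Hi => grade_inj _ _ i (H i Hi)).
 unfold grade, smm; simpl; unfold sadd.
 rewrite (smul_ext_le (s11 S) (s11 T)), (smul_ext_le (s12 S) (s12 T)),
  (smul_ext_le (s21 S) (s21 T)), (smul_ext_le (s22 S) (s22 T)); auto;
  try (intros i Hi; apply (E i); lia).
 rewrite (smul_ext_le (s11 S) (s11 T)), (smul_ext_le (s12 S) (s12 T)),
  (smul_ext_le (s21 S) (s21 T)), (smul_ext_le (s22 S) (s22 T)); auto;
  intros i Hi; apply (E i); lia.
Qed.

Lemma psi_causal A : causal (psi_op A).
Proof. intros n S T H [|N] HN; [reflexivity|].
 destruct (grade_inj _ _ _ (grade_smm_le n S T A N H ltac:(lia))) as [E1 [E2 [E3 E4]]].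
 unfold grade, psi_op, smadd, smap. cbn [s11 s12 s21 s22]. unfold sadd, sint.
 rewrite E1, E2, E3, E4. reflexivity.
Qed.

Lemma Psi_eq A : Psi A = psi_op A (Psi A).
Proof. symmetry. apply sfix_unfold, psi_causal. Qed.

(** Invariants of the terms of grade [N], where [b] is the parity in [l] that encodes the twist.
    There is no [conj z] in the potential and in [Psi]; the degree of [Psi] in [l] is at most the
    grade; the negative factor has only positive powers of [conj l] ([QX]) and the positive factor
    only powers of [l] ([QB]). *)
Definition QA (b : bool) (N : nat) (t : term) : Prop :=
 (tm t = N /\ tn t = 0 /\ ta t + tb t <= 1)%nat /\ Nat.even (ta t + tb t) = b.
Definition QPsi (b : bool) (N : nat) (t : term) : Prop :=
 (tm t = N /\ tn t = 0 /\ ta t + tb t <= N)%nat /\ Nat.even (ta t + tb t) = b.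
Definition QK (b : bool) (N : nat) (t : term) : Prop :=
 (tm t + tn t = N /\ ta t + tb t <= N)%nat /\ Nat.even (ta t + tb t) = b.
Definition QX (b : bool) (N : nat) (t : term) : Prop := QK b N t /\ ta t = 0%nat /\ (1 <= tb t)%nat.
Definition QB (b : bool) (N : nat) (t : term) : Prop := QK b N t /\ tb t = 0%nat.

Lemma even_tmul t u b b' : Nat.even (ta t + tb t) = b -> Nat.even (ta u + tb u) = b' ->
 Nat.even (ta t + ta u + (tb t + tb u)) = Bool.eqb b b'.
Proof. intros <- <-. replace (ta t + ta u + (tb t + tb u))%nat with ((ta t + tb t) + (ta u + tb u))%nat by lia.
 apply Nat.even_add.
Qed.

Lemma gall_smadd Q S T N : gall Q S N -> gall Q T N -> gall Q (smadd S T) N.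
Proof. intros [H1 [H2 [H3 H4]]] [H5 [H6 [H7 H8]]].
 split; [|split; [|split]]; apply Forall_app; auto.
Qed.

Lemma gall_smone (Q : bool -> nat -> term -> Prop) N : Q true 0%nat (Term 1 0 0 0 0) -> gall Q smone N.
Proof. destruct N; repeat constructor; auto. Qed.

Lemma gall_Psi A : (forall N, gall QA A N) -> forall N, gall QPsi (Psi A) N.
Proof. intros HA. apply sfix_gall; [apply psi_causal|]. intros S n H. apply gall_smadd.
 - apply gall_smone. repeat split; simpl; auto.
 - destruct n as [|n]; [repeat split; constructor|].
  assert (G : gall (fun b N t => QPsi b (Datatypes.S N) (tint t)) (smm S A) n).
  { apply gall_smm with (P := QPsi) (Q := QA).
   - left. apply H. lia.
   - intros; apply HA.
   - intros b b' i j t u [[T1 [T2 T3]] T4] [[U1 [U2 U3]] U4]. split; simpl.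
    + lia.
    + apply even_tmul; auto. }
  destruct G as [G1 [G2 [G3 G4]]]. split; [|split; [|split]]; cbn; apply Forall_map; assumption.
Qed.

Lemma pnorm_sint h N : pnorm (sint h (S N)) <= pnorm (h N).
Proof. cbn [sint]. induction (h N) as [|t p IH]; [simpl; lra|].
 cbn [map pnorm fold_right tint tc]. apply Rplus_le_compat; auto.
 rewrite Cmod_mult. rewrite <- (Rmult_1_l (Cmod (tc t))) at 2.
 apply Rmult_le_compat_r; [apply Cmod_ge_0|].
 rewrite Cmod_inv, Cmod_R, Rabs_pos_eq.
 - rewrite <- Rinv_1. apply Rinv_le_contravar; [lra|]. rewrite S_INR.
  generalize (pos_INR (tm t)); lra.
 - apply pos_INR.
 - intros E. apply RtoC_inj in E. revert E. apply not_0_INR. lia.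
Qed.

Lemma radius_ge_geometric a K : 0 <= a -> 0 < K -> forall g, (forall n, g n <= a * K ^ n) ->
 radius_ge (/ K) g.
Proof. exists a. intros N.
 apply Rle_trans with (a * K ^ N * s ^ N).
 - apply Rmult_le_compat_r; [apply pow_le; lra|auto].
 - rewrite Rmult_assoc, <- Rpow_mult_distr. rewrite <- (Rmult_1_r a) at 2.
  apply Rmult_le_compat_l; auto. rewrite <- (pow1 N). apply pow_incr. split.
  + apply Rmult_le_pos; lra.
  + apply Rmult_le_reg_l with (/ K); [now apply Rinv_0_lt_compat|].
   rewrite <- Rmult_assoc, Rinv_l by lra. lra.
Qed.

Lemma radius_ge_bound r g : 0 < r -> (forall N, 0 <= g N) -> radius_ge r g ->
 exists M K, 0 <= M /\ 0 < K /\ forall N, g N <= M * K ^ N.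
Proof. intros Hr Hp H. destruct (H (r / 2)) as [M HM]; [lra|].
 exists M, (/ (r / 2)). assert (H2 : 0 < r / 2) by lra. split; [|split].
 - eapply Rle_trans; [apply (Hp 0%nat)|]. specialize (HM 0%nat). lra.
 - apply Rinv_0_lt_compat; lra.
 - intros N. apply Rmult_le_reg_r with ((r / 2) ^ N); [apply pow_lt; auto|].
  rewrite Rmult_assoc, <- Rpow_mult_distr, Rinv_l, pow1, Rmult_1_r by lra. apply HM.
Qed.

(** Integration raises the grade by one without enlarging coefficients, so the norms of the grades
    satisfy the discrete Gronwall inequality. *)
Lemma mwf_Psi r A : 0 < r -> mwf r A -> (forall N, gall QA A N) ->
 exists r', 0 < r' <= r /\ mwf r' (Psi A).
Proof. intros Hr HA HQ.
 destruct (radius_ge_bound r (nrm A) Hr (nrm_ge_0 A) (mwf_nrm _ _ HA)) as [M [K [HM [HK B]]]].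
 assert (Hrec : forall n, nrm (Psi A) (S n) <=
  2 * K ^ S n + sum_f_R0 (fun i => nrm (Psi A) i * (M / K * K ^ (S n - i))) n).
 { intros n. rewrite Psi_eq at 1.
  assert (L : nrm (psi_op A (Psi A)) (S n) <= nrm (smm (Psi A) A) n).
  { unfold nrm, psi_op, smadd, smap; cbn [s11 s12 s21 s22]. unfold sadd. rewrite !pnorm_app.
   repeat apply Rplus_le_compat; rewrite Rplus_0_l; apply pnorm_sint. }
  eapply Rle_trans; [exact L|]. eapply Rle_trans; [apply nrm_smm|].
  assert (0 <= 2 * K ^ S n) by (apply Rmult_le_pos; [lra|apply pow_le; lra]).
  match goal with |- ?a <= _ + ?b => assert (a <= b); [|lra] end.
  apply sum_Rle. intros i Hi. apply Rmult_le_compat_l; [apply nrm_ge_0|].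
  eapply Rle_trans; [apply B|]. replace (S n - i)%nat with (S (n - i)) by lia.
  right. simpl. field. lra. }
 assert (HMK : 0 <= M / K) by (apply Rdiv_le_0_compat; lra).
 assert (H0 : nrm (Psi A) 0 <= 2).
 { unfold nrm, psi_op; simpl. rewrite Cmod_1. lra. }
 assert (G := discrete_gronwall _ 2 (M / K) K ltac:(lra) HMK HK H0 Hrec).
 set (K' := (1 + M / K) * K) in *.
 assert (HK' : 0 < K') by (apply Rmult_lt_0_compat; lra).
 exists (Rmin r (/ K')). split; [split; [apply Rmin_glb_lt; auto; now apply Rinv_0_lt_compat|apply Rmin_l]|].
 apply gall_mwf with QPsi.
 - now apply gall_Psi.
 - exists 0%nat. intros b N t [H _]. lia.
 - apply radius_ge_mono with (/ K'); [apply Rmin_r|]. apply radius_ge_geometric with 2; auto; lra.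
Qed.

Lemma sdz_sadd r h k z l : wf r h -> wf r k -> Cmod z < r -> Cmod l <= 1 ->
 sval (sdz (sadd h k)) z l = (sval (sdz h) z l + sval (sdz k) z l)%C.
Proof. intros Hh Hk Hz Hl. rewrite <- (sval_sadd r) by auto using wf_sdz.
 apply sval_ext. intros N. unfold sdz, sadd. now rewrite flat_map_app.
Qed.

Lemma sdz_scst c z l : sval (sdz (scst c)) z l = 0.
Proof. apply CSer_0. reflexivity. Qed.
Lemma sdz_szero z l : sval (sdz szero) z l = 0.
Proof. apply CSer_0. reflexivity. Qed.

Lemma Psi_dz r A z l : 0 < r -> mwf r A -> mwf r (Psi A) -> Cmod z < r -> Cmod l <= 1 ->
 mval (smap sdz (Psi A)) z l = (mval (Psi A) z l ** mval A z l)%M2.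
Proof. intros Hr HA HP Hz Hl. rewrite <- (mval_smm r) by auto.
 assert (W := mwf_smm _ _ _ HP HA). destruct W as [W1 [W2 [W3 W4]]].
 assert (WI := fun h => wf_sint r h Hr).
 rewrite Psi_eq at 1. unfold mval, psi_op, smadd, smone.
 cbn [smap s11 s12 s21 s22].
 rewrite !(sdz_sadd r) by (auto using wf_scst, wf_szero).
 rewrite !sdz_sint, !sdz_scst, !sdz_szero. f_equal; ring.
Qed.

Lemma sdw_0 h z l : (forall N, Forall (fun t => tn t = 0%nat) (h N)) -> sval (sdw h) z l = 0.
Proof. intros H. apply CSer_0. intros N. unfold sdw. specialize (H (S N)).
 induction H as [|t p Ht _ IH]; simpl; auto. rewrite pval_app, IH. unfold tdw. rewrite Ht. simpl. ring.
Qed.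

Lemma Psi_dw A z l : (forall N, gall QA A N) -> mval (smap sdw (Psi A)) z l = mzero.
Proof. intros HA. assert (G := gall_Psi A HA).
 assert (I : forall b N t, QPsi b N t -> tn t = 0%nat) by (intros b N t [[_ [H _]] _]; auto).
 unfold mval; simpl. rewrite mzero_mat2.
 f_equal; apply sdw_0; intros N; destruct (G N) as [G1 [G2 [G3 G4]]];
  (eapply Forall_impl; [|eassumption]; intros t; apply I).
Qed.

Lemma Psi_0 r A l : 0 < r -> mwf r (Psi A) -> Cmod l <= 1 -> mval (Psi A) 0 l = mone.
Proof. intros Hr [H1 [H2 [H3 H4]]] Hl. unfold mval.
 rewrite !(sval_at_0 _ r) by assumption. rewrite mone_mat2.
 unfold psi_op; simpl. unfold tval, mono; simpl. f_equal; ring.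
Qed.

Lemma mval_WD r S z l : mwf r S -> Cmod z < r -> Cmod l <= 1 ->
 forall i j, WD (fun w => ent (mval S w l) i j) z
  (ent (mval (smap sdz S) z l) i j) (ent (mval (smap sdw S) z l) i j).
Proof. intros [H1 [H2 [H3 H4]]] Hz Hl i j.
 assert (K := ent_cases (fun e => WD (fun w => e (mval S w l)) z
  (e (mval (smap sdz S) z l)) (e (mval (smap sdw S) z l)))).
 apply (K); try (apply (sval_WD r); assumption). apply WD_const.
Qed.

Lemma mdet_WD (F : C -> M2) z (D E : M2) :
 (forall i j, WD (fun w => ent (F w) i j) z (ent D i j) (ent E i j)) ->
 WD (fun w => mdet (F w)) z
  (ent D 0 0 * ent (F z) 1 1 + ent (F z) 0 0 * ent D 1 1
   - (ent D 0 1 * ent (F z) 1 0 + ent (F z) 0 1 * ent D 1 0))%C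
  (ent E 0 0 * ent (F z) 1 1 + ent (F z) 0 0 * ent E 1 1
   - (ent E 0 1 * ent (F z) 1 0 + ent (F z) 0 1 * ent E 1 0))%C.
Proof. intros H.
 apply (WD_plus _ (fun w => - (ent (F w) 0 1 * ent (F w) 1 0))%C).
 - apply (WD_mult (fun w => ent (F w) 0 0) (fun w => ent (F w) 1 1)); apply H.
 - apply WD_opp. apply (WD_mult (fun w => ent (F w) 0 1) (fun w => ent (F w) 1 0)); apply H.
Qed.

(** The derivative vanishes along the segment from 0 to [z]. *)
Lemma WD_zero_const_disc (f : C -> C) r z : (forall w, Cmod w < r -> WD f w 0 0) -> Cmod z < r ->
 f z = f 0.
Proof. assert (E := RD_zero_const (fun t => f (RtoC t * z)%C) 0 1).
 cbv beta in E. replace (RtoC 0 * z)%C with (RtoC 0) in E by ring. replace (RtoC 1 * z)%C with z in E by ring.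
 symmetry. apply E. intros t. rewrite Rmin_left, Rmax_right by lra. intros Ht.
 eapply RD_eq.
 - apply (RD_WD_comp f (fun t => RtoC t * z)%C t 0 0 (1 * z + RtoC t * 0)%C).
  + apply H. rewrite Cmod_mult, Cmod_R, Rabs_pos_eq by lra.
   generalize (Cmod_ge_0 z). nra.
  + apply (RD_mult (fun t => RtoC t) (fun _ => z)); [|apply RD_const].
   split; simpl; [apply @is_derive_id|apply @is_derive_const].
 - ring.
Qed.

(** The left side is [det Y] times [trace A], the derivative of the determinant along [Y' = Y A]. *)
Lemma det_traceless (Y A : M2) : mtrace A = 0 ->
 (ent (Y ** A)%M2 0 0 * ent Y 1 1 + ent Y 0 0 * ent (Y ** A)%M2 1 1
   - (ent (Y ** A)%M2 0 1 * ent Y 1 0 + ent Y 0 1 * ent (Y ** A)%M2 1 0) = 0)%C.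
Proof. rewrite (mat2_eta Y), (mat2_eta A). generalize (ent Y 0 0) (ent Y 0 1) (ent Y 1 0) (ent Y 1 1).
 generalize (ent A 0 0) (ent A 0 1) (ent A 1 0) (ent A 1 1). intros a b c d p q r s.
 rewrite mmul_mat2, mtrace_mat2, !ent00, !ent01, !ent10, !ent11. intros E.
 transitivity ((p * s - q * r) * (a + d))%C; [ring|]. rewrite E. ring.
Qed.

Lemma Psi_det r A z l : 0 < r -> mwf r A -> mwf r (Psi A) -> (forall N, gall QA A N) ->
 (forall z l, Cmod z < r -> Cmod l <= 1 -> mtrace (mval A z l) = 0) ->
 Cmod z < r -> Cmod l <= 1 -> mdet (mval (Psi A) z l) = 1%C.
Proof. intros Hr HA HP HQ HT Hz Hl.
 rewrite (WD_zero_const_disc (fun w => mdet (mval (Psi A) w l)) r z).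
 - rewrite (Psi_0 r) by auto. rewrite mone_mat2, mdet_mat2. ring.
 - intros w Hw.
  eapply WD_eq; [apply (mdet_WD _ w _ _ (mval_WD r (Psi A) w l HP Hw Hl))| |].
  + rewrite (Psi_dz r) by auto. now apply det_traceless, HT.
  + rewrite Psi_dw by auto. rewrite mzero_mat2, ent00, ent01, ent10, ent11. ring.
 - exact Hz.
Qed.

(** * Birkhoff factorization of the Gram matrix of [Psi] *)

Definition drop0 (h : ser) : ser := fun N => match N with O => [] | S _ => h N end.

Lemma wf_drop0 r h : wf r h -> wf r (drop0 h).
Proof. intros [[c Hc] H]. split.
 - exists c. intros [|N]; [constructor|apply Hc].
 - eapply radius_ge_le; [|exact H]. intros [|N]; simpl; [apply pnorm_ge_0|lra].
Qed.

Lemma sval_drop0 r h z l : wf r h -> 0 < r -> Cmod z < r -> Cmod l <= 1 ->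
 sval h z l = (sval h 0 l + sval (drop0 h) z l)%C.
Proof. intros Hw Hr Hz Hl. rewrite (sval_at_0 h r) by auto. unfold sval.
 rewrite CSer_incr by (eapply wf_abs_conv; eauto).
 rewrite (CSer_incr (fun N => pval (drop0 h N) z l)) by (apply (wf_abs_conv r); auto using wf_drop0).
 simpl. replace (pval (h 0%nat) z l) with (pval (h 0%nat) 0 l); [ring|].
 destruct Hw as [[c Hc] _]. specialize (Hc 0%nat).
 induction Hc as [|t p [Ht _] _ IH]; simpl; auto. rewrite IH. unfold tval.
 replace (tm t) with 0%nat by lia. replace (tn t) with 0%nat by lia. unfold mono; simpl. ring.
Qed.

(** This is [P^* P - 1] when [P] is the identity at [z = 0]; the missing grade 0 is what makes the
    factorization recursive. *)
Definition Kern (P : smat) : smat := smap drop0 (smm (smdag P) P).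
(** The factor [1 + X] has to remove the negative powers of [l] from [(1 + X) (1 + K)]. As [X]
    itself consists of negative powers, this is the equation [X = - (K + X K)_-], solvable grade by
    grade because [K] has no grade 0. *)
Definition birk_op (K X : smat) : smat :=
 smap (sscal (RtoC (-1))) (smap sminus (smadd K (smm X K))).
(* [1 + Xneg P] and [Bpos P] are the factors of [P^* P = (1 + Xneg P)^-1 (Bpos P)]. *)
Definition Xneg (P : smat) : smat := sfix (birk_op (Kern P)).
Definition Bpos (P : smat) : smat :=
 smadd smone (smap splus (smadd (Kern P) (smm (Xneg P) (Kern P)))).

Lemma Kern_0 P : grade (Kern P) 0 = ([], [], [], []).
Proof. auto. Qed.

Lemma birk_causal P : causal (birk_op (Kern P)).
Proof. intros n S T H N HN.
 assert (E := fun i Hi => grade_inj _ _ i (H i Hi)).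
 unfold grade, birk_op, smap, smadd, smm, sminus, sscal, sadd. cbn [s11 s12 s21 s22].
 rewrite !(smul_ext_lt (s11 S) (s11 T)), !(smul_ext_lt (s12 S) (s12 T)),
  !(smul_ext_lt (s21 S) (s21 T)), !(smul_ext_lt (s22 S) (s22 T)); auto;
  intros i Hi; apply (E i); lia.
Qed.

Lemma Xneg_eq P : Xneg P = birk_op (Kern P) (Xneg P).
Proof. symmetry. apply sfix_unfold, birk_causal. Qed.

Lemma mwf_Kern r P : mwf r P -> mwf r (Kern P).
Proof. intros H. apply mwf_smap; [apply wf_drop0|]. apply mwf_smm; auto. now apply mwf_smdag.
Qed.

Lemma QPsi_QK b N t : QPsi b N t -> QK b N t.
Proof. intros [[H1 [H2 H3]] H4]. split; auto. lia. Qed.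

Lemma gall_smdag P N : gall QK P N -> gall QK (smdag P) N.
Proof. assert (I : forall b t, QK b N t -> QK b N (tconj t)).
 { intros b t [H1 H2]. split; simpl; [lia|]. rewrite Nat.add_comm. auto. }
 intros [H1 [H2 [H3 H4]]]. split; [|split; [|split]]; simpl; unfold sconj;
  apply Forall_map; (eapply Forall_impl; [|eassumption]; intros; now apply I).
Qed.

Lemma QK_mul b b' i j t u : QK b i t -> QK b' j u -> QK (Bool.eqb b b') (i + j) (tmul t u).
Proof. intros [H1 H2] [H3 H4]. split; simpl; [lia|]. now apply even_tmul. Qed.

Lemma gall_Kern P : (forall N, gall QK P N) -> forall N, gall QK (Kern P) N.
Proof. intros H [|N]; [repeat split; constructor|].
 apply (gall_smm QK QK QK (smdag P) P); auto using QK_mul.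
 intros; left; apply gall_smdag, H.
Qed.

Lemma even_sub_add a b : (b <= a)%nat -> Nat.even (a - b) = Nat.even (a + b).
Proof. intros H. rewrite Nat.even_sub, Nat.even_add by auto. reflexivity. Qed.

Lemma gall_flat_map (f : term -> lpoly) (Q Q' : bool -> nat -> term -> Prop) S N :
 (forall b t, Q b N t -> Forall (Q' b N) (f t)) -> gall Q S N ->
 gall Q' (smap (fun h N => flat_map f (h N)) S) N.
Proof. intros H [H1 [H2 [H3 H4]]]. split; [|split; [|split]]; simpl; apply Forall_flat_map;
  (eapply Forall_impl; [|eassumption]; intros; now apply H).
Qed.

Lemma gall_sminus S N : gall QK S N -> gall QX (smap sminus S) N.
Proof. apply gall_flat_map. intros b t [H1 H2]. apply Forall_tminus. intros k Hk ->.
 split; [split|]; simpl; try lia. rewrite even_sub_add by lia. now rewrite Nat.add_comm.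
Qed.

Lemma gall_splus S N : gall QK S N -> gall QB (smap splus S) N.
Proof. apply gall_flat_map. intros b t [H1 H2]. apply Forall_tplus. intros k Hk ->.
 split; [split|]; simpl; try lia. rewrite Nat.add_0_r, even_sub_add by lia. auto.
Qed.

Lemma gall_Xneg P : (forall N, gall QK P N) -> forall N, gall QX (Xneg P) N.
Proof. intros HP. apply sfix_gall; [apply birk_causal|]. intros S n H.
 assert (G : gall QX (smap sminus (smadd (Kern P) (smm S (Kern P)))) n).
 { apply gall_sminus, gall_smadd; [now apply gall_Kern|].
  apply (gall_smm QX QK QK).
  - intros i Hi. destruct (Nat.eq_dec i n) as [->|Ni].
   + right. rewrite Nat.sub_diag. apply Kern_0.
   + left. apply H. lia.
  - intros; now apply gall_Kern.
  - intros b b' i j t u [T _] U. now apply QK_mul. }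
 destruct G as [G1 [G2 [G3 G4]]].
 split; [|split; [|split]]; simpl; unfold sscal; apply Forall_map; assumption.
Qed.

Lemma gall_Bpos P : (forall N, gall QK P N) -> forall N, gall QB (Bpos P) N.
Proof. intros HP N. apply gall_smadd; [apply gall_smone; repeat split; auto|].
 apply gall_splus, gall_smadd; [now apply gall_Kern|].
 apply (gall_smm QX QK QK).
 - left. now apply gall_Xneg.
 - intros; now apply gall_Kern.
 - intros b b' i j t u [T _] U. now apply QK_mul.
Qed.

Lemma mwf_Xneg r P : 0 < r -> mwf r P -> (forall N, gall QK P N) ->
 exists r', 0 < r' <= r /\ mwf r' (Xneg P).
Proof. intros Hr HP HQ. set (K0 := Kern P).
 destruct (radius_ge_bound r (nrm K0) Hr (nrm_ge_0 K0) (mwf_nrm _ _ (mwf_Kern r P HP)))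
  as [M [K [HM [HK B]]]].
 assert (L : forall N, nrm (Xneg P) N <= nrm K0 N + nrm (smm (Xneg P) K0) N).
 { intros N. rewrite Xneg_eq at 1. fold K0. set (Y := smm (Xneg P) K0).
  assert (E : forall h k : ser, pnorm (sscal (RtoC (-1)) (sminus (sadd h k)) N) <= pnorm (h N) + pnorm (k N)).
  { intros h k. unfold sscal.
   apply Rle_trans with (pnorm (sminus (sadd h k) N)).
   - induction (sminus (sadd h k) N) as [|t p IH]; [simpl; lra|].
    cbn [map pnorm fold_right tscal tc]. apply Rplus_le_compat; [|exact IH].
    rewrite Cmod_mult, RtoC_m1, Cmod_opp, Cmod_1. lra.
   - eapply Rle_trans; [apply pnorm_sminus|]. unfold sadd. rewrite pnorm_app. lra. }
  unfold nrm, birk_op, smap, smadd. cbn [s11 s12 s21 s22].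
  generalize (E (s11 K0) (s11 Y)) (E (s12 K0) (s12 Y)) (E (s21 K0) (s21 Y)) (E (s22 K0) (s22 Y)). fold Y. lra. }
 assert (Z : nrm K0 0 = 0) by (unfold nrm, K0, Kern; simpl; lra).
 assert (Hrec : forall n, nrm (Xneg P) (S n) <=
  M * K ^ S n + sum_f_R0 (fun i => nrm (Xneg P) i * (M * K ^ (S n - i))) n).
 { intros n. eapply Rle_trans; [apply L|]. apply Rplus_le_compat; [apply B|].
  eapply Rle_trans; [apply nrm_smm|]. rewrite tech5, Nat.sub_diag, Z, Rmult_0_r, Rplus_0_r.
  apply sum_Rle. intros i Hi. apply Rmult_le_compat_l; [apply nrm_ge_0|]. apply B. }
 assert (H0 : nrm (Xneg P) 0 <= M).
 { eapply Rle_trans; [apply L|].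
  assert (E := nrm_smm (Xneg P) K0 0). simpl in E. rewrite Z in E. lra. }
 assert (G := discrete_gronwall _ M M K HM HM HK H0 Hrec).
 set (K' := (1 + M) * K) in *.
 assert (HK' : 0 < K') by (apply Rmult_lt_0_compat; lra).
 exists (Rmin r (/ K')). split; [split; [apply Rmin_glb_lt; auto; now apply Rinv_0_lt_compat|apply Rmin_l]|].
 apply gall_mwf with QX.
 - now apply gall_Xneg.
 - exists 0%nat. intros b N t [[H _] _]. lia.
 - apply radius_ge_mono with (/ K'); [apply Rmin_r|]. apply radius_ge_geometric with M; auto; lra.
Qed.

Lemma mwf_Bpos r P : mwf r P -> mwf r (Xneg P) -> mwf r (Bpos P).
Proof. intros H1 H2. apply mwf_smadd; [apply mwf_smone|]. apply mwf_smap; [apply wf_splus|].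
 assert (H3 := mwf_Kern _ _ H1). apply mwf_smadd; auto. now apply mwf_smm.
Qed.

Lemma mval_plus_minus r S z l : mwf r S -> Cmod z < r -> Cmod l = 1 ->
 (mval (smap splus S) z l + mval (smap sminus S) z l)%M2 = mval S z l.
Proof. intros [H1 [H2 [H3 H4]]] Hz Hl. unfold mval. rewrite madd_mat2. simpl.
 assert (E : forall h, wf r h -> (sval (splus h) z l + sval (sminus h) z l = sval h z l)%C).
 { intros h Hh. unfold sval. rewrite <- CSer_plus.
  - apply CSer_ext. intros N. now apply pval_plus_minus.
  - apply (wf_abs_conv r); auto using wf_splus. lra.
  - apply (wf_abs_conv r); auto using wf_sminus. lra. }
 rewrite !E by assumption. reflexivity.
Qed.

(** The identity lives on the circle, where [conj l = / l] makes the projections meaningful: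
    [K + X K] is the sum of its two parts, and the negative one is [- X]. *)
Lemma birkhoff r P z l : 0 < r -> mwf r P -> mwf r (Xneg P) ->
 (forall l, Cmod l <= 1 -> mval P 0 l = mone) -> Cmod z < r -> Cmod l = 1 ->
 ((mone + mval (Xneg P) z l) ** (mdagger (mval P z l) ** mval P z l))%M2 = mval (Bpos P) z l.
Proof. intros Hr HP HX H0 Hz Hl1. assert (Hl : Cmod l <= 1) by lra.
 assert (HK := mwf_Kern _ _ HP). assert (HXK := mwf_smm _ _ _ HX HK).
 assert (HS := mwf_smadd _ _ _ HK HXK).
 assert (EG : (mdagger (mval P z l) ** mval P z l)%M2 = (mone + mval (Kern P) z l)%M2).
 { assert (HD := mwf_smdag _ _ HP). assert (HG := mwf_smm _ _ _ HD HP).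
  rewrite <- mval_smdag, <- (mval_smm r) by auto.
  replace mone with (mval (smm (smdag P) P) 0 l).
  - destruct HG as [G1 [G2 [G3 G4]]]. unfold mval. rewrite madd_mat2. rewrite <- !(sval_drop0 r) by assumption. reflexivity.
  - rewrite (mval_smm r), mval_smdag, H0 by (auto; rewrite Cmod_0; auto).
   rewrite mmul_1_r. rewrite mone_mat2, mdagger_mat2, !Cconj_RtoC. reflexivity. }
 rewrite EG.
 assert (EX : mval (Xneg P) z l =
  (RtoC (-1) *: mval (smap sminus (smadd (Kern P) (smm (Xneg P) (Kern P)))) z l)%M2).
 { rewrite Xneg_eq at 1. apply (mval_smscal r); auto. apply mwf_smap; auto.
  apply wf_sminus. }
 unfold Bpos. rewrite (mval_smadd r), (mval_smone r); auto using mwf_smone.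
 2:{ apply mwf_smap; auto. apply wf_splus. }
 assert (ES := mval_plus_minus r _ z l HS Hz Hl1).
 assert (E2 := mval_smadd r _ _ z l HK HXK Hz Hl). rewrite (mval_smm r) in E2 by auto.
 rewrite E2 in ES. revert EX ES.
 generalize (mval (smap sminus (smadd (Kern P) (smm (Xneg P) (Kern P)))) z l).
 generalize (mval (smap splus (smadd (Kern P) (smm (Xneg P) (Kern P)))) z l).
 generalize (mval (Xneg P) z l) (mval (Kern P) z l). intros X K Sp Sm EX ES.
 assert (E : ((mone + X) ** (mone + K))%M2 = (mone + X + (K + X ** K))%M2).
 { rewrite (mat2_eta X), (mat2_eta K), mone_mat2, ?madd_mat2, ?mmul_mat2, ?madd_mat2. f_equal; ring. }
 rewrite E, <- ES, EX. rewrite (mat2_eta Sm), (mat2_eta Sp), mone_mat2, mscal_mat2, !madd_mat2, RtoC_m1.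
 f_equal; ring.
Qed.

(** * Smooth loops *)

Fixpoint Cn (n : nat) (f : R -> C) : Prop :=
 match n with O => True | S m => exists f', (forall t, RD f t (f' t)) /\ Cn m f' end.
Definition csmooth (f : R -> C) : Prop := forall n, Cn n f.

(** A common bound for the function and its first [n] derivatives. Derivatives are given by
    existence, so that products need no closed formula for iterated derivatives. *)
Fixpoint Cn_bd (n : nat) (M : R) (f : R -> C) : Prop :=
 (forall t, Cmod (f t) <= M) /\
 match n with O => True | S m => exists f', (forall t, RD f t (f' t)) /\ Cn_bd m M f' end.

Lemma Cn_S n f : Cn (S n) f -> Cn n f.
Proof. revert f; induction n as [|n IH]; intros f [f' [H1 H2]]; auto.
 exists f'; split; auto.
Qed.

Lemma Cn_plus n f g : Cn n f -> Cn n g -> Cn n (fun t => f t + g t)%C.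
Proof. revert f g; induction n as [|n IH]; intros f g; auto.
 intros [f' [H1 H2]] [g' [H3 H4]]. exists (fun t => f' t + g' t)%C; split; auto.
 intros t. now apply RD_plus.
Qed.

Lemma Cn_mult n f g : Cn n f -> Cn n g -> Cn n (fun t => f t * g t)%C.
Proof. revert f g; induction n as [|n IH]; intros f g; [simpl; auto|].
 intros Hf Hg. assert (Hf0 := Cn_S _ _ Hf). assert (Hg0 := Cn_S _ _ Hg).
 destruct Hf as [f' [H1 H2]], Hg as [g' [H3 H4]].
 exists (fun t => f' t * g t + f t * g' t)%C; split.
 - intros t. now apply RD_mult.
 - apply Cn_plus; apply IH; auto.
Qed.

Lemma Cn_const n c : Cn n (fun _ => c).
Proof. revert c; induction n as [|n IH]; simpl; auto.
 exists (fun _ => RtoC 0). split; auto. intros; apply RD_const.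
Qed.

Lemma csmooth_plus f g : csmooth f -> csmooth g -> csmooth (fun t => f t + g t)%C.
Proof. intros Hf Hg n. now apply Cn_plus. Qed.
Lemma csmooth_mult f g : csmooth f -> csmooth g -> csmooth (fun t => f t * g t)%C.
Proof. intros Hf Hg n. now apply Cn_mult. Qed.
Lemma csmooth_const c : csmooth (fun _ => c).
Proof. intros n. apply Cn_const. Qed.
Lemma csmooth_ext f g : (forall t, f t = g t) -> csmooth f -> csmooth g.
Proof. intros E H. replace g with f; auto. extensionality t; auto. Qed.

Lemma csmooth_sval r h z : wf r h -> Cmod z < r -> csmooth (fun t => sval h z (cis t)).
Proof. intros Hw Hz n. revert h Hw. induction n as [|n IH]; intros h Hw; simpl; auto.
 exists (fun t => sval (sdt h) z (cis t)). split.
 - intros t. now apply (sval_RD_t r).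
 - apply IH. now apply wf_sdt.
Qed.

Lemma Derive_n_S_RD (f f' : R -> R) n t : (forall s, is_derive f s (f' s)) ->
 Derive_n f (S n) t = Derive_n f' n t.
Proof. intros H. replace (S n) with (n + 1)%nat by lia. rewrite <- Derive_n_comp.
 apply Derive_n_ext. intros s. now apply is_derive_unique.
Qed.

Lemma ex_derive_n_S (f f' : R -> R) n t : (forall s, is_derive f s (f' s)) ->
 (ex_derive_n f (S n) t <-> (match n with O => True | S _ => ex_derive_n f' n t end)).
Proof. destruct n as [|n].
 - split; auto. exists (f' t). apply H.
 - split; intros [d Hd]; exists d; (eapply is_derive_ext; [|exact Hd]);
   intros s; [|symmetry]; apply (Derive_n_S_RD f f' n s H).
Qed.

Lemma RCderive_n_S (f f' : R -> C) n t : (forall s, RD f s (f' s)) ->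
 RCderive_n f (S n) t = RCderive_n f' n t.
Proof. intros H. unfold RCderive_n. f_equal; apply Derive_n_S_RD; intros s; apply (H s).
Qed.

Lemma Cn_bd_RCderive n M f t : Cn_bd n M f -> Cmod (RCderive_n f n t) <= M.
Proof. revert f; induction n as [|n IH]; intros f [H1 H2].
 - unfold RCderive_n; simpl. specialize (H1 t). destruct (f t); auto.
 - destruct H2 as [f' [H3 H4]]. rewrite (RCderive_n_S _ _ _ _ H3). now apply IH.
Qed.

Lemma csmooth_iff f : csmooth f <->
 (forall n t, ex_derive_n (fun s => Re (f s)) n t /\ ex_derive_n (fun s => Im (f s)) n t).
Proof. split.
 - intros H n. specialize (H n). revert f H. induction n as [|n IH]; intros f H t; [simpl; auto|].
  destruct H as [f' [H1 H2]].
  rewrite (ex_derive_n_S _ (fun s => Re (f' s)) n t) by (intros s; apply (H1 s)).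
  rewrite (ex_derive_n_S _ (fun s => Im (f' s)) n t) by (intros s; apply (H1 s)).
  destruct n as [|n]; [auto|]. apply (IH f' H2 t).
 - intros H n. revert f H. induction n as [|n IH]; intros f H; simpl; auto.
  assert (H1 : forall t, is_derive (fun s => Re (f s)) t (Derive (fun s => Re (f s)) t)).
  { intros t. apply Derive_correct. apply (H 1%nat t). }
  assert (H2 : forall t, is_derive (fun s => Im (f s)) t (Derive (fun s => Im (f s)) t)).
  { intros t. apply Derive_correct. apply (H 1%nat t). }
  exists (fun t => (Derive (fun s => Re (f s)) t, Derive (fun s => Im (f s)) t)). split.
  + intros t; split; [apply H1|apply H2].
  + apply IH. intros [|k] t; [simpl; auto|]. destruct (H (S (S k)) t) as [A1 A2].
   apply (ex_derive_n_S _ _ (S k) t H1) in A1. apply (ex_derive_n_S _ _ (S k) t H2) in A2.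
   split; [exact A1|exact A2].
Qed.

Lemma smooth_loop_iff (g : Loop) :
 smooth_loop g <-> forall i j, csmooth (fun s => ent (g (cis s)) i j).
Proof. split.
 - intros H i j. apply csmooth_iff. apply H.
 - intros H i j n t. apply csmooth_iff. apply H.
Qed.

Lemma csmooth_entries (g : R -> M2) :
 csmooth (fun s => ent (g s) 0 0) -> csmooth (fun s => ent (g s) 0 1) ->
 csmooth (fun s => ent (g s) 1 0) -> csmooth (fun s => ent (g s) 1 1) ->
 forall i j, csmooth (fun s => ent (g s) i j).
Proof. intros. apply (ent_cases (fun e => csmooth (fun s => e (g s)))); auto. apply csmooth_const.
Qed.

Lemma csmooth_mmul (g h : R -> M2) :
 (forall i j, csmooth (fun s => ent (g s) i j)) -> (forall i j, csmooth (fun s => ent (h s) i j)) ->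
 forall i j, csmooth (fun s => ent (g s ** h s)%M2 i j).
Proof. intros Hg Hh.
 apply csmooth_entries.
 - apply csmooth_ext with (fun s => ent (g s) 0 0 * ent (h s) 0 0 + ent (g s) 0 1 * ent (h s) 1 0)%C.
  + intros s. now rewrite mmul_eta.
  + apply csmooth_plus; apply csmooth_mult; auto.
 - apply csmooth_ext with (fun s => ent (g s) 0 0 * ent (h s) 0 1 + ent (g s) 0 1 * ent (h s) 1 1)%C.
  + intros s. now rewrite mmul_eta.
  + apply csmooth_plus; apply csmooth_mult; auto.
 - apply csmooth_ext with (fun s => ent (g s) 1 0 * ent (h s) 0 0 + ent (g s) 1 1 * ent (h s) 1 0)%C.
  + intros s. now rewrite mmul_eta.
  + apply csmooth_plus; apply csmooth_mult; auto.
 - apply csmooth_ext with (fun s => ent (g s) 1 0 * ent (h s) 0 1 + ent (g s) 1 1 * ent (h s) 1 1)%C.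
  + intros s. now rewrite mmul_eta.
  + apply csmooth_plus; apply csmooth_mult; auto.
Qed.

Lemma csmooth_mval r S z : mwf r S -> Cmod z < r -> forall i j, csmooth (fun s => ent (mval S z (cis s)) i j).
Proof. intros [H1 [H2 [H3 H4]]] Hz. apply csmooth_entries; now apply (csmooth_sval r).
Qed.

Lemma Cn_bd_mono n M M' f : M <= M' -> Cn_bd n M f -> Cn_bd n M' f.
Proof. intros L. revert f; induction n as [|n IH]; intros f [H1 H2]; split; auto.
 - intros t; specialize (H1 t); lra.
 - intros t; specialize (H1 t); lra.
 - destruct H2 as [f' [H3 H4]]. exists f'; auto.
Qed.

Lemma Cn_bd_S n M f : Cn_bd (S n) M f -> Cn_bd n M f.
Proof. revert f; induction n as [|n IH]; intros f [H0 [f' [H1 H2]]]; split; auto.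
 exists f'; split; auto.
Qed.

Lemma Cn_bd_plus n M M' f g : Cn_bd n M f -> Cn_bd n M' g -> Cn_bd n (M + M') (fun t => f t + g t)%C.
Proof. revert f g; induction n as [|n IH]; intros f g [F0 F1] [G0 G1]; split; auto.
 - intros t. tri. apply Rplus_le_compat; auto.
 - intros t. tri. apply Rplus_le_compat; auto.
 - destruct F1 as [f' [F2 F3]], G1 as [g' [G2 G3]].
  exists (fun t => f' t + g' t)%C; split; auto. intros t. now apply RD_plus.
Qed.

(** The factor [2 ^ n] counts the terms of the Leibniz formula. *)
Lemma Cn_bd_mult n M M' f g : 0 <= M -> 0 <= M' -> Cn_bd n M f -> Cn_bd n M' g ->
 Cn_bd n (2 ^ n * (M * M')) (fun t => f t * g t)%C.
Proof. intros HM HM'. assert (HMM := Rmult_le_pos _ _ HM HM').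
 revert f g; induction n as [|n IH]; intros f g Hf Hg.
 - split; auto. intros t. rewrite Cmod_mult, Rmult_1_l.
  apply Rmult_le_compat; try apply Cmod_ge_0; [apply (proj1 Hf)|apply (proj1 Hg)].
 - assert (P1 : 1 <= 2 ^ n) by (apply pow_R1_Rle; lra).
  split.
  + intros t. rewrite Cmod_mult. apply Rle_trans with (M * M').
   * apply Rmult_le_compat; try apply Cmod_ge_0; [apply (proj1 Hf)|apply (proj1 Hg)].
   * simpl. nra.
  + assert (Hf0 := Cn_bd_S _ _ _ Hf). assert (Hg0 := Cn_bd_S _ _ _ Hg).
   destruct Hf as [_ [f' [F2 F3]]], Hg as [_ [g' [G2 G3]]].
   exists (fun t => f' t * g t + f t * g' t)%C; split.
   * intros t. now apply RD_mult.
   * replace (2 ^ S n * (M * M')) with (2 ^ n * (M * M') + 2 ^ n * (M * M')) by (simpl; ring).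
    apply Cn_bd_plus; apply IH; auto.
Qed.

Lemma RD_periodic (f f' : R -> C) c : (forall t, f (t + c) = f t) -> (forall t, RD f t (f' t)) ->
 forall t, f' (t + c) = f' t.
Proof. intros Hp Hd t. apply (RD_unique f t); [|apply Hd].
 apply RD_ext with (fun s => f (s + c)); [intros; apply Hp|].
 destruct (Hd (t + c)) as [D1 D2]. split.
 - assert (K := is_derive_comp (fun s => Re (f s)) (fun s => s + c) t (Re (f' (t + c))) 1 D1).
  replace (Re (f' (t + c))) with (scal 1 (Re (f' (t + c)))) by (unfold scal; simpl; unfold mult; simpl; ring).
  apply K. auto_derive; auto.
 - assert (K := is_derive_comp (fun s => Im (f s)) (fun s => s + c) t (Im (f' (t + c))) 1 D2).
  replace (Im (f' (t + c))) with (scal 1 (Im (f' (t + c)))) by (unfold scal; simpl; unfold mult; simpl; ring).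
  apply K. auto_derive; auto.
Qed.

Lemma periodic_bounded (f : R -> C) : (forall t, f (t + 2 * PI) = f t) -> (forall t, Ccont f t) ->
 exists M, 0 <= M /\ forall t, Cmod (f t) <= M.
Proof. intros Hp Hc. assert (HPI := PI_RGT_0).
 assert (B : forall g : R -> R, (forall t, continuous g t) -> exists M, forall t, 0 <= t <= 2 * PI -> Rabs (g t) <= M).
 { intros g Hg.
  destruct (continuity_ab_maj (fun t => Rabs (g t)) 0 (2 * PI)) as [m [Hm _]]; [lra| |].
  - intros t _. apply continuity_pt_filterlim.
   apply (continuous_comp g Rabs); [apply Hg|apply continuous_Rabs].
  - exists (Rabs (g m)). exact Hm. }
 destruct (B (fun t => Re (f t)) (fun t => proj1 (Hc t))) as [M1 H1].
 destruct (B (fun t => Im (f t)) (fun t => proj2 (Hc t))) as [M2 H2].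
 assert (P0 : forall t, 0 <= t <= 2 * PI -> Cmod (f t) <= M1 + M2).
 { intros t Ht. reim. apply Rplus_le_compat; auto. }
 exists (M1 + M2). split.
 - eapply Rle_trans; [apply Cmod_ge_0|apply (P0 0)]; lra.
 - assert (Pn : forall n t, f (t + 2 * PI * INR n) = f t).
  { induction n as [|n IH]; intros t; [simpl; f_equal; ring|].
   rewrite S_INR. replace (t + 2 * PI * (INR n + 1)) with (t + 2 * PI * INR n + 2 * PI) by ring.
   now rewrite Hp. }
  intros t. set (k := (Int_part (t / (2 * PI)))).
  destruct (base_Int_part (t / (2 * PI))) as [K1 K2]. fold k in K1, K2.
  assert (E : t = t / (2 * PI) * (2 * PI)) by (field; lra).
  assert (S1 : 0 <= t - 2 * PI * IZR k <= 2 * PI).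
  { split; nra. }
  replace (f t) with (f (t - 2 * PI * IZR k)); [now apply P0|].
  destruct (Z.le_gt_cases 0 k) as [Hk|Hk].
  + rewrite <- (Pn (Z.to_nat k) (t - 2 * PI * IZR k)). f_equal.
   rewrite INR_IZR_INZ, Z2Nat.id by auto. ring.
  + rewrite <- (Pn (Z.to_nat (- k)) t). f_equal.
   rewrite INR_IZR_INZ, Z2Nat.id by lia. rewrite opp_IZR. ring.
Qed.

(** Derivatives of a periodic function are periodic, hence bounded. *)
Lemma csmooth_periodic_bd (f : R -> C) n : (forall t, f (t + 2 * PI) = f t) -> csmooth f ->
 exists M, 0 <= M /\ Cn_bd n M f.
Proof. intros Hp Hs. specialize (Hs (S n)). revert f Hp Hs.
 induction n as [|n IH]; intros f Hp [f' [H1 H2]].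
 - destruct (periodic_bounded f Hp (fun t => Ccont_RD _ _ _ (H1 t))) as [M [HM B]].
  exists M. repeat split; auto.
 - destruct (periodic_bounded f Hp (fun t => Ccont_RD _ _ _ (H1 t))) as [M [HM B]].
  destruct (IH f' (RD_periodic f f' _ Hp H1) H2) as [M' [HM' B']].
  exists (Rmax M M'). split; [eapply Rle_trans; [exact HM|apply Rmax_l]|].
  split.
  + intros t; eapply Rle_trans; [apply B|apply Rmax_l].
  + exists f'; split; auto. eapply Cn_bd_mono; [|exact B']. apply Rmax_r.
Qed.

Lemma cis_period t : cis (t + 2 * PI) = cis t.
Proof. unfold cis. rewrite <- (cos_period t 1), <- (sin_period t 1). simpl INR. f_equal; f_equal; ring. Qed.

(** Without [conj z] the antiholomorphic term of the expansion is absent, so the complex difference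
    quotient converges, uniformly in the angle. *)
Lemma sdz_quotient r h z eps : wf r h -> Cmod z < r -> (forall N, Forall (fun t => tn t = 0%nat) (h N)) ->
 0 < eps -> exists d, 0 < d /\ forall k : C, k <> RtoC 0 -> Cmod k < d -> forall t,
  Cmod ((sval h (z + k) (cis t) - sval h z (cis t)) / k - sval (sdz h) z (cis t))%C <= eps.
Proof. intros Hw Hz Hn Heps.
 destruct (sval_expand_z r h z Hw Hz) as [B [d [Hd E]]].
 exists (Rmin d (eps / (Rabs B + 1))). assert (HB := Rabs_pos B).
 split; [apply Rmin_glb_lt; auto; apply Rdiv_lt_0_compat; lra|].
 intros k Hk Hkd t.
 destruct (E (cis t) k) as [_ E1]; [rewrite Cmod_cis; lra| |].
 { eapply Rlt_le_trans; [exact Hkd|apply Rmin_l]. }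
 rewrite (sdw_0 h) in E1 by auto.
 assert (Hk0 : 0 < Cmod k) by (apply Cmod_gt_0; exact Hk).
 apply Rmult_le_reg_r with (Cmod k); auto. rewrite <- Cmod_mult.
 replace (((sval h (z + k) (cis t) - sval h z (cis t)) / k - sval (sdz h) z (cis t)) * k)%C
  with (sval h (z + k) (cis t) - sval h z (cis t) - sval (sdz h) z (cis t) * k - 0 * Cconj k)%C
  by (field; auto).
 assert (Hk2 : Cmod k < eps / (Rabs B + 1)) by (eapply Rlt_le_trans; [exact Hkd|apply Rmin_r]).
 apply (Rmult_lt_compat_l (Rabs B + 1)) in Hk2; [|lra].
 replace ((Rabs B + 1) * (eps / (Rabs B + 1))) with eps in Hk2 by (field; lra).
 assert (HB2 := Rle_abs B). nra.
Qed.

(** Derivation in the angle commutes with the difference quotient and with [sdz], so every angular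
    derivative is the same expression formed with [sdt h] in place of [h]. *)
Lemma sdz_Cn_bd r h z n eps : wf r h -> Cmod z < r -> (forall N, Forall (fun t => tn t = 0%nat) (h N)) ->
 0 < eps -> exists d, 0 < d /\ forall k : C, k <> RtoC 0 -> Cmod k < d ->
  Cn_bd n eps (fun t => (sval h (z + k) (cis t) - sval h z (cis t)) / k - sval (sdz h) z (cis t))%C.
Proof. intros Hw Hz Hn Heps. revert h Hw Hn. induction n as [|n IH]; intros h Hw Hn.
 - destruct (sdz_quotient r h z eps Hw Hz Hn Heps) as [d [Hd D]].
  exists d; split; auto. split; auto.
 - destruct (IH (sdt h)) as [d1 [Hd1 D1]].
  { now apply wf_sdt. }
  { intros N. apply Forall_map. apply Hn. }
  destruct (sval_expand_z r h z Hw Hz) as [B2 [d2 [Hd2 E2]]].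
  destruct (sdz_quotient r h z eps Hw Hz Hn Heps) as [d3 [Hd3 D3]].
  exists (Rmin d1 (Rmin d2 d3)). split; [repeat apply Rmin_glb_lt; auto|].
  assert (M1 := Rmin_l d1 (Rmin d2 d3)). assert (M2 := Rmin_r d1 (Rmin d2 d3)).
  assert (M3 := Rmin_l d2 d3). assert (M4 := Rmin_r d2 d3).
  split; [apply D3; auto; lra|].
  exists (fun t => (sval (sdt h) (z + k) (cis t) - sval (sdt h) z (cis t)) / k
   - sval (sdz (sdt h)) z (cis t))%C. split; [|apply D1; auto; lra].
  intros t. rewrite <- sdt_sdz. unfold Cminus, Cdiv.
  apply RD_plus.
  + eapply RD_ext; [|eapply RD_eq; [apply (RD_scal (/ k)%C
    (fun s => sval h (z + k) (cis s) + - sval h z (cis s))%C)|]].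
   * intros s; simpl. ring.
   * apply RD_plus; [|apply RD_opp]; apply (sval_RD_t r); auto.
    apply (E2 1%C k); [rewrite Cmod_1|]; lra.
   * ring.
  + apply RD_opp. apply (sval_RD_t r); auto. now apply wf_sdz.
Qed.

(** * The local Iwasawa decomposition *)

Definition mdisc (E : C -> M2) : Prop := forall i j, disc_fun (fun l => ent (E l) i j).

Lemma mdisc_entries (E : C -> M2) :
 disc_fun (fun l => ent (E l) 0 0) -> disc_fun (fun l => ent (E l) 0 1) ->
 disc_fun (fun l => ent (E l) 1 0) -> disc_fun (fun l => ent (E l) 1 1) -> mdisc E.
Proof. intros H0 H1 H2 H3 i j. apply (ent_cases (fun e => disc_fun (fun l => e (E l)))); auto.
 apply disc_const.
Qed.

Lemma disc_ext E F : (forall l, E l = F l) -> disc_fun E -> disc_fun F.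
Proof. intros H HE. replace F with E; auto. extensionality l; auto. Qed.

Lemma mdisc_mmul E F : mdisc E -> mdisc F -> mdisc (fun l => E l ** F l)%M2.
Proof. intros HE HF. apply mdisc_entries.
 - apply disc_ext with (fun l => ent (E l) 0 0 * ent (F l) 0 0 + ent (E l) 0 1 * ent (F l) 1 0)%C;
   [intros; now rewrite mmul_eta|apply disc_plus; apply disc_mult; auto].
 - apply disc_ext with (fun l => ent (E l) 0 0 * ent (F l) 0 1 + ent (E l) 0 1 * ent (F l) 1 1)%C;
   [intros; now rewrite mmul_eta|apply disc_plus; apply disc_mult; auto].
 - apply disc_ext with (fun l => ent (E l) 1 0 * ent (F l) 0 0 + ent (E l) 1 1 * ent (F l) 1 0)%C;
   [intros; now rewrite mmul_eta|apply disc_plus; apply disc_mult; auto].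
 - apply disc_ext with (fun l => ent (E l) 1 0 * ent (F l) 0 1 + ent (E l) 1 1 * ent (F l) 1 1)%C;
   [intros; now rewrite mmul_eta|apply disc_plus; apply disc_mult; auto].
Qed.

Lemma mdisc_minv E : mdisc E -> mdisc (fun l => minv (E l)).
Proof. intros H. apply mdisc_entries; unfold minv.
 - apply (H 1%nat 1%nat).
 - apply (disc_opp _ (H 0%nat 1%nat)).
 - apply (disc_opp _ (H 1%nat 0%nat)).
 - apply (H 0%nat 0%nat).
Qed.

Lemma madd_eta (A B : M2) : (A + B)%M2 =
 mat2 (ent A 0 0 + ent B 0 0) (ent A 0 1 + ent B 0 1) (ent A 1 0 + ent B 1 0) (ent A 1 1 + ent B 1 1).
Proof. auto. Qed.

Lemma mscal_eta c (A : M2) : (c *: A)%M2 =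
 mat2 (c * ent A 0 0) (c * ent A 0 1) (c * ent A 1 0) (c * ent A 1 1).
Proof. auto. Qed.

Lemma mdagger_eta (A : M2) : mdagger A =
 mat2 (Cconj (ent A 0 0)) (Cconj (ent A 1 0)) (Cconj (ent A 0 1)) (Cconj (ent A 1 1)).
Proof. auto. Qed.

Lemma mdisc_madd E F : mdisc E -> mdisc F -> mdisc (fun l => E l + F l)%M2.
Proof. intros HE HF. apply mdisc_entries; apply disc_plus; auto. Qed.

Lemma mdisc_mscal c E : disc_fun c -> mdisc E -> mdisc (fun l => c l *: E l)%M2.
Proof. intros Hc HE. apply mdisc_entries; apply disc_mult; auto. Qed.

Lemma mdisc_const A : mdisc (fun _ => A).
Proof. intros i j. apply disc_const. Qed.

Lemma mdisc_conj_const E F : mdisc E -> mdisc F ->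
 (forall l, Cmod l = 1 -> E l = mdagger (F l)) ->
 E (RtoC 0) = mdagger (F (RtoC 0)) /\ forall l, Cmod l = 1 -> E l = E (RtoC 0).
Proof. intros HE HF EF.
 assert (K : forall i j, (i < 2)%nat -> (j < 2)%nat ->
  ent (E (RtoC 0)) i j = Cconj (ent (F (RtoC 0)) j i) /\
  forall l, Cmod l = 1 -> ent (E l) i j = ent (E (RtoC 0)) i j).
 { intros i j Hi Hj. apply (disc_conj_const (fun l => ent (E l) i j) (fun l => ent (F l) j i)); auto.
  intros l Hl. rewrite EF by auto.
  destruct i as [|[|i]]; destruct j as [|[|j]]; try lia; reflexivity. }
 split.
 - apply M2_ext; ents; apply K; lia.
 - intros l Hl. apply M2_ext; apply K; auto.
Qed.

Lemma LambdaP_disc B : in_LambdaP B -> exists E rho, mdisc E /\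
 (forall l, Cmod l = 1 -> E l = B l) /\ (forall l, Cmod l <= 1 -> mdet (E l) = 1%C) /\
 0 < rho /\ E (RtoC 0) = mat2 (RtoC rho) 0 0 (RtoC (/ rho)).
Proof. intros [_ [E [H1 [H2 [H3 [H4 [rho [Hr H5]]]]]]]].
 exists E, rho. split; [|repeat split; auto]. split.
 - intros l eps Hl Heps. assert (He2 : 0 < eps / 2) by lra.
  destruct (H3 i j l Hl (@ball C_UniformSpace (ent (E l) i j) (eps / 2))) as [d Hd].
  { exists (mkposreal _ He2). auto. }
  exists d; split; [apply cond_pos|]. intros l' Hl' Hd'.
  replace eps with (2 * (eps / 2)) by field. apply Cmod_ball_C, Hd; auto. now apply ball_C_Cmod.
 - intros l [_ Hl]. destruct (H4 l Hl) as [D HD]. exists (ent D i j).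
  apply is_derive_WD. apply HD.
Qed.

(* The quotient [B1 B2^-1 = F1^-1 F2] is unitary on the circle and extends to
  the disc, hence it is constant. *)
Lemma iwasawa_unique g F1 B1 F2 B2 : is_iwasawa g F1 B1 -> is_iwasawa g F2 B2 ->
 forall l, Cmod l = 1 -> F1 l = F2 l.
Proof. intros [HF1 [HB1 E1]] [HF2 [HB2 E2]].
 destruct (LambdaP_disc _ HB1) as [D1 [r1 [M1 [C1 [T1 [R1 Z1]]]]]].
 destruct (LambdaP_disc _ HB2) as [D2 [r2 [M2 [C2 [T2 [R2 Z2]]]]]].
 set (T := fun l => (D1 l ** minv (D2 l))%M2).
 assert (HT : mdisc T) by exact (mdisc_mmul _ _ M1 (mdisc_minv _ M2)).
 assert (ET : forall l, Cmod l = 1 -> T l = (minv (F1 l) ** F2 l)%M2).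
 { intros l Hl. unfold T. assert (S1 := proj2 (proj2 HF1) l Hl). assert (L1 : Cmod l <= 1) by lra.
  assert (E : (F1 l ** D1 l)%M2 = (F2 l ** D2 l)%M2).
  { rewrite C1, C2 by auto. now rewrite <- E1, <- E2. }
  rewrite <- (mmul_1_l (D1 l)), <- (mmul_minv_l (F1 l)) by apply S1.
  rewrite <- (mmul_assoc (minv (F1 l))), E, <- !mmul_assoc, mmul_minv_r by auto.
  now rewrite mmul_1_r. }
 assert (U : forall l, Cmod l = 1 -> T l = mdagger (minv (T l))).
 { intros l Hl. assert (S1 := proj2 (proj2 HF1) l Hl). assert (S2 := proj2 (proj2 HF2) l Hl).
  assert (S : is_SU2 (T l)) by (rewrite ET by auto; apply is_SU2_mmul; auto; now apply is_SU2_minv).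
  apply is_SU2_dagger in S. destruct S as [_ S]. rewrite <- S. now rewrite mdagger_invol. }
 destruct (mdisc_conj_const T (fun l => minv (T l)) HT (mdisc_minv _ HT) U) as [A1 A2].
 assert (ET0 : T (RtoC 0) = mat2 (RtoC (r1 / r2)) 0 0 (RtoC (r2 / r1))).
 { unfold T. rewrite Z1, Z2, minv_mat2, mmul_mat2. unfold Rdiv. rewrite !RtoC_mult. f_equal; ring. }
 (* Unitarity of the constant value forces [r1 / r2 = r2 / r1], and both are positive. *)
 assert (E12 : r1 = r2).
 { rewrite ET0, minv_mat2, mdagger_mat2 in A1. apply mat2_inj in A1. destruct A1 as [A1 _].
  rewrite Cconj_RtoC in A1. apply RtoC_inj in A1.
  assert (K : r1 * r1 = r2 * r2).
  { replace (r1 * r1) with ((r1 / r2) * (r1 * r2)) by (field; lra). rewrite A1. field; lra. }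
  nra. }
 intros l Hl. specialize (A2 l Hl). rewrite ET0, E12 in A2.
 replace (r2 / r2) with 1 in A2 by (field; lra). rewrite <- mone_mat2, ET in A2 by auto.
 assert (S1 := proj2 (proj2 HF1) l Hl).
 apply mmul_eq_one in A2; [|rewrite mdet_minv; apply S1]. rewrite minv_invol in A2. auto.
Qed.

Definition mholo (S : smat) : Prop := sholo (s11 S) /\ sholo (s12 S) /\ sholo (s21 S) /\ sholo (s22 S).

Lemma gall_mholo Q S : (forall N, gall Q S N) -> (forall b N t, Q b N t -> tb t = 0%nat) -> mholo S.
Proof. intros H HQ. split; [|split; [|split]]; intros N; destruct (H N) as [H1 [H2 [H3 H4]]];
  (eapply Forall_impl; [|eassumption]; intros t; apply HQ).
Qed.

Lemma mholo_mdisc r S z : mwf r S -> Cmod z < r -> mholo S -> mdisc (fun l => mval S z l).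
Proof. intros [W1 [W2 [W3 W4]]] Hz [H1 [H2 [H3 H4]]].
 apply mdisc_entries; unfold mval; apply (sval_disc r); assumption.
Qed.

Lemma sval_l0 h z : (forall N, Forall (fun t => (1 <= ta t + tb t)%nat) (h N)) -> sval h z 0 = 0.
Proof. intros H. apply CSer_0. intros N. specialize (H N).
 induction H as [|t p Ht _ IH]; simpl; auto. rewrite IH. unfold tval.
 replace (mono (ta t) (tb t) 0) with (RtoC 0); [ring|].
 symmetry. apply Cmod_eq_0. rewrite Cmod_mono, Cmod_0. apply pow_i. lia.
Qed.

(** The frame of the potential and its negative Birkhoff factor converge on one common disc; all
    local statements below refer to it. *)
Definition good (r : R) (A : smat) : Prop :=
 0 < r /\ mwf r A /\ (forall N, gall QA A N) /\
 (forall z l, Cmod z < r -> Cmod l <= 1 -> mtrace (mval A z l) = 0) /\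
 mwf r (Psi A) /\ mwf r (Xneg (Psi A)).

Lemma good_exists r0 A : 0 < r0 -> mwf r0 A -> (forall N, gall QA A N) ->
 (forall z l, Cmod z < r0 -> Cmod l <= 1 -> mtrace (mval A z l) = 0) ->
 exists r, 0 < r <= r0 /\ good r A.
Proof. intros H0 HA HQ HT. destruct (mwf_Psi r0 A H0 HA HQ) as [r1 [H1 W1]].
 destruct (mwf_Xneg r1 (Psi A)) as [r2 [H2 W2]]; auto; [lra| |].
 { intros N. eapply gall_impl; [|apply gall_Psi; auto]. intros; now apply QPsi_QK. }
 exists r2. split; [lra|]. split; [lra|]. split; [apply mwf_mono with r0; auto; lra|].
 split; auto. split; [intros; apply HT; auto; lra|]. split; auto.
 apply mwf_mono with r1; auto; lra.
Qed.

Lemma good_QK r A : good r A -> forall N, gall QK (Psi A) N.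
Proof. intros [_ [_ [HQ _]]] N. eapply gall_impl; [|apply gall_Psi; auto]. intros; now apply QPsi_QK.
Qed.

Lemma good_Bpos r A : good r A -> mwf r (Bpos (Psi A)).
Proof. intros [_ [_ [_ [_ [H1 H2]]]]]. now apply mwf_Bpos. Qed.

Lemma good_Bpos_mholo r A : good r A -> mholo (Bpos (Psi A)).
Proof. intros H. apply gall_mholo with QB; [apply gall_Bpos; eapply good_QK; eauto|].
 intros b N t [_ E]; auto.
Qed.

Lemma good_det r A z l : good r A -> Cmod z < r -> Cmod l <= 1 -> mdet (mval (Psi A) z l) = 1%C.
Proof. intros [H0 [H1 [H2 [H3 [H4 H5]]]]] Hz Hl. now apply (Psi_det r). Qed.

(** The adjoint of [1 + X]. It has only nonnegative powers of [l] and equals 1 at [l = 0], so it can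
    be paired with [Bpos] in Liouville arguments. *)
Definition Xdag (P : smat) : smat := smadd smone (smdag (Xneg P)).

Lemma good_Xdag r A : good r A -> mwf r (Xdag (Psi A)) /\ mholo (Xdag (Psi A)) /\
 (forall z l, Cmod z < r -> Cmod l <= 1 -> mval (Xdag (Psi A)) z l = mdagger (mone + mval (Xneg (Psi A)) z l)%M2) /\
 (forall z, Cmod z < r -> mval (Xdag (Psi A)) z 0 = mone).
Proof. intros H. assert (HX := gall_Xneg _ (good_QK r A H)). destruct H as [H0 [_ [_ [_ [_ HW]]]]].
 assert (HD := mwf_smdag _ _ HW).
 split; [apply mwf_smadd; auto using mwf_smone|]. split; [|split].
 - set (Q := fun (b : bool) (N : nat) t => tb t = 0%nat).
  apply gall_mholo with Q; auto. intros N. apply gall_smadd; [apply gall_smone; reflexivity|].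
  destruct (HX N) as [X1 [X2 [X3 X4]]].
  split; [|split; [|split]]; simpl; unfold sconj; apply Forall_map;
   (eapply Forall_impl; [|eassumption]; intros t [_ [T _]]; exact T).
 - intros z l Hz Hl. unfold Xdag. rewrite (mval_smadd r), mval_smdag, (mval_smone r); auto using mwf_smone.
  rewrite !mdagger_eta, mone_mat2, !madd_eta, !ent00, !ent01, !ent10, !ent11.
  rewrite !Cconj_plus, !Cconj_RtoC. reflexivity.
 - intros z Hz. assert (Hl : Cmod 0 <= 1) by (rewrite Cmod_0; lra).
  unfold Xdag. rewrite (mval_smadd r), (mval_smone r); auto using mwf_smone.
  assert (Z : mval (smdag (Xneg (Psi A))) z 0 = mzero).
  { unfold mval. rewrite mzero_mat2.
   f_equal; apply sval_l0; intros N; destruct (HX N) as [X1 [X2 [X3 X4]]]; simpl; unfold sconj;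
    apply Forall_map; (eapply Forall_impl; [|eassumption]; intros t [_ [T1 T2]]; simpl; lia). }
  rewrite Z, mzero_mat2, mone_mat2, madd_mat2. f_equal; ring.
Qed.

Lemma good_birkhoff r A z l : good r A -> Cmod z < r -> Cmod l = 1 ->
 ((mone + mval (Xneg (Psi A)) z l) ** (mdagger (mval (Psi A) z l) ** mval (Psi A) z l))%M2
 = mval (Bpos (Psi A)) z l.
Proof. intros [H0 [H1 [H2 [H3 [H4 H5]]]]] Hz Hl. apply (birkhoff r); auto.
 intros; now apply (Psi_0 r).
Qed.

Lemma mdisc_mdet E : mdisc E -> disc_fun (fun l => mdet (E l)).
Proof. intros H. apply disc_plus; [|apply disc_opp]; apply disc_mult; auto.
Qed.

(** On the circle [det B] is the conjugate of the determinant of [Xdag], because [Psi] has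
    determinant 1. Both extend to the disc and the second is 1 at [l = 0], so both are 1 on the
    circle. The equation passes to the interior because [det B - 1] is a series without negative
    powers. *)
Lemma good_Bdet r A z l : good r A -> Cmod z < r -> Cmod l <= 1 -> mdet (mval (Bpos (Psi A)) z l) = 1%C.
Proof. intros H Hz. assert (HB := good_Bpos r A H). assert (HBh := good_Bpos_mholo r A H).
 destruct (good_Xdag r A H) as [W [Hh [EX E0]]].
 destruct (disc_conj_const _ _ (mdisc_mdet _ (mholo_mdisc r _ z HB Hz HBh))
  (mdisc_mdet _ (mholo_mdisc r _ z W Hz Hh))) as [A1 A2].
 { intros w Hw. rewrite <- (good_birkhoff r A z w H Hz Hw), !mdet_mmul, mdet_mdagger, (good_det r) by (auto; lra).
  rewrite EX, mdet_mdagger, Cconj_conj by (auto; lra). rewrite Cconj_RtoC. ring. }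
 rewrite E0 in A1 by auto. rewrite mone_mat2, mdet_mat2 in A1.
 replace (1 * 1 - 0 * 0)%C with (RtoC 1) in A1 by ring. rewrite Cconj_RtoC in A1.
 destruct HB as [W1 [W2 [W3 W4]]]. destruct HBh as [H1 [H2 [H3 H4]]].
 set (B := Bpos (Psi A)) in *.
 set (d := sadd (sadd (smul (s11 B) (s22 B)) (sscal (RtoC (-1)) (smul (s12 B) (s21 B)))) (scst (RtoC (-1)))).
 assert (Wm : wf r (sscal (RtoC (-1)) (smul (s12 B) (s21 B)))) by (apply wf_sscal, wf_smul; auto).
 assert (Wd0 : wf r (sadd (smul (s11 B) (s22 B)) (sscal (RtoC (-1)) (smul (s12 B) (s21 B)))))
  by (apply wf_sadd; auto; apply wf_smul; auto).
 assert (Wd : wf r d) by (apply wf_sadd; auto using wf_scst).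
 assert (Ed : forall w, Cmod w <= 1 -> sval d z w = (mdet (mval B z w) - 1)%C).
 { intros w Hw. unfold d. rewrite !(sval_sadd r), (sval_sscal r), !(sval_smul r), (sval_scst _ _ _ r);
   auto using wf_scst, wf_smul. unfold mval. rewrite mdet_mat2. ring. }
 assert (Hd : sholo d).
 { assert (Hmul : forall h k, sholo h -> sholo k -> sholo (smul h k)).
  { intros h k Kh Kk. unfold sholo. apply (Forall_smul (fun _ t => tb t = 0%nat) (fun _ t => tb t = 0%nat) (fun _ t => tb t = 0%nat)); auto.
   intros i j t u Ht Hu; simpl; lia. }
  intros N. unfold d, sadd. rewrite !Forall_app. repeat split.
  - apply Hmul; auto.
  - apply Forall_map. apply Hmul; auto.
  - destruct N; repeat constructor. }
 intros Hl. apply Cminus_eq_0. rewrite <- Ed by exact Hl.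
 apply (sholo_zero r d z Wd Hz Hd); [|exact Hl].
 intros w Hw. rewrite Ed, A2, A1 by (assumption || lra). ring.
Qed.

(** Leading diagonal entry of [B] at [l = 0]; it is [rho ^ 2] for the normalized positive factor
    [Bloc]. *)
Definition kap (A : smat) (z : C) : R := Re (sval (s11 (Bpos (Psi A))) z 0).
Definition Cmat (k : R) : M2 := mat2 (RtoC k) 0 0 (RtoC (/ k)).

Lemma Re_pos_entry (Y : M2) : mdet Y = 1%C -> exists k, 0 < k /\ ent (Y ** mdagger Y)%M2 0 0 = RtoC k.
Proof. intros HY. rewrite mmul_eta, ent00, mdagger_eta, !ent00, !ent10, !Cmult_Cconj, <- RtoC_plus.
 eexists; split; [|reflexivity].
 destruct (Req_dec (Cmod (ent Y 0 0)) 0) as [E1|N1]; [|nra].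
 destruct (Req_dec (Cmod (ent Y 0 1)) 0) as [E2|N2]; [|nra]. apply Cmod_eq_0 in E1, E2. unfold mdet in HY. rewrite E1, E2 in HY.
 replace (0 * ent Y 1 1 - 0 * ent Y 1 0)%C with (RtoC 0) in HY by ring. apply RtoC_inj in HY. lra.
Qed.

(** Write [X] for [1 + Xneg] and [P] for [Psi]. On the circle [B X^*] is the product of [X P^*] with
    its adjoint, hence hermitian and positive. Both [B] and [X^*] extend to the disc, so their
    product is constant and equals [B] at [l = 0], which is diagonal by parity. *)
Lemma Bpos_l0 r A z : good r A -> Cmod z < r ->
 0 < kap A z /\ mval (Bpos (Psi A)) z 0 = Cmat (kap A z) /\
 forall l, Cmod l = 1 ->
  (mval (Bpos (Psi A)) z l ** mdagger (mone + mval (Xneg (Psi A)) z l))%M2 = Cmat (kap A z).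
Proof. intros H Hz. assert (HB := good_Bpos r A H). assert (HBh := good_Bpos_mholo r A H).
 destruct (good_Xdag r A H) as [W [Hh [EX E0]]].
 set (E := fun l => (mval (Bpos (Psi A)) z l ** mval (Xdag (Psi A)) z l)%M2).
 assert (HE : mdisc E) by exact (mdisc_mmul _ _ (mholo_mdisc r _ z HB Hz HBh) (mholo_mdisc r _ z W Hz Hh)).
 assert (EE : forall l, Cmod l = 1 -> E l = ((mone + mval (Xneg (Psi A)) z l) ** mdagger (mval (Psi A) z l) **
  mdagger ((mone + mval (Xneg (Psi A)) z l) ** mdagger (mval (Psi A) z l)))%M2).
 { intros l Hl. unfold E. rewrite EX by (auto; lra). rewrite <- (good_birkhoff r) by auto.
  rewrite (mdagger_mmul (mone + _)%M2), mdagger_invol, !mmul_assoc. reflexivity. }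
 assert (HU : forall l, Cmod l = 1 -> E l = mdagger (E l)).
 { intros l Hl. rewrite EE by auto.
  rewrite (mdagger_mmul ((mone + mval (Xneg (Psi A)) z l) ** mdagger (mval (Psi A) z l))%M2).
  rewrite mdagger_invol. reflexivity. }
 destruct (mdisc_conj_const E E HE HE HU) as [A1 A2].
 assert (EZ : E (RtoC 0) = mval (Bpos (Psi A)) z 0).
 { unfold E. rewrite E0 by auto. apply mmul_1_r. }
 assert (Hdet := good_Bdet r A z 0 H Hz ltac:(rewrite Cmod_0; lra)).
 assert (HQ := gall_Bpos _ (good_QK r A H)).
 assert (Off : forall h : smat -> ser, (forall N, Forall (QB false N) (h (Bpos (Psi A)) N)) ->
  sval (h (Bpos (Psi A))) z 0 = 0).
 { intros h Hq. apply sval_l0. intros N. eapply Forall_impl; [|apply Hq].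
  intros t [[_ T] _]. destruct (ta t + tb t)%nat; [discriminate|lia]. }
 assert (O12 := Off s12 (fun N => proj1 (proj2 (HQ N)))).
 assert (O21 := Off s21 (fun N => proj1 (proj2 (proj2 (HQ N))))).
 (* Positivity is read off at [l = 1], the product being constant on the circle. *)
 destruct (Re_pos_entry ((mone + mval (Xneg (Psi A)) z 1) ** mdagger (mval (Psi A) z 1))%M2) as [k [Hk Ek]].
 { assert (L1 : Cmod 1 = 1) by apply Cmod_1.
  assert (F := f_equal mdet (good_birkhoff r A z 1 H Hz L1)).
  rewrite !mdet_mmul, (good_det r), (good_Bdet r) in F by (auto; lra).
  rewrite mdet_mmul. etransitivity; [|exact F]. ring. }
 rewrite <- EE in Ek by apply Cmod_1. rewrite A2, EZ in Ek by apply Cmod_1.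
 assert (Kk : kap A z = k).
 { unfold kap. unfold mval in Ek. rewrite ent00 in Ek. rewrite Ek. reflexivity. }
 assert (EC : mval (Bpos (Psi A)) z 0 = Cmat (kap A z)).
 { rewrite Kk. unfold mval in *. rewrite ent00 in Ek. unfold Cmat. rewrite O12, O21, Ek in *.
  f_equal. rewrite mdet_mat2 in Hdet.
  assert (Nk : RtoC k <> 0) by nzC.
  rewrite RtoC_inv by lra.
  replace (sval (s22 (Bpos (Psi A))) z 0)
   with (/ RtoC k * (RtoC k * sval (s22 (Bpos (Psi A))) z 0 - 0 * 0))%C by (field; auto).
  rewrite Hdet. field. auto. }
 split; [lra|]. split; auto.
 intros l Hl. rewrite <- EX by (auto; lra). rewrite <- EC, <- EZ. now apply (A2 l).
Qed.

Lemma Cmat_det k : k <> 0 -> mdet (Cmat k) = 1%C.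
Proof. intros Hk. unfold Cmat. rewrite mdet_mat2, RtoC_inv by auto. field. nzC. Qed.

Lemma minv_Cmat k : k <> 0 -> minv (Cmat k) = Cmat (/ k).
Proof. intros Hk. unfold Cmat. rewrite minv_mat2. rewrite Rinv_inv. f_equal; ring. Qed.

Lemma mdagger_Cmat k : mdagger (Cmat k) = Cmat k.
Proof. unfold Cmat. rewrite mdagger_mat2, !Cconj_RtoC. reflexivity. Qed.

Lemma Cmat_mul a b : a <> 0 -> b <> 0 -> (Cmat a ** Cmat b)%M2 = Cmat (a * b).
Proof. intros Ha Hb. unfold Cmat. rewrite mmul_mat2, Rinv_mult, !RtoC_mult. f_equal; ring.
Qed.

(** The unitary frame up to the right factor [Cmat (sqrt (kap A z))]. Unlike the normalized frame it
    stays within the class of series, since no square root of a series is taken. *)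
Definition Gs (A : smat) : smat := smm (Psi A) (smadj (Bpos (Psi A))).

Lemma mwf_Gs r A : good r A -> mwf r (Gs A).
Proof. intros H. apply mwf_smm; [apply H|]. apply mwf_smadj. now apply good_Bpos. Qed.

Lemma mval_Gs r A z l : good r A -> Cmod z < r -> Cmod l <= 1 ->
 mval (Gs A) z l = (mval (Psi A) z l ** minv (mval (Bpos (Psi A)) z l))%M2.
Proof. intros H Hz Hl. assert (HB := good_Bpos r A H). assert (HP : mwf r (Psi A)) by apply H.
 unfold Gs. rewrite (mval_smm r), (mval_smadj r); auto using mwf_smadj.
Qed.

Lemma Gs_det r A z l : good r A -> Cmod z < r -> Cmod l <= 1 -> mdet (mval (Gs A) z l) = 1%C.
Proof. intros H Hz Hl. rewrite (mval_Gs r), mdet_mmul, mdet_minv, (good_det r), (good_Bdet r) by auto. ring.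
Qed.

(** With [X = 1 + Xneg], [P = Psi] and [C = Cmat (kap A z)]: the factorization [P^* P = X^-1 B] and
    the relation [B X^* = C] give [X^-1 = B^* C^-1], and conjugating by [B^-1] leaves [C^-1]. *)
Lemma Gs_gram r A z l : good r A -> Cmod z < r -> Cmod l = 1 ->
 (mdagger (mval (Gs A) z l) ** mval (Gs A) z l)%M2 = Cmat (/ kap A z).
Proof. intros H Hz Hl. assert (Hl1 : Cmod l <= 1) by lra.
 destruct (Bpos_l0 r A z H Hz) as [Hk [_ HX]]. specialize (HX l Hl).
 assert (HB := good_birkhoff r A z l H Hz Hl).
 assert (DB := good_Bdet r A z l H Hz Hl1).
 rewrite (mval_Gs r) by auto.
 set (B := mval (Bpos (Psi A)) z l) in *. set (P := mval (Psi A) z l) in *.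
 set (X := (mone + mval (Xneg (Psi A)) z l)%M2) in *.
 assert (DX : mdet X = 1%C).
 { assert (F := f_equal mdet HB). rewrite !mdet_mmul, mdet_mdagger in F.
  unfold P in F. rewrite (good_det r), DB, Cconj_RtoC in F by auto. etransitivity; [|exact F]. ring. }
 assert (E1 : (mdagger P ** P)%M2 = (minv X ** B)%M2).
 { rewrite <- HB, mmul_assoc, mmul_minv_l, mmul_1_l by auto. reflexivity. }
 assert (E2 : X = (Cmat (kap A z) ** mdagger (minv B))%M2).
 { rewrite <- (mdagger_invol X). rewrite <- (mmul_1_l (mdagger X)), <- (mmul_minv_l B) by auto.
  rewrite <- mmul_assoc, HX, mdagger_mmul, mdagger_Cmat. reflexivity. }
 assert (E3 : minv X = (mdagger B ** Cmat (/ kap A z))%M2).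
 { rewrite E2, minv_mmul, minv_Cmat by lra. f_equal.
  rewrite (mat2_eta B), minv_mat2, !mdagger_mat2, minv_mat2, !Cconj_opp. f_equal; ring. }
 rewrite mdagger_mmul, <- mmul_assoc, (mmul_assoc (mdagger P)), E1, E3.
 rewrite <- !mmul_assoc, mmul_minv_r, mmul_1_r, mmul_assoc, <- mdagger_mmul by auto.
 rewrite mmul_minv_r by auto.
 replace (mdagger mone) with mone; [apply mmul_1_l|].
 rewrite mone_mat2, mdagger_mat2, !Cconj_RtoC. reflexivity.
Qed.

Definition Floc (A : smat) (z l : C) : M2 := (mval (Gs A) z l ** Cmat (sqrt (kap A z)))%M2.
Definition Bloc (A : smat) (z l : C) : M2 := (Cmat (/ sqrt (kap A z)) ** mval (Bpos (Psi A)) z l)%M2.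

Lemma Floc_SU2 r A z l : good r A -> Cmod z < r -> Cmod l = 1 -> is_SU2 (Floc A z l).
Proof. intros H Hz Hl. destruct (Bpos_l0 r A z H Hz) as [Hk _].
 assert (Hs := sqrt_lt_R0 _ Hk).
 assert (D : mdet (Floc A z l) = 1%C).
 { unfold Floc. rewrite mdet_mmul, (Gs_det r), Cmat_det by (auto; lra). ring. }
 apply is_SU2_dagger. split; auto.
 assert (E : (mdagger (Floc A z l) ** Floc A z l)%M2 = mone).
 { unfold Floc. rewrite mdagger_mmul, <- mmul_assoc, (mmul_assoc (mdagger (mval (Gs A) z l))).
  rewrite (Gs_gram r), mdagger_Cmat by auto.
  rewrite !Cmat_mul; try (apply Rgt_not_eq; lra); try (apply Rinv_neq_0_compat; lra).
  - replace (sqrt (kap A z) * (/ kap A z * sqrt (kap A z))) with 1.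
   + unfold Cmat. rewrite mone_mat2, Rinv_1. reflexivity.
   + replace (sqrt (kap A z) * (/ kap A z * sqrt (kap A z)))
     with (sqrt (kap A z) * sqrt (kap A z) * / kap A z) by ring.
    rewrite sqrt_sqrt by lra. field. lra.
  - apply Rmult_integral_contrapositive_currified; [apply Rinv_neq_0_compat|]; lra. }
 rewrite <- (mmul_1_r (mdagger (Floc A z l))), <- (mmul_minv_r (Floc A z l)) by auto.
 rewrite mmul_assoc, E, mmul_1_l. reflexivity.
Qed.

(** * Calculus of matrix valued functions *)

Definition WDM (F : C -> M2) (z : C) (D E : M2) : Prop :=
 forall i j, WD (fun w => ent (F w) i j) z (ent D i j) (ent E i j).
Definition RDM (F : R -> M2) (t : R) (D : M2) : Prop :=
 forall i j, RD (fun s => ent (F s) i j) t (ent D i j).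

Lemma WDM_entries F z D E :
 WD (fun w => ent (F w) 0 0) z (ent D 0 0) (ent E 0 0) ->
 WD (fun w => ent (F w) 0 1) z (ent D 0 1) (ent E 0 1) ->
 WD (fun w => ent (F w) 1 0) z (ent D 1 0) (ent E 1 0) ->
 WD (fun w => ent (F w) 1 1) z (ent D 1 1) (ent E 1 1) -> WDM F z D E.
Proof. intros H0 H1 H2 H3 i j.
 apply (ent_cases (fun e => WD (fun w => e (F w)) z (e D) (e E))); auto. apply WD_const.
Qed.

Lemma RDM_entries F t D :
 RD (fun w => ent (F w) 0 0) t (ent D 0 0) -> RD (fun w => ent (F w) 0 1) t (ent D 0 1) ->
 RD (fun w => ent (F w) 1 0) t (ent D 1 0) -> RD (fun w => ent (F w) 1 1) t (ent D 1 1) -> RDM F t D.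
Proof. intros H0 H1 H2 H3 i j.
 apply (ent_cases (fun e => RD (fun w => e (F w)) t (e D))); auto. apply RD_const.
Qed.

Lemma WDM_eq F z D E D' E' : WDM F z D E -> D = D' -> E = E' -> WDM F z D' E'.
Proof. intros; now subst. Qed.
Lemma RDM_eq F t D D' : RDM F t D -> D = D' -> RDM F t D'.
Proof. intros; now subst. Qed.

Lemma WDM_ext_loc F G z D E d : 0 < d -> (forall w, Cmod (w - z)%C < d -> F w = G w) ->
 WDM F z D E -> WDM G z D E.
Proof. intros Hd H HF i j. eapply WD_ext_loc; [exact Hd| |apply HF]. intros w Hw; simpl. now rewrite H. Qed.
Lemma RDM_ext F G t D : (forall s, F s = G s) -> RDM F t D -> RDM G t D.
Proof. intros H HF i j. eapply RD_ext; [|apply HF]. intros; simpl; now rewrite H. Qed.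
Lemma RDM_ext_loc F G t D e : 0 < e -> (forall s, Rabs (s - t) < e -> F s = G s) -> RDM F t D -> RDM G t D.
Proof. intros He H HF i j. eapply RD_ext_loc; [exact He| |apply HF]. intros; simpl; now rewrite H. Qed.

Lemma WDM_unique F z D E D' E' : WDM F z D E -> WDM F z D' E' -> D = D' /\ E = E'.
Proof. intros H H'. assert (K := fun i j => WD_unique _ _ _ _ _ _ (H i j) (H' i j)).
 split; apply M2_ext; apply K.
Qed.
Lemma RDM_unique F t D D' : RDM F t D -> RDM F t D' -> D = D'.
Proof. intros H H'. assert (K := fun i j => RD_unique _ _ _ _ (H i j) (H' i j)). apply M2_ext; apply K.
Qed.

Lemma WDM_const A z : WDM (fun _ => A) z mzero mzero.
Proof. apply WDM_entries; apply WD_const. Qed.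
Lemma RDM_const A t : RDM (fun _ => A) t mzero.
Proof. apply RDM_entries; apply RD_const. Qed.

Lemma WDM_mmul F G z D E D' E' : WDM F z D E -> WDM G z D' E' ->
 WDM (fun w => F w ** G w)%M2 z (D ** G z + F z ** D')%M2 (E ** G z + F z ** E')%M2.
Proof. intros HF HG.
 assert (K : forall i j k n m, WD (fun w => ent (F w) i j * ent (G w) j k + ent (F w) i n * ent (G w) n m)%C z
  (ent D i j * ent (G z) j k + ent (F z) i j * ent D' j k + (ent D i n * ent (G z) n m + ent (F z) i n * ent D' n m))%C
  (ent E i j * ent (G z) j k + ent (F z) i j * ent E' j k + (ent E i n * ent (G z) n m + ent (F z) i n * ent E' n m))%C).
 { intros. apply (WD_plus (fun w => ent (F w) i j * ent (G w) j k)%C).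
  - apply (WD_mult (fun w => ent (F w) i j) (fun w => ent (G w) j k)); [apply HF|apply HG].
  - apply (WD_mult (fun w => ent (F w) i n) (fun w => ent (G w) n m)); [apply HF|apply HG]. }
 rewrite !mmul_eta, !madd_mat2.
 apply WDM_entries; ents.
 - apply WD_ext with (fun w => ent (F w) 0 0 * ent (G w) 0 0 + ent (F w) 0 1 * ent (G w) 1 0)%C;
   [intros; now rewrite mmul_eta|]. eapply WD_eq; [apply (K 0%nat 0%nat 0%nat 1%nat 0%nat)|ring|ring].
 - apply WD_ext with (fun w => ent (F w) 0 0 * ent (G w) 0 1 + ent (F w) 0 1 * ent (G w) 1 1)%C;
   [intros; now rewrite mmul_eta|]. eapply WD_eq; [apply (K 0%nat 0%nat 1%nat 1%nat 1%nat)|ring|ring].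
 - apply WD_ext with (fun w => ent (F w) 1 0 * ent (G w) 0 0 + ent (F w) 1 1 * ent (G w) 1 0)%C;
   [intros; now rewrite mmul_eta|]. eapply WD_eq; [apply (K 1%nat 0%nat 0%nat 1%nat 0%nat)|ring|ring].
 - apply WD_ext with (fun w => ent (F w) 1 0 * ent (G w) 0 1 + ent (F w) 1 1 * ent (G w) 1 1)%C;
   [intros; now rewrite mmul_eta|]. eapply WD_eq; [apply (K 1%nat 0%nat 1%nat 1%nat 1%nat)|ring|ring].
Qed.

Lemma RDM_mmul F G t D D' : RDM F t D -> RDM G t D' ->
 RDM (fun w => F w ** G w)%M2 t (D ** G t + F t ** D')%M2.
Proof. intros HF HG.
 assert (K : forall i j k n m, RD (fun w => ent (F w) i j * ent (G w) j k + ent (F w) i n * ent (G w) n m)%C t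
  (ent D i j * ent (G t) j k + ent (F t) i j * ent D' j k + (ent D i n * ent (G t) n m + ent (F t) i n * ent D' n m))%C).
 { intros. apply (RD_plus (fun w => ent (F w) i j * ent (G w) j k)%C).
  - apply (RD_mult (fun w => ent (F w) i j) (fun w => ent (G w) j k)); [apply HF|apply HG].
  - apply (RD_mult (fun w => ent (F w) i n) (fun w => ent (G w) n m)); [apply HF|apply HG]. }
 rewrite !mmul_eta, !madd_mat2.
 apply RDM_entries; ents.
 - apply RD_ext with (fun w => ent (F w) 0 0 * ent (G w) 0 0 + ent (F w) 0 1 * ent (G w) 1 0)%C;
   [intros; now rewrite mmul_eta|]. eapply RD_eq; [apply (K 0%nat 0%nat 0%nat 1%nat 0%nat)|ring].
 - apply RD_ext with (fun w => ent (F w) 0 0 * ent (G w) 0 1 + ent (F w) 0 1 * ent (G w) 1 1)%C;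
   [intros; now rewrite mmul_eta|]. eapply RD_eq; [apply (K 0%nat 0%nat 1%nat 1%nat 1%nat)|ring].
 - apply RD_ext with (fun w => ent (F w) 1 0 * ent (G w) 0 0 + ent (F w) 1 1 * ent (G w) 1 0)%C;
   [intros; now rewrite mmul_eta|]. eapply RD_eq; [apply (K 1%nat 0%nat 0%nat 1%nat 0%nat)|ring].
 - apply RD_ext with (fun w => ent (F w) 1 0 * ent (G w) 0 1 + ent (F w) 1 1 * ent (G w) 1 1)%C;
   [intros; now rewrite mmul_eta|]. eapply RD_eq; [apply (K 1%nat 0%nat 1%nat 1%nat 1%nat)|ring].
Qed.

Lemma WDM_madd F G z D E D' E' : WDM F z D E -> WDM G z D' E' ->
 WDM (fun w => F w + G w)%M2 z (D + D')%M2 (E + E')%M2.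
Proof. intros HF HG. apply WDM_entries; apply WD_plus; auto. Qed.

Lemma WDM_mscal c F z D E : WDM F z D E -> WDM (fun w => c *: F w)%M2 z (c *: D)%M2 (c *: E)%M2.
Proof. intros HF. apply WDM_entries; apply WD_scal; auto. Qed.
Lemma RDM_mscal c F t D : RDM F t D -> RDM (fun w => c *: F w)%M2 t (c *: D)%M2.
Proof. intros HF. apply RDM_entries; apply RD_scal; auto. Qed.

Lemma WDM_mscal_fun c F z D E a b : WD c z a b -> WDM F z D E ->
 WDM (fun w => c w *: F w)%M2 z (a *: F z + c z *: D)%M2 (b *: F z + c z *: E)%M2.
Proof. intros Hc HF. apply WDM_entries; apply (WD_mult c); auto.
Qed.

Lemma WDM_minv F z D E : WDM F z D E -> WDM (fun w => minv (F w)) z (minv D) (minv E).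
Proof. intros HF. apply WDM_entries.
 - apply (HF 1%nat 1%nat).
 - apply (WD_opp _ _ _ _ (HF 0%nat 1%nat)).
 - apply (WD_opp _ _ _ _ (HF 1%nat 0%nat)).
 - apply (HF 0%nat 0%nat).
Qed.
Lemma RDM_minv F t D : RDM F t D -> RDM (fun w => minv (F w)) t (minv D).
Proof. intros HF. apply RDM_entries.
 - apply (HF 1%nat 1%nat).
 - apply (RD_opp _ _ _ (HF 0%nat 1%nat)).
 - apply (RD_opp _ _ _ (HF 1%nat 0%nat)).
 - apply (HF 0%nat 0%nat).
Qed.

Lemma WDM_mdagger F z D E : WDM F z D E -> WDM (fun w => mdagger (F w)) z (mdagger E) (mdagger D).
Proof. intros HF. apply WDM_entries.
 - apply (WD_conj _ _ _ _ (HF 0%nat 0%nat)).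
 - apply (WD_conj _ _ _ _ (HF 1%nat 0%nat)).
 - apply (WD_conj _ _ _ _ (HF 0%nat 1%nat)).
 - apply (WD_conj _ _ _ _ (HF 1%nat 1%nat)).
Qed.
Lemma RDM_mdagger F t D : RDM F t D -> RDM (fun w => mdagger (F w)) t (mdagger D).
Proof. intros HF. apply RDM_entries.
 - apply (RD_conj _ _ _ (HF 0%nat 0%nat)).
 - apply (RD_conj _ _ _ (HF 1%nat 0%nat)).
 - apply (RD_conj _ _ _ (HF 0%nat 1%nat)).
 - apply (RD_conj _ _ _ (HF 1%nat 1%nat)).
Qed.

Lemma is_Mderive_RDM g t D : is_Mderive g t D <-> RDM g t D.
Proof. split; intros H i j; apply is_derive_RD, H. Qed.

Lemma Mderive_RDM g t D : RDM g t D -> Mderive g t = D.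
Proof. intros H.
 assert (K : forall i j, RCderive_n (fun s => ent (g s) i j) 1 t = ent D i j).
 { intros i j. destruct (H i j) as [H1 H2].
  transitivity ((Derive (fun s => Re (ent (g s) i j)) t, Derive (fun s => Im (ent (g s) i j)) t) : C);
   [reflexivity|].
  assert (E1 : Derive (fun s : R => Re (ent (g s) i j)) t = Re (ent D i j))
   by (apply is_derive_unique; exact H1).
  assert (E2 : Derive (fun s : R => Im (ent (g s) i j)) t = Im (ent D i j))
   by (apply is_derive_unique; exact H2).
  rewrite E1, E2. destruct (ent D i j); reflexivity. }
 unfold Mderive. apply M2_ext; unfold ent at 1; rewrite coeff_mat_bij by lia; apply K.
Qed.

Lemma mval_WDM r S z l : mwf r S -> Cmod z < r -> Cmod l <= 1 ->
 WDM (fun w => mval S w l) z (mval (smap sdz S) z l) (mval (smap sdw S) z l).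
Proof. intros; intros i j. now apply (mval_WD r). Qed.

Lemma mval_RDM_t r S z t : mwf r S -> Cmod z < r ->
 RDM (fun s => mval S z (cis s)) t (mval (smap sdt S) z (cis t)).
Proof. intros [H1 [H2 [H3 H4]]] Hz. apply RDM_entries; unfold mval; apply (sval_RD_t r); assumption.
Qed.

Lemma mmul_madd_l (A B D : M2) : ((A + B) ** D)%M2 = (A ** D + B ** D)%M2.
Proof. m2. Qed.
Lemma mmul_madd_r (A B D : M2) : (D ** (A + B))%M2 = (D ** A + D ** B)%M2.
Proof. m2. Qed.
Lemma mmul_mscal_l c (A D : M2) : ((c *: A) ** D)%M2 = (c *: (A ** D))%M2.
Proof. m2. Qed.
Lemma mmul_mscal_r c (A D : M2) : (D ** (c *: A))%M2 = (c *: (D ** A))%M2.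
Proof. m2. Qed.
Lemma mscal_mscal c d (A : M2) : (c *: (d *: A))%M2 = ((c * d)%C *: A)%M2.
Proof. m2. Qed.
Lemma mscal_madd c (A B : M2) : (c *: (A + B))%M2 = (c *: A + c *: B)%M2.
Proof. m2. Qed.
Lemma mmul_0_l (A : M2) : (mzero ** A)%M2 = mzero.
Proof. m2. Qed.
Lemma mmul_0_r (A : M2) : (A ** mzero)%M2 = mzero.
Proof. m2. Qed.
Lemma madd_0_l (A : M2) : (mzero + A)%M2 = A.
Proof. m2. Qed.
Lemma madd_0_r (A : M2) : (A + mzero)%M2 = A.
Proof. m2. Qed.
Lemma mscal_1 (A : M2) : (RtoC 1 *: A)%M2 = A.
Proof. m2. Qed.

Lemma mscal_0 (A : M2) : (RtoC 0 *: A)%M2 = mzero.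
Proof. m2. Qed.
Lemma mdagger_mscal c (A : M2) : mdagger (c *: A)%M2 = (Cconj c *: mdagger A)%M2.
Proof. rewrite !mdagger_eta, !mscal_eta, ?ent00, ?ent01, ?ent10, ?ent11, !Cconj_mult. reflexivity. Qed.
Lemma mdagger_minv (A : M2) : mdagger (minv A) = minv (mdagger A).
Proof. auto. Qed.

Lemma mscal_cancel w (Q N : M2) : (w * Cconj w)%C = 1 ->
 (w *: (Q + RtoC (-1) *: (Cconj w *: N + Q)))%M2 = (RtoC (-1) *: N)%M2.
Proof. intros E. rewrite !mscal_eta, !madd_eta, ?ent00, ?ent01, ?ent10, ?ent11, RtoC_m1.
 assert (Sh : forall x y : C, (w * (x + - (1) * (Cconj w * y + x)) = - (1) * y)%C).
 { intros x y. replace (w * (x + - (1) * (Cconj w * y + x)))%C with (- (w * Cconj w) * y)%C by ring.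
  rewrite E. ring. }
 rewrite !Sh. reflexivity.
Qed.

(** * Parity in [l] and membership in the loop groups *)

Lemma mono_opp a b l : mono a b (- l) = (if Nat.even (a + b) then mono a b l else - mono a b l)%C.
Proof. unfold mono. rewrite Cconj_opp.
 assert (K : forall (n : nat) (x : C), ((- x) ^ n)%C = (if Nat.even n then x ^ n else - (x ^ n))%C).
 { induction n as [|n IH]; intros x; [reflexivity|].
  rewrite Nat.even_succ, <- Nat.negb_even. simpl. rewrite IH. destruct (Nat.even n); simpl; ring. }
 rewrite !K, Nat.even_add. destruct (Nat.even a), (Nat.even b); simpl; ring.
Qed.

Lemma sval_parity b h z l : (forall N, Forall (fun t => Nat.even (ta t + tb t) = b) (h N)) ->
 sval h z (- l) = (if b then sval h z l else - sval h z l)%C.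
Proof. intros H.
 assert (K : forall N, pval (h N) z (- l) = (if b then pval (h N) z l else - pval (h N) z l)%C).
 { intros N. specialize (H N). induction H as [|t p Ht _ IH]; simpl; [destruct b; ring|].
  rewrite IH. unfold tval. rewrite mono_opp, Ht. destruct b; ring. }
 unfold sval. destruct b; [now apply CSer_ext|]. rewrite <- CSer_opp. now apply CSer_ext.
Qed.

Lemma gall_twisted Q S z : (forall N, gall Q S N) ->
 (forall b N t, Q b N t -> Nat.even (ta t + tb t) = b) -> twisted (fun l => mval S z l).
Proof. intros H HQ l _.
 repeat split.
 - apply (sval_parity true). intros N. eapply Forall_impl; [|apply (H N)]. intros; eapply HQ; eauto.
 - apply (sval_parity true). intros N. eapply Forall_impl; [|apply (H N)]. intros; eapply HQ; eauto.
 - apply (sval_parity false). intros N. eapply Forall_impl; [|apply (H N)]. intros; eapply HQ; eauto.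
 - apply (sval_parity false). intros N. eapply Forall_impl; [|apply (H N)]. intros; eapply HQ; eauto.
Qed.

Lemma twisted_mmul (F G : Loop) : twisted F -> twisted G -> twisted (fun l => F l ** G l)%M2.
Proof. intros HF HG l Hl. destruct (HF l Hl) as [F1 [F2 [F3 F4]]]. destruct (HG l Hl) as [G1 [G2 [G3 G4]]].
 rewrite !mmul_eta, !ent00, !ent01, !ent10, !ent11, F1, F2, F3, F4, G1, G2, G3, G4.
 repeat split; ring.
Qed.
Lemma twisted_minv (F : Loop) : twisted F -> twisted (fun l => minv (F l)).
Proof. intros HF l Hl. destruct (HF l Hl) as [F1 [F2 [F3 F4]]]. unfold minv.
 rewrite !ent00, !ent01, !ent10, !ent11, F1, F2, F3, F4. repeat split; ring.
Qed.
Lemma twisted_Cmat k : twisted (fun _ => Cmat k).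
Proof. intros l Hl. unfold Cmat. rewrite !ent00, !ent01, !ent10, !ent11. repeat split; ring. Qed.

Lemma QB_even b N t : QB b N t -> Nat.even (ta t + tb t) = b.
Proof. intros [[_ H] _]; auto. Qed.
Lemma QPsi_even b N t : QPsi b N t -> Nat.even (ta t + tb t) = b.
Proof. intros [_ H]; auto. Qed.

Lemma Psi_LambdaGC r A z : good r A -> Cmod z < r -> in_LambdaGC (fun l => mval (Psi A) z l).
Proof. split; [|split].
 - apply smooth_loop_iff. apply (csmooth_mval r); auto. apply H.
 - apply gall_twisted with QPsi; [apply gall_Psi; apply H|apply QPsi_even].
 - intros l Hl. apply (good_det r); auto. unfold on_circle in Hl. lra.
Qed.

Lemma Bpos_loop r A z : good r A -> Cmod z < r ->
 smooth_loop (fun l => mval (Bpos (Psi A)) z l) /\ twisted (fun l => mval (Bpos (Psi A)) z l).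
Proof. split.
 - apply smooth_loop_iff. apply (csmooth_mval r); auto. now apply good_Bpos.
 - apply gall_twisted with QB; [apply gall_Bpos; eapply good_QK; eauto|apply QB_even].
Qed.

Lemma smooth_loop_mmul (F G : Loop) : smooth_loop F -> smooth_loop G -> smooth_loop (fun l => F l ** G l)%M2.
Proof. rewrite !smooth_loop_iff. now apply csmooth_mmul. Qed.
Lemma smooth_loop_const A : smooth_loop (fun _ => A).
Proof. rewrite smooth_loop_iff. intros. apply csmooth_const. Qed.

Lemma Bloc_LambdaP r A z : good r A -> Cmod z < r -> in_LambdaP (Bloc A z).
Proof. intros H Hz. destruct (Bpos_l0 r A z H Hz) as [Hk [EC _]]. assert (Hs := sqrt_lt_R0 _ Hk).
 destruct (Bpos_loop r A z H Hz) as [SB TB].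
 assert (HB := good_Bpos r A H). assert (HBh := good_Bpos_mholo r A H).
 assert (Nz : / sqrt (kap A z) <> 0) by (apply Rinv_neq_0_compat; lra).
 assert (DB : forall l, Cmod l <= 1 -> is_SL2 (Bloc A z l)).
 { intros l Hl. unfold is_SL2, Bloc. rewrite mdet_mmul, (good_Bdet r), Cmat_det by auto. ring. }
 assert (MD : mdisc (Bloc A z)).
 { exact (mdisc_mmul (fun _ => Cmat _) _ (mdisc_const _) (mholo_mdisc r _ z HB Hz HBh)). }
 split; [split; [|split]|].
 - exact (smooth_loop_mmul _ _ (smooth_loop_const _) SB).
 - exact (twisted_mmul _ _ (twisted_Cmat _) TB).
 - intros l Hl. apply DB. unfold on_circle in Hl. lra.
 - exists (Bloc A z). split; auto. split; auto. split; [|split].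
  + intros i j l Hl P [e He]. destruct (proj1 (MD i j) l e Hl (cond_pos e)) as [d [Hd D]].
   assert (Hd2 : 0 < d / 2) by lra. exists (mkposreal _ Hd2). intros w Hw Hw1.
   apply He, ball_C_Cmod, D; auto. apply Cmod_ball_C in Hw. simpl in Hw. lra.
  + intros l Hl. exists (Cmat (/ sqrt (kap A z)) ** mval (smap sdl (Bpos (Psi A))) z l)%M2.
   assert (W : WDM (Bloc A z) l (Cmat (/ sqrt (kap A z)) ** mval (smap sdl (Bpos (Psi A))) z l)%M2 mzero).
   { eapply WDM_eq.
    - apply (WDM_mmul (fun _ => Cmat (/ sqrt (kap A z))) (fun l => mval (Bpos (Psi A)) z l) l
      mzero mzero (mval (smap sdl (Bpos (Psi A))) z l) mzero (WDM_const _ _)).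
     destruct HB as [W1 [W2 [W3 W4]]]. destruct HBh as [H1 [H2 [H3 H4]]]. apply WDM_entries; unfold mval; ents;
      apply (sval_hol_WD r); auto.
    - rewrite mmul_0_l, madd_0_l. reflexivity.
    - rewrite mmul_0_l, mmul_0_r, madd_0_l. reflexivity. }
   intros i j. apply is_derive_WD. eapply WD_eq; [apply (W i j)|reflexivity|].
   apply (ent_cases (fun e => e (mat2 0 0 0 0) = RtoC 0)); reflexivity.
  (* At [l = 0] the factor [B] is [Cmat (kap A z)], and [Bloc] divides it by
     [Cmat (sqrt (kap A z))]. *)
  + exists (sqrt (kap A z)). split; auto. unfold Bloc. rewrite EC, Cmat_mul by (auto; lra). replace (/ sqrt (kap A z) * kap A z) with (sqrt (kap A z)); [reflexivity|].
   rewrite <- (sqrt_sqrt (kap A z)) at 3 by lra. field. lra.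
Qed.

(** A unitary loop on the left is absorbed by the unitary factor, so the value of the frame at the
    centre of a disc never has to be factorized. *)
Lemma local_iwasawa r A z (U : Loop) : good r A -> Cmod z < r -> in_LambdaG U ->
 is_iwasawa (fun l => U l ** mval (Psi A) z l)%M2 (fun l => U l ** Floc A z l)%M2 (Bloc A z).
Proof. intros H Hz [U1 [U2 U3]]. destruct (Bpos_l0 r A z H Hz) as [Hk [EC _]].
 assert (Hs := sqrt_lt_R0 _ Hk).
 destruct (Bpos_loop r A z H Hz) as [SB TB]. destruct (Psi_LambdaGC r A z H Hz) as [SP [TP DP]].
 assert (EF : forall l, Cmod l <= 1 -> Floc A z l =
  (mval (Psi A) z l ** minv (mval (Bpos (Psi A)) z l) ** Cmat (sqrt (kap A z)))%M2).
 { intros l Hl. unfold Floc. now rewrite (mval_Gs r). }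
 split; [|split; [now apply (Bloc_LambdaP r)|]].
 - split; [|split].
  + apply smooth_loop_mmul; auto. apply smooth_loop_mmul; [|apply smooth_loop_const].
   apply smooth_loop_iff. apply (csmooth_mval r); auto. now apply mwf_Gs.
  + apply twisted_mmul; auto. intros l Hl. unfold on_circle in Hl.
   assert (T := twisted_mmul _ _ (twisted_mmul _ _ TP (twisted_minv _ TB)) (twisted_Cmat (sqrt (kap A z))) l Hl).
   cbv beta in T. rewrite <- !EF in T; [exact T|lra|]. rewrite Cmod_opp. lra.
  + intros l Hl. apply is_SU2_mmul; auto. now apply (Floc_SU2 r).
 - intros l Hl. unfold on_circle in Hl. rewrite EF by lra. unfold Bloc.
  rewrite <- !mmul_assoc, (mmul_assoc (Cmat (sqrt _))), Cmat_mul, Rinv_r.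
  + replace (Cmat 1) with mone by (unfold Cmat; rewrite Rinv_1; apply mone_mat2).
   rewrite mmul_1_l, mmul_minv_l, mmul_1_r by (apply (good_Bdet r); auto; lra). reflexivity.
  + lra.
  + lra.
  + apply Rinv_neq_0_compat; lra.
Qed.

(* [l G^-1 G_z] extends to the disc, and its adjoint as well because of
  [Psi^* Psi = X^-1 B] and [d/dz Psi^* = 0]; hence it is constant in [l]. *)
Lemma Gs_dz r A z l (Am1 A0 A1 : M2) : good r A -> Cmod z < r -> Cmod l = 1 ->
 (forall l, Cmod l <= 1 -> mval A z l = (Cconj l *: Am1 + A0 + l *: A1)%M2) ->
 mval (smap sdz (Gs A)) z l =
 (mval (Gs A) z l ** (Cconj l *: (Cmat (kap A z) ** Am1 ** Cmat (/ kap A z))))%M2.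
Proof. intros H Hz Hl HA. assert (Hl1 : Cmod l <= 1) by lra.
 destruct (Bpos_l0 r A z H Hz) as [Hk [EC _]].
 assert (HB := good_Bpos r A H). assert (HBh := good_Bpos_mholo r A H).
 destruct (good_Xdag r A H) as [WX [HXh [EX E0]]].
 assert (HQX := gall_Xneg _ (good_QK r A H)).
 pose proof H as [H0 [WA [HQ [HT [WP WXn]]]]].
 set (P := Psi A) in *. set (B := Bpos P) in *. set (X := Xneg P) in *.
 set (Bz := fun l => mval (smap sdz B) z l). set (Xz := fun l => mval (smap sdz X) z l).
 assert (WBz : mwf r (smap sdz B)) by (apply mwf_smap; auto; apply wf_sdz).
 assert (HBz : mholo (smap sdz B)).
 { assert (K : forall h, sholo h -> sholo (sdz h)).
  { intros h Hh N. unfold sdz. apply Forall_flat_map. eapply Forall_impl; [|apply (Hh (S N))].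
   intros t Ht. unfold tdz. destruct (tm t); constructor; auto. }
  destruct HBh as [K1 [K2 [K3 K4]]]. repeat split; apply K; auto. }
 assert (WP' : forall l, Cmod l <= 1 -> WDM (fun w => mval P w l) z (mval P z l ** mval A z l)%M2 mzero).
 { intros w Hw. eapply WDM_eq; [apply (mval_WDM r); auto| |].
  - unfold P. now apply (Psi_dz r).
  - unfold P. now apply Psi_dw. }
 assert (Hpos : 0 < r - Cmod z) by lra.
 assert (Hnear := Cmod_near r z).
 assert (DG : forall l, Cmod l <= 1 -> mval (smap sdz (Gs A)) z l =
  (mval P z l ** mval A z l ** minv (mval B z l) + mval P z l ** minv (Bz l))%M2).
 { intros w Hw.
  assert (V1 := WDM_mmul _ _ _ _ _ _ _ (WP' w Hw) (WDM_minv _ _ _ _ (mval_WDM r B z w HB Hz Hw))).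
  assert (V2 := WDM_ext_loc _ _ z _ _ (r - Cmod z) Hpos
   (fun v Hv => eq_sym (mval_Gs r A v w H (Hnear v Hv) Hw)) V1).
  apply (proj1 (WDM_unique _ z _ _ _ _ (mval_WDM r _ _ _ (mwf_Gs r A H) Hz Hw) V2)). }
 assert (DB : forall l, Cmod l = 1 ->
  Bz l = (Xz l ** (mdagger (mval P z l) ** mval P z l) + mval B z l ** mval A z l)%M2).
 { intros w Hw. assert (Hw1 : Cmod w <= 1) by lra.
  assert (W1 := mval_WDM r X z w WXn Hz Hw1).
  assert (W2 := WDM_madd _ _ _ _ _ _ _ (WDM_const mone z) W1).
  assert (W3 := WDM_mmul _ _ _ _ _ _ _ (WDM_mdagger _ _ _ _ (WP' w Hw1)) (WP' w Hw1)).
  assert (W4 := WDM_mmul _ _ _ _ _ _ _ W2 W3).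
  assert (W5 := WDM_ext_loc _ _ z _ _ (r - Cmod z) Hpos
   (fun v Hv => good_birkhoff r A v w H (Hnear v Hv) Hw) W4).
  destruct (WDM_unique _ _ _ _ _ _ (mval_WDM r B z w HB Hz Hw1) W5) as [E _].
  unfold Bz. rewrite E.
  replace (mdagger mzero) with mzero by (rewrite mzero_mat2, mdagger_mat2, !Cconj_RtoC; reflexivity).
  rewrite madd_0_l, mmul_0_l, madd_0_l. f_equal.
  assert (Q := good_birkhoff r A z w H Hz Hw). fold P X B in Q.
  rewrite <- Q, !mmul_assoc. reflexivity. }
 (* This is [l G^-1 G_z] written without negative powers. The adjugate is linear, so [minv (Bz l)]
    is the [z] derivative of [B^-1]. *)
 set (E := fun l => (mval B z l ** (Am1 + (l *: A0 + (l * l)%C *: A1)) ** minv (mval B z l)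
  + l *: (mval B z l ** minv (Bz l)))%M2).
 assert (MB := mholo_mdisc r B z HB Hz HBh). assert (MBz := mholo_mdisc r _ z WBz Hz HBz).
 assert (HE : mdisc E).
 { apply mdisc_madd.
  - apply mdisc_mmul; [apply mdisc_mmul; [exact MB|]|exact (mdisc_minv _ MB)].
   apply mdisc_madd; [apply mdisc_const|]. apply mdisc_madd.
   + apply mdisc_mscal; [apply disc_id|apply mdisc_const].
   + apply mdisc_mscal; [apply disc_mult; apply disc_id|apply mdisc_const].
  - apply mdisc_mscal; [apply disc_id|]. apply mdisc_mmul; [exact MB|exact (mdisc_minv _ MBz)]. }
 assert (EG : forall l, Cmod l = 1 -> E l = (l *: (minv (mval (Gs A) z l) ** mval (smap sdz (Gs A)) z l))%M2).
 { intros w Hw. assert (Hw1 : Cmod w <= 1) by lra.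
  rewrite (mval_Gs r), DG, minv_mmul, minv_invol by auto.
  rewrite mmul_madd_r, !mmul_assoc, <- (mmul_assoc (mval B z w) (minv _)), mmul_minv_l, mmul_1_r
   by (now apply (good_det r)).
  unfold E. rewrite mscal_madd. f_equal.
  rewrite HA, <- !mmul_assoc by auto. rewrite <- mmul_mscal_r.
  rewrite <- mmul_mscal_l.
  rewrite !mscal_madd, !mscal_mscal, circle_conj, mscal_1 by auto.
  rewrite madd_assoc. reflexivity. }
 assert (DBw : forall l, Cmod l <= 1 -> mdet (mval B z l) = 1%C) by (intros; now apply (good_Bdet r)).
 (* The adjoint of [X_z] has a factor [l], because [X] has only negative powers; [Y] is the
    quotient. *)
 set (Y := smap sdivl (smdag (smap sdz X))).
 assert (WY0 : mwf r (smdag (smap sdz X))) by (apply mwf_smdag, mwf_smap; auto; apply wf_sdz).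
 assert (WY : mwf r Y) by (apply mwf_smap; auto; apply wf_sdivl).
 assert (XT : forall N, gall (fun _ _ t => ta t = 0%nat /\ (1 <= tb t)%nat) (smap sdz X) N).
 { intros N. destruct (HQX (S N)) as [X1 [X2 [X3 X4]]].
  split; [|split; [|split]]; simpl; unfold sdz; apply Forall_flat_map;
   (eapply Forall_impl; [|eassumption]; intros t [_ [T1 T2]]; unfold tdz;
    destruct (tm t); constructor; auto). }
 assert (HY0 : mholo (smdag (smap sdz X))).
 { split; [|split; [|split]]; intros N; destruct (XT N) as [X1 [X2 [X3 X4]]]; simpl; unfold sconj;
   apply Forall_map; (eapply Forall_impl; [|eassumption]; intros t [T1 T2]; exact T1). }
 assert (HY : mholo Y).
 { destruct HY0 as [K1 [K2 [K3 K4]]]. repeat split; apply sholo_sdivl; assumption. }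
 assert (EY : forall l, Cmod l <= 1 -> mdagger (Xz l) = (l *: mval Y z l)%M2).
 { intros w Hw. unfold Xz. rewrite <- mval_smdag. unfold Y, mval. rewrite mscal_mat2.
  destruct HY0 as [K1 [K2 [K3 K4]]]. destruct WY0 as [V1 [V2 [V3 V4]]].
  assert (Z : forall h, wf r h -> sholo h -> (forall N, Forall (fun t => (1 <= ta t)%nat) (h N)) ->
   sval h z w = (w * sval (sdivl h) z w)%C).
  { intros h Wh Hh Th. rewrite (sval_sl0 r h z w Wh Hz Hw Hh). rewrite (sval_l0 h); [ring|].
   intros N. eapply Forall_impl; [|apply Th]. simpl; intros; lia. }
  f_equal; apply Z; auto; intros N; destruct (XT N) as [X1 [X2 [X3 X4]]]; simpl; unfold sconj;
   apply Forall_map; (eapply Forall_impl; [|eassumption]; intros t [T1 T2]; exact T2). }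
 (* On the circle the terms with [A] cancel and [E = - Y^* (1 + X)^-1] remains; [F] is the adjoint
    of this, again without negative powers. *)
 set (F := fun l => (RtoC (-1) *: (minv (mval (Xdag P) z l) ** mval Y z l))%M2).
 assert (HF : mdisc F).
 { apply (mdisc_mscal (fun _ => RtoC (-1))); [apply disc_const|].
  apply mdisc_mmul; [exact (mdisc_minv _ (mholo_mdisc r _ z WX Hz HXh))|exact (mholo_mdisc r Y z WY Hz HY)]. }
 assert (EF : forall l, Cmod l = 1 -> E l = mdagger (F l)).
 { intros w Hw. assert (Hw1 : Cmod w <= 1) by lra.
  assert (DX : mdet (mone + mval X z w)%M2 = 1%C).
  { assert (Q := f_equal mdet (good_birkhoff r A z w H Hz Hw)). fold P X B in Q.
   assert (DP : mdet (mval P z w) = 1%C) by exact (good_det r A z w H Hz Hw1).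
   rewrite !mdet_mmul, mdet_mdagger, DBw, DP, Cconj_RtoC in Q by auto.
   etransitivity; [|exact Q]. ring. }
  assert (G1 : (mdagger (mval P z w) ** mval P z w)%M2 = (minv (mone + mval X z w) ** mval B z w)%M2).
  { assert (Q := good_birkhoff r A z w H Hz Hw). fold P X B in Q.
   rewrite <- Q, mmul_assoc, mmul_minv_l, mmul_1_l by auto. reflexivity. }
  rewrite EG, (mval_Gs r), DG, minv_mmul, minv_invol by auto.
  assert (EBz : (mval B z w ** minv (Bz w))%M2 = (RtoC (-1) *: (Bz w ** minv (mval B z w)))%M2).
  { assert (W := mval_WDM r B z w HB Hz Hw1).
   assert (W1 := WDM_mmul _ _ _ _ _ _ _ W (WDM_minv _ _ _ _ W)).
   assert (W2 := WDM_ext_loc _ _ z _ _ (r - Cmod z) Hpos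
    (fun v Hv => mmul_minv_r _ (good_Bdet r A v w H (Hnear v Hv) Hw1)) W1).
   destruct (WDM_unique _ _ _ _ _ _ W2 (WDM_const mone z)) as [Q _]. fold (Bz w) in Q.
   revert Q. rewrite !mmul_eta, madd_mat2, mzero_mat2, mscal_mat2, RtoC_m1. intros Q.
   apply mat2_inj in Q. destruct Q as [Q1 [Q2 [Q3 Q4]]].
   f_equal; apply Cminus_eq_0; [rewrite <- Q1|rewrite <- Q2|rewrite <- Q3|rewrite <- Q4]; ring. }
  rewrite mmul_madd_r, !mmul_assoc, <- (mmul_assoc (mval B z w) (minv _)), mmul_minv_l, mmul_1_r
   by (now apply (good_det r)).
  rewrite EBz, DB, G1 by auto.
  rewrite mmul_madd_l, <- !mmul_assoc, mmul_minv_r, mmul_1_r by auto.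
  unfold F. rewrite EX by auto.
  assert (EYw := EY w Hw1).
  assert (EXz : Xz w = (Cconj w *: mdagger (mval Y z w))%M2).
  { rewrite <- (mdagger_invol (Xz w)), EYw. rewrite !mdagger_eta, !mscal_eta; ents.
   rewrite !Cconj_mult. reflexivity. }
  rewrite EXz, mmul_mscal_l, mdagger_mscal, mdagger_mmul, mdagger_minv, mdagger_invol.
  replace (Cconj (RtoC (-1))) with (RtoC (-1)) by (now rewrite Cconj_RtoC).
  apply mscal_cancel, circle_conj, Hw. }
 destruct (mdisc_conj_const E F HE HF EF) as [_ A2].
 specialize (A2 l Hl). rewrite EG in A2 by auto.
 assert (EE0 : E (RtoC 0) = (Cmat (kap A z) ** Am1 ** Cmat (/ kap A z))%M2).
 { unfold E. rewrite EC, minv_Cmat by lra. replace (0 * 0)%C with (RtoC 0) by ring.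
  rewrite !mscal_0, !madd_0_r. reflexivity. }
 rewrite EE0 in A2. rewrite <- A2, mscal_mscal, Cmult_comm, circle_conj, mscal_1 by auto.
 rewrite mmul_assoc, mmul_minv_r, mmul_1_l by (now apply (Gs_det r)). reflexivity.
Qed.

(** * The Sym-Bobenko surface of the local frame *)

(** The Sym-Bobenko expression with [Gs] in place of the unitary frame: the factor [Cmat] is
    diagonal and independent of [l], so it commutes with [e3] and drops out of the logarithmic
    derivative. On the circle [2 i l d/dl] is twice the derivative in the angle. *)
Definition fsurf (H : R) (A : smat) : smat :=
 smap (sscal (RtoC (- / (2 * H))))
  (smadd (smm (smm (Gs A) (smcst e3)) (smadj (Gs A)))
      (smap (sscal 2) (smm (smap sdt (Gs A)) (smadj (Gs A))))).

Lemma mwf_fsurf H r A : good r A -> mwf r (fsurf H A).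
Proof. intros HA. assert (HG := mwf_Gs r A HA). assert (HI := mwf_smadj _ _ HG).
 apply mwf_smap; [intros; now apply wf_sscal|]. apply mwf_smadd.
 - apply mwf_smm; auto. apply mwf_smm; auto. apply mwf_smcst.
 - apply mwf_smap; [intros; now apply wf_sscal|]. apply mwf_smm; auto.
  apply mwf_smap; auto. apply wf_sdt.
Qed.

Lemma mval_fsurf H r A z l : good r A -> Cmod z < r -> Cmod l <= 1 ->
 mval (fsurf H A) z l = (RtoC (- / (2 * H)) *:
  (mval (Gs A) z l ** e3 ** minv (mval (Gs A) z l)
   + RtoC 2 *: (mval (smap sdt (Gs A)) z l ** minv (mval (Gs A) z l))))%M2.
Proof. intros HA Hz Hl. assert (HG := mwf_Gs r A HA). assert (HI := mwf_smadj _ _ HG).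
 assert (HT : mwf r (smap sdt (Gs A))) by (apply mwf_smap; auto; apply wf_sdt).
 assert (H1 := mwf_smm _ _ _ HG (mwf_smcst r e3)). assert (H2 := mwf_smm _ _ _ H1 HI).
 assert (H3 := mwf_smm _ _ _ HT HI).
 assert (H4 : mwf r (smap (sscal 2) (smm (smap sdt (Gs A)) (smadj (Gs A)))))
  by (apply mwf_smap; auto; intros; now apply wf_sscal).
 unfold fsurf. rewrite (mval_smscal r), (mval_smadd r), (mval_smscal r), !(mval_smm r), (mval_smcst r),
  !(mval_smadj r); auto using mwf_smcst, mwf_smadd.
Qed.

Definition E12 : M2 := mat2 0 1 0 0.

Lemma minv_traceless (W : M2) : mtrace W = 0 -> minv W = (RtoC (-1) *: W)%M2.
Proof. intros E. unfold mtrace in E. unfold minv. rewrite mscal_eta, RtoC_m1.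
 f_equal; try ring; apply Cminus_eq_0; rewrite <- E; ring.
Qed.

Lemma RDM_cis_conj_scal (W : M2) t :
 RDM (fun s => Cconj (cis s) *: W)%M2 t ((- Ci * Cconj (cis t)) *: W)%M2.
Proof. assert (K : RD (fun s => Cconj (cis s)) t (- Ci * Cconj (cis t))%C).
 { eapply RD_eq; [apply (RD_conj _ _ _ (RD_cis t))|]. rewrite Cconj_mult, Cconj_Ci. reflexivity. }
 assert (K2 : forall x, RD (fun s => Cconj (cis s) * x)%C t (- Ci * Cconj (cis t) * x)%C).
 { intros x. eapply RD_eq; [apply (RD_mult _ (fun _ => x) _ _ _ K (RD_const x t))|]. ring. }
 apply RDM_entries; apply K2.
Qed.

(** The formula for [G_z] holds on the whole circle and may be differentiated in the angle; the
    factor [conj l] contributes the second summand. *)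
Lemma Gs_dt_dz r A z (W : C -> M2) t : good r A -> Cmod z < r ->
 (forall l, Cmod l = 1 -> mval (smap sdz (Gs A)) z l = (mval (Gs A) z l ** (Cconj l *: W z))%M2) ->
 mval (smap sdz (smap sdt (Gs A))) z (cis t) =
 (mval (smap sdt (Gs A)) z (cis t) ** (Cconj (cis t) *: W z)
  + mval (Gs A) z (cis t) ** ((- Ci * Cconj (cis t)) *: W z))%M2.
Proof. intros HA Hz HW. assert (HG := mwf_Gs r A HA).
 assert (E : mval (smap sdz (smap sdt (Gs A))) z (cis t) = mval (smap sdt (smap sdz (Gs A))) z (cis t)).
 { unfold mval, smap. cbn [s11 s12 s21 s22]. rewrite <- !sdt_sdz. reflexivity. }
 rewrite E.
 apply (RDM_unique (fun s => mval (smap sdz (Gs A)) z (cis s)) t).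
 - apply (mval_RDM_t r); auto. apply mwf_smap; auto. apply wf_sdz.
 - eapply RDM_ext; [intros s; symmetry; apply HW, Cmod_cis|].
  apply (RDM_mmul (fun s => mval (Gs A) z (cis s)) (fun s => Cconj (cis s) *: W z)%M2).
  + now apply (mval_RDM_t r).
  + apply RDM_cis_conj_scal.
Qed.

(** The terms with [G_t] cancel. What remains is the conjugate by [G] of [[W, e3] - 2 i W], in which
    the lower left entry cancels and the two upper right contributions coincide. *)
Lemma fsurf_dz H r A z (W : C -> M2) : H <> 0 -> good r A -> Cmod z < r ->
 (forall l, Cmod l = 1 -> mval (smap sdz (Gs A)) z l = (mval (Gs A) z l ** (Cconj l *: W z))%M2) ->
 ent (W z) 0 0 = 0 -> ent (W z) 1 1 = 0 ->
 mval (smap sdz (fsurf H A)) z 1 =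
 ((RtoC 2 * Ci / RtoC H * ent (W z) 0 1) *: (mval (Gs A) z 1 ** E12 ** minv (mval (Gs A) z 1)))%M2.
Proof. intros H0 HA Hz HW W0 W1. assert (HG := mwf_Gs r A HA).
 assert (L1 : Cmod 1 = 1) by apply Cmod_1. assert (L2 : Cmod 1 <= 1) by lra.
 assert (Hpos : 0 < r - Cmod z) by lra.
 assert (Hnear := Cmod_near r z).
 assert (HT : mwf r (smap sdt (Gs A))) by (apply mwf_smap; auto; apply wf_sdt).
 assert (V1 := mval_WDM r _ z 1 HG Hz L2). assert (V2 := mval_WDM r _ z 1 HT Hz L2).
 assert (V3 := WDM_minv _ _ _ _ V1).
 assert (V4 := WDM_mmul _ _ _ _ _ _ _ (WDM_mmul _ _ _ _ _ _ _ V1 (WDM_const e3 z)) V3).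
 assert (V5 := WDM_mscal (RtoC 2) _ _ _ _ (WDM_mmul _ _ _ _ _ _ _ V2 V3)).
 assert (V6 := WDM_mscal (RtoC (- / (2 * H))) _ _ _ _ (WDM_madd _ _ _ _ _ _ _ V4 V5)).
 assert (V7 := WDM_ext_loc _ _ z _ _ (r - Cmod z) Hpos
  (fun v Hv => eq_sym (mval_fsurf H r A v 1 HA (Hnear v Hv) L2)) V6).
 rewrite (proj1 (WDM_unique _ _ _ _ _ _ (mval_WDM r _ z 1 (mwf_fsurf H r A HA) Hz L2) V7)).
 rewrite <- cis_0, (Gs_dt_dz r A z W 0 HA Hz HW), cis_0, (HW 1 L1).
 replace (Cconj 1) with (RtoC 1) by (now rewrite Cconj_RtoC).
 rewrite !mscal_1, Cmult_1_r, minv_mmul, (minv_traceless (W z)) by (unfold mtrace; rewrite W0, W1; ring).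
 generalize (mval (Gs A) z 1) (mval (smap sdt (Gs A)) z 1). intros G T.
 rewrite mmul_0_r, madd_0_r.
 rewrite (mat2_eta (W z)), W0, W1. generalize (ent (W z) 0 1) (ent (W z) 1 0). intros p q.
 assert (NH : RtoC H <> 0) by nzC.
 assert (EH : RtoC (- / (2 * H)) = (- / (2 * H))%C).
 { rewrite RtoC_opp, RtoC_inv, RtoC_mult by lra. reflexivity. }
 rewrite (mat2_eta G), (mat2_eta T), EH. unfold E12, e3.
 rewrite ?minv_mat2, ?mscal_mat2, ?mmul_mat2, ?mscal_mat2, ?madd_mat2, ?mmul_mat2, ?mscal_mat2, ?madd_mat2,
  ?mscal_mat2, ?madd_mat2, ?mscal_mat2, RtoC_m1, ?ent01.
 f_equal; field; auto.
Qed.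

Lemma mdagger_madd (A B : M2) : mdagger (A + B)%M2 = (mdagger A + mdagger B)%M2.
Proof. rewrite !mdagger_eta, !madd_eta; ents. rewrite !Cconj_plus. reflexivity. Qed.

Lemma Ad_mdagger F X : is_SU2 F -> mdagger (Ad F X) = Ad F (mdagger X).
Proof. intros HF. apply is_SU2_dagger in HF. destruct HF as [H1 H2]. unfold Ad.
 rewrite !mdagger_mmul, H2, mmul_assoc. rewrite <- H2, mdagger_invol, H2. reflexivity.
Qed.

Lemma mtrace_mmul (A B : M2) : mtrace (A ** B)%M2 = mtrace (B ** A)%M2.
Proof. rewrite !mmul_eta. unfold mtrace; ents. ring. Qed.

Lemma Ad_mmul F X Y : mdet F = 1%C -> (Ad F X ** Ad F Y)%M2 = Ad F (X ** Y)%M2.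
Proof. intros HF. unfold Ad. rewrite <- !mmul_assoc, (mmul_assoc (minv F)), mmul_minv_l, mmul_1_l by auto. reflexivity.
Qed.

Lemma mtrace_Ad F X : mdet F = 1%C -> mtrace (Ad F X) = mtrace X.
Proof. intros HF. unfold Ad. rewrite mtrace_mmul, mmul_assoc, mmul_minv_l, mmul_1_l; auto.
Qed.

Lemma inner_Ad F X Y : mdet F = 1%C -> inner (Ad F X) (Ad F Y) = inner X Y.
Proof. intros HF. unfold inner. rewrite Ad_mmul, mtrace_Ad by auto. reflexivity. Qed.

Lemma Ad_madd F X Y : Ad F (X + Y)%M2 = (Ad F X + Ad F Y)%M2.
Proof. unfold Ad. now rewrite mmul_madd_r, mmul_madd_l. Qed.
Lemma Ad_mscal F c X : Ad F (c *: X)%M2 = (c *: Ad F X)%M2.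
Proof. unfold Ad. now rewrite mmul_mscal_r, mmul_mscal_l. Qed.
Lemma Ad_comp F G X : Ad (F ** G)%M2 X = Ad F (Ad G X).
Proof. unfold Ad. rewrite minv_mmul, !mmul_assoc. reflexivity. Qed.

Lemma is_su2_Ad F X : is_SU2 F -> is_su2 X -> is_su2 (Ad F X).
Proof. intros HF [H1 H2]. split.
 - rewrite Ad_mdagger, H1, Ad_mscal by auto. reflexivity.
 - rewrite mtrace_Ad by apply HF. exact H2.
Qed.
Lemma is_su2_madd X Y : is_su2 X -> is_su2 Y -> is_su2 (X + Y)%M2.
Proof. intros [H1 H2] [H3 H4]. split.
 - rewrite mdagger_madd, H1, H3, mscal_madd. reflexivity.
 - rewrite madd_eta. unfold mtrace in *; ents.
  transitivity ((ent X 0 0 + ent X 1 1) + (ent Y 0 0 + ent Y 1 1))%C; [ring|].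
  rewrite H2, H4. ring.
Qed.
Lemma is_su2_mscal (c : R) X : is_su2 X -> is_su2 (RtoC c *: X)%M2.
Proof. intros [H1 H2]. split.
 - rewrite mdagger_mscal, H1, Cconj_RtoC, !mscal_mscal, Cmult_comm. reflexivity.
 - rewrite mscal_eta. unfold mtrace in *; ents.
  transitivity (RtoC c * (ent X 0 0 + ent X 1 1))%C; [ring|]. rewrite H2. ring.
Qed.
Lemma is_su2_e3 : is_su2 e3.
Proof. split; unfold e3; [|rewrite mtrace_mat2; ring].
 rewrite mdagger_mat2, mscal_mat2, RtoC_m1, !Cconj_opp, !Cconj_RtoC, Cconj_Ci. f_equal; ring.
Qed.

Lemma e1_Cmat k : k <> 0 -> Ad (Cmat k) e3 = e3.
Proof. intros Hk. unfold Ad, Cmat, e3. rewrite minv_mat2, !mmul_mat2, RtoC_inv by auto.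
 assert (RtoC k <> 0) by nzC.
 f_equal; field; auto.
Qed.

Lemma madd_eq_0 (X Y : M2) : (X + Y)%M2 = mzero -> Y = (RtoC (-1) *: X)%M2.
Proof. intros E. rewrite madd_eta, mzero_mat2 in E. apply mat2_inj in E. destruct E as [Q1 [Q2 [Q3 Q4]]].
 rewrite (mat2_eta Y), mscal_eta, RtoC_m1.
 f_equal; apply Cminus_eq_0; [rewrite <- Q1|rewrite <- Q2|rewrite <- Q3|rewrite <- Q4]; ring.
Qed.

(** Differentiate [F F^-1 = 1] and [F^* = F^-1]; [minv] being linear, the derivative of [F^-1] is
    [minv D]. *)
Lemma unitary_log_derivative (F : R -> M2) t D : (forall s, is_SU2 (F s)) -> RDM F t D ->
 is_su2 (D ** minv (F t))%M2.
Proof. intros HF HD. destruct (proj1 (is_SU2_dagger _) (HF t)) as [D1 D2].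
 assert (V1 := RDM_mmul _ _ _ _ _ HD (RDM_minv _ _ _ HD)).
 assert (V2 := RDM_ext _ (fun _ => mone) t _ (fun s => mmul_minv_r _ (proj1 (HF s))) V1).
 assert (E1 := RDM_unique _ _ _ _ V2 (RDM_const mone t)).
 assert (V3 := RDM_ext _ (fun s => minv (F s)) t _ (fun s => proj2 (proj1 (is_SU2_dagger _) (HF s)))
  (RDM_mdagger _ _ _ HD)).
 assert (E2 := RDM_unique _ _ _ _ V3 (RDM_minv _ _ _ HD)).
 assert (E3 : (F t ** minv D)%M2 = (RtoC (-1) *: (D ** minv (F t)))%M2).
 { exact (madd_eq_0 _ _ E1). }
 split.
 - rewrite mdagger_mmul, E2, <- E3. rewrite <- D2. now rewrite mdagger_invol.
 - assert (T : mtrace (F t ** minv D)%M2 = mtrace (D ** minv (F t))%M2).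
  { rewrite !mmul_eta. unfold mtrace, minv; ents. ring. }
  rewrite E3, mscal_eta in T. unfold mtrace in *. revert T; ents. rewrite RtoC_m1.
  set (x := ent (D ** minv (F t))%M2 0 0). set (y := ent (D ** minv (F t))%M2 1 1). intros T.
  assert (T2 : (RtoC 2 * (x + y) = 0)%C).
  { transitivity ((x + y) - (- (1) * x + - (1) * y))%C; [ring|]. rewrite T. ring. }
  replace (x + y)%C with (/ 2 * (RtoC 2 * (x + y)))%C by (field; apply C2_neq_0).
  rewrite T2. ring.
Qed.

Lemma Floc_dt r A z t : good r A -> Cmod z < r ->
 RDM (fun s => Floc A z (cis s)) t (mval (smap sdt (Gs A)) z (cis t) ** Cmat (sqrt (kap A z)))%M2.
Proof. intros HA Hz. eapply RDM_eq.
 - apply (RDM_mmul (fun s => mval (Gs A) z (cis s)) (fun _ => Cmat (sqrt (kap A z)))).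
  + apply (mval_RDM_t r); auto. now apply mwf_Gs.
  + apply RDM_const.
 - rewrite mmul_0_r, madd_0_r. reflexivity.
Qed.

Lemma fsurf_eq_frame H r A z : good r A -> Cmod z < r ->
 mval (fsurf H A) z 1 = (RtoC (- / (2 * H)) *: (Ad (Floc A z 1) e3
   + RtoC 2 *: (mval (smap sdt (Gs A)) z 1 ** Cmat (sqrt (kap A z)) ** minv (Floc A z 1))))%M2.
Proof. intros HA Hz. destruct (Bpos_l0 r A z HA Hz) as [Hk _]. assert (Hs := sqrt_lt_R0 _ Hk).
 assert (L2 : Cmod 1 <= 1) by (rewrite Cmod_1; lra).
 rewrite (mval_fsurf H r) by auto. unfold Floc. rewrite Ad_comp, e1_Cmat by lra.
 rewrite minv_mmul, mmul_assoc, <- (mmul_assoc (mval (smap sdt (Gs A)) z 1)), mmul_minv_r, mmul_1_r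
  by (apply Cmat_det; lra). reflexivity.
Qed.

(** Reality becomes visible through the unitary frame: both the rotated [e3] and the logarithmic
    derivative of the frame in the angle lie in [su(2)]. *)
Lemma fsurf_su2 H r A z : good r A -> Cmod z < r -> is_su2 (mval (fsurf H A) z 1).
Proof. intros HA Hz. rewrite (fsurf_eq_frame H r) by auto.
 apply is_su2_mscal, is_su2_madd.
 - apply is_su2_Ad; [|apply is_su2_e3]. apply (Floc_SU2 r); auto. apply Cmod_1.
 - apply is_su2_mscal. assert (K := unitary_log_derivative (fun s => Floc A z (cis s)) 0
   (mval (smap sdt (Gs A)) z (cis 0) ** Cmat (sqrt (kap A z)))%M2).
  cbv beta in K. rewrite cis_0 in K. apply K.
  + intros s. apply (Floc_SU2 r); auto. apply Cmod_cis.
  + rewrite <- cis_0. now apply (Floc_dt r).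
Qed.

(** Null vectors for the complex bilinear extension of the inner product: [f_z] being a multiple of
    the rotated [e1 - i e2] expresses conformality. *)
Definition e_minus : M2 := (e1 + (- Ci)%C *: e2)%M2.
Definition e_plus : M2 := (e1 + Ci *: e2)%M2.

Lemma e_minus_E12 : e_minus = ((- (RtoC 2 * Ci))%C *: E12)%M2.
Proof. unfold e_minus, e1, e2, E12. rewrite !mscal_mat2, madd_mat2, RtoC_m1. f_equal; ring.
Qed.
Lemma e_minus_dagger : mdagger e_minus = (RtoC (-1) *: e_plus)%M2.
Proof. unfold e_minus, e_plus, e1, e2.
 rewrite !mscal_mat2, !madd_mat2, mdagger_mat2, mscal_mat2, !Cconj_plus, !Cconj_mult, !Cconj_opp, !Cconj_RtoC,
  Cconj_Ci, RtoC_m1.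
 f_equal; ring.
Qed.

(** [c] is [e^u] up to a phase. The derivative in [conj z] follows from [f^* = - f]. The mixed
    second derivative is determined up to [y], which has no component along [e3] and so does not
    enter the mean curvature. *)
Lemma local_surface H r A z (W : C -> M2) a0 b0 : H <> 0 -> good r A -> Cmod z < r ->
 (forall z l, Cmod z < r -> Cmod l = 1 -> mval (smap sdz (Gs A)) z l = (mval (Gs A) z l ** (Cconj l *: W z))%M2) ->
 (forall z, Cmod z < r -> ent (W z) 0 0 = 0 /\ ent (W z) 1 1 = 0) ->
 WD (fun w => ent (W w) 0 1) z a0 b0 ->
 let F := Floc A z 1 in
 let c := (- (ent (W z) 0 1 * / RtoC (kap A z)) * / RtoC H)%C in
 mval (smap sdz (fsurf H A)) z 1 = (c *: Ad F e_minus)%M2 /\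
 mval (smap sdw (fsurf H A)) z 1 = (Cconj c *: Ad F e_plus)%M2 /\
 exists y, mval (smap sdw (smap sdz (fsurf H A))) z 1 =
  Ad F (mat2 (Ci * RtoC (2 * H * Cmod c ^ 2)) y 0 (- (Ci * RtoC (2 * H * Cmod c ^ 2)))).
Proof. intros H0 HA Hz HW HWd HWD F c.
 destruct (Bpos_l0 r A z HA Hz) as [Hk _]. assert (Hs := sqrt_lt_R0 _ Hk).
 assert (HG := mwf_Gs r A HA). assert (HF := mwf_fsurf H r A HA).
 assert (L1 : Cmod 1 = 1) by apply Cmod_1. assert (L2 : Cmod 1 <= 1) by lra.
 assert (SF : is_SU2 F) by (apply (Floc_SU2 r); auto).
 assert (NH : RtoC H <> 0) by nzC.
 assert (Nk : RtoC (kap A z) <> 0) by nzC.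
 assert (Ns : RtoC (sqrt (kap A z)) <> 0) by nzC.
 assert (Ess : (RtoC (sqrt (kap A z)) * RtoC (sqrt (kap A z)))%C = RtoC (kap A z))
  by (rewrite <- RtoC_mult, sqrt_sqrt by lra; reflexivity).
 assert (Hpos : 0 < r - Cmod z) by lra.
 assert (Hnear := Cmod_near r z).
 assert (Dz : forall v, Cmod v < r -> mval (smap sdz (fsurf H A)) v 1 =
  ((RtoC 2 * Ci / RtoC H * ent (W v) 0 1) *: (mval (Gs A) v 1 ** E12 ** minv (mval (Gs A) v 1)))%M2).
 { intros v Hv. destruct (HWd v Hv). apply (fsurf_dz H r A v W); auto. }
 set (G := mval (Gs A) z 1) in *.
 assert (GF : forall X, (G ** X ** minv G)%M2 =
  Ad F (minv (Cmat (sqrt (kap A z))) ** X ** Cmat (sqrt (kap A z)))%M2).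
 { intros X. unfold F, Floc, Ad. rewrite minv_mmul, <- !mmul_assoc.
  rewrite !(mmul_assoc (Cmat (sqrt (kap A z)))), mmul_minv_r, !mmul_1_l by (apply Cmat_det; lra). reflexivity. }
 assert (E1 : mval (smap sdz (fsurf H A)) z 1 = (c *: Ad F e_minus)%M2).
 { rewrite Dz by auto. rewrite GF, e_minus_E12, Ad_mscal, mscal_mscal.
  rewrite minv_Cmat by lra. unfold Cmat at 1 2, E12 at 1. rewrite !mmul_mat2, Rinv_inv.
  replace (mat2 _ _ _ _) with (/ RtoC (kap A z) *: E12)%M2.
  - rewrite Ad_mscal, mscal_mscal. f_equal. unfold c. field. auto.
  - unfold E12. rewrite mscal_mat2, RtoC_inv by lra. f_equal; try ring.
   rewrite <- Ess. field. auto. }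
 split; auto. split.
 - assert (V := mval_WDM r _ z 1 HF Hz L2).
  assert (V2 := WDM_mscal (RtoC (-1)) _ _ _ _ (WDM_mdagger _ _ _ _ V)).
  assert (V3 : WDM (fun v => mval (fsurf H A) v 1) z
   (RtoC (-1) *: mdagger (mval (smap sdw (fsurf H A)) z 1))%M2
   (RtoC (-1) *: mdagger (mval (smap sdz (fsurf H A)) z 1))%M2).
  { eapply WDM_ext_loc; [exact Hpos| |exact V2]. intros v Hv.
   destruct (fsurf_su2 H r A v HA (Hnear v Hv)) as [S _]. rewrite S, mscal_mscal.
   replace (RtoC (-1) * RtoC (-1))%C with (RtoC 1) by (rewrite RtoC_m1; ring). apply mscal_1. }
  rewrite (proj2 (WDM_unique _ _ _ _ _ _ V V3)), E1, mdagger_mscal, Ad_mdagger, e_minus_dagger, Ad_mscal,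
   !mscal_mscal by auto.
  f_equal. ring.
 - set (w := ent (W z) 0 1) in *.
  set (Gw := mval (smap sdw (Gs A)) z 1).
  assert (VG := mval_WDM r _ z 1 HG Hz L2). fold Gw in VG.
  set (V := (minv G ** Gw)%M2).
  assert (DG : mdet G = 1%C) by (apply (Gs_det r); auto).
  assert (EGw : Gw = (G ** V)%M2) by (unfold V; rewrite mmul_assoc, mmul_minv_r, mmul_1_l; auto).
  assert (W0 := HWd z Hz). destruct W0 as [W00 W11].
  assert (TV : minv Gw = (RtoC (-1) *: (V ** minv G))%M2).
  { assert (Q1 := WDM_mmul _ _ _ _ _ _ _ (WDM_minv _ _ _ _ VG) VG).
   assert (Q2 := WDM_ext_loc _ _ z _ _ (r - Cmod z) Hpos
    (fun v Hv => mmul_minv_l _ (Gs_det r A v 1 HA (Hnear v Hv) L2)) Q1).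
   destruct (WDM_unique _ _ _ _ _ _ Q2 (WDM_const mone z)) as [_ Q].
   assert (Q' : (minv Gw ** G)%M2 = (RtoC (-1) *: V)%M2).
   { rewrite madd_comm in Q. exact (madd_eq_0 _ _ Q). }
   rewrite <- mmul_mscal_l, <- Q', <- mmul_assoc, mmul_minv_r, mmul_1_r by auto. reflexivity. }
  (* the Gram matrix is diagonal *)
  assert (EV : ent V 1 0 = (- (Cconj w / (RtoC (kap A z) * RtoC (kap A z))))%C).
  { assert (Q1 := WDM_mmul _ _ _ _ _ _ _ (WDM_mdagger _ _ _ _ VG) VG).
   assert (Q2 := WD_ext_loc _ (fun _ => RtoC 0) z _ _ (r - Cmod z) Hpos
    (fun v Hv => eq_trans (f_equal (fun M => ent M 1 0) (Gs_gram r A v 1 HA (Hnear v Hv) L1)) eq_refl)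
    (Q1 1%nat 0%nat)).
   destruct (WD_unique _ _ _ _ _ _ Q2 (WD_const 0 z)) as [_ Q]. fold G in Q.
   rewrite (HW z 1 Hz L1) in Q. replace (Cconj 1) with (RtoC 1) in Q by (now rewrite Cconj_RtoC).
   rewrite mscal_1, mdagger_mmul, EGw, <- mmul_assoc, (mmul_assoc (mdagger G) G V) in Q.
   unfold G in Q. rewrite (Gs_gram r A z 1 HA Hz L1) in Q. unfold Cmat in Q. rewrite Rinv_inv in Q.
   rewrite madd_eta, ent10, !mmul_eta, !ent10, mdagger_eta in Q.
   rewrite ?ent00, ?ent01, ?ent10, ?ent11, W11 in Q. fold w in Q. rewrite Cconj_RtoC, RtoC_inv in Q by lra.
   replace (ent V 1 0) with (/ RtoC (kap A z) * (RtoC (kap A z) * ent V 1 0))%C by (field; auto).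
   replace (RtoC (kap A z) * ent V 1 0)%C with (- (Cconj w * / RtoC (kap A z)))%C.
   - field. auto.
   - symmetry. apply Cminus_eq_0. etransitivity; [|exact Q]. ring. }
  assert (VE := WDM_mmul _ _ _ _ _ _ _ (WDM_mmul _ _ _ _ _ _ _ VG (WDM_const E12 z)) (WDM_minv _ _ _ _ VG)).
  assert (VS := WDM_mscal_fun _ _ _ _ _ _ _ (WD_scal (RtoC 2 * Ci / RtoC H)%C _ _ _ _ HWD) VE).
  assert (VL := WDM_ext_loc _ (fun v => mval (smap sdz (fsurf H A)) v 1) z _ _ (r - Cmod z) Hpos
   (fun v Hv => eq_sym (Dz v (Hnear v Hv))) VS).
  assert (VR := mval_WDM r _ z 1 (mwf_smap r sdz _ (wf_sdz r) HF) Hz L2).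
  rewrite (proj2 (WDM_unique _ _ _ _ _ _ VR VL)). fold G w Gw.
  rewrite mmul_0_r, madd_0_r, TV, EGw.
  set (q := (RtoC 2 * Ci / RtoC H)%C).
  assert (EM : (q * b0 *: (G ** E12 ** minv G)
    + q * w *: (G ** V ** E12 ** minv G + G ** E12 ** (RtoC (-1) *: (V ** minv G))))%M2
   = (G ** (q * b0 *: E12 + q * w *: (V ** E12 + RtoC (-1) *: (E12 ** V))) ** minv G)%M2).
  { rewrite mmul_madd_r, mmul_madd_l, !mmul_mscal_r, !mmul_mscal_l, mmul_madd_r, mmul_madd_l, !mmul_mscal_r,
    !mmul_mscal_l, !mmul_assoc. reflexivity. }
  rewrite EM, GF.
  (* The diagonal entries of [[V, E12]] are [- V_21] and [V_21], and the value of [V_21] turns the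
     product with [w] into [|w|^2 / kap^2 = H^2 |c|^2]. *)
  set (x := (Ci * RtoC (2 * H * Cmod c ^ 2))%C).
  assert (Ex : x = (- (q * w * ent V 1 0))%C).
  { unfold x, q. rewrite EV, !RtoC_mult, RtoC_pow, <- RtoC_pow, <- Cmult_Cconj.
   unfold c. rewrite !Cconj_mult, Cconj_opp, Cconj_mult, <- !RtoC_inv, !Cconj_RtoC, !RtoC_inv by lra. field. auto. }
  rewrite minv_Cmat by lra. unfold Cmat at 1 2, E12. rewrite Rinv_inv.
  rewrite (mat2_eta V), !mmul_mat2, !mscal_mat2, !madd_mat2, !mscal_mat2, !madd_mat2, !mmul_mat2, !RtoC_inv by lra.
  match goal with |- exists y, Ad F (mat2 ?a ?b ?c ?d) = _ => exists b end.
  rewrite Ex, RtoC_m1. f_equal. f_equal; [field; auto|ring|field; auto].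
Qed.

(** * Uniqueness of analytic continuation off the real axis *)

Lemma hol_disc_fun E : (forall l, Cmod l < 2 -> exists d, WD E l d 0) -> disc_fun E.
Proof. split; [|intros l Hl; apply H; lra].
 intros l eps Hl He. destruct (H l ltac:(lra)) as [d Hd].
 destruct (proj1 (continuous_C_eps E l) (WD_continuous _ _ _ _ Hd) eps He) as [r [Hr K]]. exists r. auto.
Qed.

(* Extending [q] by 0 below the line keeps it holomorphic, since its derivative vanishes there. On the part of the
  unit circle above the line [Re (Ci * l - l ^ 2 / 2) <= -1/4], so the mean value property of the extension times
  [exp (N * (Ci * l - l ^ 2 / 2))] gives [|q 0| = O(exp (- N / 4))]. *)
Lemma half_disc_zero (q : C -> C) e : 0 <= e <= 1 / 8 -> (forall l, Cmod l < 2 -> exists d, WD q l d 0) ->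
 (forall l, Cmod l < 2 -> Im l = - e -> q l = 0) -> q 0 = 0.
Proof. intros He Hq Hz. assert (HPI := PI_RGT_0).
 set (g := fun l => if Rle_dec (Im l) (- e) then RtoC 0 else q l).
 assert (gq : forall l, - e <= Im l -> Cmod l < 2 -> g l = q l).
 { intros l H1 H2. unfold g. destruct Rle_dec; auto. symmetry. apply Hz; lra. }
 assert (Hg : forall l, Cmod l < 2 -> exists d, WD g l d 0).
 { intros l Hl. destruct (Hq l Hl) as [d Hd].
  assert (Im_lt : forall w m, Cmod (w - l) < m -> Rabs (Im w - Im l) < m).
  { intros w m Hw. eapply Rle_lt_trans; [apply (Im_le_Cmod (w - l)%C)|exact Hw]. }
  destruct (Rtotal_order (Im l) (- e)) as [H|[H|H]].
  - exists 0. apply (WD_ext_loc (fun _ => RtoC 0) _ _ _ _ (- e - Im l)); [lra| |apply WD_const].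
   intros w Hw. unfold g. apply Im_lt, Rabs_def2 in Hw. destruct Rle_dec; [auto|lra].
  - exists 0.
   assert (d0 : d = 0).
   { assert (X := WD_RD_x _ _ _ _ Hd). rewrite Cplus_0_r in X. apply (RD_unique _ _ _ _ X).
    apply (RD_ext_loc (fun _ => RtoC 0) _ _ _ (2 - Cmod l)); [lra| |apply RD_const].
    intros t Ht. symmetry. apply Hz; auto.
    replace (t, Im l) with (l + RtoC (t - Re l))%C
     by (destruct l; unfold RtoC, Cplus, Re; simpl; f_equal; ring).
    trilt. rewrite Cmod_R. lra. }
   subst d. intros eps Heps. destruct (Hd eps Heps) as [m [Hm K]]. exists m. split; auto. intros h Hh.
   specialize (K h Hh). unfold g. destruct (Rle_dec (Im l) (- e)); [|lra].
   rewrite (Hz l) in K by auto. destruct Rle_dec; [|exact K].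
   replace (0 - 0 - 0 * h - 0 * Cconj h)%C with (RtoC 0) by ring. rewrite Cmod_0.
   generalize (Cmod_ge_0 h). nra.
  - exists d. apply (WD_ext_loc q _ _ _ _ (Rmin (Im l + e) (2 - Cmod l))); [apply Rmin_glb_lt; lra| |exact Hd].
   intros w Hw. symmetry. assert (A := Rmin_l (Im l + e) (2 - Cmod l)). assert (B := Rmin_r (Im l + e) (2 - Cmod l)).
   apply gq.
   + apply Im_lt, Rabs_def2 in Hw. lra.
   + replace w with (l + (w - l))%C by ring. trilt; lra. }
 set (p := fun l => (Ci * l + - / 2 * (l * l))%C).
 assert (HE : forall N, disc_fun (fun l => Cexp (RtoC N * p l) * g l)%C).
 { intros N. apply hol_disc_fun. intros l Hl. destruct (Hg l Hl) as [d Hd].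
  assert (Hp := WD_scal (RtoC N) _ _ _ _ (WD_plus _ _ _ _ _ _ _ (WD_scal Ci _ _ _ _ (WD_id l))
   (WD_scal (- / 2)%C _ _ _ _ (WD_mult _ _ _ _ _ _ _ (WD_id l) (WD_id l))))).
  eexists. eapply WD_eq; [|reflexivity|].
  - apply WD_mult; [|exact Hd]. eapply WD_comp_hol; [apply WD_Cexp|].
   eapply WD_eq; [exact Hp|reflexivity|ring].
  - ring. }
 assert (Hc := hol_disc_fun g Hg).
 destruct (periodic_bounded (fun t => g (cis t))) as [M [HM B]].
 { intros t. now rewrite cis_period. }
 { intros t. now apply disc_circle_Ccont. }
 assert (E0 : forall N, 0 <= N -> 2 * PI * Cmod (q 0) <= 2 * (2 * PI - 0) * (exp (- N / 4) * M)).
 { intros N HN. assert (D := disc_mean _ (HE N)). cbv beta in D.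
  replace (Cexp (RtoC N * p 0) * g 0)%C with (q 0) in D.
  2:{ rewrite gq by (rewrite ?Cmod_0; simpl; lra). replace (RtoC N * p 0)%C with (RtoC 0) by (unfold p; ring).
    unfold Cexp, cis. simpl. rewrite exp_0, cos_0, sin_0. change (1, 0) with (RtoC 1). ring. }
  assert (I := CInt_bound (fun t => Cexp (RtoC N * p (cis t)) * g (cis t))%C 0 (2 * PI) (exp (- N / 4) * M) ltac:(lra)
   (fun t _ => disc_circle_Ccont _ t (HE N))).
  rewrite D, Cmod_mult, Cmod_R, Rabs_pos_eq in I by lra. apply I. intros t _.
  rewrite Cmod_mult, Cmod_Cexp. destruct (Rle_dec (Im (cis t)) (- e)) as [L|L].
  - unfold g at 1. destruct Rle_dec; [|tauto]. rewrite Cmod_0, Rmult_0_r.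
   apply Rmult_le_pos; [apply Rlt_le, exp_pos|exact HM].
  - apply Rmult_le_compat; [apply Rlt_le, exp_pos|apply Cmod_ge_0| |apply B].
   assert (Le : forall a b, a <= b -> exp a <= exp b) by (intros a b [Q| ->]; [left; now apply exp_increasing|lra]).
   apply Le. unfold p, cis, RtoC, Ci, Re in *; simpl in *.
   generalize (sin2_cos2 t) (SIN_bound t). unfold Rsqr. intros S1 S2.
   assert (K : - sin t - / 2 * (cos t * cos t - sin t * sin t) <= - / 4) by nra. nra. }
 apply NNPP. intros X. assert (Q : 0 < Cmod (q 0)) by (now apply Cmod_gt_0).
 (* With this exponent the bound contradicts [exp t >= 1 + t] at [t = N / 4]. *)
 set (N := 4 * (2 * M / Cmod (q 0))).
 assert (HN : 0 <= 2 * M / Cmod (q 0)) by (apply Rmult_le_pos; [lra|apply Rlt_le, Rinv_0_lt_compat, Q]).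
 specialize (E0 N ltac:(unfold N; lra)).
 assert (E1 := exp_ineq1_le (N / 4)).
 replace (- N / 4) with (- (N / 4)) in E0 by field. rewrite exp_Ropp in E0.
 assert (E2 : Cmod (q 0) * exp (N / 4) <= 2 * M).
 { apply Rmult_le_reg_l with (2 * PI); [lra|].
  apply Rmult_le_compat_r with (r := exp (N / 4)) in E0; [|apply Rlt_le, exp_pos].
  replace (2 * (2 * PI - 0) * (/ exp (N / 4) * M) * exp (N / 4)) with (2 * PI * (2 * M)) in E0
   by (field; apply Rgt_not_eq, exp_pos). lra. }
 assert (E3 : Cmod (q 0) * (1 + N / 4) = Cmod (q 0) + 2 * M) by (unfold N; field; lra).
 nra.
Qed.

(** Rescaling by [rho], with a sign that reflects the lower half plane, turns the real axis into the
    line at height [- |Im c| / rho]; the factor 8 keeps it within the range of [half_disc_zero]. *)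
Lemma real_axis_unique (h : C -> C) c rho : 0 < rho -> (forall w, Cmod (w - c) < 2 * rho -> exists d, WD h w d 0) ->
 (forall x, Cmod (RtoC x - c) < 2 * rho -> h (RtoC x) = 0) -> 8 * Rabs (Im c) <= rho -> h c = 0.
Proof. intros Hr Hh Hz Hc.
 assert (K : exists s, Rabs s = rho /\ Im c = s * (Rabs (Im c) / rho)).
 { destruct (Rle_lt_dec 0 (Im c)).
  - exists rho. rewrite !Rabs_pos_eq by lra. split; [auto|field; lra].
  - exists (- rho). rewrite Rabs_Ropp, Rabs_pos_eq, Rabs_left by lra. split; [auto|field; lra]. }
 destruct K as [s [Hs E]].
 assert (L : forall l, Cmod l < 2 -> Cmod (c + RtoC s * l - c) < 2 * rho).
 { intros l Hl. replace (c + RtoC s * l - c)%C with (RtoC s * l)%C by ring.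
  rewrite Cmod_mult, Cmod_R, Hs. nra. }
 replace (h c) with (h (c + RtoC s * 0)%C) by (f_equal; ring).
 apply (half_disc_zero (fun l => h (c + RtoC s * l)%C) (Rabs (Im c) / rho)).
 - split; [apply Rmult_le_pos; [apply Rabs_pos|apply Rlt_le, Rinv_0_lt_compat, Hr]|].
  apply Rmult_le_reg_r with rho; auto. unfold Rdiv at 1. rewrite Rmult_assoc, Rinv_l; lra.
 - intros l Hl. destruct (Hh _ (L l Hl)) as [d Hd]. eexists. apply WD_comp_hol; [exact Hd|].
  eapply WD_eq; [apply WD_plus; [apply WD_const|apply WD_scal, WD_id]|reflexivity|ring].
 - intros l Hl HI.
  replace (c + RtoC s * l)%C with (RtoC (Re c + s * Re l)).
  + apply Hz.
   replace (RtoC (Re c + s * Re l)) with (c + RtoC s * l)%C; auto.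
   destruct c, l; unfold RtoC, Cplus, Cmult, Re, Im in *; simpl in *; f_equal; [ring|nra].
  + destruct c, l; unfold RtoC, Cplus, Cmult, Re, Im in *; simpl in *; f_equal; [ring|nra].
Qed.

(** * The potential along the curve *)

(** Terms free of [conj z] and of [l]: the Taylor series of a function of a real variable, continued
    to complex [z]. *)
Definition QR (b : bool) (N : nat) (t : term) : Prop :=
 (tm t = N /\ tn t = 0 /\ ta t = 0 /\ tb t = 0)%nat.

Lemma sum_n_C_R (u : nat -> C) n :
 @sum_n C_R_NormedModule u n = (sum_n (fun k => Re (u k)) n, sum_n (fun k => Im (u k)) n).
Proof. induction n as [|n IH].
 - destruct (u 0%nat); reflexivity.
 - rewrite !sum_Sn, IH. reflexivity.
Qed.

Lemma is_series_C_R (u : nat -> C) (s : C) : @is_series R_AbsRing C_R_NormedModule u s ->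
 is_series (fun k => Re (u k)) (Re s) /\ is_series (fun k => Im (u k)) (Im s).
Proof. destruct s as [a b]. split.
 -
  apply (filterlim_comp _ _ _ (fun n => (sum_n (fun k => Re (u k)) n, sum_n (fun k => Im (u k)) n)) fst _ (locally ((a, b) : prod_UniformSpace R_UniformSpace R_UniformSpace))).
  + eapply filterlim_ext; [|exact H]. apply sum_n_C_R.
  + apply (@continuous_fst R_UniformSpace R_UniformSpace a b).
 -
  apply (filterlim_comp _ _ _ (fun n => (sum_n (fun k => Re (u k)) n, sum_n (fun k => Im (u k)) n)) snd _ (locally ((a, b) : prod_UniformSpace R_UniformSpace R_UniformSpace))).
  + eapply filterlim_ext; [|exact H]. apply sum_n_C_R.
  + apply (@continuous_snd R_UniformSpace R_UniformSpace a b).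
Qed.

Lemma series_terms_bounded (u : nat -> R) s : is_series u s -> exists M, forall n, Rabs (u n) <= M.
Proof. intros H. destruct (filterlim_bounded _ (ex_intro _ 0 (ex_series_lim_0 _ (ex_intro _ _ H)))) as [M HM].
 exists M. intros n. apply (HM n).
Qed.

Definition pser (c : nat -> C) : ser := fun N => [Term (c N) N 0 0 0].

(** Convergence at the real point [s] bounds the terms there, which is all that [radius_ge] asks;
    absolute convergence at complex points follows. *)
Lemma pseries_pser (c : nat -> C) r (g : R -> C) : 0 < r ->
 (forall t, Rabs t < r -> @is_pseries R_AbsRing C_R_NormedModule c t (g t)) ->
 wf r (pser c) /\ (forall t, Rabs t < r -> g t = sval (pser c) (RtoC t) 1).
Proof. intros Hr H.
 assert (Tm : forall t k, @scal R_AbsRing C_R_ModuleSpace (pow_n t k) (c k) = (RtoC (t ^ k) * c k)%C).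
 { intros t k. rewrite pow_n_pow. unfold RtoC, Cmult; simpl.
  unfold scal; simpl. unfold prod_scal, scal; simpl. unfold mult; simpl. f_equal; ring. }
 assert (S : forall t, Rabs t < r -> is_series (fun k => Re (RtoC (t ^ k) * c k)%C) (Re (g t)) /\
   is_series (fun k => Im (RtoC (t ^ k) * c k)%C) (Im (g t))).
 { intros t Ht. apply is_series_C_R. specialize (H t Ht).
  eapply is_series_ext; [|exact H]. apply Tm. }
 split.
 - split.
  + exists 0%nat. constructor; [simpl; lia|constructor].
  + intros s Hs. destruct (S s) as [S1 S2]; [rewrite Rabs_pos_eq; lra|].
   destruct (series_terms_bounded _ _ S1) as [M1 H1]. destruct (series_terms_bounded _ _ S2) as [M2 H2].
   exists (M1 + M2). intros N. specialize (H1 N). specialize (H2 N). simpl. rewrite Rplus_0_r.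
   replace (Cmod (c N) * s ^ N) with (Cmod (RtoC (s ^ N) * c N)%C).
   * reim. lra.
   * rewrite Cmod_mult, Cmod_R, Rabs_pos_eq by (apply pow_le; lra). ring.
 - intros t Ht. destruct (S t Ht) as [S1 S2].
  assert (Pv : forall n, pval (pser c n) (RtoC t) 1 = (RtoC (t ^ n) * c n)%C).
  { intros n. unfold pser, pval, fold_right, tval, mono. cbn [tc tm tn ta tb]. rewrite RtoC_pow. ring. }
  apply injective_projections.
  + change (fst (g t)) with (Re (g t)). rewrite <- (is_series_unique _ _ S1). apply Series_ext. intros n.
   now rewrite Pv.
  + change (snd (g t)) with (Im (g t)). rewrite <- (is_series_unique _ _ S2). apply Series_ext. intros n.
   now rewrite Pv.
Qed.

Definition anM (x : R) (G : R -> M2) (S : smat) (r : R) : Prop :=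
 0 < r /\ mwf r S /\ (forall N, gall QR S N) /\ forall t, Rabs t < r -> G (x + t) = mval S (RtoC t) 1.

Lemma anM_mono x G S r r' : anM x G S r -> 0 < r' <= r -> anM x G S r'.
Proof. intros [H1 [H2 [H3 H4]]] Hr. split; [lra|split; [|split; [exact H3|]]].
 - apply (mwf_mono r r' S ltac:(lra) H2).
 - intros t Ht. apply H4. lra.
Qed.

Lemma real_analytic_anM J G x : real_analytic_on J G -> J x -> exists S r, anM x G S r.
Proof. intros H Hx.
 assert (E : forall i j, exists c r, 0 < r /\ wf r (pser c) /\
   forall t, Rabs t < r -> ent (G (x + t)) i j = sval (pser c) (RtoC t) 1).
 { intros i j. destruct (H x Hx i j) as [c [r [Hr Hc]]]. exists c, r. split; auto.
  apply (pseries_pser c r (fun t => ent (G (x + t)) i j) Hr). intros t Ht.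
  specialize (Hc (x + t)). replace (x + t - x) with t in Hc by ring. now apply Hc. }
 destruct (E 0%nat 0%nat) as [c1 [r1 [R1 [W1 E1]]]]. destruct (E 0%nat 1%nat) as [c2 [r2 [R2 [W2 E2]]]].
 destruct (E 1%nat 0%nat) as [c3 [r3 [R3 [W3 E3]]]]. destruct (E 1%nat 1%nat) as [c4 [r4 [R4 [W4 E4]]]].
 set (r := Rmin (Rmin r1 r2) (Rmin r3 r4)).
 assert (L : 0 < r /\ r <= r1 /\ r <= r2 /\ r <= r3 /\ r <= r4).
 { unfold r. generalize (Rmin_l (Rmin r1 r2) (Rmin r3 r4)) (Rmin_r (Rmin r1 r2) (Rmin r3 r4))
   (Rmin_l r1 r2) (Rmin_r r1 r2) (Rmin_l r3 r4) (Rmin_r r3 r4).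
  repeat split; try lra. repeat apply Rmin_glb_lt; auto. }
 exists (SM (pser c1) (pser c2) (pser c3) (pser c4)), r.
 split; [apply L|split; [|split]].
 - split; [|split; [|split]]; simpl; [apply (wf_mono r1)|apply (wf_mono r2)|apply (wf_mono r3)|apply (wf_mono r4)];
   auto; apply L.
 - repeat split; simpl; repeat constructor.
 - intros t Ht. rewrite (mat2_eta (G (x + t))), E1, E2, E3, E4 by lra. reflexivity.
Qed.

Lemma gall_QR_smm S T : (forall N, gall QR S N) -> (forall N, gall QR T N) -> forall N, gall QR (smm S T) N.
Proof. intros HS HT N. apply (gall_smm QR QR QR); auto.
 unfold QR, tmul; simpl; intros; lia.
Qed.

Lemma gall_QR_smap f S : (forall h, (forall N, Forall (QR true N) (h N)) -> forall N, Forall (QR true N) (f h N)) ->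
 (forall N, gall QR S N) -> forall N, gall QR (smap f S) N.
Proof. intros Hf H N. repeat split; simpl; apply Hf; intros n; apply (H n). Qed.

Lemma QR_sscal c h : (forall N, Forall (QR true N) (h N)) -> forall N, Forall (QR true N) (sscal c h N).
Proof. intros H N. unfold sscal. rewrite Forall_map. eapply Forall_impl; [|apply (H N)]. auto. Qed.

Lemma gall_QR_smadj S : (forall N, gall QR S N) -> forall N, gall QR (smadj S) N.
Proof. repeat split; try (apply (H N)); apply QR_sscal; intros n; apply (H n).
Qed.

Lemma QR_sdz h : (forall N, Forall (QR true N) (h N)) -> forall N, Forall (QR true N) (sdz h N).
Proof. intros H N. unfold sdz. rewrite Forall_flat_map. eapply Forall_impl; [|apply (H (S N))].
 intros t [E1 [E2 [E3 E4]]]. unfold tdz. rewrite E1. constructor; [|constructor]. repeat split; simpl; auto.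
Qed.

Lemma anM_mmul x F G S T r : anM x F S r -> anM x G T r -> anM x (fun s => F s ** G s)%M2 (smm S T) r.
Proof.
 intros [H1 [H2 [H3 H4]]] [_ [K2 [K3 K4]]]. split; [auto|split; [now apply mwf_smm|split; [now apply gall_QR_smm|]]].
 intros t Ht. rewrite H4, K4 by auto. symmetry. apply (mval_smm r); auto; [rewrite Cmod_R; auto|rewrite Cmod_1; lra].
Qed.

Lemma anM_minv x F S r : anM x F S r -> anM x (fun s => minv (F s)) (smadj S) r.
Proof. intros [H1 [H2 [H3 H4]]]. split; [auto|split; [now apply mwf_smadj|split; [now apply gall_QR_smadj|]]].
 intros t Ht. rewrite H4 by auto. symmetry. apply (mval_smadj r); auto; [rewrite Cmod_R; auto|rewrite Cmod_1; lra].
Qed.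

Lemma RD_shift x t : RD (fun s => RtoC (s - x)) t 1.
Proof. split; simpl; auto_derive; auto. Qed.

Lemma gall_tn0 (Q : bool -> nat -> term -> Prop) S z l : (forall N, gall Q S N) ->
 (forall b N t, Q b N t -> tn t = 0%nat) -> mval (smap sdw S) z l = mzero.
Proof. intros H K. unfold mval, smap; simpl. rewrite mzero_mat2.
 f_equal; apply sdw_0; intros N; (eapply Forall_impl; [|apply (H N)]); simpl; intros t; apply K.
Qed.

Lemma mval_RDM_real r S x t l : mwf r S -> (forall z, mval (smap sdw S) z l = mzero) -> Cmod (RtoC t) < r ->
 Cmod l <= 1 -> RDM (fun s => mval S (RtoC (s - x)) l) (x + t) (mval (smap sdz S) (RtoC t) l).
Proof. intros H K Ht Hl i j.
 assert (W := mval_WDM r S (RtoC t) l H Ht Hl i j). rewrite K in W.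
 assert (E0 : forall i j, ent mzero i j = 0).
 { apply (ent_cases (fun e => e mzero = 0)); rewrite ?mzero_mat2; ents; reflexivity. }
 rewrite E0 in W.
 assert (R := RD_WD_comp (fun w => ent (mval S w l) i j) (fun s => RtoC (s - x)) (x + t)
  (ent (mval (smap sdz S) (RtoC t) l) i j) 0 1).
 eapply RD_eq; [apply R|ring]; [|apply RD_shift]. replace (x + t - x) with t by ring. exact W.
Qed.

Lemma anM_RDM x G S r t : anM x G S r -> Rabs t < r -> RDM G (x + t) (mval (smap sdz S) (RtoC t) 1).
Proof. intros [H1 [H2 [H3 H4]]] Ht.
 apply (RDM_ext_loc (fun s => mval S (RtoC (s - x)) 1) _ _ _ (r - Rabs t)); [lra| |].
 - intros s Hs. replace s with (x + (s - x)) at 2 by ring. symmetry. apply H4.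
  replace (s - x) with ((s - (x + t)) + t) by ring. eapply Rle_lt_trans; [apply Rabs_triang|lra].
 - apply (mval_RDM_real r); auto; [|rewrite Cmod_R; auto|rewrite Cmod_1; lra].
  intros z. apply (gall_tn0 QR); auto. unfold QR; intros; lia.
Qed.

Lemma anM_deriv x G S r : anM x G S r -> anM x (Mderive G) (smap sdz S) r.
Proof. split; [apply H|split; [|split]].
 - apply mwf_smap; [apply wf_sdz|apply H].
 - apply gall_QR_smap; [apply QR_sdz|apply H].
 - intros t Ht. apply Mderive_RDM, (anM_RDM x G S r); auto.
Qed.

Lemma sval_QR_l h z l : (forall N, Forall (QR true N) (h N)) -> sval h z l = sval h z 1.
Proof. intros H. apply CSer_ext. intros N. specialize (H N). induction H as [|t p [_ [_ [Ha Hb]]] _ IH]; simpl; auto.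
 rewrite IH. unfold tval. rewrite Ha, Hb. reflexivity.
Qed.

Lemma su2_logder (J : R -> Prop) (F : R -> M2) x D e : 0 < e -> (forall s, Rabs (s - x) < e -> J s) ->
 (forall s, J s -> is_SU2 (F s)) -> RDM F x D ->
 mtrace (minv (F x) ** D)%M2 = 0 /\ ent (minv (F x) ** D)%M2 1 0 = (- Cconj (ent (minv (F x) ** D)%M2 0 1))%C.
Proof. intros He HJ HF HD.
 (* Extended by the identity off [J], since [unitary_log_derivative] speaks of curves that are
    unitary at all times. *)
 set (G := fun s => if excluded_middle_informative (J s) then minv (F s) else mone).
 assert (Jx : J x) by (apply HJ; rewrite Rminus_diag, Rabs_R0; auto).
 assert (GS : forall s, is_SU2 (G s)).
 { intros s. unfold G. destruct excluded_middle_informative; [apply is_SU2_minv; auto|apply is_SU2_mone]. }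
 assert (GD : RDM G x (minv D)).
 { apply (RDM_ext_loc (fun s => minv (F s)) _ _ _ e He); [|now apply RDM_minv].
  intros s Hs. unfold G. destruct excluded_middle_informative as [_|N]; auto. now destruct N; apply HJ. }
 destruct (unitary_log_derivative G x (minv D) GS GD) as [K1 K2].
 assert (Gx : G x = minv (F x)). { unfold G. destruct excluded_middle_informative; tauto. }
 rewrite Gx, minv_invol in K1, K2.
 assert (E : (minv D ** F x)%M2 = minv (minv (F x) ** D)%M2) by (rewrite minv_mmul, minv_invol; reflexivity).
 rewrite E in K1, K2. set (w := (minv (F x) ** D)%M2) in *.
 unfold minv, mtrace in K1, K2. rewrite mdagger_eta, mscal_eta in K1.
 revert K1 K2. ents. intros K1 K2. apply mat2_inj in K1. destruct K1 as [_ [K1 _]].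
 unfold mtrace. split.
 - rewrite <- K2. ring.
 - apply Cminus_eq_0.
  assert (K3 : (Cconj (- ent w 1 0) - - (1) * - ent w 0 1 = 0)%C) by (rewrite K1; ring).
  apply (f_equal Cconj) in K3. unfold Cminus in K3.
  rewrite !Cconj_plus, !Cconj_opp, Cconj_mult, !Cconj_opp, Cconj_conj, !Cconj_RtoC in K3.
  transitivity (- (- ent w 1 0 + - (- (1) * - Cconj (ent w 0 1))))%C; [ring|rewrite K3; ring].
Qed.

Lemma open_interval_nbhd J x : is_open_interval J -> J x -> exists e, 0 < e /\ forall s, Rabs (s - x) < e -> J s.
Proof. intros [a [b HJ]] Hx. apply HJ in Hx. destruct Hx as [Ha Hb].
 assert (A : exists e, 0 < e /\ forall s, Rabs (s - x) < e -> Rbar_lt a s).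
 { destruct a as [a| |]; simpl in Ha; try tauto.
  - exists (x - a). split; [lra|]. intros s Hs. simpl. apply Rabs_def2 in Hs. lra.
  - exists 1. split; [lra|]. intros s _. exact I. }
 assert (B : exists e, 0 < e /\ forall s, Rabs (s - x) < e -> Rbar_lt s b).
 { destruct b as [b| |]; simpl in Hb; try tauto.
  - exists (b - x). split; [lra|]. intros s Hs. simpl. apply Rabs_def2 in Hs. lra.
  - exists 1. split; [lra|]. intros s _. exact I. }
 destruct A as [e1 [He1 A]], B as [e2 [He2 B]]. exists (Rmin e1 e2). split; [now apply Rmin_glb_lt|]. generalize (Rmin_l e1 e2) (Rmin_r e1 e2). intros. apply HJ. split; [apply A|apply B]; lra.
Qed.

Lemma open_interval_convex J a b s : is_open_interval J -> J a -> J b -> Rmin a b <= s <= Rmax a b -> J s.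
Proof. intros [p [q HJ]] Ha Hb Hs. apply HJ in Ha, Hb. apply HJ.
 assert (L : Rbar_lt p (Rmin a b)) by (unfold Rmin; destruct Rle_dec; tauto).
 assert (M : Rbar_lt (Rmax a b) q) by (unfold Rmax; destruct Rle_dec; tauto).
 split; [eapply Rbar_lt_le_trans; [exact L|simpl; lra]|eapply Rbar_le_lt_trans; [|exact M]; simpl; lra].
Qed.

(* [w] stands for [F_0^-1 F_0'] and [g] for [F_0^-1 f_0' F_0 = 2 e^u e_1]. *)
Definition Apot (H : R) (w g : smat) : smat :=
 let Heu := sscal (RtoC H * (Ci / RtoC 2))%C (s12 g) in
 SM (s11 w)
   (sadd (smul slb (sscal (RtoC (-1)) Heu)) (smul sla (sadd (s12 w) Heu)))
   (sadd (smul slb (sadd (s21 w) (sscal (RtoC (-1)) Heu))) (smul sla Heu))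
   (sscal (RtoC (-1)) (s11 w)).

(** [H e^u] continued analytically: the upper right entry of [2 e^u e1] is [- 2 i e^u]. Reading
    [e^u] off the rotated tangent avoids the logarithm and the norm in the definition of [u]. *)
Definition Heu_of (H : R) (g : smat) (z : C) : C := (RtoC H * (Ci / RtoC 2) * sval (s12 g) z 1)%C.
(** Along [J] one has [w_21 = - conj b], so [s21 w] continues the antiholomorphic expression
    analytically, and the lower left entry is [Q e^-u / 2]. *)
Definition Am1_of (H : R) (w g : smat) (z : C) : M2 :=
 mat2 0 (- Heu_of H g z) (sval (s21 w) z 1 - Heu_of H g z) 0.
Definition A0_of (w : smat) (z : C) : M2 := mat2 (sval (s11 w) z 1) 0 0 (- sval (s11 w) z 1).
Definition A1_of (H : R) (w g : smat) (z : C) : M2 :=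
 mat2 0 (sval (s12 w) z 1 + Heu_of H g z) (Heu_of H g z) 0.

Lemma Apot_mwf r H w g : mwf r w -> mwf r g -> mwf r (Apot H w g).
Proof. intros [A [B [D E]]] [A' [B' [D' E']]].
 split; [exact A|split; [|split]]; simpl.
 - apply wf_sadd; apply wf_smul; auto using wf_sla, wf_slb, wf_sscal, wf_sadd.
 - apply wf_sadd; apply wf_smul; auto using wf_sla, wf_slb, wf_sscal, wf_sadd.
 - apply wf_sscal; auto.
Qed.

Lemma Apot_mval r H w g z l : mwf r w -> mwf r g -> (forall N, gall QR w N) -> (forall N, gall QR g N) ->
 Cmod z < r -> Cmod l <= 1 ->
 mval (Apot H w g) z l = (Cconj l *: Am1_of H w g z + A0_of w z + l *: A1_of H w g z)%M2.
Proof. intros Hw Hg Qw Qg Hz Hl. assert (Hw' := Hw). assert (Hg' := Hg).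
 destruct Hw' as [A [B [D E]]], Hg' as [A' [B' [D' E']]].
 assert (W := wf_sscal r (RtoC H * (Ci / RtoC 2))%C _ B').
 assert (W2 := wf_sscal r (RtoC (-1)) _ W).
 unfold mval, Apot, Am1_of, A0_of, A1_of, Heu_of. cbn [s11 s12 s21 s22].
 rewrite !(sval_sadd r) by auto using wf_smul, wf_sla, wf_slb, wf_sadd.
 rewrite !(sval_smul r) by auto using wf_sla, wf_slb, wf_sadd.
 rewrite !(sval_sadd r) by auto. rewrite !(sval_sscal r) by auto.
 rewrite (sval_sla z l r), (sval_slb z l r) by auto.
 rewrite (sval_QR_l (s12 g) z l), (sval_QR_l (s11 w) z l), (sval_QR_l (s12 w) z l), (sval_QR_l (s21 w) z l)
  by (intros N; apply Qg || apply Qw).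
 rewrite !mscal_mat2, !madd_mat2, RtoC_m1. f_equal; ring.
Qed.

Lemma Apot_QA H w g : (forall N, gall QR w N) -> (forall N, gall QR g N) -> forall N, gall QA (Apot H w g) N.
Proof. intros Qw Qg N.
 assert (T : forall N t, QR true N t -> QA true N t) by (unfold QR, QA; intros n t [E1 [E2 [E3 E4]]]; rewrite E3, E4; simpl; auto with arith).
 assert (W := QR_sscal (RtoC H * (Ci / RtoC 2))%C (s12 g) (fun n => proj1 (proj2 (Qg n)))).
 assert (W2 := QR_sscal (RtoC (-1)) _ W).
 assert (P1 : forall h, (forall N, Forall (QR true N) (h N)) -> Forall (QA false N) (smul slb h N)).
 { intros h Hh. apply (Forall_smul (fun n t => n = 0%nat /\ t = Term 1 0 0 0 1) (QR true)); auto.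
  - intros [|n]; simpl; [constructor; [auto|constructor]|constructor].
  - intros i j t u [-> ->] [E1 [E2 [E3 E4]]]. unfold QA, tmul; simpl. rewrite E3, E4. repeat split; lia. }
 assert (P2 : forall h, (forall N, Forall (QR true N) (h N)) -> Forall (QA false N) (smul sla h N)).
 { intros h Hh. apply (Forall_smul (fun n t => n = 0%nat /\ t = Term 1 0 0 1 0) (QR true)); auto.
  - intros [|n]; simpl; [constructor; [auto|constructor]|constructor].
  - intros i j t u [-> ->] [E1 [E2 [E3 E4]]]. unfold QA, tmul; simpl. rewrite E3, E4. repeat split; lia. }
 assert (Ad : forall h k, (forall N, Forall (QR true N) (h N)) -> (forall N, Forall (QR true N) (k N)) ->
   forall N, Forall (QR true N) (sadd h k N)) by (intros h k Hh Hk n; apply Forall_app; auto). split; [|split; [|split]].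
 - eapply Forall_impl; [apply T|apply (Qw N)].
 - apply Forall_app; split; [apply P1|apply P2]; auto. apply Ad; auto. intros n; apply (Qw n).
 - apply Forall_app; split; [apply P1|apply P2]; auto. apply Ad; auto. intros n; apply (Qw n).
 - eapply Forall_impl; [apply T|]. apply QR_sscal. intros n; apply (Qw n).
Qed.

(** Two solutions of one linear equation differ by a constant left factor; for a trace free
    coefficient [minv] turns the sign as an inverse does. *)
Lemma ode_quotient (F G alpha : R -> M2) a b :
 (forall s, Rmin a b <= s <= Rmax a b ->
   RDM F s (F s ** alpha s)%M2 /\ RDM G s (G s ** alpha s)%M2 /\ mtrace (alpha s) = 0) ->
 (F a ** minv (G a))%M2 = (F b ** minv (G b))%M2.
Proof. intros H.
 assert (K : forall i j, ent (F a ** minv (G a))%M2 i j = ent (F b ** minv (G b))%M2 i j).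
 { intros i j. apply (RD_zero_const (fun s => ent (F s ** minv (G s))%M2 i j)).
  intros s Hs. destruct (H s Hs) as [H1 [H2 H3]].
  assert (V := RDM_mmul _ _ _ _ _ H1 (RDM_minv _ _ _ H2)).
  eapply RD_eq; [apply (V i j)|].
  rewrite minv_mmul, (minv_traceless _ H3), mmul_mscal_l, mmul_mscal_r, !mmul_assoc. rewrite madd_eta, mscal_eta, RtoC_m1. apply (ent_cases (fun e => e (mat2 _ _ _ _) = 0)); ents; ring. }
 apply M2_ext; apply K.
Qed.

Lemma logder_eq (F D A : M2) : mdet F = 1%C -> (minv F ** D)%M2 = A -> D = (F ** A)%M2.
Proof. intros H <-. rewrite mmul_assoc, mmul_minv_r, mmul_1_l by auto. reflexivity. Qed.

Lemma frame_tangent (F X : M2) (c : R) : mdet F = 1%C -> c <> 0 -> Ad F e1 = (RtoC (/ c) *: X)%M2 ->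
 (minv F ** X ** F)%M2 = (RtoC c *: e1)%M2.
Proof. intros HF Hc E. assert (E2 : X = (RtoC c *: Ad F e1)%M2).
 { rewrite E, mscal_mscal, <- RtoC_mult, Rinv_r, mscal_1 by auto. reflexivity. }
 rewrite E2. unfold Ad. rewrite mmul_mscal_r, mmul_mscal_l, !mmul_assoc, mmul_minv_l, mmul_1_l by auto.
 rewrite <- !mmul_assoc, mmul_minv_l, mmul_1_r by auto. reflexivity.
Qed.

(** Inserting [Q] cancels [e^u] against [e^-u], and on the circle [/ l] is [conj l], the form in
    which the series are written. *)
Lemma alpha0_eq f0 H F0 x l : Cmod l = 1 ->
 let w := (minv (F0 x) ** Mderive F0 x)%M2 in
 let h := (RtoC H * RtoC (exp (curve_u f0 x)))%C in
 alpha0 f0 H F0 x l =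
 mat2 (ent w 0 0) (Cconj l * - h + l * (ent w 0 1 + h))
  (Cconj l * - (Cconj (ent w 0 1) + h) + l * h) (- ent w 0 0).
Proof. intros Hl w h. unfold alpha0. fold w. rewrite circle_inv by auto.
 assert (E : (RtoC (exp (curve_u f0 x)) * RtoC (exp (- curve_u f0 x)))%C = 1).
 { rewrite <- RtoC_mult, <- exp_plus, Rplus_opp_r, exp_0. reflexivity. } set (eu := RtoC (exp (curve_u f0 x))) in *. set (em := RtoC (exp (- curve_u f0 x))) in *.
 assert (E2 : (RtoC (/ 2) * RtoC 2 = 1)%C) by (rewrite <- RtoC_mult; f_equal; field).
 assert (Ceu : Cconj eu = eu) by apply Cconj_RtoC.
 rewrite !Cconj_mult, Cconj_opp, Cconj_plus, Cconj_mult, Cconj_conj, Ceu, !Cconj_RtoC.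
 assert (K : forall q x : C, (q = eu * x * RtoC 2 -> RtoC (/ 2) * q * em = x)%C).
 { intros q y ->. transitivity (y * (eu * em) * (RtoC (/ 2) * RtoC 2))%C; [ring|rewrite E, E2; ring]. }
 f_equal.
 - transitivity (Cconj l * - (RtoC H * eu) + l * (RtoC (/ 2) * (RtoC 2 * eu * (ent w 0 1 + RtoC H * eu)) * em))%C; [ring|].
  rewrite (K _ (ent w 0 1 + RtoC H * eu)%C) by ring. reflexivity.
 - transitivity (Cconj l * - (RtoC (/ 2) * (RtoC 2 * eu * (Cconj (ent w 0 1) + RtoC H * eu)) * em) + l * (RtoC H * eu))%C; [ring|].
  rewrite (K _ (Cconj (ent w 0 1) + RtoC H * eu)%C) by ring. reflexivity.
Qed.

(** The data of one chart of the holomorphic extension, centred at [x1]. *)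
Definition pkg (J : R -> Prop) (f0 : R -> M2) (H : R) (F0 : R -> M2) (Fhat0 : R -> Loop) (x1 : R)
  (w g : smat) (r : R) : Prop :=
 good r (Apot H w g) /\ (mwf r w /\ mwf r g /\ (forall N, gall QR w N) /\ (forall N, gall QR g N)) /\
 (forall t, Rabs t < r -> J (x1 + t)) /\
 (forall z, Cmod z < r -> Heu_of H g z <> 0) /\
 (forall t, Rabs t < r -> Heu_of H g (RtoC t) = (RtoC H * RtoC (exp (curve_u f0 (x1 + t))))%C) /\
 (forall t l, Rabs t < r -> Cmod l = 1 -> Fhat0 (x1 + t) l = (Fhat0 x1 l ** mval (Psi (Apot H w g)) (RtoC t) l)%M2).

Lemma good_mono r r' A : good r A -> 0 < r' <= r -> good r' A.
Proof. intros [H1 [H2 [H3 [H4 [H5 H6]]]]] Hr.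
 split; [lra|split; [apply (mwf_mono r); [lra|auto]|split; [auto|split; [|split; (apply (mwf_mono r); [lra|auto])]]]].
 intros z l Hz. apply H4. lra.
Qed.

Definition local_data (J : R -> Prop) (f0 v : R -> M2) (H x0 : R) (Fhat0 : R -> Loop) (F0 : R -> M2) : Prop :=
 is_open_interval J /\ real_analytic_on J f0 /\ H <> 0 /\ J x0 /\ is_frame_along J f0 v x0 F0 /\
  (forall x : R, J x -> in_LambdaG (Fhat0 x)) /\
  (forall (x : R) (l : C), J x -> on_circle l ->
    exists D : M2, is_Mderive (fun t => Fhat0 t l) x D /\
     (minv (Fhat0 x l) ** D)%M2 = alpha0 f0 H F0 x l) /\
  (forall l : C, on_circle l -> Fhat0 x0 l = mone).

Lemma frame_RDM J f0 v H x0 Fhat0 F0 x : local_data J f0 v H x0 Fhat0 F0 -> J x ->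
 let w := (minv (F0 x) ** Mderive F0 x)%M2 in
 RDM F0 x (Mderive F0 x) /\ mtrace w = 0 /\ ent w 1 0 = (- Cconj (ent w 0 1))%C.
Proof. intros [HJ [_ [_ [_ [[FA [FE _]] _]]]]] Hx.
 destruct (real_analytic_anM J F0 x FA Hx) as [S [r HS]].
 assert (D := anM_RDM x F0 S r 0 HS ltac:(rewrite Rabs_R0; apply HS)). rewrite Rplus_0_r in D.
 assert (E := Mderive_RDM _ _ _ D). rewrite <- E in D. split; auto.
 destruct (open_interval_nbhd J x HJ Hx) as [e [He HJe]].
 apply (su2_logder J F0 x _ e He HJe); auto. apply FE; auto.
Qed.

Lemma Fhat0_RDM J f0 v H x0 Fhat0 F0 x l : local_data J f0 v H x0 Fhat0 F0 -> J x -> Cmod l = 1 ->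
 RDM (fun t => Fhat0 t l) x (Fhat0 x l ** alpha0 f0 H F0 x l)%M2.
Proof. intros [_ [_ [_ [_ [_ [HG [HD _]]]]]]] Hx Hl. destruct (HD x l Hx Hl) as [D [D1 D2]].
 apply is_Mderive_RDM in D1. rewrite <- (logder_eq _ _ _ (proj1 (proj2 (proj2 (HG x Hx)) l Hl)) D2). exact D1.
Qed.

Lemma alpha0_trace f0 H F0 x l : mtrace (alpha0 f0 H F0 x l) = 0.
Proof. unfold alpha0. rewrite mtrace_mat2. ring. Qed.

(** At [l = 1] the terms with [H e^u] cancel and [alpha0] becomes [F0^-1 F0'], so both curves solve
    the same equation with value 1 at [x0]. *)
Lemma Fhat0_at_1 J f0 v H x0 Fhat0 F0 x : local_data J f0 v H x0 Fhat0 F0 -> J x -> Fhat0 x 1 = F0 x.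
Proof. intros L Hx. assert (L0 := L). destruct L0 as [HJ [_ [_ [Hx0 [[_ [FE F00]] [_ [_ H1]]]]]]].
 assert (Q := ode_quotient (fun s => Fhat0 s 1) F0 (fun s => alpha0 f0 H F0 s 1) x0 x).
 assert (E : (Fhat0 x0 1 ** minv (F0 x0))%M2 = (Fhat0 x 1 ** minv (F0 x))%M2).
 { apply Q. intros s Hs. assert (Js := open_interval_convex J _ _ _ HJ Hx0 Hx Hs).
  split; [|split; [|apply alpha0_trace]].
  - apply (Fhat0_RDM J f0 v H x0 Fhat0); auto. apply Cmod_1.
  - destruct (frame_RDM J f0 v H x0 Fhat0 F0 s L Js) as [D [T C10]].
   eapply RDM_eq; [exact D|]. apply logder_eq; [apply FE; auto|].
   rewrite alpha0_eq by apply Cmod_1. set (w := (minv (F0 s) ** Mderive F0 s)%M2) in *.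
   rewrite (mat2_eta w), C10. ents. rewrite Cconj_RtoC. unfold mtrace in T.
   f_equal; try ring. apply Cminus_eq_0. rewrite <- T. ring. }
 rewrite H1, F00 in E by apply Cmod_1. rewrite mmul_1_l in E.
 replace (minv mone) with mone in E by (rewrite mone_mat2, minv_mat2; f_equal; ring).
 assert (Dt : mdet (F0 x) = 1%C) by (apply FE; auto).
 rewrite <- (mmul_1_l (F0 x)), E, <- mmul_assoc, mmul_minv_l, mmul_1_r by auto. reflexivity.
Qed.

Lemma pkg_exists J f0 v H x0 Fhat0 F0 x1 : local_data J f0 v H x0 Fhat0 F0 -> J x1 ->
 exists w g r, pkg J f0 H F0 Fhat0 x1 w g r.
Proof. intros L Hx. assert (L0 := L). destruct L0 as [HJ [fA [HH [Hx0 [[FA [FE F00]] [HG [_ H1]]]]]]].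
 destruct (real_analytic_anM J F0 x1 FA Hx) as [S0 [r0 A0]].
 destruct (real_analytic_anM J f0 x1 fA Hx) as [Sf [rf Af]].
 destruct (open_interval_nbhd J x1 HJ Hx) as [e [He HJe]].
 set (r1 := Rmin e (Rmin r0 rf)).
 assert (Hr1 : 0 < r1 /\ r1 <= e /\ r1 <= r0 /\ r1 <= rf).
 { unfold r1. generalize (Rmin_l e (Rmin r0 rf)) (Rmin_r e (Rmin r0 rf)) (Rmin_l r0 rf) (Rmin_r r0 rf). repeat split; try lra. repeat apply Rmin_glb_lt; auto; [apply A0|apply Af]. }
 apply (anM_mono _ _ _ _ r1) in A0; [|lra]. apply (anM_mono _ _ _ _ r1) in Af; [|lra].
 set (w := smm (smadj S0) (smap sdz S0)). set (g := smm (smm (smadj S0) (smap sdz Sf)) S0).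
 assert (Aw : anM x1 (fun s => minv (F0 s) ** Mderive F0 s)%M2 w r1)
  by (apply anM_mmul; [now apply anM_minv|now apply anM_deriv]).
 assert (Ag : anM x1 (fun s => minv (F0 s) ** Mderive f0 s ** F0 s)%M2 g r1)
  by (apply (anM_mmul x1 (fun s => minv (F0 s) ** Mderive f0 s)%M2); auto; apply anM_mmul; [now apply anM_minv|now apply anM_deriv]).
 assert (JJ : forall t, Rabs t < r1 -> J (x1 + t)).
 { intros t Ht. apply HJe. replace (x1 + t - x1) with t by ring. lra. }
 assert (Eu : forall t, Rabs t < r1 -> Heu_of H g (RtoC t) = (RtoC H * RtoC (exp (curve_u f0 (x1 + t))))%C).
 { intros t Ht. destruct (FE _ (JJ t Ht)) as [SU [E1 _]]. rewrite exp_Ropp, <- Rinv_mult in E1.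
  apply frame_tangent in E1; [|apply SU|generalize (exp_pos (curve_u f0 (x1 + t))); lra].
  unfold Heu_of. replace (sval (s12 g) (RtoC t) 1) with (ent (mval g (RtoC t) 1) 0 1) by (unfold mval; ents; reflexivity).
  destruct Ag as [_ [_ [_ Eg]]]. rewrite <- (Eg t Ht), E1. unfold e1. rewrite mscal_mat2. ents.
  rewrite RtoC_mult. transitivity (- (Ci * Ci) * (RtoC H * RtoC (exp (curve_u f0 (x1 + t)))))%C;
   [field; apply C2_neq_0|rewrite Ci_mult; ring]. }
 assert (Wf := Apot_mwf r1 H w g (proj1 (proj2 Aw)) (proj1 (proj2 Ag))).
 assert (QAA := Apot_QA H w g (proj1 (proj2 (proj2 Aw))) (proj1 (proj2 (proj2 Ag)))).
 assert (Mv := fun z l => Apot_mval r1 H w g z l (proj1 (proj2 Aw)) (proj1 (proj2 Ag))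
   (proj1 (proj2 (proj2 Aw))) (proj1 (proj2 (proj2 Ag)))).
 destruct (good_exists r1 (Apot H w g)) as [r2 [Hr2 G2]]; auto; [apply Hr1| |].
 { intros z l Hz Hl. rewrite Mv by auto. unfold Am1_of, A0_of, A1_of.
  rewrite !mscal_mat2, !madd_mat2, mtrace_mat2. ring. }
 (* [H e^u] is nonzero at the centre because [H] is, and it stays so nearby by continuity; this
    becomes the nonvanishing of the upper right entry of the coefficient of [/ l]. *)
 assert (Nz : exists d, 0 < d /\ forall z, Cmod z < d -> Heu_of H g z <> 0).
 { assert (W := sval_WD r1 (s12 g) 0 1 (proj1 (proj2 (proj1 (proj2 Ag)))) ltac:(rewrite Cmod_0; apply Hr1) ltac:(rewrite Cmod_1; lra)).
  assert (W2 := proj1 (continuous_C_eps (Heu_of H g) (RtoC 0)) (WD_continuous _ _ _ _ (WD_scal (RtoC H * (Ci / RtoC 2))%C _ _ _ _ W))).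
  clear W. rename W2 into W.
  assert (E0 := Eu 0 ltac:(rewrite Rabs_R0; apply Hr1)). rewrite Rplus_0_r, <- RtoC_mult in E0.
  assert (Pe := exp_pos (curve_u f0 x1)).
  assert (P : 0 < Cmod (Heu_of H g 0)).
  { rewrite E0, Cmod_R. apply Rabs_pos_lt. apply Rmult_integral_contrapositive; split; lra. }
  destruct (W _ P) as [d [Hd K]]. exists d. split; auto. intros z Hz E.
  specialize (K z ltac:(replace (z - 0)%C with z by ring; auto)).
  rewrite E in K.
  replace (0 - Heu_of H g 0)%C with (- Heu_of H g 0)%C in K by ring. rewrite Cmod_opp in K. lra. }
 destruct Nz as [d [Hd Nz]]. set (r := Rmin d r2).
 assert (Hr : 0 < r /\ r <= d /\ r <= r2).
 { unfold r. generalize (Rmin_l d r2) (Rmin_r d r2). repeat split; try lra. apply Rmin_glb_lt; lra. }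
 assert (G : good r (Apot H w g)) by (apply (good_mono r2); auto; lra).
 exists w, g, r. split; [exact G|split; [|split; [|split; [|split]]]].
 - split; [apply (mwf_mono r1); [lra|apply Aw]|split; [apply (mwf_mono r1); [lra|apply Ag]|split; [apply Aw|apply Ag]]].
 - intros t Ht. apply JJ. lra.
 - intros z Hz. apply Nz. lra.
 - intros t Ht. apply Eu. lra.
 - intros t l Ht Hl. set (A := Apot H w g) in *.
  (* On the real axis the potential is the given Maurer-Cartan form; [C10] identifies the lower left
     entry of [w] with [- conj b]. *)
  assert (Al : forall s, Rabs s < r -> mval A (RtoC s) l = alpha0 f0 H F0 (x1 + s) l).
  { intros s Hs. destruct (frame_RDM J f0 v H x0 Fhat0 F0 (x1 + s) L (JJ s ltac:(lra))) as [_ [T C10]]. rewrite Mv, alpha0_eq by (try rewrite Cmod_R; lra).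
   destruct Aw as [_ [_ [_ Ew]]]. rewrite (Ew s ltac:(lra)) in *. unfold mval in C10 |- *. revert C10; ents; intros C10.
   unfold Am1_of, A0_of, A1_of. rewrite (Eu s) by lra. rewrite C10.
   rewrite !mscal_mat2, !madd_mat2. f_equal; ring. }
  assert (Q := ode_quotient (fun s => Fhat0 s l) (fun s => mval (Psi A) (RtoC (s - x1)) l)
   (fun s => alpha0 f0 H F0 s l) x1 (x1 + t)).
  assert (Hl1 : Cmod l <= 1) by lra.
  assert (E : (Fhat0 x1 l ** minv (mval (Psi A) (RtoC (x1 - x1)%R) l))%M2 =
    (Fhat0 (x1 + t)%R l ** minv (mval (Psi A) (RtoC (x1 + t - x1)%R) l))%M2).
  { eapply eq_trans; [apply Q|reflexivity]. intros s Hs.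
   assert (Ls : Rabs (s - x1) < r).
   { eapply Rle_lt_trans; [|exact Ht].
    revert Hs. unfold Rmin, Rmax. destruct Rle_dec; unfold Rabs; repeat destruct Rcase_abs; lra. }
   assert (Js : J s) by (replace s with (x1 + (s - x1)) by ring; apply JJ; lra).
   split; [|split; [|apply alpha0_trace]].
   - apply (Fhat0_RDM J f0 v H x0 Fhat0); auto.
   - assert (V := mval_RDM_real r (Psi A) x1 (s - x1) l).
    replace (x1 + (s - x1)) with s in V by ring.
    eapply RDM_eq; [apply V; auto|].
    + apply G.
    + intros z. apply Psi_dw. apply G.
    + now rewrite Cmod_R.
    + rewrite (Psi_dz r); try apply G; auto; [|now rewrite Cmod_R].
     rewrite Al by auto. replace (x1 + (s - x1)) with s by ring. reflexivity. }
  rewrite Rminus_diag in E. replace (x1 + t - x1) with t in E by ring.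
  rewrite (Psi_0 r) in E by (apply G || auto).
  replace (minv mone) with mone in E by (rewrite mone_mat2, minv_mat2; f_equal; ring).
  rewrite mmul_1_r in E. rewrite E, <- mmul_assoc, mmul_minv_l, mmul_1_r; auto.
  apply (good_det r); auto. now rewrite Cmod_R.
Qed.

Lemma pkg_Psi_terms J f0 H F0 Fhat0 x w g r : pkg J f0 H F0 Fhat0 x w g r ->
 forall N, gall (fun _ N t => tm t = N /\ tn t = 0%nat) (Psi (Apot H w g)) N.
Proof. intros [G _] N. eapply gall_impl; [|apply gall_Psi; apply G]. intros b t Ht. split; apply Ht.
Qed.

Lemma WD_shift f z c a b : WD f (z - c)%C a b -> WD (fun u => f (u - c)%C) z a b.
Proof. intros H eps He. destruct (H eps He) as [d [Hd K]]. exists d. split; auto. intros h Hh.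
 replace (z + h - c)%C with (z - c + h)%C by ring. now apply K.
Qed.

Lemma mval_WDM_shift r S (z c : C) l : mwf r S -> Cmod (z - c)%C < r -> Cmod l <= 1 ->
 WDM (fun u => mval S (u - c)%C l) z (mval (smap sdz S) (z - c)%C l) (mval (smap sdw S) (z - c)%C l).
Proof. intros H Hz Hl i j. apply (WD_shift (fun u => ent (mval S u l) i j)). now apply (mval_WDM r).
Qed.

Lemma is_iwasawa_ext g g' F B : (forall l, Cmod l = 1 -> g l = g' l) -> is_iwasawa g F B -> is_iwasawa g' F B.
Proof. intros E [H1 [H2 H3]]. split; [auto|split; auto]. intros l Hl. rewrite <- E by auto. now apply H3. Qed.

(** * The surface *)

Definition vec3 (a b d : R) : M2 :=
 mat2 (RtoC d * Ci) (RtoC b - RtoC a * Ci) (- RtoC b - RtoC a * Ci) (- (RtoC d * Ci)).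

Lemma vec3_e a b d : vec3 a b d = (RtoC a *: e1 + RtoC b *: e2 + RtoC d *: e3)%M2.
Proof. unfold vec3, e1, e2, e3. rewrite !mscal_mat2, !madd_mat2, RtoC_m1. f_equal; ring. Qed.

Lemma inner_vec3 a b d a' b' d' : inner (vec3 a b d) (vec3 a' b' d') = a * a' + b * b' + d * d'.
Proof. unfold inner. unfold Re, RtoC, Ci, Cmult, Cminus, Cplus, Copp; simpl. field.
Qed.

Lemma vec3_add a b d a' b' d' : (vec3 a b d + vec3 a' b' d')%M2 = vec3 (a + a') (b + b') (d + d').
Proof. unfold vec3. rewrite madd_mat2, !RtoC_plus. f_equal; ring. Qed.

Lemma vec3_scal c a b d : (RtoC c *: vec3 a b d)%M2 = vec3 (c * a) (c * b) (c * d).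
Proof. unfold vec3. rewrite mscal_mat2, !RtoC_mult. f_equal; ring. Qed.

Lemma mzero_vec3 : mzero = vec3 0 0 0.
Proof. unfold vec3. rewrite mzero_mat2. f_equal; ring. Qed.

Lemma su2_vec3 X : is_su2 X -> exists a b d, X = vec3 a b d.
Proof. intros [H1 H2]. apply mat2_inj in H1. destruct H1 as [A [_ [B _]]].
 exists (- Im (ent X 0 1)), (Re (ent X 0 1)), (Im (ent X 0 0)). rewrite (mat2_eta X) at 1. unfold vec3, mtrace in *.
 assert (K : ent X 0 0 = (RtoC (Im (ent X 0 0)) * Ci)%C).
 { apply (f_equal Re) in A. revert A. destruct (ent X 0 0) as [x y]. unfold RtoC, Ci, Cmult, Cconj, Copp; simpl. intros.
  f_equal; lra. }
 f_equal.
 - exact K.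
 - destruct (ent X 0 1) as [x y]. unfold RtoC, Ci, Cmult, Cminus, Cplus, Copp; simpl. f_equal; ring.
 - transitivity (- Cconj (ent X 0 1))%C; [rewrite B; ring|]. destruct (ent X 0 1) as [x y].
  unfold RtoC, Ci, Cmult, Cminus, Cplus, Copp, Cconj; simpl. f_equal; ring.
 - rewrite <- K. apply Cminus_eq_0. rewrite <- H2. ring.
Qed.

Lemma RDM_exists (g : R -> M2) t : (forall i j, exists d, RD (fun s => ent (g s) i j) t d) -> RDM g t (Mderive g t).
Proof.
 intros H. destruct (H 0%nat 0%nat) as [a Ha], (H 0%nat 1%nat) as [b Hb], (H 1%nat 0%nat) as [c Hc], (H 1%nat 1%nat) as [d Hd].
 assert (D : RDM g t (mat2 a b c d)) by (apply RDM_entries; ents; auto).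
 now rewrite (Mderive_RDM _ _ _ D).
Qed.

Lemma smooth_loop_RDM (U : Loop) : smooth_loop U -> RDM (fun s => U (cis s)) 0 (Mderive (fun s => U (cis s)) 0).
Proof. intros H. apply RDM_exists. intros i j. destruct (proj1 (smooth_loop_iff U) H i j 1%nat) as [f' [K _]].
 exists (f' 0). apply K.
Qed.

Lemma sym_bobenko_eq H (g : Loop) : sym_bobenko H g =
 (RtoC (- / (2 * H)) *: (Ad (g 1) e3 + RtoC 2 *: (Mderive (fun s => g (cis s)) 0 ** minv (g 1))))%M2.
Proof. unfold sym_bobenko, loop_dlambda. rewrite cis_0, mmul_mscal_l, mscal_mscal. do 3 f_equal.
 assert (C := Ci_neq_0). field. auto.
Qed.

Lemma sym_bobenko_ext H (g g' : Loop) : (forall l, Cmod l = 1 -> g l = g' l) -> sym_bobenko H g = sym_bobenko H g'.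
Proof. intros E. rewrite !sym_bobenko_eq, (E 1%C) by apply Cmod_1.
 replace (fun s => g (cis s)) with (fun s => g' (cis s)); auto.
 apply functional_extensionality. symmetry. apply E, Cmod_cis.
Qed.

Lemma sym_bobenko_su2 H (g : Loop) : in_LambdaG g -> is_su2 (sym_bobenko H g).
Proof. intros [S [_ U]]. rewrite sym_bobenko_eq. apply is_su2_mscal, is_su2_madd.
 - apply is_su2_Ad; [apply U, Cmod_1|apply is_su2_e3].
 - apply is_su2_mscal.
  assert (K := unitary_log_derivative (fun s => g (cis s)) 0 _ (fun s => U _ (Cmod_cis s)) (smooth_loop_RDM g S)).
  cbv beta in K. now rewrite cis_0 in K.
Qed.

(** The translation part of the rigid motion caused by multiplying the frame from the left by the
    loop [U]. *)
Definition Kc (H : R) (U : Loop) : M2 := (RtoC (- / H) *: (Mderive (fun s => U (cis s)) 0 ** minv (U 1%C)))%M2.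

Lemma sym_bobenko_loc H r A z (U : Loop) : H <> 0 -> good r A -> Cmod z < r -> in_LambdaG U ->
 sym_bobenko H (fun l => U l ** Floc A z l)%M2 = (Ad (U 1%C) (mval (fsurf H A) z 1) + Kc H U)%M2.
Proof. intros HH G Hz [SU [_ U2]].
 assert (DU := smooth_loop_RDM U SU). assert (DF := Floc_dt r A z 0 G Hz).
 assert (D := RDM_mmul _ _ _ _ _ DU DF). apply Mderive_RDM in D. rewrite cis_0 in D.
 rewrite sym_bobenko_eq, D, (fsurf_eq_frame H r A z) by auto.
 set (Ud := Mderive (fun s => U (cis s)) 0). set (F := Floc A z 1).
 set (Fd := (mval (smap sdt (Gs A)) z 1 ** Cmat (sqrt (kap A z)))%M2).
 assert (dF : mdet F = 1%C) by (apply (Floc_SU2 r); auto; apply Cmod_1).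
 rewrite Ad_mscal, Ad_madd, Ad_mscal, <- Ad_comp, !mscal_madd, !mscal_mscal, minv_mmul, mmul_madd_l, mscal_madd.
 replace (Ud ** F ** (minv F ** minv (U 1%C)))%M2 with (Ud ** minv (U 1%C))%M2.
 2:{ rewrite mmul_assoc, <- (mmul_assoc Ud F), mmul_minv_r, mmul_1_r by auto. reflexivity. }
 replace (U 1%C ** Fd ** (minv F ** minv (U 1%C)))%M2 with (Ad (U 1%C) (Fd ** minv F)%M2)
  by (unfold Ad; rewrite !mmul_assoc; reflexivity).
 replace (RtoC (- / (2 * H)) * RtoC 2)%C with (RtoC (- / H)) by (rewrite <- RtoC_mult; f_equal; field; auto).
 rewrite <- madd_assoc. f_equal. apply madd_comm.
Qed.

(** Near [z] the map is a series about a centre [c] that may differ from [z], so partial derivatives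
    stay in the same form with the same centre. *)
Definition serat (f : C -> M2) (z : C) (S : smat) (r : R) (c : C) : Prop :=
 mwf r S /\ Cmod (z - c)%C < r /\ exists d, 0 < d /\ forall w, Cmod (w - z)%C < d -> f w = mval S (w - c)%C 1.

Lemma serat_near f z S r c : serat f z S r c -> exists d, 0 < d /\ forall w, Cmod (w - z)%C < d -> serat f w S r c.
Proof. intros [H1 [H2 [d [Hd K]]]]. set (m := Rmin d (r - Cmod (z - c)%C)).
 assert (m1 := Rmin_l d (r - Cmod (z - c)%C)). assert (m2 := Rmin_r d (r - Cmod (z - c)%C)). fold m in m1, m2.
 exists m. split; [apply Rmin_glb_lt; lra|]. split; [auto|split].
 - replace (w - c)%C with ((w - z) + (z - c))%C by ring. trilt. lra.
 - exists (m - Cmod (w - z)%C). split; [lra|]. intros u Hu. apply K.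
  replace (u - z)%C with ((u - w) + (w - z))%C by ring. trilt. lra.
Qed.

Lemma serat_WDM f z S r c : serat f z S r c ->
 WDM f z (mval (smap sdz S) (z - c)%C 1) (mval (smap sdw S) (z - c)%C 1).
Proof. intros [H1 [H2 [d [Hd K]]]].
 apply (WDM_ext_loc (fun w => mval S (w - c)%C 1) f z _ _ d Hd); [intros; symmetry; now apply K|].
 apply (mval_WDM_shift r); auto. rewrite Cmod_1. lra.
Qed.

Lemma WDM_RDM_x f z D E : WDM f z D E -> RDM (fun t => f (t, Im z)) (Re z) (D + E)%M2.
Proof. intros H. apply RDM_entries; rewrite madd_eta; ents; apply (WD_RD_x (fun w => ent (f w) _ _)), H.
Qed.
Lemma WDM_RDM_y f z D E : WDM f z D E -> RDM (fun t => f (Re z, t)) (Im z) (Ci *: (D + RtoC (-1) *: E))%M2.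
Proof. intros H. apply RDM_entries; rewrite mscal_eta, madd_eta, mscal_eta; ents;
  (eapply RD_eq; [apply (WD_RD_y (fun w => ent (f w) _ _)), H|rewrite RtoC_m1; ring]).
Qed.
Lemma WDM_pdx f z D E : WDM f z D E -> pdx f z = (D + E)%M2.
Proof. intros H. apply Mderive_RDM, WDM_RDM_x, H. Qed.
Lemma WDM_pdy f z D E : WDM f z D E -> pdy f z = (Ci *: (D + RtoC (-1) *: E))%M2.
Proof. intros H. apply Mderive_RDM, WDM_RDM_y, H. Qed.

Definition sdx (S : smat) : smat := smadd (smap sdz S) (smap sdw S).
Definition sdy (S : smat) : smat := smap (sscal Ci) (smadd (smap sdz S) (smap (sscal (RtoC (-1))) (smap sdw S))).

Lemma mwf_sdx r S : mwf r S -> mwf r (sdx S).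
Proof. intros H. apply mwf_smadd; apply mwf_smap; auto; [apply wf_sdz|apply wf_sdw]. Qed.
Lemma mwf_sdy r S : mwf r S -> mwf r (sdy S).
Proof. intros H. apply mwf_smap; [intros; now apply wf_sscal|].
 apply mwf_smadd; [apply mwf_smap; auto; apply wf_sdz|].
 apply mwf_smap; [intros; now apply wf_sscal|]. apply mwf_smap; auto; apply wf_sdw.
Qed.

Lemma mval_sdx r S z : mwf r S -> Cmod z < r ->
 mval (sdx S) z 1 = (mval (smap sdz S) z 1 + mval (smap sdw S) z 1)%M2.
Proof.
 intros H Hz. apply (mval_smadd r); auto; try (apply mwf_smap; auto; [apply wf_sdz || apply wf_sdw]). rewrite Cmod_1. lra.
Qed.
Lemma mval_sdy r S z : mwf r S -> Cmod z < r ->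
 mval (sdy S) z 1 = (Ci *: (mval (smap sdz S) z 1 + RtoC (-1) *: mval (smap sdw S) z 1))%M2.
Proof. intros H Hz. assert (O : Cmod 1 <= 1) by (rewrite Cmod_1; lra).
 assert (W1 : mwf r (smap sdz S)) by (apply mwf_smap; auto; apply wf_sdz).
 assert (W2 : mwf r (smap sdw S)) by (apply mwf_smap; auto; apply wf_sdw).
 assert (W3 : mwf r (smap (sscal (RtoC (-1))) (smap sdw S))) by (apply mwf_smap; auto; intros; now apply wf_sscal).
 unfold sdy. rewrite (mval_smscal r), (mval_smadd r), (mval_smscal r); auto. now apply mwf_smadd.
Qed.

Lemma serat_pdx f z S r c : serat f z S r c -> serat (pdx f) z (sdx S) r c.
Proof. intros H. destruct (serat_near _ _ _ _ _ H) as [d [Hd K]]. destruct H as [H1 [H2 _]].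
 split; [now apply mwf_sdx|split; auto]. exists d. split; auto. intros w Hw. specialize (K w Hw).
 rewrite (WDM_pdx _ _ _ _ (serat_WDM _ _ _ _ _ K)), (mval_sdx r); auto. apply K.
Qed.
Lemma serat_pdy f z S r c : serat f z S r c -> serat (pdy f) z (sdy S) r c.
Proof. intros H. destruct (serat_near _ _ _ _ _ H) as [d [Hd K]]. destruct H as [H1 [H2 _]].
 split; [now apply mwf_sdy|split; auto]. exists d. split; auto. intros w Hw. specialize (K w Hw).
 rewrite (WDM_pdy _ _ _ _ (serat_WDM _ _ _ _ _ K)), (mval_sdy r); auto. apply K.
Qed.

Lemma is_Ck_serat U n : forall f, (forall z, U z -> exists S r c, serat f z S r c) -> is_Ck U n f.
Proof. induction n as [|n IH].
 - split; [|exact I]. intros z Hz i j. destruct (H z Hz) as [S [r [c K]]].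
  apply (WD_continuous _ _ _ _ (serat_WDM _ _ _ _ _ K i j)).
 - split; [|split; [|split]].
  + intros z Hz i j. destruct (H z Hz) as [S [r [c K]]].
   apply (WD_continuous _ _ _ _ (serat_WDM _ _ _ _ _ K i j)).
  + intros z Hz. destruct (H z Hz) as [S [r [c K]]]. apply serat_WDM in K. split.
   * eexists. apply is_Mderive_RDM, WDM_RDM_x, K.
   * eexists. apply is_Mderive_RDM, WDM_RDM_y, K.
  + apply IH. intros z Hz. destruct (H z Hz) as [S [r [c K]]]. exists (sdx S), r, c. now apply serat_pdx.
  + apply IH. intros z Hz. destruct (H z Hz) as [S [r [c K]]]. exists (sdy S), r, c. now apply serat_pdy.
Qed.

Lemma ent_madd (A B : M2) i j : ent (A + B)%M2 i j = (ent A i j + ent B i j)%C.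
Proof.
 destruct (le_lt_dec 2 i); [rewrite !ent_out by lia; ring|]. destruct (le_lt_dec 2 j); [rewrite !ent_out by lia; ring|]. destruct i as [|[|i]]; [| |lia]; (destruct j as [|[|j]]; [| |lia]); ents; reflexivity.
Qed.
Lemma ent_mscal c (A : M2) i j : ent (c *: A)%M2 i j = (c * ent A i j)%C.
Proof.
 destruct (le_lt_dec 2 i); [rewrite !ent_out by lia; ring|]. destruct (le_lt_dec 2 j); [rewrite !ent_out by lia; ring|]. destruct i as [|[|i]]; [| |lia]; (destruct j as [|[|j]]; [| |lia]); ents; reflexivity.
Qed.

(** From [f_x = f_z + f_w] and [f_y = i (f_z - f_w)], with [w] for [conj z]: the pure second
    derivatives cancel and the mixed ones add up. *)
Lemma serat_laplacian f z S r c : serat f z S r c ->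
 (pdx (pdx f) z + pdy (pdy f) z)%M2 = (RtoC 4 *: mval (smap sdw (smap sdz S)) (z - c)%C 1)%M2.
Proof. intros K. assert (Kx := serat_pdx _ _ _ _ _ K). assert (Ky := serat_pdy _ _ _ _ _ K).
 destruct K as [H1 [H2 _]]. set (u := (z - c)%C) in *.
 assert (O : Cmod 1 <= 1) by (rewrite Cmod_1; lra).
 assert (W1 : mwf r (smap sdz S)) by (apply mwf_smap; auto; apply wf_sdz).
 assert (W2 : mwf r (smap sdw S)) by (apply mwf_smap; auto; apply wf_sdw).
 assert (D1 := mval_WDM r _ u 1 W1 H2 O). assert (D2 := mval_WDM r _ u 1 W2 H2 O).
 assert (Nr : 0 < r - Cmod u) by lra.
 assert (Nw : forall w, Cmod (w - u)%C < r - Cmod u -> Cmod w < r).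
 { intros w Hw. replace w with ((w - u) + u)%C by ring. trilt; lra. }
 assert (X := WDM_ext_loc _ (fun w => mval (sdx S) w 1) u _ _ _ Nr
  (fun w Hw => eq_sym (mval_sdx r S w H1 (Nw w Hw))) (WDM_madd _ _ _ _ _ _ _ D1 D2)).
 assert (Y := WDM_ext_loc _ (fun w => mval (sdy S) w 1) u _ _ _ Nr
  (fun w Hw => eq_sym (mval_sdy r S w H1 (Nw w Hw)))
  (WDM_mscal Ci _ _ _ _ (WDM_madd _ _ _ _ _ _ _ D1 (WDM_mscal (RtoC (-1)) _ _ _ _ D2)))).
 destruct (WDM_unique _ _ _ _ _ _ (mval_WDM r _ u 1 (mwf_sdx r S H1) H2 O) X) as [X1 X2].
 destruct (WDM_unique _ _ _ _ _ _ (mval_WDM r _ u 1 (mwf_sdy r S H1) H2 O) Y) as [Y1 Y2].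
 rewrite (WDM_pdx _ _ _ _ (serat_WDM _ _ _ _ _ Kx)), (WDM_pdy _ _ _ _ (serat_WDM _ _ _ _ _ Ky)). fold u.
 rewrite X1, X2, Y1, Y2.
 assert (Cm : mval (smap sdz (smap sdw S)) u 1 = mval (smap sdw (smap sdz S)) u 1)
  by (unfold mval, smap; simpl; rewrite !sdw_sdz; reflexivity).
 rewrite Cm.
 assert (T : forall p q v : C, (p + q + (q + v) + Ci * (Ci * (p + - (1) * q) + - (1) * (Ci * (q + - (1) * v))) = RtoC 4 * q)%C).
 { intros. transitivity (p + q + (q + v) + (Ci * Ci) * ((p + - (1) * q) + - (1) * (q + - (1) * v)))%C; [ring|].
  rewrite Ci_mult. ring. }
 apply M2_ext; rewrite ?ent_madd, ?ent_mscal, ?ent_madd, ?ent_mscal, ?ent_madd, ?ent_mscal, ?RtoC_m1; apply T.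
Qed.

Lemma cis_half (c : C) : c <> RtoC 0 -> exists s, (s * Cconj s)%C = 1 /\ c = (RtoC (Cmod c) * (s * s))%C.
Proof. intros Hc. assert (M : Cmod c <> 0) by (intros X; apply Cmod_eq_0 in X; auto).
 assert (Mc : RtoC (Cmod c) <> 0) by nzC.
 destruct (circle_cis (c / RtoC (Cmod c))%C) as [t [_ E]].
 { unfold Cdiv. rewrite Cmod_mult, Cmod_inv, Cmod_R, Rabs_pos_eq by (auto using Cmod_ge_0). field. auto. }
 exists (cis (t / 2)). split; [apply circle_conj, Cmod_cis|].
 replace (cis (t / 2) * cis (t / 2))%C with (cis t); [rewrite <- E; field; auto|].
 unfold cis, Cmult; simpl. replace t with (t / 2 + t / 2) at 1 2 by field. rewrite cos_plus, sin_plus. f_equal; ring.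
Qed.

(** The local frame differs from the coordinate frame by a rotation about [e3] through the argument
    of [c]. It lifts to [diag (s, conj s)] with half the angle, hence the square root in
    [cis_half]. *)
Lemma frame_rotation (c : C) : c <> RtoC 0 -> exists T, is_SU2 T /\
 Ad T e1 = vec3 (Re c / Cmod c) (Im c / Cmod c) 0 /\ Ad T e2 = vec3 (- Im c / Cmod c) (Re c / Cmod c) 0 /\ Ad T e3 = e3.
Proof. intros Hc. destruct (cis_half c Hc) as [s [S1 S2]].
 assert (M : Cmod c <> 0) by (intros X; apply Cmod_eq_0 in X; auto).
 assert (Mc : RtoC (Cmod c) <> 0) by nzC.
 assert (K : (s * s)%C = (RtoC (Re c / Cmod c) + RtoC (Im c / Cmod c) * Ci)%C).
 { transitivity (/ RtoC (Cmod c) * c)%C; [rewrite S2 at 2; field; auto|]. destruct c as [x y]. unfold RtoC, Ci, Cmult, Cplus; simpl. f_equal; field; auto. }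
 assert (K2 : (Cconj s * Cconj s)%C = (RtoC (Re c / Cmod c) - RtoC (Im c / Cmod c) * Ci)%C).
 { rewrite <- Cconj_mult, K, Cconj_plus, Cconj_mult, !Cconj_RtoC, Cconj_Ci. ring. }
 exists (mat2 s 0 0 (Cconj s)). unfold Ad, vec3, e1, e2, e3. rewrite minv_mat2, !mmul_mat2. repeat split.
 - rewrite mdet_mat2. rewrite <- S1. ring.
 - rewrite mdagger_mat2, mmul_mat2, mone_mat2, !Cconj_RtoC, Cconj_conj. f_equal; try ring; rewrite <- S1; ring.
 - f_equal; try ring.
  + transitivity (- Ci * (s * s))%C; [ring|]. rewrite K. transitivity (- ((Ci * Ci) * RtoC (Im c / Cmod c)) - RtoC (Re c / Cmod c) * Ci)%C; [ring|]. rewrite Ci_mult. ring.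
  + transitivity (- Ci * (Cconj s * Cconj s))%C; [ring|]. rewrite K2. transitivity ((Ci * Ci) * RtoC (Im c / Cmod c) - RtoC (Re c / Cmod c) * Ci)%C; [ring|]. rewrite Ci_mult. ring.
 - replace (- Im c / Cmod c) with (- (Im c / Cmod c)) by (field; auto). rewrite RtoC_opp, RtoC_m1. f_equal; try ring.
  + transitivity (s * s)%C; [ring|]. rewrite K. ring.
  + transitivity (- (Cconj s * Cconj s))%C; [ring|]. rewrite K2. ring.
 - f_equal; try ring.
  + transitivity (Ci * (s * Cconj s))%C; [ring|]. rewrite S1. ring.
  + transitivity (- Ci * (s * Cconj s))%C; [ring|]. rewrite S1. ring.
Qed.

Lemma Ad_tangent F (c : C) :
 (c *: Ad F e_minus + Cconj c *: Ad F e_plus)%M2 = Ad F (vec3 (2 * Re c) (2 * Im c) 0) /\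
 (Ci *: (c *: Ad F e_minus + RtoC (-1) *: (Cconj c *: Ad F e_plus)))%M2 = Ad F (vec3 (- (2 * Im c)) (2 * Re c) 0).
Proof. rewrite <- !Ad_mscal, <- !Ad_madd.
 destruct c as [x y].
 split; f_equal; apply M2_ext; ents; apply injective_projections; simpl; ring.
Qed.

Lemma enorm_Ad_vec3 F a b d : mdet F = 1%C -> enorm (Ad F (vec3 a b d)) = sqrt (a * a + b * b + d * d).
Proof. intros H. unfold enorm. rewrite inner_Ad, inner_vec3 by auto. reflexivity. Qed.

Lemma Cmod_sqr (c : C) : Cmod c * Cmod c = Re c * Re c + Im c * Im c.
Proof. unfold Cmod. rewrite sqrt_sqrt; [unfold Re, Im; simpl; ring|nra]. Qed.

(** The partial derivatives are the images under the frame of [2 c] and [2 i c] in the plane of [e1]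
    and [e2], which gives an immersion, conformality and [e^u = |c|]. The component of the Laplacian
    along the normal is [8 H |c|^2]. *)
Lemma cmc_of_frame U f H :
 (forall z, U z -> is_su2 (f z)) -> (forall z, U z -> exists S r c, serat f z S r c) ->
 (forall z, U z -> exists F (c : C) y, is_SU2 F /\ c <> RtoC 0 /\ WDM f z (c *: Ad F e_minus)%M2 (Cconj c *: Ad F e_plus)%M2 /\
   let h := (Ci * RtoC (2 * H * Cmod c ^ 2))%C in
   (pdx (pdx f) z + pdy (pdy f) z)%M2 = (RtoC 4 *: Ad F (mat2 h y 0 (- h)))%M2) ->
 cmc_surface U f H.
Proof. intros Hs Hser HF.
 assert (P : forall z, U z -> exists F (c : C) y, is_SU2 F /\ mdet F = 1%C /\ 0 < Cmod c /\ c <> RtoC 0 /\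
   pdx f z = Ad F (vec3 (2 * Re c) (2 * Im c) 0) /\ pdy f z = Ad F (vec3 (- (2 * Im c)) (2 * Re c) 0) /\
   let h := (Ci * RtoC (2 * H * Cmod c ^ 2))%C in
   (pdx (pdx f) z + pdy (pdy f) z)%M2 = (RtoC 4 *: Ad F (mat2 h y 0 (- h)))%M2).
 { intros z Hz. destruct (HF z Hz) as [F [c [y [H1 [H2 [H3 H4]]]]]]. exists F, c, y.
  destruct (Ad_tangent F c) as [T1 T2]. rewrite <- T1, <- T2.
  repeat split; auto; try apply H1; [now apply Cmod_gt_0|now apply WDM_pdx|now apply WDM_pdy]. }
 split; [split; [auto|split; [|split]]|].
 - intros n. apply is_Ck_serat; auto.
 - intros z Hz p q E. destruct (P z Hz) as [F [c [y [H1 [D [M [H2 [X [Y _]]]]]]]]].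
  rewrite X, Y, <- !Ad_mscal, <- Ad_madd, !vec3_scal, vec3_add in E.
  assert (I := inner_Ad F (vec3 (p * (2 * Re c) + q * - (2 * Im c)) (p * (2 * Im c) + q * (2 * Re c)) (p * 0 + q * 0))
   (vec3 (p * (2 * Re c) + q * - (2 * Im c)) (p * (2 * Im c) + q * (2 * Re c)) (p * 0 + q * 0)) D).
  rewrite E, mzero_vec3, !inner_vec3 in I. assert (S := Cmod_sqr c).
  assert (Z : (p * p + q * q) * (Cmod c * Cmod c) = 0) by (rewrite S; lra).
  assert (0 < Cmod c * Cmod c) by nra.
  assert (p * p + q * q = 0) by (apply Rmult_integral in Z; destruct Z; lra). nra.
 - intros z Hz. destruct (P z Hz) as [F [c [y [H1 [D [M [H2 [X [Y _]]]]]]]]].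
  rewrite X, Y, !inner_Ad, !inner_vec3 by auto. split; ring.
 - intros z Hz. destruct (P z Hz) as [F [c [y [H1 [D [M [H2 [X [Y L]]]]]]]]].
  assert (N1 : enorm (pdx f z) = 2 * Cmod c).
  { rewrite X, enorm_Ad_vec3 by auto.
   replace (_ + _) with ((2 * Cmod c) * (2 * Cmod c)) by (generalize (Cmod_sqr c); lra). apply sqrt_square. lra. }
  assert (N2 : enorm (pdy f z) = 2 * Cmod c).
  { rewrite Y, enorm_Ad_vec3 by auto.
   replace (_ + _) with ((2 * Cmod c) * (2 * Cmod c)) by (generalize (Cmod_sqr c); lra). apply sqrt_square. lra. }
  destruct (frame_rotation c H2) as [T [T0 [T1 [T2 T3]]]].
  exists (F ** T)%M2. split; [split; [now apply is_SU2_mmul|split]|].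
  + rewrite Ad_comp, T1, N1, X, <- Ad_mscal, vec3_scal. f_equal. f_equal; field; lra.
  + rewrite Ad_comp, T2, N2, Y, <- Ad_mscal, vec3_scal. f_equal. f_equal; field; lra.
  + rewrite Ad_comp, T3, L. rewrite <- Ad_mscal, inner_Ad by auto.
   unfold conf_factor. rewrite N1. replace (/ 2 * (2 * Cmod c)) with (Cmod c) by field.
   replace (- 2 * ln (Cmod c)) with (- (ln (Cmod c) + ln (Cmod c))) by ring.
   rewrite exp_Ropp, exp_plus, exp_ln by auto.
   unfold inner, e3.
   unfold Re, Ci, RtoC, Cmult, Cplus, Copp; simpl. field. lra.
Qed.

Lemma Bpos_z0 r A l : good r A -> Cmod l <= 1 -> mval (Bpos (Psi A)) 0 l = mone.
Proof. intros G Hl. destruct (good_Bpos r A G) as [W1 [W2 [W3 W4]]].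
 unfold mval. rewrite !(sval_at_0 _ r) by (assumption || apply G).
 simpl. unfold tval, mono; simpl. rewrite mone_mat2. f_equal; ring.
Qed.

Lemma Floc_z0 r A : good r A -> kap A 0 = 1 /\ Floc A 0 1 = mone.
Proof. intros G. assert (R0 : Cmod 0 < r) by (rewrite Cmod_0; apply G).
 assert (O : Cmod 1 <= 1) by (rewrite Cmod_1; lra). assert (O0 : Cmod 0 <= 1) by (rewrite Cmod_0; lra).
 assert (K : kap A 0 = 1).
 { unfold kap. assert (E := Bpos_z0 r A 0 G O0). apply mat2_inj in E.
  destruct E as [E _]. rewrite E. reflexivity. }
 split; auto. unfold Floc. rewrite K, (mval_Gs r), (Bpos_z0 r), (Psi_0 r) by (auto; apply G).
 unfold Cmat. rewrite sqrt_1, Rinv_1, mmul_1_l, mone_mat2, minv_mat2, mmul_mat2. f_equal; ring.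
Qed.

(** [kap] is defined as a real part, but it coincides with the value of a series at [l = 0], which
    is differentiable. *)
Lemma kap_WD r A z : good r A -> Cmod z < r -> exists a b, WD (fun w => RtoC (kap A w)) z a b.
Proof. intros G Hz. assert (O0 : Cmod 0 <= 1) by (rewrite Cmod_0; lra).
 eexists. eexists.
 apply (WD_ext_loc (fun w => sval (s11 (Bpos (Psi A))) w 0) _ z _ _ (r - Cmod z)); [lra| |].
 - intros w Hw. destruct (Bpos_l0 r A w G) as [_ [E _]].
  + replace w with ((w - z) + z)%C by ring. trilt; lra.
  + apply mat2_inj in E. apply E.
 - apply (sval_WD r); auto. apply (good_Bpos r A G).
Qed.

(** [W] is the coefficient of [/ l] in the potential, conjugated by the value of [B] at [l = 0]; its
    upper right entry is [- kap^2 H e^u]. *)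
Lemma pkg_surface J f0 H F0 Fhat0 x w g r z : H <> 0 -> pkg J f0 H F0 Fhat0 x w g r -> Cmod z < r ->
 let A := Apot H w g in let F := Floc A z 1 in
 let c := (RtoC (kap A z) * Heu_of H g z * / RtoC H)%C in
 c <> RtoC 0 /\
 mval (smap sdz (fsurf H A)) z 1 = (c *: Ad F e_minus)%M2 /\
 mval (smap sdw (fsurf H A)) z 1 = (Cconj c *: Ad F e_plus)%M2 /\
 exists y, mval (smap sdw (smap sdz (fsurf H A))) z 1 =
  Ad F (mat2 (Ci * RtoC (2 * H * Cmod c ^ 2)) y 0 (- (Ci * RtoC (2 * H * Cmod c ^ 2)))).
Proof. intros HH P Hz A F c. destruct P as [G [[Ww [Wg [Qw Qg]]] [_ [Nz _]]]].
 assert (NH : RtoC H <> 0) by nzC.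
 destruct (Bpos_l0 r A z G Hz) as [Hk _].
 assert (Nk : RtoC (kap A z) <> 0) by nzC.
 split.
 { apply Cmult_neq_0; [apply Cmult_neq_0; auto|]. 
  intros X; assert (E : (RtoC H * / RtoC H)%C = 1) by (field; auto); rewrite X, Cmult_0_r in E; apply RtoC_inj in E; lra. }
 set (W := fun u => (Cmat (kap A u) ** Am1_of H w g u ** Cmat (/ kap A u))%M2).
 assert (EW : forall u, Cmod u < r -> W u = mat2 0 (RtoC (kap A u) * RtoC (kap A u) * - Heu_of H g u)
   (ent (W u) 1 0) 0).
 { intros u Hu.
  assert (E : W u = mat2 0 (RtoC (kap A u) * RtoC (kap A u) * - Heu_of H g u) (RtoC (/ kap A u) * (sval (s21 w) u 1 - Heu_of H g u) * RtoC (/ kap A u)) 0).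
  { unfold W, Am1_of, Cmat. rewrite Rinv_inv, !mmul_mat2. f_equal; ring. }
  rewrite E at 2. exact E. }
 destruct (kap_WD r A z G Hz) as [a1 [b1 K1]].
 assert (K2 := WD_opp _ _ _ _ (WD_scal (RtoC H * (Ci / RtoC 2))%C _ _ _ _ (sval_WD r (s12 g) z 1 ltac:(apply Wg) Hz ltac:(rewrite Cmod_1; lra)))).
 assert (K3 := WD_mult _ _ _ _ _ _ _ (WD_mult _ _ _ _ _ _ _ K1 K1) K2).
 assert (K4 : forall u, Cmod (u - z)%C < r - Cmod z ->
   (RtoC (kap A u) * RtoC (kap A u) * - (RtoC H * (Ci / RtoC 2) * sval (s12 g) u 1))%C = ent (W u) 0 1).
 { intros u Hu. rewrite (EW u); [ents; reflexivity|].
  replace u with ((u - z) + z)%C by ring. trilt; lra. }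
 assert (K5 := WD_ext_loc _ (fun u => ent (W u) 0 1) z _ _ (r - Cmod z) ltac:(lra) K4 K3).
 assert (LS := fun a0 b0 => local_surface H r A z W a0 b0 HH G Hz).
 assert (Ec : (- (ent (W z) 0 1 * / RtoC (kap A z)) * / RtoC H)%C = c).
 { rewrite (EW z Hz). ents. unfold c. field. auto. }
 rewrite <- Ec. eapply LS; [| |exact K5].
 - intros u l Hu Hl. apply (Gs_dz r A u l (Am1_of H w g u) (A0_of w u) (A1_of H w g u)); auto.
  intros l' Hl'. apply (Apot_mval r); auto.
 - intros u Hu. rewrite (EW u Hu). split; reflexivity.
Qed.

Lemma Ad_series_deriv r S T (U K : M2) : mwf r S -> mwf r T ->
 (forall u, Cmod u < r -> mval T u 1 = (Ad U (mval S u 1) + K)%M2) ->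
 forall u, Cmod u < r -> mval (smap sdz T) u 1 = Ad U (mval (smap sdz S) u 1) /\
  mval (smap sdw T) u 1 = Ad U (mval (smap sdw S) u 1).
Proof. intros HS HT E u Hu. assert (O : Cmod 1 <= 1) by (rewrite Cmod_1; lra).
 assert (D := mval_WDM r S u 1 HS Hu O).
 assert (D2 := WDM_madd _ _ _ _ _ _ _ (WDM_mmul _ _ _ _ _ _ _ (WDM_mmul _ _ _ _ _ _ _ (WDM_const U u) D) (WDM_const (minv U) u)) (WDM_const K u)).
 assert (D3 := WDM_ext_loc _ (fun u => mval T u 1) u _ _ (r - Cmod u) ltac:(lra)
   (fun v Hv => eq_sym (E v ltac:(replace v with ((v - u) + u)%C by ring; trilt; lra))) D2).
 destruct (WDM_unique _ _ _ _ _ _ (mval_WDM r T u 1 HT Hu O) D3) as [E1 E2]. rewrite E1, E2.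
 rewrite !mmul_0_l, !mmul_0_r, !madd_0_r, !madd_0_l. split; reflexivity.
Qed.

(** * The holomorphic extension *)

Definition atlas J f0 v H x0 Fhat0 F0 (w g : R -> smat) (r : R -> R) : Prop :=
 local_data J f0 v H x0 Fhat0 F0 /\ forall x, J x -> pkg J f0 H F0 Fhat0 x (w x) (g x) (r x).

Lemma atlas_exists J f0 v H x0 Fhat0 F0 : local_data J f0 v H x0 Fhat0 F0 ->
 exists w g r, atlas J f0 v H x0 Fhat0 F0 w g r.
Proof. intros L.
 assert (K : forall x, exists p : smat * smat * R, J x -> pkg J f0 H F0 Fhat0 x (fst (fst p)) (snd (fst p)) (snd p)).
 { intros x. destruct (classic (J x)) as [Hx|N].
  - destruct (pkg_exists J f0 v H x0 Fhat0 F0 x L Hx) as [w [g [r P]]]. exists (w, g, r). auto.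
  - exists (smone, smone, 0). tauto. }
 exists (fun x => fst (fst (proj1_sig (constructive_indefinite_description _ (K x))))),
  (fun x => snd (fst (proj1_sig (constructive_indefinite_description _ (K x))))),
  (fun x => snd (proj1_sig (constructive_indefinite_description _ (K x)))).
 split; auto. intros x Hx. destruct (constructive_indefinite_description _ (K x)) as [p Hp]. auto.
Qed.

Section Atlas.
Context (J : R -> Prop) (f0 v : R -> M2) (H x0 : R) (Fhat0 : R -> Loop) (F0 : R -> M2).
Context (w g : R -> smat) (r : R -> R) (A : atlas J f0 v H x0 Fhat0 F0 w g r).

(** The factor 32 leaves room for [real_axis_unique]: with [m] the smaller of two radii it is
    applied with [rho = m / 4], which asks for [32 |Im z| <= m] and for holomorphy in the disc of
    radius [m / 2] about [z]. *)
Definition near (z : C) (x : R) : Prop := J x /\ Cmod (z - RtoC x)%C < r x / 32.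
Definition Sig (z : C) : Prop := exists x, near z x.
(** Charts overlap, so a centre is chosen; [loc_consistent] makes the choice immaterial on the
    circle. *)
Definition cen (z : C) : R := epsilon (inhabits 0) (near z).
Definition Aat (x : R) : smat := Apot H (w x) (g x).
Definition loc (x : R) (z l : C) : M2 :=
 (Fhat0 x l ** mval (Psi (Aat x)) (z - RtoC x)%C l)%M2.
Definition PhiG (z l : C) : M2 := loc (cen z) z l.

Lemma cen_near z : Sig z -> near z (cen z).
Proof. exact (epsilon_spec (inhabits 0) (near z)). Qed.

Lemma loc_WDM x z l : good (r x) (Aat x) -> Cmod (z - RtoC x)%C < r x -> Cmod l <= 1 ->
 WDM (fun u => loc x u l) z (Fhat0 x l ** mval (smap sdz (Psi (Aat x))) (z - RtoC x)%C l)%M2 mzero.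
Proof. intros G Z Hl.
 assert (V := mval_WDM_shift _ _ z (RtoC x) l (proj1 (proj2 (proj2 (proj2 (proj2 G))))) Z Hl).
 rewrite Psi_dw in V by apply G.
 assert (V2 := WDM_mmul _ _ _ _ _ _ _ (WDM_const (Fhat0 x l) z) V).
 rewrite !mmul_0_l, mmul_0_r, !madd_0_l in V2. exact V2.
Qed.

(** For fixed [l] the two local extensions are holomorphic in a common disc about [z], and both
    equal [Fhat0] at its real points. *)
Lemma loc_consistent x1 x2 z l : near z x1 -> near z x2 -> Cmod l = 1 -> loc x1 z l = loc x2 z l.
Proof.
 destruct A as [L P]. intros [J1 Z1] [J2 Z2] Hl. destruct (P x1 J1) as [G1 [_ [_ [_ [_ Q1]]]]], (P x2 J2) as [G2 [_ [_ [_ [_ Q2]]]]].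
 set (m := Rmin (r x1) (r x2)).
 assert (M1 := Rmin_l (r x1) (r x2)). assert (M2 := Rmin_r (r x1) (r x2)). fold m in M1, M2.
 assert (I : forall x, Rabs (Im z) <= Cmod (z - RtoC x)).
 { intros x. replace (Im z) with (Im (z - RtoC x)%C) by (unfold Im; simpl; ring). apply Im_le_Cmod. }
 assert (I1 := I x1). assert (I2 := I x2). assert (I0 := Rabs_pos (Im z)).
 assert (IM : 32 * Rabs (Im z) < m) by (unfold m; apply Rmin_glb_lt; lra).
 assert (N : forall u x, m <= r x -> Cmod (z - RtoC x) < r x / 32 -> Cmod (u - z) < 2 * (m / 4) -> Cmod (u - RtoC x) < r x).
 { intros u x X1 X2 X3. replace (u - RtoC x)%C with ((u - z) + (z - RtoC x))%C by ring.
  trilt; lra. }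
 assert (K : forall i j, ent (loc x1 z l) i j = ent (loc x2 z l) i j).
 2:{ apply M2_ext; apply K. }
 intros i j. apply Cminus_eq_0.
 apply (real_axis_unique (fun u => ent (loc x1 u l) i j - ent (loc x2 u l) i j)%C z (m / 4)); try lra.
 - intros u Hu. eexists. eapply WD_eq.
  + apply WD_plus; [|apply WD_opp]; [exact (loc_WDM _ _ l G1 (N u x1 M1 Z1 Hu) ltac:(lra) i j)
    |exact (loc_WDM _ _ l G2 (N u x2 M2 Z2 Hu) ltac:(lra) i j)].
  + reflexivity.
  + ring.
 - intros x Hx. assert (X1 := N _ _ M1 Z1 Hx). assert (X2 := N _ _ M2 Z2 Hx). unfold loc.
  rewrite <- RtoC_minus, Cmod_R in X1, X2. rewrite <- !RtoC_minus, <- Q1, <- Q2 by auto.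
  replace (x1 + (x - x1)) with (x2 + (x - x2)) by ring. ring.
Qed.

Lemma PhiG_loc x1 z l : near z x1 -> Cmod l = 1 -> PhiG z l = loc x1 z l.
Proof. intros N. exact (loc_consistent _ _ z l (cen_near z (ex_intro _ x1 N)) N).
Qed.

Lemma near_open z x : near z x -> exists d, 0 < d /\ forall u, Cmod (u - z)%C < d -> near u x.
Proof. intros [Jx Hz]. exists (r x / 32 - Cmod (z - RtoC x)%C). split; [lra|]. split; auto.
 replace (u - RtoC x)%C with ((u - z) + (z - RtoC x))%C by ring.
 trilt; lra.
Qed.

Lemma near_self x : J x -> near (RtoC x) x.
Proof. intros Hx. destruct A as [_ P]. split; auto. replace (RtoC x - RtoC x)%C with (RtoC 0) by ring. rewrite Cmod_0.
 destruct (P x Hx) as [[G _] _]. lra.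
Qed.

Lemma near_lt x z : near z x ->
 good (r x) (Aat x) /\ Cmod (z - RtoC x)%C < r x /\ in_LambdaG (Fhat0 x).
Proof. intros [Jx Hz]. destruct A as [L P]. split; [apply (P x Jx)|split].
 - generalize (Cmod_ge_0 (z - RtoC x)). lra.
 - apply L. auto.
Qed.

Lemma Sig_open : @open C_UniformSpace Sig.
Proof. apply open_C_eps. intros z [x Hx]. destruct (near_open _ _ Hx) as [d [Hd K]].
 exists d. split; auto. exists x. auto.
Qed.

Lemma PhiG_real x l : J x -> Cmod l = 1 ->
 PhiG (RtoC x) l = Fhat0 x l.
Proof. intros Hx Hl. assert (N := near_self _ Hx).
 rewrite (PhiG_loc x) by auto. unfold loc.
 replace (RtoC x - RtoC x)%C with (RtoC 0) by ring.
 destruct (near_lt _ _ N) as [G _].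
 rewrite (Psi_0 (r x)), mmul_1_r by (try apply G; lra). reflexivity.
Qed.

Lemma PhiG_LambdaGC z : Sig z ->
 in_LambdaGC (PhiG z).
Proof. intros Hz. destruct (near_lt _ _ (cen_near _ Hz)) as [G [Z [U1 [U2 U3]]]].
 destruct (Psi_LambdaGC _ _ _ G Z) as [P1 [P2 P3]]. unfold PhiG, loc.
 split; [now apply smooth_loop_mmul|split; [now apply twisted_mmul|]].
 intros l Hl. specialize (P3 l Hl). unfold is_SL2 in *. rewrite mdet_mmul, P3, (proj1 (U3 l Hl)). ring.
Qed.

Lemma PhiG_derive z l : Sig z -> Cmod l = 1 ->
 let c := cen z in
 exists D, is_CMderive (fun u => PhiG u l) z D /\
  (minv (PhiG z l) ** D)%M2 =
  ((/ l)%C *: Am1_of H (w c) (g c) (z - RtoC c)%C + A0_of (w c) (z - RtoC c)%C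
   + l *: A1_of H (w c) (g c) (z - RtoC c)%C)%M2.
Proof. intros Hz Hl c. assert (N := cen_near _ Hz).
 destruct (near_lt _ _ N) as [G [Z U]].
 assert (Hl1 : Cmod l <= 1) by lra.
 assert (V2 := loc_WDM _ _ l G Z Hl1).
 destruct (near_open _ _ N) as [d [Hd K]].
 exists (Fhat0 c l ** mval (smap sdz (Psi (Aat c))) (z - RtoC c)%C l)%M2. split.
 - intros i j. apply is_derive_WD.
  assert (V3 := WDM_ext_loc _ (fun u => PhiG u l) z _ _ d Hd
   (fun u Hu => eq_sym (PhiG_loc c u l (K u Hu) Hl)) V2 i j).
  eapply WD_eq; [exact V3|reflexivity|]. apply (ent_cases (fun e => e (mat2 _ _ _ _) = 0)); ents; reflexivity.
 - destruct (proj2 A c (proj1 N)) as [_ [[Ww [Wg [Qw Qg]]] _]].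
  rewrite circle_inv, <- (Apot_mval (r c)) by auto.
  rewrite (Psi_dz (r c)) by (auto; apply G). set (P := mval (Psi (Aat c)) (z - RtoC c)%C l).
  assert (DU : mdet (Fhat0 c l) = 1%C) by (apply U; exact Hl).
  assert (DP : mdet P = 1%C) by (apply (good_det (r c)); auto).
  rewrite (mmul_assoc (Fhat0 c l)), mmul_assoc, mmul_minv_l, mmul_1_l; auto.
  rewrite mdet_mmul, DU, DP. ring.
Qed.

Ltac fin_loc D T := auto; try (intros n; apply (T n));
 try (intros; unfold loc, D; rewrite mmul_eta; unfold mval; ents; reflexivity).

(** Each entry is a sum of two products of a loop constant in [z] with a series in [z] alone and
    [l]. The quotients of the series converge with all angular derivatives, and the fixed loops are
    bounded with theirs by periodicity. *)
Lemma PhiG_holomorphic : holomorphic_into_loops Sig PhiG.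
Proof. intros z Hz. set (c := cen z). assert (N := cen_near _ Hz).
 destruct (near_lt _ _ N) as [G [Z U]].
 set (P := Psi (Aat c)). assert (WP : mwf (r c) P) by apply G.
 assert (T := pkg_Psi_terms _ _ _ _ _ _ _ _ _ (proj2 A c (proj1 N))).
 set (D := fun l => (Fhat0 c l ** mval (smap sdz P) (z - RtoC c)%C l)%M2).
 assert (SU : forall i j, csmooth (fun s => ent (Fhat0 c (cis s)) i j)) by (apply smooth_loop_iff; apply U).
 exists D. split.
 { assert (SD : smooth_loop (fun l => mval (smap sdz P) (z - RtoC c)%C l)).
  { apply smooth_loop_iff, (csmooth_mval (r c)); auto. apply mwf_smap; auto. apply wf_sdz. }
  exact (smooth_loop_mmul (Fhat0 c) (fun l => mval (smap sdz P) (z - RtoC c)%C l) (proj1 U) SD). }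
 intros k eps He. destruct (near_open _ _ N) as [d0 [Hd0 K0]].
 assert (B : forall i j, exists M, 0 <= M /\ Cn_bd k M (fun s => ent (Fhat0 c (cis s)) i j)).
 { intros i j. apply csmooth_periodic_bd; auto. intros t. now rewrite cis_period. }
 assert (E1 : forall i m h1 h2 (e : M2 -> C), wf (r c) h1 -> wf (r c) h2 ->
   (forall N, Forall (fun t => tm t = N /\ tn t = 0%nat) (h1 N)) -> (forall N, Forall (fun t => tm t = N /\ tn t = 0%nat) (h2 N)) ->
   (forall z l, e (loc c z l) = ent (Fhat0 c l) i 0 * sval h1 (z - RtoC c) l + ent (Fhat0 c l) i m * sval h2 (z - RtoC c) l)%C ->
   (forall l, e (D l) = ent (Fhat0 c l) i 0 * sval (sdz h1) (z - RtoC c) l + ent (Fhat0 c l) i m * sval (sdz h2) (z - RtoC c) l)%C ->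
   exists d, 0 < d /\ forall h : C, h <> RtoC 0 -> Cmod h < d -> forall t,
    Cmod (RCderive_n (fun s => ((e (PhiG (z + h)%C (cis s)) - e (PhiG z (cis s))) / h - e (D (cis s)))%C) k t) <= eps).
 { intros i m h1 h2 e W1 W2 F1 F2 El Ed.
  destruct (B i 0%nat) as [M1 [HM1 B1]]. destruct (B i m) as [M2 [HM2 B2]].
  assert (P2 : 0 < 2 ^ k) by (apply pow_lt; lra).
  (* Absorbs the Leibniz factor [2 ^ k] and the bounds [M1], [M2] of the fixed loops; the summand 1
     excludes a zero denominator. *)
  set (e1 := eps / (2 * (2 ^ k * (M1 + M2 + 1)))).
  assert (He1 : 0 < e1) by (apply Rdiv_lt_0_compat; [lra|nra]).
  destruct (sdz_Cn_bd (r c) h1 (z - RtoC c)%C k e1 W1 Z) as [d1 [Hd1 Q1]]; auto.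
  { intros n. eapply Forall_impl; [|apply (F1 n)]. intros t Ht. apply Ht. }
  destruct (sdz_Cn_bd (r c) h2 (z - RtoC c)%C k e1 W2 Z) as [d2 [Hd2 Q2]]; auto.
  { intros n. eapply Forall_impl; [|apply (F2 n)]. intros t Ht. apply Ht. }
  exists (Rmin d0 (Rmin d1 d2)).
  split; [repeat apply Rmin_glb_lt; auto|]. intros h Hh Hl t.
  generalize (Rmin_l d0 (Rmin d1 d2)) (Rmin_r d0 (Rmin d1 d2)) (Rmin_l d1 d2) (Rmin_r d1 d2). intros m1 m2 m3 m4.
  assert (Nh : near (z + h)%C c) by (apply K0; replace (z + h - z)%C with h by ring; lra).
  apply Cn_bd_RCderive.
  apply Cn_bd_mono with (2 ^ k * (M1 * e1) + 2 ^ k * (M2 * e1)).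
  { apply Rle_trans with (2 ^ k * (M1 + M2 + 1) * e1).
   - apply Rle_trans with (2 ^ k * (M1 + M2) * e1); [right; ring|]. apply Rmult_le_compat_r; [lra|]. apply Rmult_le_compat_l; lra.
   - replace (2 ^ k * (M1 + M2 + 1) * e1) with (eps / 2) by (unfold e1; field; split; nra). lra. }
  replace (fun s => ((e (PhiG (z + h)%C (cis s)) - e (PhiG z (cis s))) / h - e (D (cis s)))%C)
   with (fun s => (ent (Fhat0 c (cis s)) i 0 * ((sval h1 (z - RtoC c + h) (cis s) - sval h1 (z - RtoC c) (cis s)) / h - sval (sdz h1) (z - RtoC c) (cis s))
     + ent (Fhat0 c (cis s)) i m * ((sval h2 (z - RtoC c + h) (cis s) - sval h2 (z - RtoC c) (cis s)) / h - sval (sdz h2) (z - RtoC c) (cis s)))%C).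
  - apply Cn_bd_plus; apply Cn_bd_mult; auto; try lra; [apply Q1|apply Q2]; auto; lra.
  - apply functional_extensionality. intros s.
   rewrite !(PhiG_loc c) by (auto; apply Cmod_cis).
   rewrite Ed, !El. replace (z + h - RtoC c)%C with (z - RtoC c + h)%C by ring. field. auto. }
 destruct WP as [Wa [Wb [Wc Wd]]].
 destruct (E1 0%nat 1%nat (s11 P) (s21 P) (fun A => ent A 0 0)) as [d1 [Hd1 Q1]]; fin_loc D T.
 destruct (E1 0%nat 1%nat (s12 P) (s22 P) (fun A => ent A 0 1)) as [d2 [Hd2 Q2]]; fin_loc D T.
 destruct (E1 1%nat 1%nat (s11 P) (s21 P) (fun A => ent A 1 0)) as [d3 [Hd3 Q3]]; fin_loc D T.
 destruct (E1 1%nat 1%nat (s12 P) (s22 P) (fun A => ent A 1 1)) as [d4 [Hd4 Q4]]; fin_loc D T.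
 exists (Rmin (Rmin d1 d2) (Rmin d3 d4)). split; [repeat apply Rmin_glb_lt; auto|].
 generalize (Rmin_l (Rmin d1 d2) (Rmin d3 d4)) (Rmin_r (Rmin d1 d2) (Rmin d3 d4)) (Rmin_l d1 d2) (Rmin_r d1 d2) (Rmin_l d3 d4) (Rmin_r d3 d4).
 intros.
 revert i j t. apply (ent_cases (fun e => forall t, Cmod (RCderive_n (fun s =>
  ((e (PhiG (z + h)%C (cis s)) - e (PhiG z (cis s))) / h - e (D (cis s)))%C) k t) <= eps)).
 - apply Q1; auto; lra.
 - apply Q2; auto; lra.
 - apply Q3; auto; lra.
 - apply Q4; auto; lra.
 - intros t. apply Cn_bd_RCderive. replace (fun s : R => ((0 - 0) / h - 0)%C) with (fun _ : R => RtoC 0)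
   by (apply functional_extensionality; intros; field; auto).
  clear -He. induction k as [|k IH]; simpl; (split; [intros; rewrite Cmod_0; lra|]); auto.
  exists (fun _ => RtoC 0). split; auto. intros; apply RD_const.
Qed.

Lemma PhiG_iwasawa z x : near z x ->
 is_iwasawa (PhiG z) (fun l => Fhat0 x l ** Floc (Aat x) (z - RtoC x)%C l)%M2
  (Bloc (Aat x) (z - RtoC x)%C).
Proof. intros N. destruct (near_lt _ _ N) as [G [Z U]].
 apply (is_iwasawa_ext (loc x z)).
 - symmetry. now apply (PhiG_loc).
 - exact (local_iwasawa (r x) (Aat x) (z - RtoC x)%C (Fhat0 x) G Z U).
Qed.

Definition surf (Fhat : C -> Loop) (z : C) : M2 :=
 (sym_bobenko H (Fhat z) - sym_bobenko H (Fhat (RtoC x0)) + f0 x0)%M2.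

(** By uniqueness any Iwasawa frame agrees on the circle with the local one, so near [z] the surface
    is a rigid motion of [fsurf], with rotation [F0 x]. At the centre of the chart the local frame
    is 1 and [c] is [e^u]. *)
Lemma surf_frame Fhat Bhat z x : (forall z, Sig z -> is_iwasawa (PhiG z) (Fhat z) (Bhat z)) -> near z x ->
 let f := surf Fhat in
 exists S F (c : C) y, serat f z S (r x) (RtoC x) /\ is_SU2 F /\ c <> RtoC 0 /\
  WDM f z (c *: Ad F e_minus)%M2 (Cconj c *: Ad F e_plus)%M2 /\
   (let h := (Ci * RtoC (2 * H * Cmod c ^ 2))%C in
   (pdx (pdx f) z + pdy (pdy f) z)%M2 = (RtoC 4 *: Ad F (mat2 h y 0 (- h)))%M2) /\
  (z = RtoC x -> F = F0 x /\ c = RtoC (exp (curve_u f0 x))).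
Proof. intros HI N f. assert (L := proj1 A). destruct (near_lt _ _ N) as [G [Z U]].
 assert (HH : H <> 0) by apply L. assert (P := proj2 A x (proj1 N)).
 assert (F01 := Fhat0_at_1 _ _ _ _ _ _ _ x L (proj1 N)).
 set (B := Aat x) in *.
 set (K := (Kc H (Fhat0 x) - sym_bobenko H (Fhat (RtoC x0)) + f0 x0)%M2).
 assert (Ef : forall u, near u x -> f u = (Ad (F0 x) (mval (fsurf H B) (u - RtoC x)%C 1) + K)%M2).
 { intros u Nu. destruct (near_lt _ _ Nu) as [_ [Zu _]].
  unfold f, surf, K, msub. rewrite !madd_assoc. do 2 f_equal.
  rewrite <- F01, <- (sym_bobenko_loc H (r x) B) by auto. apply sym_bobenko_ext. intros l Hl.
  exact (iwasawa_unique (PhiG u) (Fhat u) (Bhat u) (fun l => Fhat0 x l ** Floc B (u - RtoC x)%C l)%M2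
   (Bloc B (u - RtoC x)%C) (HI u (ex_intro _ x Nu)) (PhiG_iwasawa u x Nu) l Hl). }
 assert (Wf := mwf_fsurf H (r x) B G).
 set (S := smadd (smm (smm (smcst (F0 x)) (fsurf H B)) (smcst (minv (F0 x)))) (smcst K)).
 assert (WS : mwf (r x) S) by (apply mwf_smadd; [apply mwf_smm; [apply mwf_smm|]|]; auto using mwf_smcst).
 assert (ES : forall u, Cmod u < r x -> mval S u 1 = (Ad (F0 x) (mval (fsurf H B) u 1) + K)%M2).
 { intros u Hu. assert (O : Cmod 1 <= 1) by (rewrite Cmod_1; lra).
  unfold S. rewrite (mval_smadd (r x)), (mval_smm (r x)), (mval_smm (r x)), !(mval_smcst (r x));
   auto using mwf_smcst, mwf_smm. }
 destruct (near_open _ _ N) as [d [Hd Kd]].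
 assert (SR : serat f z S (r x) (RtoC x)).
 { split; [auto|split; auto]. exists d. split; auto. intros u Hu. rewrite Ef by auto. symmetry. apply ES.
  apply (near_lt _ _ (Kd u Hu)). }
 destruct (Ad_series_deriv (r x) (fsurf H B) S (F0 x) K Wf WS ES (z - RtoC x)%C Z) as [D1 D2].
 destruct (Ad_series_deriv (r x) (smap sdz (fsurf H B)) (smap sdz S) (F0 x) mzero) with (z - RtoC x)%C as [_ D3]; auto.
 { apply mwf_smap; auto. apply wf_sdz. }
 { apply mwf_smap; auto. apply wf_sdz. }
 { intros u Hu. rewrite madd_0_r. exact (proj1 (Ad_series_deriv (r x) (fsurf H B) S (F0 x) K Wf WS ES u Hu)). }
 destruct (pkg_surface J f0 H F0 Fhat0 x (w x) (g x) (r x) (z - RtoC x)%C HH P Z) as [C0 [E1 [E2 [y E3]]]].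
 fold (Aat x) in C0, E1, E2, E3. fold B in C0, E1, E2, E3.
 set (F := Floc B (z - RtoC x)%C 1) in *.
 set (c := (RtoC (kap B (z - RtoC x)) * Heu_of H (g x) (z - RtoC x) * / RtoC H)%C) in *.
 assert (FS : is_SU2 (F0 x)) by (rewrite <- F01; apply U, Cmod_1).
 exists S, (F0 x ** F)%M2, c, y. split; [auto|split; [|split; [auto|split; [|split]]]].
 - apply is_SU2_mmul; auto. apply (Floc_SU2 (r x)); auto. apply Cmod_1.
 - eapply WDM_eq; [apply (serat_WDM _ _ _ _ _ SR)| |].
  + rewrite D1, E1, Ad_mscal, Ad_comp. reflexivity.
  + rewrite D2, E2, Ad_mscal, Ad_comp. reflexivity.
 - rewrite (serat_laplacian _ _ _ _ _ SR), D3, E3, <- Ad_comp. reflexivity.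
 - intros Ez. assert (Z0 : (z - RtoC x)%C = RtoC 0) by (rewrite Ez; ring).
  destruct (Floc_z0 (r x) B G) as [K0 FL].
  unfold F, c. rewrite Z0, FL, K0, mmul_1_r. split; auto.
  destruct P as [_ [_ [_ [_ [Eu _]]]]]. rewrite (Eu 0) by (rewrite Rabs_R0; apply G). rewrite Rplus_0_r.
  assert (NH : RtoC H <> 0) by nzC. field. auto.
Qed.

(** On [J] the frame is [F0] and the factor is [e^u], so [f_x] is [2 e^u] times the rotated [e1],
    that is [f0'], and [f_y] is [2 e^u v]. *)
Lemma surf_bjorling Fhat Bhat : (forall x, J x -> is_su2 (f0 x)) ->
 (forall z, Sig z -> is_iwasawa (PhiG z) (Fhat z) (Bhat z)) ->
 bjorling_solution J f0 v H Sig (surf Fhat).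
Proof. intros Hf HI. assert (L := proj1 A). set (f := surf Fhat).
 assert (Jx0 : J x0) by apply L.
 assert (S0 : Sig (RtoC x0)) by (exists x0; now apply (near_self)).
 assert (T : forall x, J x -> WDM f (RtoC x) (RtoC (exp (curve_u f0 x)) *: Ad (F0 x) e_minus)%M2
   (RtoC (exp (curve_u f0 x)) *: Ad (F0 x) e_plus)%M2 /\ pdx f (RtoC x) = Mderive f0 x /\
   pdy f (RtoC x) = (RtoC (2 * exp (curve_u f0 x)) *: v x)%M2).
 { intros x Hx. assert (N := near_self _ Hx).
  destruct (surf_frame Fhat Bhat _ x HI N) as [S [F [c [y [_ [SF [_ [W [_ E]]]]]]]]].
  destruct (E eq_refl) as [-> ->]. rewrite Cconj_RtoC in W. split; [exact W|].
  destruct L as [_ [_ [_ [_ [[_ [FE _]] _]]]]]. destruct (FE x Hx) as [_ [E1 E2]].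
  assert (Pe := exp_pos (curve_u f0 x)).
  fold f in W. rewrite (WDM_pdx _ _ _ _ W), (WDM_pdy _ _ _ _ W).
  destruct (Ad_tangent (F0 x) (RtoC (exp (curve_u f0 x)))) as [T1 T2]. rewrite Cconj_RtoC in T1, T2.
  rewrite T1, T2. cbn [Re Im fst snd RtoC]. split.
  - rewrite vec3_e, Ad_madd, Ad_madd, !Ad_mscal, E1, !mscal_mscal, <- RtoC_mult, exp_Ropp.
   replace (2 * exp (curve_u f0 x) * (/ 2 * / exp (curve_u f0 x))) with 1 by (field; lra).
   rewrite !Rmult_0_r, !mscal_0, !madd_0_r, mscal_1. reflexivity.
  - rewrite vec3_e, Ad_madd, Ad_madd, !Ad_mscal, E2, Rmult_0_r, Ropp_0, !mscal_0, madd_0_l, madd_0_r. reflexivity. }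
 (* [f] and [f0] have the same derivative along [J] and, by the normalization of [f], the same value
    at [x0]. *)
 assert (Rs : restricts_to J f f0).
 { intros x Hx.
  assert (K : forall i j, (ent (f (RtoC x0)) i j - ent (f0 x0) i j)%C = (ent (f (RtoC x)) i j - ent (f0 x) i j)%C).
  { intros i j. apply (RD_zero_const (fun s => ent (f (RtoC s)) i j - ent (f0 s) i j)%C).
   intros s Hs. assert (Js : J s) by (apply (open_interval_convex J x0 x); auto; apply L).
   destruct (T s Js) as [W [PX _]]. assert (D1 := WDM_RDM_x _ _ _ _ W i j).
   rewrite <- (WDM_pdx _ _ _ _ W), PX in D1.
   destruct (real_analytic_anM J f0 s ltac:(apply L) Js) as [S [q HS]].
   assert (D2 := anM_RDM s f0 S q 0 HS ltac:(rewrite Rabs_R0; apply HS)). rewrite Rplus_0_r in D2.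
   assert (E := Mderive_RDM _ _ _ D2). rewrite <- E in D2.
   eapply RD_eq; [apply (RD_plus _ _ _ _ _ D1 (RD_opp _ _ _ (D2 i j)))|ring]. }
  assert (E0 : f (RtoC x0) = f0 x0).
  { unfold f, surf, msub. apply M2_ext; rewrite !ent_madd, ent_mscal, RtoC_m1; ring. }
  rewrite E0 in K. apply M2_ext; apply Cminus_eq_0; rewrite <- K; ring. }
 split; [apply Sig_open|split; [|split; [|split; [exact Rs|split]]]].
 - intros x Hx. exists x. now apply (near_self).
 - apply cmc_of_frame.
  + intros z Hz. apply is_su2_madd; [apply is_su2_madd|auto].
   * apply sym_bobenko_su2. apply (HI z Hz).
   * apply is_su2_mscal, sym_bobenko_su2. apply (HI _ S0).
  + intros z [x Hx]. destruct (surf_frame Fhat Bhat z x HI Hx) as [S [F [c [y [K _]]]]].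
   exists S, (r x), (RtoC x). exact K.
  + intros z [x Hx]. destruct (surf_frame Fhat Bhat z x HI Hx) as [S [F [c [y K]]]].
   exists F, c, y. tauto.
 - intros x Hx. destruct (T x Hx) as [_ [-> ->]]. assert (Pe := exp_pos (curve_u f0 x)). split.
  + intros [p [q ->]]. exists p, (q * (2 * exp (curve_u f0 x))). rewrite mscal_mscal, <- RtoC_mult. reflexivity.
  + intros [p [q ->]]. exists p, (q / (2 * exp (curve_u f0 x))). rewrite mscal_mscal, <- RtoC_mult. do 3 f_equal. field. lra.
 - intros x Hx. destruct (T x Hx) as [_ [_ ->]]. exists (2 * exp (curve_u f0 x)).
  split; auto. generalize (exp_pos (curve_u f0 x)); lra.
Qed.

End Atlas.

(** * Uniqueness for the Cauchy problem *)

Definition dX (f : R -> R -> R) (x y : R) : R := Derive (fun t => f t y) x.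
Definition dY (f : R -> R -> R) (x y : R) : R := Derive (fun t => f x t) y.
Definition sq (a x y : R) : Prop := Rabs x < a /\ Rabs y < a.

(** Class [C^n] on an open square about 0 for real functions of two real variables; the whole
    uniqueness argument takes place in these coordinates. *)
Fixpoint K2 (a : R) (n : nat) (f : R -> R -> R) : Prop :=
 (forall x y, sq a x y -> continuity_2d_pt f x y) /\
 match n with
 | O => True
 | S m => (forall x y, sq a x y -> ex_derive (fun t => f t y) x /\ ex_derive (fun t => f x t) y) /\
      K2 a m (dX f) /\ K2 a m (dY f)
 end.

Lemma sq_open a x y : sq a x y -> exists d : posreal, forall u v, Rabs (u - x) < d -> Rabs (v - y) < d -> sq a u v.
Proof. intros [Hx Hy]. assert (P : 0 < Rmin (a - Rabs x) (a - Rabs y)) by (apply Rmin_glb_lt; lra).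
 exists (mkposreal _ P). simpl.
 generalize (Rmin_l (a - Rabs x) (a - Rabs y)) (Rmin_r (a - Rabs x) (a - Rabs y)).
 split; [replace u with ((u - x) + x) by ring|replace v with ((v - y) + y) by ring];
  (eapply Rle_lt_trans; [apply Rabs_triang|lra]).
Qed.

Lemma sq_locally_x a x y : sq a x y -> locally x (fun u => sq a u y).
Proof. intros H. destruct (sq_open a x y H) as [d Hd]. exists d. intros u Hu. apply Hd; [exact Hu|].
 rewrite Rminus_diag, Rabs_R0. apply d.
Qed.
Lemma sq_locally_y a x y : sq a x y -> locally y (fun u => sq a x u).
Proof. intros H. destruct (sq_open a x y H) as [d Hd]. exists d. intros u Hu. apply Hd; [|exact Hu].
 rewrite Rminus_diag, Rabs_R0. apply d.
Qed.

Lemma dX_ext a f g x y : (forall x y, sq a x y -> f x y = g x y) -> sq a x y -> dX f x y = dX g x y.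
Proof. intros E H. apply Derive_ext_loc. destruct (sq_locally_x _ _ _ H) as [d Hd]. exists d. auto.
Qed.
Lemma dY_ext a f g x y : (forall x y, sq a x y -> f x y = g x y) -> sq a x y -> dY f x y = dY g x y.
Proof. intros E H. apply Derive_ext_loc. destruct (sq_locally_y _ _ _ H) as [d Hd]. exists d. auto.
Qed.

Lemma K2_ext a n : forall f g, (forall x y, sq a x y -> f x y = g x y) -> K2 a n f -> K2 a n g.
Proof.
 assert (C : forall f g, (forall x y, sq a x y -> f x y = g x y) -> (forall x y, sq a x y -> continuity_2d_pt f x y) ->
  forall x y, sq a x y -> continuity_2d_pt g x y).
 { intros f g E H x y Hs. apply continuity_2d_pt_ext_loc with f; auto.
  destruct (sq_open a x y Hs) as [d Hd]. exists d. intros u v Hu Hv. apply E; auto. }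
 induction n as [|n IH]; intros f g E [H1 H2]; (split; [now apply (C f)|]); auto.
 destruct H2 as [H2 [H3 H4]]. split; [|split].
 - intros x y Hs. destruct (H2 x y Hs) as [A B]. split.
  + apply ex_derive_ext_loc with (fun t => f t y); auto.
   destruct (sq_locally_x _ _ _ Hs) as [d Hd]. exists d. auto.
  + apply ex_derive_ext_loc with (fun t => f x t); auto.
   destruct (sq_locally_y _ _ _ Hs) as [d Hd]. exists d. auto.
 - apply IH with (dX f); auto. intros; now apply (dX_ext a).
 - apply IH with (dY f); auto. intros; now apply (dY_ext a).
Qed.

Lemma K2_S a n : forall f, K2 a (S n) f -> K2 a n f.
Proof. induction n as [|n IH]; intros f [H1 [H2 [H3 H4]]]; split; auto.
Qed.

Lemma K2_cont a n f x y : K2 a n f -> sq a x y -> continuity_2d_pt f x y.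
Proof. destruct n; intros H; apply H. Qed.

Lemma K2_const a n c : K2 a n (fun _ _ => c).
Proof. revert c. induction n as [|n IH]; intros c; (split; [intros; apply continuity_2d_pt_const|]); auto.
 split; [intros; split; apply ex_derive_const|].
 split; (apply K2_ext with (fun _ _ => 0); [intros; symmetry; unfold dX, dY; apply Derive_const|apply IH]).
Qed.

Lemma K2_plus a n : forall f g, K2 a n f -> K2 a n g -> K2 a n (fun x y => f x y + g x y).
Proof. induction n as [|n IH]; intros f g [F1 F2] [G1 G2];
  (split; [intros; apply continuity_2d_pt_plus; auto|]); auto.
 destruct F2 as [F2 [F3 F4]], G2 as [G2 [G3 G4]]. split; [|split].
 - intros x y Hs. destruct (F2 x y Hs), (G2 x y Hs). split; now apply @ex_derive_plus.
 - apply K2_ext with (fun x y => dX f x y + dX g x y); auto.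
  intros x y Hs. symmetry. apply Derive_plus; [apply (F2 x y Hs)|apply (G2 x y Hs)].
 - apply K2_ext with (fun x y => dY f x y + dY g x y); auto.
  intros x y Hs. symmetry. apply Derive_plus; [apply (F2 x y Hs)|apply (G2 x y Hs)].
Qed.

Lemma K2_mult a n : forall f g, K2 a n f -> K2 a n g -> K2 a n (fun x y => f x y * g x y).
Proof. induction n as [|n IH]; intros f g F G; assert (F0 := F); assert (G0 := G); destruct F as [F1 F2], G as [G1 G2];
  (split; [intros; apply continuity_2d_pt_mult; auto|]); auto.
 apply K2_S in F0, G0. destruct F2 as [F2 [F3 F4]], G2 as [G2 [G3 G4]]. split; [|split].
 - intros x y Hs. destruct (F2 x y Hs), (G2 x y Hs). split; now apply @ex_derive_mult.
 - apply K2_ext with (fun x y => dX f x y * g x y + f x y * dX g x y); [|apply K2_plus; auto].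
  intros x y Hs. symmetry. apply (Derive_mult (fun t => f t y) (fun t => g t y)); [apply (F2 x y Hs)|apply (G2 x y Hs)].
 - apply K2_ext with (fun x y => dY f x y * g x y + f x y * dY g x y); [|apply K2_plus; auto].
  intros x y Hs. symmetry. apply (Derive_mult (fun t => f x t) (fun t => g x t)); [apply (F2 x y Hs)|apply (G2 x y Hs)].
Qed.

Lemma K2_scal a n c f : K2 a n f -> K2 a n (fun x y => c * f x y).
Proof. apply (K2_mult a n (fun _ _ => c)). apply K2_const. Qed.
Lemma K2_opp a n f : K2 a n f -> K2 a n (fun x y => - f x y).
Proof. intros H. apply K2_ext with (fun x y => -1 * f x y); [intros; ring|]. now apply K2_scal. Qed.
Lemma K2_minus a n f g : K2 a n f -> K2 a n g -> K2 a n (fun x y => f x y - g x y).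
Proof. intros H G. apply (K2_plus a n f (fun x y => - g x y)); auto. now apply K2_opp. Qed.

Lemma K2_dX a n f : K2 a (S n) f -> K2 a n (dX f).
Proof. intros H. apply H. Qed.
Lemma K2_dY a n f : K2 a (S n) f -> K2 a n (dY f).
Proof. intros H. apply H. Qed.
Lemma K2_ex_derive a n f x y : K2 a (S n) f -> sq a x y -> ex_derive (fun t => f t y) x /\ ex_derive (fun t => f x t) y.
Proof. intros [_ [H _]] Hs. exact (H x y Hs). Qed.
Lemma K2_is_derive_x a n f x y : K2 a (S n) f -> sq a x y -> is_derive (fun t => f t y) x (dX f x y).
Proof. intros H Hs. exact (Derive_correct (fun t => f t y) x (proj1 (K2_ex_derive a n f x y H Hs))). Qed.
Lemma K2_is_derive_y a n f x y : K2 a (S n) f -> sq a x y -> is_derive (fun t => f x t) y (dY f x y).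
Proof. intros H Hs. exact (Derive_correct (fun t => f x t) y (proj2 (K2_ex_derive a n f x y H Hs))). Qed.

Lemma K2_schwarz a n f x y : K2 a (S (S n)) f -> sq a x y -> dX (dY f) x y = dY (dX f) x y.
Proof. intros H Hs. apply (Schwarz f x y).
 - destruct (sq_open a x y Hs) as [d Hd]. exists d. intros u v Hu Hv. specialize (Hd u v Hu Hv).
  destruct (K2_ex_derive a (S n) f u v H Hd) as [E1 E2].
  exact (conj E1 (conj E2 (conj (proj1 (K2_ex_derive a n (dY f) u v (K2_dY a (S n) f H) Hd))
   (proj2 (K2_ex_derive a n (dX f) u v (K2_dX a (S n) f H) Hd))))).
 - exact (K2_cont a n (dX (dY f)) x y (K2_dX a n _ (K2_dY a (S n) f H)) Hs).
 - exact (K2_cont a n (dY (dX f)) x y (K2_dY a n _ (K2_dX a (S n) f H)) Hs).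
Qed.

Definition S3 (F : nat -> R) : R := F 0%nat + F 1%nat + F 2%nat.

Lemma S3_le F G : (forall k, F k <= G k) -> S3 F <= S3 G.
Proof. intros H. unfold S3. generalize (H 0%nat) (H 1%nat) (H 2%nat). lra. Qed.

Lemma S3_ge_0 F : (forall k, 0 <= F k) -> 0 <= S3 F.
Proof. intros H. unfold S3. generalize (H 0%nat) (H 1%nat) (H 2%nat). lra. Qed.

Lemma K2_S3 a n (F : nat -> R -> R -> R) : (forall k, K2 a n (F k)) -> K2 a n (fun x y => S3 (fun k => F k x y)).
Proof. intros H. apply (K2_plus a n (fun x y => F 0%nat x y + F 1%nat x y)); auto. now apply K2_plus. Qed.

(** The maximum over the rectangle is the maximum in [x] of the maxima in [y]; uniform continuity
    makes the latter continuous in [x]. *)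
Lemma K2_max a n f w c d : K2 a n f -> 0 <= w < a -> - a < c -> c <= d -> d < a ->
 exists x0 y0, - w <= x0 <= w /\ c <= y0 <= d /\ forall x y, - w <= x <= w -> c <= y <= d -> f x y <= f x0 y0.
Proof. intros H Hw Hc Hcd Hd. set (w' := (w + a) / 2).
 assert (C : forall x y, - w' <= x <= w' -> c <= y <= d -> continuity_2d_pt f x y).
 { intros x y X Y. apply (K2_cont a n f x y H). unfold w' in X. split; apply Rabs_def1; lra. }
 set (P := fun x y => - w' <= x <= w' -> c <= y <= d /\ forall t, c <= t <= d -> f x t <= f x y).
 assert (E : forall x, exists y, P x y).
 { intros x. destruct (classic (- w' <= x <= w')) as [X|]; [|exists 0; red; tauto].
  destruct (continuity_ab_maj (f x) c d Hcd) as [y [M B]].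
  - intros y Y eps He. destruct (C x y X Y (mkposreal eps He)) as [r Hr]. exists r. split; [apply r|].
   intros t [_ Ht]. apply Hr; [rewrite Rminus_diag, Rabs_R0; apply r|exact Ht].
  - exists y. red. auto. }
 set (Y := fun x => epsilon (inhabits 0) (P x)). assert (HY : forall x, P x (Y x)) by (intros x; apply epsilon_spec, E).
 destruct (continuity_ab_maj (fun x => f x (Y x)) (- w) w) as [x0 [M B]]; [lra| |].
 (* Uniform continuity is used on the wider interval up to [w'], because continuity at the ends of
    [[-w, w]] is tested on full neighbourhoods. *)
 - intros x X eps He. destruct (uniform_continuity_2d f (- w') w' c d C (mkposreal eps He)) as [r Hr].
  exists (Rmin r (w' - w)). split; [apply Rmin_glb_lt; [apply r|unfold w'; lra]|].
  generalize (Rmin_l r (w' - w)) (Rmin_r r (w' - w)). intros m1 m2 t [_ T]. simpl in *. unfold Rdist in *.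
  assert (X' : - w' <= x <= w') by (unfold w'; lra).
  assert (T' : - w' <= t <= w') by (apply Rabs_def2 in T; lra).
  destruct (HY x X') as [Y1 M1], (HY t T') as [Y2 M2]. specialize (M1 _ Y2). specialize (M2 _ Y1).
  assert (Z : forall y, Rabs (y - y) < r) by (intros; rewrite Rminus_diag, Rabs_R0; apply r).
  assert (A1 := Hr x (Y t) t (Y t) X' Y2 T' Y2 ltac:(lra) (Z _)).
  assert (A2 := Hr x (Y x) t (Y x) X' Y1 T' Y1 ltac:(lra) (Z _)).
  apply Rabs_def2 in A1, A2. apply Rabs_def1; lra.
 - exists x0, (Y x0). destruct (HY x0) as [Y0 _]; [unfold w'; lra|]. split; [auto|split; [auto|]]. intros x y X Y1.
  eapply Rle_trans; [|apply (M x X)]. apply HY; auto. unfold w'; lra.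
Qed.

Lemma K2_bounded a n f w : K2 a n f -> 0 <= w < a -> exists M, 0 <= M /\ forall x y, Rabs x <= w -> Rabs y <= w -> Rabs (f x y) <= M.
Proof. intros H Hw. destruct (K2_max a n _ w (- w) w (K2_mult a n f f H H) Hw) as [x0 [y0 [_ [_ M]]]]; try lra.
 exists (f x0 y0 * f x0 y0 + 1). split; [nra|]. intros x y X Y.
 specialize (M x y (proj1 (Rabs_le_between _ _) X) (proj1 (Rabs_le_between _ _) Y)).
 apply Rabs_le. split; nra.
Qed.

Lemma local_max_derive2 (u u1 : R -> R) t u2 e : 0 < e -> (forall s, Rabs (s - t) < e -> is_derive u s (u1 s)) ->
 is_derive u1 t u2 -> (forall s, Rabs (s - t) < e -> u s <= u t) -> u1 t = 0 /\ u2 <= 0.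
Proof. intros He D1 D2 M.
 assert (Z : u1 t = 0).
 { assert (D := D1 t ltac:(rewrite Rminus_diag, Rabs_R0; lra)). apply is_derive_Reals in D.
  rewrite <- (derive_pt_eq_0 u t (u1 t) (exist _ (u1 t) D) D).
  apply (deriv_maximum u (t - e) (t + e)); try lra. intros s S1 S2. apply M, Rabs_def1; lra. }
 split; [exact Z|]. apply Rnot_lt_le. intros P.
 destruct (proj1 (is_derive_eps u1 t u2) D2 (u2 / 2) ltac:(lra)) as [d [Hd K]].
 set (h := Rmin d e / 2).
 assert (Hh : 0 < h /\ h < d /\ h < e)
  by (unfold h; generalize (Rmin_l d e) (Rmin_r d e) (Rmin_glb_lt _ _ _ Hd He); lra).
 destruct (MVT_cor2 u u1 t (t + h)) as [s [E Hs]]; [lra| |].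
 - intros s Hs. apply is_derive_Reals, D1, Rabs_def1; lra.
 - assert (L := M (t + h) ltac:(apply Rabs_def1; lra)).
  specialize (K (s - t) ltac:(apply Rabs_def1; lra)). replace (t + (s - t)) with s in K by ring.
  rewrite Z, (Rabs_pos_eq (s - t)) in K by lra. apply Rabs_le_between in K.
  assert (Q : 0 < u1 s) by (assert (0 < u2 / 2 * (s - t)) by (apply Rmult_lt_0_compat; lra); lra). assert (0 < u1 s * h) by (apply Rmult_lt_0_compat; lra). lra.
Qed.

(** First and second order conditions at a maximum of [n * exp p], divided by [exp p], the second
    simplified by the first. *)
Lemma weighted_max (n n1 p p1 : R -> R) t n2 p2 e : 0 < e -> (forall s, Rabs (s - t) < e -> is_derive n s (n1 s)) ->
 is_derive n1 t n2 -> (forall s, is_derive p s (p1 s)) -> is_derive p1 t p2 ->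
 (forall s, Rabs (s - t) < e -> n s * exp (p s) <= n t * exp (p t)) ->
 n1 t = - n t * p1 t /\ n2 - n t * p1 t ^ 2 + n t * p2 <= 0.
Proof. intros He Dn Dn1 Dp Dp1 M. assert (X := exp_pos (p t)).
 assert (Pr : forall (f g : R -> R) s a b, is_derive f s a -> is_derive g s b -> is_derive (fun s => f s * g s) s (a * g s + f s * b)).
 { intros f g s a b Hf Hg. exact (is_derive_mult f g s a b Hf Hg Rmult_comm). }
 assert (De : forall s, is_derive (fun s => exp (p s)) s (p1 s * exp (p s))).
 { intros s. exact (is_derive_comp exp p s _ _ (is_derive_exp (p s)) (Dp s)). }
 assert (D0 : Rabs (t - t) < e) by (rewrite Rminus_diag, Rabs_R0; lra).
 destruct (local_max_derive2 (fun s => n s * exp (p s)) (fun s => (n1 s + n s * p1 s) * exp (p s)) t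
  ((n2 + (n1 t * p1 t + n t * p2)) * exp (p t) + (n1 t + n t * p1 t) * (p1 t * exp (p t))) e) as [E1 E2]; auto.
 - intros s Hs. replace ((n1 s + n s * p1 s) * exp (p s)) with (n1 s * exp (p s) + n s * (p1 s * exp (p s))) by ring.
  exact (Pr n (fun s => exp (p s)) s _ _ (Dn s Hs) (De s)).
 - exact (Pr (fun s => n1 s + n s * p1 s) (fun s => exp (p s)) t _ _
   (is_derive_plus n1 (fun s => n s * p1 s) t _ _ Dn1 (Pr n p1 t _ _ (Dn t D0) Dp1)) (De t)).
 - assert (E : n1 t = - n t * p1 t) by nra. nra.
Qed.

(** Cauchy-Schwarz for the complex vectors [p + i q] and [a + i b] in dimension 3, by Lagrange's
    identity. *)
Lemma cauchy_schwarz3 (p q a b : nat -> R) :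
 S3 (fun k => p k * a k + q k * b k) ^ 2 + S3 (fun k => p k * b k - q k * a k) ^ 2 <=
 S3 (fun k => p k ^ 2 + q k ^ 2) * S3 (fun k => a k ^ 2 + b k ^ 2).
Proof.
 assert (L : forall j k, 0 <= (p j * a k - q j * b k - (p k * a j - q k * b j)) ^ 2 + (p j * b k + q j * a k - (p k * b j + q k * a j)) ^ 2)
  by (intros; apply Rplus_le_le_0_compat; apply pow2_ge_0).
 generalize (L 0%nat 1%nat) (L 0%nat 2%nat) (L 1%nat 2%nat). unfold S3. lra.
Qed.

(* With [d] such that [p = d_x], [q = d_y], [a = d_xx], [b = d_xy], [c = d_yy] and [N = |p|^2 + |q|^2], the hypotheses
  on [px, py, lp] are those satisfied by the gradient and Laplacian of [P] at a maximum of [N * exp P]. *)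
Lemma max_point (p q a b c L1 L2 : nat -> R) K N px py lp m : 0 <= K ->
 N = S3 (fun k => p k ^ 2 + q k ^ 2) -> 0 < N ->
 2 * S3 (fun k => p k * a k + q k * b k) = - N * px -> 2 * S3 (fun k => p k * b k + q k * c k) = - N * py ->
 2 * S3 (fun k => a k ^ 2 + 2 * b k ^ 2 + c k ^ 2 + p k * L1 k + q k * L2 k) - N * (px ^ 2 + py ^ 2) + N * lp <= 0 ->
 S3 (fun k => (a k + c k) ^ 2) <= K ^ 2 * N ->
 S3 (fun k => L1 k ^ 2 + L2 k ^ 2) <= K ^ 2 * (N + S3 (fun k => a k ^ 2 + 2 * b k ^ 2 + c k ^ 2)) ->
 m ^ 2 = px ^ 2 + py ^ 2 -> 2 * K <= m -> lp <= 4 * K * m + 2 * K.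
Proof. intros HK EN PN Ex Ey Lp HE HL Hm KM.
 assert (SQ : forall x y, 0 <= y -> x ^ 2 <= y ^ 2 -> x <= y) by (intros; nra).
 (* [2 A] is the squared norm of the trace-free part of the Hessian of [d], and [EE] that of the
    Laplacian, which is controlled by [N]. *)
 set (A := S3 (fun k => ((a k - c k) / 2) ^ 2 + b k ^ 2)). set (EE := S3 (fun k => (a k + c k) ^ 2)) in *.
 assert (PA : 0 <= A) by (apply S3_ge_0; intros; apply Rplus_le_le_0_compat; apply pow2_ge_0).
 set (n := sqrt N). set (al := sqrt A).
 assert (Hn : n ^ 2 = N) by (apply pow2_sqrt; lra). assert (Ha : al ^ 2 = A) by (now apply pow2_sqrt).
 assert (Pn : 0 < n) by (now apply sqrt_lt_R0). assert (Pa : 0 <= al) by apply sqrt_pos.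
 set (u1 := S3 (fun k => p k * ((a k - c k) / 2) + q k * b k)). set (u2 := S3 (fun k => p k * b k - q k * ((a k - c k) / 2))).
 set (f1 := S3 (fun k => p k * (a k + c k) + q k * 0)). set (f2 := S3 (fun k => p k * 0 - q k * (a k + c k))).
 set (T := S3 (fun k => p k * L1 k + q k * L2 k)).
 assert (CU : u1 ^ 2 + u2 ^ 2 <= N * A) by (rewrite EN; apply cauchy_schwarz3).
 assert (CF : f1 ^ 2 + f2 ^ 2 <= N * EE).
 { replace EE with (S3 (fun k => (a k + c k) ^ 2 + 0 ^ 2)) by (unfold EE, S3; ring). rewrite EN. apply cauchy_schwarz3. }
 assert (CT := cauchy_schwarz3 p q L1 L2). rewrite <- EN in CT. fold T in CT.
 assert (Hs : S3 (fun k => a k ^ 2 + 2 * b k ^ 2 + c k ^ 2) = 2 * A + EE / 2) by (unfold A, EE, S3; field).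
 assert (G1 : 2 * u1 + f1 = - N * px) by (rewrite <- Ex; unfold u1, f1, S3; field).
 assert (G2 : 2 * u2 - f2 = - N * py) by (rewrite <- Ey; unfold u2, f2, S3; field).
 assert (KE : N * EE <= (K * n ^ 2) ^ 2).
 { replace ((K * n ^ 2) ^ 2) with (N * (K ^ 2 * N)) by (rewrite <- Hn; ring). apply Rmult_le_compat_l; lra. }
 (* [G1] and [G2] say that [- N] times the gradient of [P] is twice the product of the gradient of
    [d] with the trace-free Hessian, up to the Laplacian. Cauchy-Schwarz then bounds the trace-free
    Hessian from below by nearly [m n / 2], which compensates the term [N m^2] of the second order
    condition. *)
 assert (F1 : m * n <= 2 * al + K * n).
 { assert (UF : u1 * f1 - u2 * f2 <= (n * al) * (K * n ^ 2)).
  { apply SQ; [apply Rmult_le_pos; apply Rmult_le_pos; try apply pow_le; lra|].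
   apply Rle_trans with ((u1 ^ 2 + u2 ^ 2) * (f1 ^ 2 + f2 ^ 2)).
   - generalize (pow2_ge_0 (u1 * f2 + u2 * f1)). lra.
   - replace ((n * al * (K * n ^ 2)) ^ 2) with ((N * A) * (K * n ^ 2) ^ 2) by (rewrite <- Hn, <- Ha; ring).
    apply Rmult_le_compat; try (apply Rplus_le_le_0_compat; apply pow2_ge_0); lra. }
  apply Rmult_le_reg_r with n; auto. apply SQ; [apply Rmult_le_pos; [|lra]; apply Rplus_le_le_0_compat; [|apply Rmult_le_pos]; lra|].
  replace ((m * n * n) ^ 2) with ((- N * px) ^ 2 + (- N * py) ^ 2)
   by (replace ((m * n * n) ^ 2) with (m ^ 2 * (n ^ 2) ^ 2) by ring; rewrite Hm, Hn; ring).
  rewrite <- G1, <- G2.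
  replace (((2 * al + K * n) * n) ^ 2) with (4 * (N * A) + 4 * (n * al * (K * n ^ 2)) + (K * n ^ 2) ^ 2) by (rewrite <- Hn, <- Ha; ring).
  lra. }
 assert (F2 : - T <= K * n * ((1 + K) * n + 2 * al)).
 { apply SQ; [apply Rmult_le_pos; [apply Rmult_le_pos|apply Rplus_le_le_0_compat; [apply Rmult_le_pos|]]; lra|].
  apply Rle_trans with (N * (K ^ 2 * (N + (2 * A + K ^ 2 * N / 2)))).
  - apply Rle_trans with (N * S3 (fun k => L1 k ^ 2 + L2 k ^ 2)); [generalize (pow2_ge_0 (S3 (fun k => p k * L2 k - q k * L1 k))); lra|].
   apply Rmult_le_compat_l; [lra|]. eapply Rle_trans; [exact HL|]. apply Rmult_le_compat_l; [apply pow2_ge_0|lra].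
  - replace ((K * n * ((1 + K) * n + 2 * al)) ^ 2) with (N * (K ^ 2 * ((1 + K) ^ 2 * N + 4 * ((1 + K) * (n * al)) + 4 * A)))
    by (rewrite <- Hn, <- Ha; ring).
   apply Rmult_le_compat_l; [lra|]. apply Rmult_le_compat_l; [apply pow2_ge_0|].
   assert (0 <= (1 + K) * (n * al)) by (apply Rmult_le_pos; [|apply Rmult_le_pos]; lra).
   assert (0 <= K * N) by (apply Rmult_le_pos; lra). assert (0 <= K ^ 2 * N) by (apply Rmult_le_pos; [apply pow2_ge_0|lra]). lra. }
 assert (ET : S3 (fun k => a k ^ 2 + 2 * b k ^ 2 + c k ^ 2 + p k * L1 k + q k * L2 k) = 2 * A + EE / 2 + T)
  by (rewrite <- Hs; unfold T, S3; ring).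
 rewrite ET, <- Hm, <- Hn, <- Ha in Lp.
 assert (0 <= EE) by (apply S3_ge_0; intros; apply pow2_ge_0).
 (* As [m >= 2 K], the lower bound for [2 al - K n] may be squared; in [Lp] the terms [n^2 m^2] then
    cancel and only terms linear in [m] remain. *)
 assert (F3 : ((m - 2 * K) * n) ^ 2 <= (2 * al - K * n) ^ 2).
 { apply pow_incr. split; [apply Rmult_le_pos; lra|lra]. }
 apply Rmult_le_reg_l with (n ^ 2); [rewrite Hn; auto|]. assert (0 <= K ^ 2 * n ^ 2) by (apply Rmult_le_pos; apply pow2_ge_0). lra.
Qed.

Lemma weighted_max_sq (u v : nat -> R -> R) (p p1 : R -> R) t p2 e : 0 < e ->
 (forall k s, Rabs (s - t) < e -> ex_derive (u k) s /\ ex_derive (v k) s) ->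
 (forall k, ex_derive (Derive (fun r => u k r)) t /\ ex_derive (Derive (fun r => v k r)) t) ->
 (forall s, is_derive p s (p1 s)) -> is_derive p1 t p2 ->
 let n := fun s => S3 (fun k => u k s * u k s + v k s * v k s) in
 (forall s, Rabs (s - t) < e -> n s * exp (p s) <= n t * exp (p t)) ->
 2 * S3 (fun k => u k t * Derive (fun r => u k r) t + v k t * Derive (fun r => v k r) t) = - n t * p1 t /\
 2 * S3 (fun k => Derive (fun r => u k r) t ^ 2 + u k t * Derive (fun s => Derive (fun r => u k r) s) t + Derive (fun r => v k r) t ^ 2 + v k t * Derive (fun s => Derive (fun r => v k r) s) t)
  - n t * p1 t ^ 2 + n t * p2 <= 0.
Proof. intros He D D2 Dp Dp1 n M.
 apply (weighted_max n (fun s => 2 * S3 (fun k => u k s * Derive (fun r => u k r) s + v k s * Derive (fun r => v k r) s)) p p1 t _ p2 e); auto.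
 - intros s Hs. destruct (D 0%nat s Hs), (D 1%nat s Hs), (D 2%nat s Hs). unfold n, S3. auto_derive; [tauto|]. ring.
 - assert (D0 := fun k => D k t ltac:(rewrite Rminus_diag, Rabs_R0; lra)).
  destruct (D0 0%nat), (D0 1%nat), (D0 2%nat), (D2 0%nat), (D2 1%nat), (D2 2%nat). unfold S3. auto_derive; [tauto|]. ring.
Qed.

Definition Nsq (W1 W2 : nat -> R -> R -> R) (x y : R) : R := S3 (fun k => W1 k x y * W1 k x y + W2 k x y * W2 k x y).

Lemma Nsq_ge_0 W1 W2 x y : 0 <= Nsq W1 W2 x y.
Proof. apply S3_ge_0. intros; nra. Qed.

(** [W1], [W2] are the components of the gradient of the difference of two solutions. If [N] were
    positive near 0, [N * exp P] would have a positive maximum on a small square, off the axis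
    because [N] vanishes there. Off the axis [s] is harmonic, so the Laplacian of
    [P = tau * exp (- lam * s)] is [lam^2 |grad s|^2 P]; for this [lam] that contradicts
    [max_point]. *)
Lemma cauchy_unique a K (W1 W2 : nat -> R -> R -> R) : 0 < a -> 0 <= K ->
 (forall k, K2 a 2 (W1 k)) -> (forall k, K2 a 2 (W2 k)) -> (forall k x y, sq a x y -> dY (W1 k) x y = dX (W2 k) x y) ->
 let E := fun k x y => dX (W1 k) x y + dY (W2 k) x y in
 (forall x y, sq a x y -> S3 (fun k => E k x y ^ 2) <= K ^ 2 * Nsq W1 W2 x y) ->
 (forall x y, sq a x y -> S3 (fun k => dX (E k) x y ^ 2 + dY (E k) x y ^ 2) <=
   K ^ 2 * (Nsq W1 W2 x y + S3 (fun k => dX (W1 k) x y ^ 2 + 2 * dX (W2 k) x y ^ 2 + dY (W2 k) x y ^ 2))) ->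
 (forall k x, Rabs x < a -> W1 k x 0 = 0 /\ W2 k x 0 = 0) ->
 exists eta, 0 < eta < a /\ forall x y, Rabs x < eta -> Rabs y < eta -> Nsq W1 W2 x y = 0.
Proof. intros Ha HK H1 H2 Cu E HE HL H0.
 (* The bound [|y| <= 1/4] keeps the gradient of [s] at length at least 1/2, and [w^2 <= w / 4]
    keeps the region [s < w^2] inside the open square. *)
 set (w := Rmin (a / 2) (1 / 4)).
 assert (Hw : 0 < w /\ w <= a / 2 /\ w <= 1 / 4)
  by (unfold w; generalize (Rmin_l (a / 2) (1 / 4)) (Rmin_r (a / 2) (1 / 4)); split; [apply Rmin_glb_lt; lra|lra]).
 assert (Hw2 : 0 < w ^ 2 <= w / 4) by (simpl; nra).
 set (N := Nsq W1 W2).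
 assert (HN : K2 a 2 N) by (apply K2_S3; intros k; apply K2_plus; apply K2_mult; auto).
 assert (Npos := Nsq_ge_0 W1 W2 : forall x y, 0 <= N x y).
 destruct (K2_bounded a 2 N w HN ltac:(lra)) as [M [PM HM]].
 (* At this distance from 0 the test point satisfies [s < w^2]. *)
 exists (w ^ 2 / 2). split; [lra|]. intros xs ys Hx Hy.
 destruct (Rle_lt_or_eq_dec 0 (N xs ys) (Npos xs ys)) as [NP|]; [exfalso|auto].
 (* The term [- y * y] balances [x * x], so that [s] is harmonic off the axis; [lam] is chosen to
    outweigh [K] in the final inequality. *)
 set (lam := 8 * (K + 1)). set (s := fun x y => Rabs y + x * x - y * y).
 set (de := exp (- lam * s xs ys) - exp (- lam * w ^ 2)).
 assert (Ss : s xs ys < w ^ 2).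
 { unfold s. assert (xs * xs <= w ^ 2 / 2).
  { replace (xs * xs) with (Rabs xs * Rabs xs) by (rewrite <- Rabs_mult; apply Rabs_pos_eq; nra).
   assert (Rabs xs * Rabs xs <= Rabs xs * 1) by (apply Rmult_le_compat_l; [apply Rabs_pos|lra]). lra. }
  generalize (pow2_ge_0 ys). lra. }
 assert (Pde : 0 < de) by (apply Rlt_0_minus, exp_increasing; unfold lam; nra).
 (* The first summand gives [P >= 1] where [s <= 1]. The second makes the value of [N * exp P] at
    [(xs, ys)] exceed every value taken where [s >= w^2]. *)
 set (tau := exp lam + M / N xs ys / de).
 assert (PMN : 0 <= M / N xs ys / de) by (repeat apply Rdiv_le_0_compat; auto).
 set (P := fun x y => tau * exp (- lam * s x y)).
 destruct (K2_max a 0 (fun x y => N x y * exp (P x y)) w (- w) w) as [x0 [y0 [X0 [Y0 Mx]]]]; try lra.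
 { split; [|exact I]. intros x y Hs. apply continuity_2d_pt_mult; [now apply (K2_cont a 2)|].
  assert (Ce : forall f, continuity_2d_pt f x y -> continuity_2d_pt (fun x y => exp (f x y)) x y).
  { intros f Hf. apply continuity_1d_2d_pt_comp; auto. apply derivable_continuous_pt, derivable_pt_exp. }
  apply Ce, (continuity_2d_pt_mult (fun _ _ => tau)); [apply continuity_2d_pt_const|].
  apply Ce, (continuity_2d_pt_mult (fun _ _ => - lam)); [apply continuity_2d_pt_const|].
  apply continuity_2d_pt_minus; [apply continuity_2d_pt_plus|]; [|apply continuity_2d_pt_mult; apply continuity_2d_pt_id1|
   apply continuity_2d_pt_mult; apply continuity_2d_pt_id2].
  apply continuity_1d_2d_pt_comp; [apply Rcontinuity_abs|apply continuity_2d_pt_id2]. }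
 assert (Mxs := Mx xs ys ltac:(apply Rabs_def2 in Hx; lra) ltac:(apply Rabs_def2 in Hy; lra)).
 assert (PN : 0 < N x0 y0).
 { apply Rmult_lt_reg_r with (exp (P x0 y0)); [apply exp_pos|]. rewrite Rmult_0_l.
  eapply Rlt_le_trans; [|exact Mxs]. apply Rmult_lt_0_compat; [auto|apply exp_pos]. }
 assert (Y00 : y0 <> 0).
 { intros ->. assert (Z := fun k => H0 k x0 ltac:(apply Rabs_def1; lra)). unfold N, Nsq, S3 in PN.
  rewrite !(fun k => proj1 (Z k)), !(fun k => proj2 (Z k)) in PN. lra. }
 assert (S0 : s x0 y0 < w ^ 2).
 { apply Rnot_le_lt. intros L.
  assert (B : N x0 y0 * exp (P x0 y0) <= M * exp (tau * exp (- lam * w ^ 2))).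
  { assert (Mo : forall p q, p <= q -> exp p <= exp q) by (intros p q [Q| ->]; [left; now apply exp_increasing|lra]).
   apply Rmult_le_compat; [auto|left; apply exp_pos| |].
   - eapply Rle_trans; [apply Rle_abs|apply HM; apply Rabs_le; lra].
   - apply Mo, Rmult_le_compat_l; [unfold tau; generalize (exp_pos lam); lra|]. apply Mo. unfold lam; nra. }
  assert (B' : N xs ys * exp (tau * de) <= M).
  { apply Rmult_le_reg_r with (exp (tau * exp (- lam * w ^ 2))); [apply exp_pos|].
   rewrite Rmult_assoc, <- exp_plus. replace (tau * de + tau * exp (- lam * w ^ 2)) with (P xs ys) by (unfold P, de; ring). lra. }
  assert (T : M / N xs ys <= tau * de).
  { replace (tau * de) with (exp lam * de + M / N xs ys) by (unfold tau; field; lra).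
   assert (0 < exp lam * de) by (apply Rmult_lt_0_compat; [apply exp_pos|auto]). lra. }
  assert (T2 := exp_ineq1_le (tau * de)).
  assert (T3 : N xs ys * (1 + M / N xs ys) = N xs ys + M) by (field; lra). nra. }
 assert (AY : 0 < Rabs y0 <= w) by (split; [now apply Rabs_pos_lt|apply Rabs_le; lra]).
 assert (YY : y0 * y0 = Rabs y0 * Rabs y0) by (rewrite <- Rabs_mult; symmetry; apply Rabs_pos_eq; nra).
 assert (Xw : Rabs x0 < w) by (unfold s in S0; rewrite YY in S0; apply Rabs_def1; nra).
 assert (Yw : Rabs y0 < w) by (unfold s in S0; nra).
 set (e := Rmin (Rmin (w - Rabs x0) (w - Rabs y0)) (Rabs y0)).
 assert (He : 0 < e /\ e <= w - Rabs x0 /\ e <= w - Rabs y0 /\ e <= Rabs y0).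
 { unfold e. generalize (Rmin_l (Rmin (w - Rabs x0) (w - Rabs y0)) (Rabs y0)) (Rmin_r (Rmin (w - Rabs x0) (w - Rabs y0)) (Rabs y0))
   (Rmin_l (w - Rabs x0) (w - Rabs y0)) (Rmin_r (w - Rabs x0) (w - Rabs y0)).
  repeat split; try lra. repeat apply Rmin_glb_lt; lra. }
 (* Near [y0], which is not 0, the absolute value is linear with slope [sg], so the weight is smooth
    there. *)
 assert (Sg : exists sg, sg * sg = 1 /\ forall y, Rabs (y - y0) < e -> sg * y = Rabs y).
 { destruct (Rle_lt_dec 0 y0) as [L|L]; [exists 1|exists (-1)]; (split; [ring|]); intros y Hy'; apply Rabs_def2 in Hy';
   [rewrite (Rabs_pos_eq y0) in He by lra; rewrite Rabs_pos_eq|rewrite (Rabs_left y0) in He by lra; rewrite Rabs_left]; lra. }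
 destruct Sg as [sg [Sg1 Sg2]].
 assert (Near : forall t t0 : R, Rabs t0 < w -> Rabs (t - t0) < w - Rabs t0 -> Rabs t < w).
 { intros t t0 T1 T2. replace t with ((t - t0) + t0) by ring. eapply Rle_lt_trans; [apply Rabs_triang|lra]. }
 assert (D0 : forall t, Rabs (t - t) < e) by (intros; rewrite Rminus_diag, Rabs_R0; lra).
 assert (Hs : sq a x0 y0) by (split; lra).
 destruct (weighted_max_sq (fun k t => W1 k t y0) (fun k t => W2 k t y0) (fun t => tau * exp (- lam * (sg * y0 + t * t - y0 * y0)))
   (fun t => - lam * (2 * t) * (tau * exp (- lam * (sg * y0 + t * t - y0 * y0)))) x0
   ((- lam * 2 + lam ^ 2 * (2 * x0) ^ 2) * (tau * exp (- lam * (sg * y0 + x0 * x0 - y0 * y0)))) e) as [X1 X2]; try lra.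
 { intros k t Ht. assert (St : sq a t y0) by (split; [assert (Rabs t < w) by (apply (Near t x0); lra); lra|lra]).
  exact (conj (proj1 (K2_ex_derive a 1 _ t y0 (H1 k) St)) (proj1 (K2_ex_derive a 1 _ t y0 (H2 k) St))). }
 { intros k. exact (conj (proj1 (K2_ex_derive a 0 _ x0 y0 (K2_dX a 1 _ (H1 k)) Hs)) (proj1 (K2_ex_derive a 0 _ x0 y0 (K2_dX a 1 _ (H2 k)) Hs))). }
 { intros t. auto_derive; auto. unfold Rminus. ring. }
 { auto_derive; auto. unfold Rminus. ring. }
 { intros t Ht. rewrite Sg2 by auto. apply (Mx t y0); [apply Rabs_le_between, Rlt_le, (Near t x0); lra|lra]. }
 destruct (weighted_max_sq (fun k t => W1 k x0 t) (fun k t => W2 k x0 t) (fun t => tau * exp (- lam * (sg * t + x0 * x0 - t * t)))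
   (fun t => - lam * (sg - 2 * t) * (tau * exp (- lam * (sg * t + x0 * x0 - t * t)))) y0
   ((lam * 2 + lam ^ 2 * (sg - 2 * y0) ^ 2) * (tau * exp (- lam * (sg * y0 + x0 * x0 - y0 * y0)))) e) as [Y1 Y2]; try lra.
 { intros k t Ht. assert (St : sq a x0 t) by (split; [lra|assert (Rabs t < w) by (apply (Near t y0); lra); lra]).
  exact (conj (proj2 (K2_ex_derive a 1 _ x0 t (H1 k) St)) (proj2 (K2_ex_derive a 1 _ x0 t (H2 k) St))). }
 { intros k. exact (conj (proj2 (K2_ex_derive a 0 _ x0 y0 (K2_dY a 1 _ (H1 k)) Hs)) (proj2 (K2_ex_derive a 0 _ x0 y0 (K2_dY a 1 _ (H2 k)) Hs))). }
 { intros t. auto_derive; auto. unfold Rminus. ring. }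
 { auto_derive; auto. unfold Rminus. ring. }
 { intros t Ht. rewrite !Sg2 by auto. apply (Mx x0 t); [lra|apply Rabs_le_between, Rlt_le, (Near t y0); lra]. }
 fold (Nsq W1 W2 x0 y0) in X1, X2, Y1, Y2. fold N in X1, X2, Y1, Y2.
 set (P0 := tau * exp (- lam * (sg * y0 + x0 * x0 - y0 * y0))) in *.
 set (ka := sqrt ((2 * x0) ^ 2 + (sg - 2 * y0) ^ 2)).
 assert (Hka : ka ^ 2 = (2 * x0) ^ 2 + (sg - 2 * y0) ^ 2) by (apply pow2_sqrt, Rplus_le_le_0_compat; apply pow2_ge_0).
 assert (Pka : 1 / 2 <= ka).
 { assert (0 <= ka) by apply sqrt_pos. rewrite <- (Sg2 y0 (D0 y0)) in Yw. assert (X2' := pow2_ge_0 (2 * x0)).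
  assert (ka ^ 2 >= (1 - 2 * (sg * y0)) ^ 2) by (rewrite Hka; replace ((1 - 2 * (sg * y0)) ^ 2) with ((sg - 2 * y0) ^ 2 + (1 - sg * sg) * (1 - 4 * (y0 * y0))) by ring; rewrite Sg1; lra).
  assert ((1 / 2) ^ 2 <= (1 - 2 * (sg * y0)) ^ 2) by (apply pow_incr; lra).
  apply Rnot_lt_le. intros L. assert (ka * ka < 1 / 2 * (1 / 2)) by (apply Rmult_le_0_lt_compat; lra). lra. }
 assert (PP : 1 <= P0).
 { unfold P0. rewrite Sg2 by auto. apply Rle_trans with (exp lam * exp (- lam * s x0 y0)).
  - rewrite <- exp_plus. eapply Rle_trans; [|apply exp_ineq1_le].
   assert (0 <= lam * (1 - s x0 y0)) by (apply Rmult_le_pos; unfold lam; lra). lra.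
  - apply Rmult_le_compat_r; [left; apply exp_pos|unfold tau; lra]. }
 (* The curl condition turns the gradient of [E] into the Laplacians of [W1] and [W2], the form in
    which they occur in the second order condition. *)
 assert (Sch : forall k, dX (E k) x0 y0 = dX (dX (W1 k)) x0 y0 + dY (dY (W1 k)) x0 y0 /\
   dY (E k) x0 y0 = dX (dX (W2 k)) x0 y0 + dY (dY (W2 k)) x0 y0).
 { intros k.
  destruct (K2_ex_derive a 0 _ x0 y0 (K2_dX a 1 _ (H1 k)) Hs) as [e1 e2], (K2_ex_derive a 0 _ x0 y0 (K2_dY a 1 _ (H2 k)) Hs) as [e3 e4].
  rewrite (dY_ext a (dY (W1 k)) (dX (W2 k))), <- (dX_ext a (dY (W1 k)) (dX (W2 k))), <- (K2_schwarz a 0 (W2 k)), (K2_schwarz a 0 (W1 k)) by auto.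
  split; [exact (Derive_plus _ _ _ e1 e3)|exact (Derive_plus _ _ _ e2 e4)]. }
 assert (Q : 1 / 2 * 1 <= ka * P0) by (apply Rmult_le_compat; lra).
 (* In the sum of the two second derivatives of the weight exponent the terms linear in [lam]
    cancel, [s] being harmonic. *)
 assert (Bad : lam ^ 2 * ka ^ 2 * P0 <= 4 * K * (lam * ka * P0) + 2 * K).
 { apply (max_point (fun k => W1 k x0 y0) (fun k => W2 k x0 y0) (fun k => dX (W1 k) x0 y0) (fun k => dX (W2 k) x0 y0)
   (fun k => dY (W2 k) x0 y0) (fun k => dX (E k) x0 y0) (fun k => dY (E k) x0 y0) K (N x0 y0)
   (- lam * (2 * x0) * P0) (- lam * (sg - 2 * y0) * P0)); auto.
  - unfold N, Nsq, S3. ring.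
  - rewrite <- Y1. unfold S3. rewrite <- !Cu by auto. reflexivity.
  - assert (XY := Rplus_le_compat _ _ _ _ X2 Y2). assert (C0 := fun k => Cu k x0 y0 Hs).
   unfold S3 in *. rewrite Hka, !(fun k => proj1 (Sch k)), !(fun k => proj2 (Sch k)). unfold dX, dY in C0 |- *.
   rewrite !C0 in XY. lra.
  - exact (HE x0 y0 Hs).
  - replace ((lam * ka * P0) ^ 2) with (lam ^ 2 * ka ^ 2 * P0 ^ 2) by ring. rewrite Hka. ring.
  - apply (Rmult_le_compat_l lam) in Q; unfold lam in *; lra. }
 set (m := ka * P0) in *.
 replace (lam ^ 2 * ka ^ 2 * P0) with (64 * (K + 1) ^ 2 * m * ka) in Bad by (unfold m, lam; ring).
 replace (lam * ka * P0) with (8 * (K + 1) * m) in Bad by (unfold m, lam; ring).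
 apply (Rmult_le_compat_l (64 * (K + 1) ^ 2 * m)) in Pka; [|apply Rmult_le_pos; [apply Rmult_le_pos; [lra|apply pow2_ge_0]|lra]].
 apply (Rmult_le_compat_l (32 * (K + 1))) in Q; lra.
Qed.

(** * The constant mean curvature equation in coordinates *)

Lemma K2_sub a a' n : a' <= a -> forall f, K2 a n f -> K2 a' n f.
Proof. intros L. assert (Sq : forall x y, sq a' x y -> sq a x y) by (unfold sq; intros; lra).
 induction n as [|n IH]; intros f [H1 H2]; (split; [auto|]); auto.
 destruct H2 as [H2 [H3 H4]]. auto.
Qed.

(** Coordinates in the basis [e1], [e2], [e3]. Every index from 2 on gives the third one, so that
    statements may quantify over all natural numbers; [cross] follows the same convention. *)
Definition cf (k : nat) (X : M2) : R :=
 match k with O => - Im (ent X 0 1) | 1%nat => Re (ent X 0 1) | _ => Im (ent X 0 0) end.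

Lemma cf_vec3 a b d : cf 0 (vec3 a b d) = a /\ cf 1 (vec3 a b d) = b /\ cf 2 (vec3 a b d) = d.
Proof. simpl. repeat split; ring.
Qed.

Lemma su2_cf X : is_su2 X -> X = vec3 (cf 0 X) (cf 1 X) (cf 2 X).
Proof. intros H. destruct (su2_vec3 X H) as [a [b [d ->]]]. destruct (cf_vec3 a b d) as [E1 [E2 E3]]. now rewrite E1, E2, E3. Qed.

Lemma inner_cf X Y : is_su2 X -> is_su2 Y -> inner X Y = S3 (fun k => cf k X * cf k Y).
Proof. intros HX HY. rewrite (su2_cf X HX), (su2_cf Y HY) at 1. apply inner_vec3. Qed.

Lemma cf_mscal k c X : cf k (RtoC c *: X)%M2 = c * cf k X.
Proof. destruct k as [|[|k]]; unfold cf; unfold Re, Im; simpl; ring. Qed.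

Lemma RDM_cf k g t D : RDM g t D -> is_derive (fun s => cf k (g s)) t (cf k D).
Proof. intros H. destruct k as [|[|k]].
 - apply (is_derive_opp (fun s => Im (ent (g s) 0 1))). apply (H 0%nat 1%nat).
 - apply (H 0%nat 1%nat).
 - apply (H 0%nat 0%nat).
Qed.

Lemma cf_dist k X Y : Rabs (cf k X - cf k Y) <= Cmod (ent X 0 1 - ent Y 0 1)%C + Cmod (ent X 0 0 - ent Y 0 0)%C.
Proof. assert (P1 := Cmod_ge_0 (ent X 0 1 - ent Y 0 1)). assert (P2 := Cmod_ge_0 (ent X 0 0 - ent Y 0 0)).
 assert (R1 := Re_le_Cmod (ent X 0 1 - ent Y 0 1)). assert (I1 := Im_le_Cmod (ent X 0 1 - ent Y 0 1)).
 assert (I2 := Im_le_Cmod (ent X 0 0 - ent Y 0 0)).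
 destruct k as [|[|k]]; unfold cf.
 - replace (- Im (ent X 0 1) - - Im (ent Y 0 1)) with (- Im (ent X 0 1 - ent Y 0 1)%C) by (unfold Im; simpl; ring).
  rewrite Rabs_Ropp. lra.
 - change (Re (ent X 0 1) - Re (ent Y 0 1)) with (Re (ent X 0 1 - ent Y 0 1)%C). lra.
 - change (Im (ent X 0 0) - Im (ent Y 0 0)) with (Im (ent X 0 0 - ent Y 0 0)%C). lra.
Qed.

Definition cof (f : C -> M2) (x1 : R) (k : nat) (x y : R) : R := cf k (f (x1 + x, y)).

Lemma ex_Mderive_RDM g t : ex_Mderive g t -> RDM g t (Mderive g t).
Proof. intros [D HD]. apply is_Mderive_RDM in HD. now rewrite (Mderive_RDM _ _ _ HD). Qed.

Lemma is_derive_shift (g : R -> R) x1 x d : is_derive g (x1 + x) d -> is_derive (fun t => g (x1 + t)) x d.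
Proof.
 intros H. replace d with (1 * d) by ring. apply (is_derive_comp g (fun t => x1 + t)); auto. auto_derive; auto; ring.
Qed.

Lemma cof_derive U n f x1 k x y : is_Ck U (S n) f -> U (x1 + x, y) ->
 is_derive (fun t => cof f x1 k t y) x (cof (pdx f) x1 k x y) /\
 is_derive (fun t => cof f x1 k x t) y (cof (pdy f) x1 k x y).
Proof. intros [_ [H _]] Hu. destruct (H _ Hu) as [D1 D2]. split.
 - apply (is_derive_shift (fun t => cf k (f (t, y)))). exact (RDM_cf k _ _ _ (ex_Mderive_RDM _ _ D1)).
 - exact (RDM_cf k _ _ _ (ex_Mderive_RDM _ _ D2)).
Qed.

Lemma is_Ck_K2 U a x1 k n : (forall x y, sq a x y -> U (x1 + x, y)) -> forall f, is_Ck U n f -> K2 a n (cof f x1 k).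
Proof. intros HU.
 assert (C : forall f, (forall z, U z -> forall i j, @continuous C_UniformSpace C_UniformSpace (fun w => ent (f w) i j) z) ->
  forall x y, sq a x y -> continuity_2d_pt (cof f x1 k) x y).
 { intros f Hf x y Hs eps. specialize (Hf _ (HU x y Hs)).
  assert (Pe := cond_pos eps).
  destruct (proj1 (continuous_C_eps _ _) (Hf 0%nat 1%nat) (eps / 2) ltac:(lra)) as [d1 [P1 D1]].
  destruct (proj1 (continuous_C_eps _ _) (Hf 0%nat 0%nat) (eps / 2) ltac:(lra)) as [d2 [P2 D2]].
  assert (P : 0 < Rmin d1 d2 / 2) by (assert (0 < Rmin d1 d2) by (now apply Rmin_glb_lt); lra).
  exists (mkposreal _ P). simpl. intros u v Hu Hv. generalize (Rmin_l d1 d2) (Rmin_r d1 d2). intros m1 m2.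
  assert (Dist : Cmod (((x1 + u)%R, v) - ((x1 + x)%R, y))%C < Rmin d1 d2).
  { reimlt. unfold Re, Im; simpl.
   replace (x1 + u + - (x1 + x)) with (u - x) by ring. change (v + - y) with (v - y). lra. } eapply Rle_lt_trans; [apply cf_dist|].
  assert (Q1 := D1 (x1 + u, v) (Rlt_le_trans _ _ _ Dist m1)). assert (Q2 := D2 (x1 + u, v) (Rlt_le_trans _ _ _ Dist m2)).
  lra. }
 induction n as [|n IH]; intros f H; assert (H' := H); destruct H as [H1 H2]; (split; [now apply C|]); auto.
 destruct H2 as [H2 [H3 H4]].
 assert (D := fun x y Hs => cof_derive U n f x1 k x y H' (HU x y Hs)). split; [|split].
 - intros x y Hs. destruct (D x y Hs). split; eexists; eassumption.
 - apply K2_ext with (cof (pdx f) x1 k); auto. intros x y Hs. symmetry. exact (is_derive_unique _ _ _ (proj1 (D x y Hs))).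
 - apply K2_ext with (cof (pdy f) x1 k); auto. intros x y Hs. symmetry. exact (is_derive_unique _ _ _ (proj2 (D x y Hs))).
Qed.

Lemma su2_RDM (g : R -> M2) t D e : 0 < e -> (forall s, Rabs (s - t) < e -> is_su2 (g s)) -> RDM g t D -> is_su2 D.
Proof. intros He Hg HD. split.
 - apply (RDM_unique (fun s => mdagger (g s)) t); [now apply RDM_mdagger|].
  apply (RDM_ext_loc (fun s => RtoC (-1) *: g s)%M2 _ t _ e He); [|now apply RDM_mscal].
  intros s Hs. symmetry. apply (Hg s Hs).
 - apply (RD_unique (fun s => ent (g s) 0 0 + ent (g s) 1 1)%C t).
  + apply RD_plus; apply HD.
  + apply (RD_ext_loc (fun _ => RtoC 0) _ t _ e He); [|apply RD_const]. intros s Hs. symmetry. apply (Hg s Hs).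
Qed.

Lemma su2_pd U f n : @open C_UniformSpace U -> (forall z, U z -> is_su2 (f z)) -> is_Ck U (S n) f ->
 forall z, U z -> is_su2 (pdx f z) /\ is_su2 (pdy f z).
Proof. intros HU Hf [_ [H _]] z Hz. destruct (H z Hz) as [D1 D2].
 destruct (proj1 (open_C_eps U) HU z Hz) as [d [Hd K]]. destruct z as [p q]. split.
 - apply (su2_RDM (fun t => f (t, q)) p _ d Hd); [|exact (ex_Mderive_RDM _ _ D1)]. intros s Hs. apply Hf, K.
  reimlt. unfold Re, Im; simpl. rewrite Rplus_opp_r, Rabs_R0, Rplus_0_r. exact Hs.
 - apply (su2_RDM (fun t => f (p, t)) q _ d Hd); [|exact (ex_Mderive_RDM _ _ D2)]. intros s Hs. apply Hf, K.
  reimlt. unfold Re, Im; simpl. rewrite Rplus_opp_r, Rabs_R0, Rplus_0_l. exact Hs.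
Qed.

Definition cross (p q : nat -> R) (k : nat) : R :=
 match k with
 | O => p 1%nat * q 2%nat - p 2%nat * q 1%nat
 | 1%nat => p 2%nat * q 0%nat - p 0%nat * q 2%nat
 | _ => p 0%nat * q 1%nat - p 1%nat * q 0%nat
 end.

Lemma vec3_mmul a b d a' b' d' : a * a' + b * b' + d * d' = 0 ->
 (vec3 a b d ** vec3 a' b' d')%M2 = vec3 (b * d' - d * b') (d * a' - a * d') (a * b' - b * a').
Proof. intros E.
 apply M2_ext; ents; apply injective_projections; simpl; lra.
Qed.

Lemma frame_solve (X p q : nat -> R) L H : 0 < L -> S3 (fun k => p k * p k) = L -> S3 (fun k => q k * q k) = L ->
 S3 (fun k => p k * q k) = 0 -> S3 (fun k => X k * p k) = 0 -> S3 (fun k => X k * q k) = 0 ->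
 S3 (fun k => X k * cross p q k) = 2 * H * L ^ 2 ->
 forall k, (k <= 2)%nat -> X k = 2 * H * cross p q k.
Proof. unfold S3. intros PL Ep Eq Epq E1 E2 E3.
 set (n := cross p q) in *.
 assert (En : n 0%nat * n 0%nat + n 1%nat * n 1%nat + n 2%nat * n 2%nat = L ^ 2).
 { transitivity ((p 0%nat * p 0%nat + p 1%nat * p 1%nat + p 2%nat * p 2%nat) * (q 0%nat * q 0%nat + q 1%nat * q 1%nat + q 2%nat * q 2%nat)
   - (p 0%nat * q 0%nat + p 1%nat * q 1%nat + p 2%nat * q 2%nat) * (p 0%nat * q 0%nat + p 1%nat * q 1%nat + p 2%nat * q 2%nat)).
  - unfold n, cross. ring.
  - rewrite Ep, Eq, Epq. ring. }
 assert (PL2 : L ^ 2 <> 0) by (apply pow_nonzero; lra).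
 (* Cramer's rule in the basis [p, q, p x q] *)
 assert (Cr : forall k, (k <= 2)%nat -> L ^ 2 * X k = (2 * H * L ^ 2) * n k).
 { intros k Hk. rewrite <- E3, <- En.
  transitivity ((X 0%nat * p 0%nat + X 1%nat * p 1%nat + X 2%nat * p 2%nat) * cross q n k
   + (X 0%nat * q 0%nat + X 1%nat * q 1%nat + X 2%nat * q 2%nat) * cross n p k
   + (X 0%nat * n 0%nat + X 1%nat * n 1%nat + X 2%nat * n 2%nat) * n k).
  - destruct k as [|[|[|k]]]; try lia; unfold n, cross; ring.
  - rewrite E1, E2. ring. }
 intros k Hk. apply (Rmult_eq_reg_l (L ^ 2)); auto. rewrite (Cr k Hk). ring.
Qed.

Lemma e1_e2 : (e1 ** e2)%M2 = e3.
Proof. unfold e1, e2, e3. rewrite mmul_mat2, RtoC_m1. f_equal; ring.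
Qed.

Lemma cross_mmul X Y : is_su2 X -> is_su2 Y -> S3 (fun k => cf k X * cf k Y) = 0 ->
 (X ** Y)%M2 = vec3 (cross (fun k => cf k X) (fun k => cf k Y) 0) (cross (fun k => cf k X) (fun k => cf k Y) 1)
  (cross (fun k => cf k X) (fun k => cf k Y) 2).
Proof. intros HX HY E. rewrite (su2_cf X HX), (su2_cf Y HY) at 1. rewrite vec3_mmul; [reflexivity|exact E].
Qed.

(** Since [e3 = e1 e2] and the product of orthogonal elements of [su(2)] is their cross product, the
    normal is the cross product of [f_x] and [f_y] divided by [L], and the frame disappears from the
    definition of [H]. *)
Lemma mean_curvature_normal U f H z : @open C_UniformSpace U -> cmc_surface U f H -> U z ->
 let p := fun k => cf k (pdx f z) in let q := fun k => cf k (pdy f z) in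
 let X := fun k => cf k (pdx (pdx f) z) + cf k (pdy (pdy f) z) in
 exists L, 0 < L /\ S3 (fun k => p k * p k) = L /\ S3 (fun k => q k * q k) = L /\ S3 (fun k => p k * q k) = 0 /\
  S3 (fun k => X k * cross p q k) = 2 * H * L ^ 2.
Proof. intros HU [[Hs [Hsm [Him Hcf]]] Hmc] Hz p q X.
 destruct (su2_pd U f 1 HU Hs (Hsm 2%nat) z Hz) as [Sx Sy].
 assert (Sxx := proj1 (su2_pd U (pdx f) 0 HU (fun u Hu => proj1 (su2_pd U f 1 HU Hs (Hsm 2%nat) u Hu)) (proj1 (proj2 (proj2 (Hsm 2%nat)))) z Hz)).
 assert (Syy := proj2 (su2_pd U (pdy f) 0 HU (fun u Hu => proj2 (su2_pd U f 1 HU Hs (Hsm 2%nat) u Hu)) (proj2 (proj2 (proj2 (Hsm 2%nat)))) z Hz)).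
 destruct (Hcf z Hz) as [C1 C2]. rewrite (inner_cf _ _ Sx Sx), (inner_cf _ _ Sy Sy) in C1. rewrite (inner_cf _ _ Sx Sy) in C2.
 change (S3 (fun k => p k * p k) = S3 (fun k => q k * q k)) in C1.
 set (L := S3 (fun k => p k * p k)) in *.
 assert (PL : 0 < L).
 { assert (L0 : 0 <= L) by (unfold L, S3; nra).
  destruct (Rle_lt_or_eq_dec 0 L L0) as [|E]; auto.
  assert (Z : p 0%nat = 0 /\ p 1%nat = 0 /\ p 2%nat = 0) by (unfold L, S3 in E; repeat split; nra).
  assert (Z0 : pdx f z = mzero).
  { rewrite (su2_cf _ Sx), mzero_vec3. fold (p 0%nat) (p 1%nat) (p 2%nat). destruct Z as [-> [-> ->]]. reflexivity. }
  destruct (Him z Hz 1 0) as [E1 _]; [|lra]. rewrite Z0, mscal_0, madd_0_r.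
  rewrite mzero_mat2, mscal_mat2. f_equal; ring. }
 exists L. split; [auto|split; [reflexivity|split; [auto|split; [auto|]]]].
 destruct (Hmc z Hz) as [F [[SF [F1 F2]] EH]].
 assert (En : enorm (pdx f z) = sqrt L /\ enorm (pdy f z) = sqrt L).
 { unfold enorm. rewrite !inner_cf by auto. split; [reflexivity|]. now rewrite C1. }
 destruct En as [En1 En2]. assert (Ps := sqrt_lt_R0 L PL). assert (Qs := sqrt_sqrt L ltac:(lra)).
 rewrite <- e1_e2, <- Ad_mmul, F1, F2, En1, En2, mmul_mscal_l, mmul_mscal_r, mscal_mscal, <- RtoC_mult in EH by apply SF.
 rewrite (cross_mmul _ _ Sx Sy C2), vec3_scal in EH. fold p q in EH.
 unfold conf_factor in EH. rewrite En1 in EH.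
 replace (- 2 * ln (/ 2 * sqrt L)) with (- (ln (/ 2 * sqrt L) + ln (/ 2 * sqrt L))) in EH by ring.
 rewrite exp_Ropp, exp_plus, exp_ln in EH by lra.
 rewrite (su2_cf _ Sxx), (su2_cf _ Syy), vec3_add, inner_vec3 in EH.
 fold (X 0%nat) (X 1%nat) (X 2%nat) in EH.
 assert (R : / sqrt L * / sqrt L = / L) by (rewrite <- Rinv_mult, Qs; reflexivity).
 assert (R2 : / (/ 2 * sqrt L * (/ 2 * sqrt L)) = 4 / L).
 { replace (/ 2 * sqrt L * (/ 2 * sqrt L)) with (/ 4 * (sqrt L * sqrt L)) by field. rewrite Qs. field. lra. }
 rewrite R, R2 in EH. rewrite EH. unfold S3. field. lra.
Qed.

(** Differentiating the conformality relations shows that the Laplacian is orthogonal to both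
    tangent vectors; the mean curvature fixes its normal component. *)
Lemma cmc_equation U f H a x1 : @open C_UniformSpace U -> cmc_surface U f H -> (forall x y, sq a x y -> U (x1 + x, y)) ->
 forall x y, sq a x y -> forall k,
 dX (dX (cof f x1 k)) x y + dY (dY (cof f x1 k)) x y =
 2 * H * cross (fun k => dX (cof f x1 k) x y) (fun k => dY (cof f x1 k) x y) k.
Proof. intros HU Hc Ha x y Hs.
 enough (Low : forall k, (k <= 2)%nat -> dX (dX (cof f x1 k)) x y + dY (dY (cof f x1 k)) x y =
  2 * H * cross (fun k => dX (cof f x1 k) x y) (fun k => dY (cof f x1 k) x y) k)
  by (intros [|[|k]]; [apply Low; lia|apply Low; lia|exact (Low 2%nat (le_n _))]). assert (Hsm := proj1 (proj2 (proj1 Hc))).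
 assert (K3 := fun k => is_Ck_K2 U a x1 k 3 Ha f (Hsm 3%nat)).
 assert (EX : forall k u v, sq a u v -> dX (cof f x1 k) u v = cof (pdx f) x1 k u v)
  by (intros j u v Huv; exact (is_derive_unique _ _ _ (proj1 (cof_derive U 2 f x1 j u v (Hsm 3%nat) (Ha u v Huv))))).
 assert (EY : forall k u v, sq a u v -> dY (cof f x1 k) u v = cof (pdy f) x1 k u v)
  by (intros j u v Huv; exact (is_derive_unique _ _ _ (proj2 (cof_derive U 2 f x1 j u v (Hsm 3%nat) (Ha u v Huv))))).
 assert (EXX : forall k, dX (dX (cof f x1 k)) x y = cof (pdx (pdx f)) x1 k x y).
 { intros j. rewrite (dX_ext a _ _ x y (EX j) Hs). 
  exact (is_derive_unique _ _ _ (proj1 (cof_derive U 1 (pdx f) x1 j x y (proj1 (proj2 (proj2 (Hsm 3%nat)))) (Ha x y Hs)))). }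
 assert (EYY : forall k, dY (dY (cof f x1 k)) x y = cof (pdy (pdy f)) x1 k x y).
 { intros j. rewrite (dY_ext a _ _ x y (EY j) Hs). 
  exact (is_derive_unique _ _ _ (proj2 (cof_derive U 1 (pdy f) x1 j x y (proj2 (proj2 (proj2 (Hsm 3%nat)))) (Ha x y Hs)))). }
 set (p := fun k => dX (cof f x1 k)). set (q := fun k => dY (cof f x1 k)).
 assert (Data := fun u v (Huv : sq a u v) => mean_curvature_normal U f H (x1 + u, v) HU Hc (Ha u v Huv)).
 assert (C1 : forall u v, sq a u v -> S3 (fun k => p k u v * p k u v) = S3 (fun k => q k u v * q k u v)).
 { intros u v Huv. destruct (Data u v Huv) as [L [_ [D1 [D2 _]]]]. unfold p, q, S3 in *. rewrite !EX, !EY by auto.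
  etransitivity; [exact D1|symmetry; exact D2]. }
 assert (C2 : forall u v, sq a u v -> S3 (fun k => p k u v * q k u v) = 0).
 { intros u v Huv. destruct (Data u v Huv) as [L [_ [_ [_ [D3 _]]]]]. unfold p, q, S3 in *. rewrite !EX, !EY by auto. exact D3. }
 assert (Kp : forall k, K2 a 2 (p k)) by (intros j; apply (K2_dX a 2), K3).
 assert (Kq : forall k, K2 a 2 (q k)) by (intros j; apply (K2_dY a 2), K3).
 assert (DXY : forall g h : nat -> R -> R -> R, (forall k, K2 a 2 (g k)) -> (forall k, K2 a 2 (h k)) ->
   dX (fun x y => S3 (fun k => g k x y * h k x y)) x y = S3 (fun k => dX (g k) x y * h k x y + g k x y * dX (h k) x y) /\
   dY (fun x y => S3 (fun k => g k x y * h k x y)) x y = S3 (fun k => dY (g k) x y * h k x y + g k x y * dY (h k) x y)).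
 { intros g h Hg Hh. assert (Eg := fun k => K2_ex_derive a 1 _ x y (Hg k) Hs). assert (Eh := fun k => K2_ex_derive a 1 _ x y (Hh k) Hs).
  destruct (Eg 0%nat), (Eg 1%nat), (Eg 2%nat), (Eh 0%nat), (Eh 1%nat), (Eh 2%nat).
  split; apply is_derive_unique; unfold S3; (auto_derive; [tauto|]); unfold dX, dY; ring. }
 assert (DX := fun g h Hg Hh => proj1 (DXY g h Hg Hh)). assert (DY := fun g h Hg Hh => proj2 (DXY g h Hg Hh)).
 assert (X1 := dX_ext a _ _ x y C1 Hs). rewrite !DX in X1 by auto.
 assert (Y1 := dY_ext a _ _ x y C1 Hs). rewrite !DY in Y1 by auto.
 assert (X2 := dX_ext a _ (fun _ _ => 0) x y C2 Hs). rewrite DX in X2 by auto.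
 assert (Y2 := dY_ext a _ (fun _ _ => 0) x y C2 Hs). rewrite DY in Y2 by auto.
 replace (dX (fun _ _ => 0) x y) with 0 in X2 by (symmetry; unfold dX, dY; apply Derive_const).
 replace (dY (fun _ _ => 0) x y) with 0 in Y2 by (symmetry; unfold dX, dY; apply Derive_const).
 assert (Sw : forall k, dX (q k) x y = dY (p k) x y) by (intros j; apply (K2_schwarz a 1 (cof f x1 j)); auto).
 destruct (Data x y Hs) as [L [PL [D1 [D2 [D3 D4]]]]].
 apply (frame_solve (fun k => dX (p k) x y + dY (q k) x y) (fun k => p k x y) (fun k => q k x y) L H PL); auto.
 - unfold p. unfold S3 in *. rewrite !EX by auto. exact D1.
 - unfold q. unfold S3 in *. rewrite !EY by auto. exact D2.
 - unfold S3 in *. rewrite !Sw in *. lra.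
 - unfold S3 in *. rewrite !Sw in *. lra.
 - unfold p, q. rewrite <- D4. unfold S3, cross. rewrite !EXX, !EYY, !EX, !EY by auto. reflexivity.
Qed.

(** The difference of the cross products splits as [p - p'] against [q] plus [p'] against [q - q'],
    so bounds for [q] and [p'] suffice. *)
Lemma cross_lip (p q p' q' : nat -> R) M : (forall k, Rabs (q k) <= M) -> (forall k, Rabs (p' k) <= M) ->
 S3 (fun k => (cross p q k - cross p' q' k) ^ 2) <=
 6 * M ^ 2 * S3 (fun k => (p k - p' k) * (p k - p' k) + (q k - q' k) * (q k - q' k)).
Proof. intros Hq Hp.
 assert (Sq : forall g : nat -> R, (forall k, Rabs (g k) <= M) -> S3 (fun k => g k * g k) <= 3 * M ^ 2).
 { intros g Hg. assert (B : forall k, g k * g k <= M ^ 2).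
  { intros k. replace (g k * g k) with (Rabs (g k) * Rabs (g k)) by (rewrite <- Rabs_mult; apply Rabs_pos_eq; nra).
   simpl. rewrite Rmult_1_r. apply Rmult_le_compat; auto; apply Rabs_pos. }
  unfold S3. generalize (B 0%nat) (B 1%nat) (B 2%nat). lra. }
 assert (Lag : forall g h : nat -> R, S3 (fun k => cross g h k * cross g h k) <= S3 (fun k => g k * g k) * S3 (fun k => h k * h k)).
 { intros g h. unfold S3, cross.
  generalize (pow2_ge_0 (g 0%nat * h 0%nat + g 1%nat * h 1%nat + g 2%nat * h 2%nat)). lra. }
 set (d := fun k => p k - p' k). set (e := fun k => q k - q' k).
 assert (A1 := Lag d q). assert (A2 := Lag p' e).
 assert (B1 := Sq q Hq). assert (B2 := Sq p' Hp).
 assert (N1 : 0 <= S3 (fun k => d k * d k)) by (unfold S3; nra).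
 assert (N2 : 0 <= S3 (fun k => e k * e k)) by (unfold S3; nra).
 assert (A3 : S3 (fun k => (cross p q k - cross p' q' k) ^ 2) <=
   2 * S3 (fun k => cross d q k * cross d q k) + 2 * S3 (fun k => cross p' e k * cross p' e k)).
 { assert (T : forall k, (cross p q k - cross p' q' k) ^ 2 <= 2 * (cross d q k * cross d q k) + 2 * (cross p' e k * cross p' e k)).
  { intros k. replace (cross p q k - cross p' q' k) with (cross d q k + cross p' e k)
    by (destruct k as [|[|k]]; unfold d, e, cross; ring).
   generalize (pow2_ge_0 (cross d q k - cross p' e k)). lra. }
  eapply Rle_trans; [apply (S3_le _ _ T)|]. right. unfold S3. ring. }
 replace (S3 (fun k => (p k - p' k) * (p k - p' k) + (q k - q' k) * (q k - q' k))) with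
  (S3 (fun k => d k * d k) + S3 (fun k => e k * e k)) by (unfold d, e, S3; ring).
 apply (Rmult_le_compat_l (S3 (fun k => d k * d k))) in B1; auto.
 apply (Rmult_le_compat_l (S3 (fun k => e k * e k))) in B2; auto. lra.
Qed.

Lemma cross_lip2 (p q a b p' q' a' b' : nat -> R) M : (forall k, Rabs (q k) <= M) -> (forall k, Rabs (a' k) <= M) ->
 (forall k, Rabs (b k) <= M) -> (forall k, Rabs (p' k) <= M) ->
 S3 (fun k => (cross a q k + cross p b k - (cross a' q' k + cross p' b' k)) ^ 2) <=
 12 * M ^ 2 * S3 (fun k => (a k - a' k) ^ 2 + (b k - b' k) ^ 2 + ((p k - p' k) ^ 2 + (q k - q' k) ^ 2)).
Proof. intros H1 H2 H3 H4. assert (A := cross_lip a q a' q' M H1 H2). assert (B := cross_lip p b p' b' M H3 H4).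
 apply Rle_trans with (S3 (fun k => 2 * (cross a q k - cross a' q' k) ^ 2 + 2 * (cross p b k - cross p' b' k) ^ 2)).
 - apply S3_le. intros k. generalize (pow2_ge_0 (cross a q k - cross a' q' k - (cross p b k - cross p' b' k))). lra.
 - unfold S3 in *. lra.
Qed.

Lemma is_derive_cross (p q : nat -> R -> R) (p1 q1 : nat -> R) t : (forall k, is_derive (p k) t (p1 k)) ->
 (forall k, is_derive (q k) t (q1 k)) -> forall k,
 is_derive (fun s => cross (fun j => p j s) (fun j => q j s) k) t (cross p1 (fun j => q j t) k + cross (fun j => p j t) q1 k).
Proof. intros Hp Hq.
 assert (M : forall i j, is_derive (fun s => p i s * q j s - p j s * q i s) t
  (p1 i * q j t - p1 j * q i t + (p i t * q1 j - p j t * q1 i))).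
 { intros i j. eapply eq_ind; [exact (is_derive_minus _ _ t _ _ (is_derive_mult _ _ t _ _ (Hp i) (Hq j) Rmult_comm)
   (is_derive_mult _ _ t _ _ (Hp j) (Hq i) Rmult_comm))|]. unfold minus, plus, opp, mult; simpl. ring. }
 intros [|[|k]]; apply M.
Qed.

(** The last hypothesis reflects the convention for indices above 2: three bounds then cover every
    [k]. *)
Lemma K2_bounded3 b n a (g : nat -> R -> R -> R) : (forall k, K2 b n (g k)) -> 0 <= a < b -> (forall k, g (S (S k)) = g 2%nat) ->
 exists M, 0 <= M /\ forall k x y, sq a x y -> Rabs (g k x y) <= M.
Proof.
 intros Hg Ha E. destruct (K2_bounded b n _ a (Hg 0%nat) Ha) as [M0 [Q0 B0]], (K2_bounded b n _ a (Hg 1%nat) Ha) as [M1 [Q1 B1]],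
  (K2_bounded b n _ a (Hg 2%nat) Ha) as [M2 [Q2 B2]].
 exists (M0 + M1 + M2). split; [lra|]. intros k x y [X Y].
 specialize (B0 x y ltac:(lra) ltac:(lra)). specialize (B1 x y ltac:(lra) ltac:(lra)). specialize (B2 x y ltac:(lra) ltac:(lra)).
 destruct k as [|[|k]]; [| |rewrite E]; lra.
Qed.

Lemma bjorling_square J f0 v H U f x1 : is_open_interval J -> bjorling_solution J f0 v H U f -> J x1 ->
 exists a, 0 < a /\ (forall x y, sq a x y -> U (x1 + x, y)).
Proof. intros HJ [HU [HC _]] Hx. destruct (proj1 (open_C_eps U) HU _ (HC x1 Hx)) as [d [Hd K]].
 exists (d / 2). split; [lra|]. intros x y [X Y]. apply K. reimlt.
 unfold Re, Im; simpl. replace (x1 + x + - x1) with x by ring. replace (y + - 0) with y by ring. lra.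
Qed.

(** Both [y] derivatives are positive multiples of [v], and conformality gives them the length of
    the common [x] derivative. *)
Lemma bjorling_cauchy_data J f0 v H U f U' f' x : is_open_interval J ->
 (forall x, J x -> is_su2 (v x)) -> (forall x, J x -> enorm (v x) = 1) ->
 bjorling_solution J f0 v H U f -> bjorling_solution J f0 v H U' f' -> J x ->
 f (RtoC x) = f' (RtoC x) /\ pdx f (RtoC x) = pdx f' (RtoC x) /\ pdy f (RtoC x) = pdy f' (RtoC x).
Proof. intros HJ Hv Hn [O [C1 [S [R [_ Y]]]]] [O' [C1' [S' [R' [_ Y']]]]] Hx.
 assert (EX : pdx f (RtoC x) = pdx f' (RtoC x)).
 { destruct (open_interval_nbhd J x HJ Hx) as [e [He K]].
  assert (D := proj1 (proj1 (proj2 (proj1 (proj2 (proj1 S)) 1%nat)) (RtoC x) (C1 x Hx))).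
  apply ex_Mderive_RDM in D. symmetry. apply Mderive_RDM.
  apply (RDM_ext_loc (fun t => f (t, Im (RtoC x))) _ _ _ e He); [|exact D].
  intros s Hs. change (f (RtoC s) = f' (RtoC s)). rewrite R, R' by auto. reflexivity. }
 split; [rewrite R, R' by auto; reflexivity|split; [exact EX|]].
 destruct (Y x Hx) as [c [Pc E]], (Y' x Hx) as [c' [Pc' E']]. rewrite E, E'.
 assert (Q := proj1 (proj2 (proj2 (proj2 (proj1 S))) _ (C1 x Hx))).
 assert (Q' := proj1 (proj2 (proj2 (proj2 (proj1 S'))) _ (C1' x Hx))).
 rewrite EX, Q', E, E' in Q. specialize (Hn x Hx).
 rewrite !inner_cf in Q by (apply is_su2_mscal; auto).
 unfold enorm in Hn. rewrite inner_cf in Hn by auto.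
 set (V := S3 (fun k => cf k (v x) * cf k (v x))) in *.
 assert (V1 : V = 1).
 { assert (0 <= V) by (unfold V, S3; nra). rewrite <- (sqrt_sqrt V), Hn by auto. ring. }
 unfold S3 in Q. rewrite !cf_mscal in Q.
 assert (Q2 : c' * c' * V = c * c * V) by (unfold V, S3; lra).
 assert (c = c') by nra. subst. reflexivity.
Qed.

Lemma bjorling_unique J f0 v H U f U' f' x1 : is_open_interval J ->
 (forall x, J x -> is_su2 (v x)) -> (forall x, J x -> enorm (v x) = 1) ->
 bjorling_solution J f0 v H U f -> bjorling_solution J f0 v H U' f' -> J x1 ->
 exists eps delta : R, 0 < eps /\ 0 < delta /\
  forall x y : R, x1 - eps < x < x1 + eps -> - delta < y < delta -> U (x, y) /\ U' (x, y) /\ f (x, y) = f' (x, y).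
Proof. intros HJ Hv Hn B B' Hx.
 destruct (bjorling_square _ _ _ _ _ _ _ HJ B Hx) as [a1 [P1 U1]].
 destruct (bjorling_square _ _ _ _ _ _ _ HJ B' Hx) as [a2 [P2 U2]].
 destruct (open_interval_nbhd J x1 HJ Hx) as [a3 [P3 J3]].
 set (b := Rmin (Rmin a1 a2) a3).
 assert (Hb : 0 < b /\ b <= a1 /\ b <= a2 /\ b <= a3).
 { unfold b. generalize (Rmin_l (Rmin a1 a2) a3) (Rmin_r (Rmin a1 a2) a3) (Rmin_l a1 a2) (Rmin_r a1 a2).
  repeat split; try lra. repeat apply Rmin_glb_lt; auto. }
 assert (V1 : forall x y, sq b x y -> U (x1 + x, y)) by (intros x y [? ?]; apply U1; split; lra).
 assert (V2 : forall x y, sq b x y -> U' (x1 + x, y)) by (intros x y [? ?]; apply U2; split; lra).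
 assert (S := proj1 (proj2 (proj2 B))). assert (S' := proj1 (proj2 (proj2 B'))).
 assert (K := fun k => is_Ck_K2 U b x1 k 3 V1 f (proj1 (proj2 (proj1 S)) 3%nat)).
 assert (K' := fun k => is_Ck_K2 U' b x1 k 3 V2 f' (proj1 (proj2 (proj1 S')) 3%nat)).
 set (a := b / 2). assert (Ha : 0 <= a < b) by (unfold a; lra).
 assert (Data : forall x, Rabs x < b -> f (RtoC (x1 + x)) = f' (RtoC (x1 + x)) /\ pdx f (RtoC (x1 + x)) = pdx f' (RtoC (x1 + x)) /\ pdy f (RtoC (x1 + x)) = pdy f' (RtoC (x1 + x))).
 { intros x X. apply (bjorling_cauchy_data J f0 v H U f U'); auto. apply J3. replace (x1 + x - x1) with x by ring. lra. }
 set (P := fun k => dX (cof f x1 k)). set (Q := fun k => dY (cof f x1 k)).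
 set (P' := fun k => dX (cof f' x1 k)). set (Q' := fun k => dY (cof f' x1 k)).
 assert (HP : forall k, K2 b 2 (P k)) by (intros; apply K2_dX, K). assert (HQ : forall k, K2 b 2 (Q k)) by (intros; apply K2_dY, K).
 assert (HP' : forall k, K2 b 2 (P' k)) by (intros; apply K2_dX, K'). assert (HQ' : forall k, K2 b 2 (Q' k)) by (intros; apply K2_dY, K').
 destruct (K2_bounded3 b 2 a Q HQ Ha) as [m1 [p1 b1]]; [reflexivity|].
 destruct (K2_bounded3 b 2 a P' HP' Ha) as [m2 [p2 b2]]; [reflexivity|].
 destruct (K2_bounded3 b 1 a (fun k => dX (P' k)) (fun k => K2_dX b 1 _ (HP' k)) Ha) as [m3 [p3 b3]]; [reflexivity|].
 destruct (K2_bounded3 b 1 a (fun k => dX (Q k)) (fun k => K2_dX b 1 _ (HQ k)) Ha) as [m4 [p4 b4]]; [reflexivity|].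
 destruct (K2_bounded3 b 1 a (fun k => dY (P' k)) (fun k => K2_dY b 1 _ (HP' k)) Ha) as [m5 [p5 b5]]; [reflexivity|].
 destruct (K2_bounded3 b 1 a (fun k => dY (Q k)) (fun k => K2_dY b 1 _ (HQ k)) Ha) as [m6 [p6 b6]]; [reflexivity|].
 set (M := m1 + m2 + m3 + m4 + m5 + m6).
 assert (Bd : forall (g : nat -> R -> R -> R) m x y, (forall k x y, sq a x y -> Rabs (g k x y) <= m) -> m <= M -> sq a x y ->
  forall k, Rabs (g k x y) <= M) by (intros g m x y Hg Hm Hs k; eapply Rle_trans; [apply Hg; auto|auto]).
 set (W1 := fun k x y => P k x y - P' k x y). set (W2 := fun k x y => Q k x y - Q' k x y).
 assert (Sb : forall x y, sq a x y -> sq b x y) by (intros x y [? ?]; split; lra).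
 assert (DM : forall (g h : nat -> R -> R -> R), (forall k, K2 b 2 (g k)) -> (forall k, K2 b 2 (h k)) -> forall k x y, sq b x y ->
  dX (fun x y => g k x y - h k x y) x y = dX (g k) x y - dX (h k) x y /\ dY (fun x y => g k x y - h k x y) x y = dY (g k) x y - dY (h k) x y).
 { intros g h Hg Hh k x y Hs. destruct (K2_ex_derive b 1 _ x y (Hg k) Hs), (K2_ex_derive b 1 _ x y (Hh k) Hs).
  split; [apply (Derive_minus (fun t => g k t y) (fun t => h k t y))|apply (Derive_minus (fun t => g k x t) (fun t => h k x t))]; auto. }
 assert (DP := DM P P' HP HP'). assert (DQ := DM Q Q' HQ HQ').
 set (G := fun k x y => 2 * H * (cross (fun j => P j x y) (fun j => Q j x y) k - cross (fun j => P' j x y) (fun j => Q' j x y) k)).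
 assert (EG : forall k x y, sq a x y -> dX (W1 k) x y + dY (W2 k) x y = G k x y).
 { intros k x y Hs. apply Sb in Hs. unfold W1, W2. rewrite (proj1 (DP k x y Hs)), (proj2 (DQ k x y Hs)).
  assert (E1 := cmc_equation U f H b x1 (proj1 B) S V1 x y Hs k). assert (E2 := cmc_equation U' f' H b x1 (proj1 B') S' V2 x y Hs k).
  unfold G. unfold P, Q, P', Q' in *. lra. }
 assert (DG : forall k x y, sq a x y ->
  dX (G k) x y = 2 * H * (cross (fun j => dX (P j) x y) (fun j => Q j x y) k + cross (fun j => P j x y) (fun j => dX (Q j) x y) k -
   (cross (fun j => dX (P' j) x y) (fun j => Q' j x y) k + cross (fun j => P' j x y) (fun j => dX (Q' j) x y) k)) /\
  dY (G k) x y = 2 * H * (cross (fun j => dY (P j) x y) (fun j => Q j x y) k + cross (fun j => P j x y) (fun j => dY (Q j) x y) k -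
   (cross (fun j => dY (P' j) x y) (fun j => Q' j x y) k + cross (fun j => P' j x y) (fun j => dY (Q' j) x y) k))).
 { intros k x y Hs. apply Sb in Hs. split; apply is_derive_unique; apply (is_derive_scal (fun t => _ - _)).
  - exact (is_derive_minus _ _ x _ _ (is_derive_cross (fun j t => P j t y) (fun j t => Q j t y) _ _ x (fun j => K2_is_derive_x b 1 _ x y (HP j) Hs)
    (fun j => K2_is_derive_x b 1 _ x y (HQ j) Hs) k) (is_derive_cross (fun j t => P' j t y) (fun j t => Q' j t y) _ _ x
    (fun j => K2_is_derive_x b 1 _ x y (HP' j) Hs) (fun j => K2_is_derive_x b 1 _ x y (HQ' j) Hs) k)).
  - exact (is_derive_minus _ _ y _ _ (is_derive_cross (fun j => P j x) (fun j => Q j x) _ _ y (fun j => K2_is_derive_y b 1 _ x y (HP j) Hs)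
    (fun j => K2_is_derive_y b 1 _ x y (HQ j) Hs) k) (is_derive_cross (fun j => P' j x) (fun j => Q' j x) _ _ y
    (fun j => K2_is_derive_y b 1 _ x y (HP' j) Hs) (fun j => K2_is_derive_y b 1 _ x y (HQ' j) Hs) k)). }
 assert (Cu : forall k x y, sq a x y -> dY (W1 k) x y = dX (W2 k) x y).
 { intros k x y Hs. apply Sb in Hs. unfold W1, W2. rewrite (proj2 (DP k x y Hs)), (proj1 (DQ k x y Hs)). unfold P, Q, P', Q'.
  now rewrite !(K2_schwarz b 1) by auto. }
 (* Two partial derivatives, each with the constant [12 M^2] and the factor [4 H^2]:
    [96 <= 10^2]. *)
 assert (KH : 4 * H ^ 2 * (12 * M ^ 2) * 2 <= (10 * Rabs H * M) ^ 2).
 { replace ((10 * Rabs H * M) ^ 2) with (100 * (Rabs H ^ 2) * M ^ 2) by ring. rewrite pow2_abs.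
  assert (0 <= H ^ 2 * M ^ 2) by (apply Rmult_le_pos; apply pow2_ge_0). lra. }
 assert (H4 : 0 <= 4 * H ^ 2) by (generalize (pow2_ge_0 H); lra).
 assert (Np := Nsq_ge_0 W1 W2).
 destruct (cauchy_unique a (10 * Rabs H * M) W1 W2) as [eta [He Z]]; auto.
 - unfold a; lra.
 - apply Rmult_le_pos; [generalize (Rabs_pos H); lra|unfold M; lra].
 - intros k. apply (K2_sub b); [lra|]. now apply K2_minus.
 - intros k. apply (K2_sub b); [lra|]. now apply K2_minus.
 - intros x y Hs. assert (C := cross_lip (fun k => P k x y) (fun k => Q k x y) (fun k => P' k x y) (fun k => Q' k x y) M
   (Bd Q m1 x y b1 ltac:(unfold M; lra) Hs) (Bd P' m2 x y b2 ltac:(unfold M; lra) Hs)). change (S3 (fun k => _ * _ + _)) with (Nsq W1 W2 x y) in C.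
  apply (Rmult_le_compat_l (4 * H ^ 2)) in C; auto. apply (Rmult_le_compat_r _ _ _ (Np x y)) in KH.
  assert (0 <= H ^ 2 * (M ^ 2 * Nsq W1 W2 x y)) by (apply Rmult_le_pos; [|apply Rmult_le_pos; auto]; apply pow2_ge_0).
  apply Rle_trans with (4 * H ^ 2 * S3 (fun k => (cross (fun k => P k x y) (fun k => Q k x y) k - cross (fun k => P' k x y) (fun k => Q' k x y) k) ^ 2)); [|lra].
  right. unfold S3. rewrite !EG by auto. unfold G. ring.
 - intros x y Hs. assert (Hsb := Sb x y Hs).
  assert (C1 := cross_lip2 (fun k => P k x y) (fun k => Q k x y) (fun k => dX (P k) x y) (fun k => dX (Q k) x y)
   (fun k => P' k x y) (fun k => Q' k x y) (fun k => dX (P' k) x y) (fun k => dX (Q' k) x y) M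
   (Bd Q m1 x y b1 ltac:(unfold M; lra) Hs) (Bd _ m3 x y b3 ltac:(unfold M; lra) Hs)
   (Bd _ m4 x y b4 ltac:(unfold M; lra) Hs) (Bd P' m2 x y b2 ltac:(unfold M; lra) Hs)).
  assert (C2 := cross_lip2 (fun k => P k x y) (fun k => Q k x y) (fun k => dY (P k) x y) (fun k => dY (Q k) x y)
   (fun k => P' k x y) (fun k => Q' k x y) (fun k => dY (P' k) x y) (fun k => dY (Q' k) x y) M
   (Bd Q m1 x y b1 ltac:(unfold M; lra) Hs) (Bd _ m5 x y b5 ltac:(unfold M; lra) Hs)
   (Bd _ m6 x y b6 ltac:(unfold M; lra) Hs) (Bd P' m2 x y b2 ltac:(unfold M; lra) Hs)).
  assert (C0 : forall k, dY (P k) x y - dY (P' k) x y = dX (Q k) x y - dX (Q' k) x y).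
  { intros k. rewrite <- (proj2 (DP k x y Hsb)), <- (proj1 (DQ k x y Hsb)). exact (Cu k x y Hs). }
  set (h := S3 (fun k => dX (W1 k) x y ^ 2 + 2 * dX (W2 k) x y ^ 2 + dY (W2 k) x y ^ 2)).
  assert (Ph : 0 <= h).
  { apply S3_ge_0. intros k. generalize (pow2_ge_0 (dX (W1 k) x y)) (pow2_ge_0 (dX (W2 k) x y)) (pow2_ge_0 (dY (W2 k) x y)). lra. }
  apply (Rmult_le_compat_l (4 * H ^ 2)) in C1, C2; auto. specialize (Np x y).
  apply (Rmult_le_compat_r (Nsq W1 W2 x y + h)) in KH; [|lra].
  assert (0 <= H ^ 2 * (M ^ 2 * h)) by (apply Rmult_le_pos; [|apply Rmult_le_pos; auto]; apply pow2_ge_0).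
  eapply Rle_trans; [|eapply Rle_trans; [exact (Rplus_le_compat _ _ _ _ C1 C2)|]].
  + right. unfold S3. rewrite !(fun k => dX_ext a _ _ x y (EG k) Hs), !(fun k => dY_ext a _ _ x y (EG k) Hs),
    !(fun k => proj1 (DG k x y Hs)), !(fun k => proj2 (DG k x y Hs)). ring.
  + apply Rle_trans with (4 * H ^ 2 * (12 * M ^ 2) * (2 * Nsq W1 W2 x y + h)); [right|lra].
   unfold h, Nsq, S3. unfold W1, W2. rewrite !(fun k => proj1 (DP k x y Hsb)), !(fun k => proj1 (DQ k x y Hsb)), !(fun k => proj2 (DQ k x y Hsb)), !C0. ring.
 - intros k x X. destruct (Data x ltac:(lra)) as [E0 [E1 E2]].
  assert (Hs : sq b x 0) by (split; [lra|rewrite Rabs_R0; lra]).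
  destruct (cof_derive U 0 f x1 k x 0 (proj1 (proj2 (proj1 S)) 1%nat) (V1 x 0 Hs)) as [F1 F2].
  destruct (cof_derive U' 0 f' x1 k x 0 (proj1 (proj2 (proj1 S')) 1%nat) (V2 x 0 Hs)) as [F3 F4].
  split; apply Rminus_diag_eq;
   [transitivity (cof (pdx f) x1 k x 0); [exact (is_derive_unique _ _ _ F1)|symmetry; etransitivity; [exact (is_derive_unique _ _ _ F3)|]]
   |transitivity (cof (pdy f) x1 k x 0); [exact (is_derive_unique _ _ _ F2)|symmetry; etransitivity; [exact (is_derive_unique _ _ _ F4)|]]];
   unfold cof; [change (x1 + x, 0) with (RtoC (x1 + x)); now rewrite E1|change (x1 + x, 0) with (RtoC (x1 + x)); now rewrite E2].
 - exists eta, eta. split; [lra|split; [lra|]]. intros x y X Y.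
  assert (X' : Rabs (x - x1) < eta) by (apply Rabs_def1; lra).
  assert (Hs : forall t, - eta < t < eta -> sq b (x - x1) t) by (intros t Ht; split; [lra|apply Rabs_def1; lra]).
  assert (Ux := V1 _ _ (Hs y Y)). assert (Ux' := V2 _ _ (Hs y Y)). replace (x1 + (x - x1)) with x in Ux, Ux' by ring.
  split; [auto|split; [auto|]].
  (* The gradient of the difference vanishes near [x1], so the difference is constant on vertical
     segments, and these meet [J], where it is 0. *)
  assert (T : forall k, (k = 0 \/ k = 1 \/ k = 2)%nat -> cf k (f (x, y)) = cf k (f' (x, y))).
  { intros k Hk. set (g := fun t => cof f x1 k (x - x1) t - cof f' x1 k (x - x1) t).
   assert (D : forall t, - eta < t < eta -> is_derive g t 0).
   { intros t Ht. specialize (Z (x - x1) t X' ltac:(apply Rabs_def1; lra)). unfold Nsq, S3 in Z.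
    assert (E : W2 k (x - x1) t = 0) by (destruct Hk as [->|[->| ->]]; nra). rewrite <- E.
    apply (is_derive_minus (fun t => cof f x1 k (x - x1) t)); apply (K2_is_derive_y b 2); auto. }
   assert (E : g y = g 0).
   { destruct (Rle_lt_dec 0 y); [|symmetry]; apply is_derive_zero_const; try lra; intros; apply D; lra. }
   destruct (Data (x - x1) ltac:(lra)) as [E0 _]. unfold g, cof in E. replace (x1 + (x - x1)) with x in E, E0 by ring.
   change (x, 0) with (RtoC x) in E. rewrite E0 in E. lra. }
  rewrite (su2_cf (f (x, y))), (su2_cf (f' (x, y))), !T by (auto; apply S || apply S'; auto). reflexivity.
Qed.

Theorem theorem3p1 (J : R -> Prop) (f0 v : R -> M2) (H x0 : R)
    (Fhat0 : R -> Loop)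
    (hJ : is_open_interval J)
    (hf0_E3 : forall x : R, J x -> is_su2 (f0 x))
    (hf0_an : real_analytic_on J f0)
    (hf0_reg : forall x : R, J x -> Mderive f0 x <> mzero)
    (hv_E3 : forall x : R, J x -> is_su2 (v x))
    (hv_an : real_analytic_on J v)
    (hv_unit : forall x : R, J x -> enorm (v x) = 1)
    (hv_orth : forall x : R, J x -> inner (v x) (Mderive f0 x) = 0)
    (hH : H <> 0)
    (hx0 : J x0)
    (hdir1 : exists c : R, 0 < c /\ Mderive f0 x0 = (RtoC c *: e1)%M2)
    (hdir2 : exists c : R, 0 < c /\ v x0 = (RtoC c *: e2)%M2)
    (hFhat0 : is_extended_frame_along J f0 v H x0 Fhat0) :
  exists (Sigma : C -> Prop) (Phi : C -> Loop),
    (* (1) *)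
    (@open C_UniformSpace Sigma /\ contains_interval Sigma J /\
     (forall z : C, Sigma z -> in_LambdaGC (Phi z)) /\
     holomorphic_into_loops Sigma Phi /\
     (forall (x : R) (l : C), J x -> on_circle l ->
        Phi (RtoC x) l = Fhat0 x l)) /\
    (* (2) *)
    (exists Am1 A0 A1 : C -> M2,
       (forall z l : C, Sigma z -> on_circle l ->
          exists D : M2, is_CMderive (fun w => Phi w l) z D /\
            (minv (Phi z l) ** D)%M2 =
            ((/ l)%C *: Am1 z + A0 z + l *: A1 z)%M2) /\
       (forall z : C, Sigma z -> ent (Am1 z) 0 1 <> RtoC 0)) /\
    (exists Fhat Bhat : C -> Loop,
       forall z : C, Sigma z -> is_iwasawa (Phi z) (Fhat z) (Bhat z)) /\
    (forall Fhat Bhat : C -> Loop,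
       (forall z : C, Sigma z -> is_iwasawa (Phi z) (Fhat z) (Bhat z)) ->
       let f : C -> M2 := fun z =>
         (sym_bobenko H (Fhat z) - sym_bobenko H (Fhat (RtoC x0)) + f0 x0)%M2 in
       (* (3) *)
       (cmc_surface Sigma f H /\ restricts_to J f f0 /\
        tangent_along J f f0 v) /\
       (* (4) *)
       (bjorling_solution J f0 v H Sigma f /\
        forall (Sigma' : C -> Prop) (f' : C -> M2),
          bjorling_solution J f0 v H Sigma' f' ->
          forall x1 : R, J x1 ->
            exists eps delta : R, 0 < eps /\ 0 < delta /\
              forall x y : R, x1 - eps < x < x1 + eps -> - delta < y < delta ->
                Sigma (x, y) /\ Sigma' (x, y) /\ f (x, y) = f' (x, y))).
Proof.
 destruct hFhat0 as [F0 [hF0 [hG [hD h1]]]].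
 assert (L : local_data J f0 v H x0 Fhat0 F0) 
  by exact (conj hJ (conj hf0_an (conj hH (conj hx0 (conj hF0 (conj hG (conj hD h1))))))).
 destruct (atlas_exists J f0 v H x0 Fhat0 F0 L) as [w [g [r A]]].
 exists (Sig J r), (PhiG J H Fhat0 w g r).
 split; [|split; [|split]].
 - split; [apply Sig_open|split; [|split; [|split]]].
  + intros x Hx. exists x. exact (near_self _ _ _ _ _ _ _ _ _ _ A x Hx).
  + intros z Hz. exact (PhiG_LambdaGC _ _ _ _ _ _ _ _ _ _ A z Hz).
  + exact (PhiG_holomorphic _ _ _ _ _ _ _ _ _ _ A).
  + intros x l Hx Hl. exact (PhiG_real _ _ _ _ _ _ _ _ _ _ A x l Hx Hl).
 - exists (fun z => Am1_of H (w (cen J r z)) (g (cen J r z)) (z - RtoC (cen J r z))%C),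
   (fun z => A0_of (w (cen J r z)) (z - RtoC (cen J r z))%C),
   (fun z => A1_of H (w (cen J r z)) (g (cen J r z)) (z - RtoC (cen J r z))%C). split.
  + intros z l Hz Hl. exact (PhiG_derive _ _ _ _ _ _ _ _ _ _ A z l Hz Hl).
  + intros z Hz. unfold Am1_of. rewrite ent01. assert (N := cen_near J r z Hz).
   destruct (near_lt _ _ _ _ _ _ _ _ _ _ A _ _ N) as [_ [Z _]].
   destruct (proj2 A _ (proj1 N)) as [_ [_ [_ [Nz _]]]]. intros E. apply (Nz _ Z).
   apply (f_equal Copp) in E. etransitivity; [|etransitivity; [exact E|]]; ring.
 - exists (fun z l => Fhat0 (cen J r z) l ** Floc (Aat H w g (cen J r z)) (z - RtoC (cen J r z))%C l)%M2,
   (fun z => Bloc (Aat H w g (cen J r z)) (z - RtoC (cen J r z))%C).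
  intros z Hz. exact (PhiG_iwasawa _ _ _ _ _ _ _ _ _ _ A z _ (cen_near J r z Hz)).
 (* The factorization is arbitrary here; uniqueness on the circle was used in [surf_frame] to
    compare it with the local ones. *)
 - intros Fhat Bhat HI f.
  assert (B := surf_bjorling _ _ _ _ _ _ _ _ _ _ A Fhat Bhat hf0_E3 HI).
  split; [|split; [exact B|]].
  { destruct B as [_ [_ [B1 [B2 [B3 _]]]]]. exact (conj B1 (conj B2 B3)). }
  intros Sigma' f' B' x1 Hx1. exact (bjorling_unique J f0 v H _ f Sigma' f' x1 hJ hv_E3 hv_unit B B' Hx1).
Qed.
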